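(* Let $G$ be a compact connected semi-simple Lie group whose center contains a cyclic group $\mathbb{Z}_q$ of order $q$, let $C:[G\times S^1]/\mathbb{Z}_q\to G/\mathbb{Z}_q$ be the associated circle bundle with Euler class $\omega\in H^2(G/\mathbb{Z}_q)$, and let $\theta$ be the degree $-1$ map of its Gysin sequence. Identify $H^*([G\times S^1]/\mathbb{Z}_q)$ with $H^*(G\times S^1)$ (the two spaces are diffeomorphic). Then the induced map $C^*$ fits into the exact sequence $$0\to H^*(G/\mathbb{Z}_q)_{\langle\omega\rangle}\xrightarrow{C^*}H^*(G\times S^1)\xrightarrow{\theta}H^*(G/\mathbb{Z}_q)\xrightarrow{\ \cup\omega\ }\langle\omega\rangle\to 0,$$ in which $\theta$ has the following properties: i) $\theta(\xi_1)=q\in H^0(G/\mathbb{Z}_q)$; ii) $\theta(x\cup C^*(y))=\theta(x)\cup y$ for all $x\in H^*(G\times S^1)$ and $y\in H^*(G/\mathbb{Z}_q)$. Moreover, if the quotient map $g:H^*(G/\mathbb{Z}_q)\to H^*(G/\mathbb{Z}_q)_{\langle\omega\rangle}$ admits a split homomorphism $j:H^*(G/\mathbb{Z}_q)_{\langle\omega\rangle}\to H^*(G/\mathbb{Z}_q)$ (that is, $g\circ j=\mathrm{id}$), then the map $$h:J(\omega)\otimes H^*(G/\mathbb{Z}_q)_{\langle\omega\rangle}\to H^*(G/\mathbb{Z}_q),\qquad h(\omega^r\otimes x)=\omega^r\cup j(x),$$ induces an isomorphism of $J(\omega)$-modules $$H^*(G/\mathbb{Z}_q)\cong\frac{J(\omega)\otimes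 H^*(G/\mathbb{Z}_q)_{\langle\omega\rangle}}{\langle\omega\cdot\operatorname{Im}\theta\rangle}.$$
   Context: Cohomology has integer coefficients. $\mathbb{Z}_q$ acts on the circle group $S^1$ by rotation through the angle $2\pi/q$, and $[G\times S^1]/\mathbb{Z}_q$ is the quotient by the diagonal action; $C$ is the homomorphism induced by projection to the first factor, an oriented circle bundle on $G/\mathbb{Z}_q$. If $\iota\in H^1(G/\mathbb{Z}_q;\mathbb{Z}/q)$ is the class classifying the covering $G\to G/\mathbb{Z}_q$, then the Euler class of $C$ is $\omega=\beta_q(\iota)$, with $\beta_q$ the Bockstein homomorphism. The Gysin sequence of $C$ is $$\cdots\to H^r(G/\mathbb{Z}_q)\xrightarrow{C^*}H^r([G\times S^1]/\mathbb{Z}_q)\xrightarrow{\theta}H^{r-1}(G/\mathbb{Z}_q)\xrightarrow{\cup\omega}H^{r+1}(G/\mathbb{Z}_q)\to\cdots .$$ The class $\xi_1$ is the pull-back of the orientation class $\varepsilon\in H^1(S^1)$ under the projection $p:[G\times S^1]/\mathbb{Z}_q\cong G\times S^1\to S^1$, which is $[g,z]\mapsto z^q$. $J(\omega)$ and $\langle\omega\rangle$ denote respectively the subring and the ideal of $H^*(G/\mathbb{Z}_q)$ generated by $\omega$, and $H^*(G/\mathbb{Z}_q)_{\langle\omega\rangle}:=H^*(G/\mathbb{Z}_q)/\langle\omega\rangle$; since $C^*(\omega)=0$, $C^*$ is defined on this quotient. $H^*(G/\mathbb{Z}_q)$ is a module over $J(\omega)$. In the last formula $\langle\omega\cdot\operatorname{Im}\theta\rangle$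 denotes the submodule of $J(\omega)\otimes H^*(G/\mathbb{Z}_q)_{\langle\omega\rangle}$ generated by all $\omega\cdot z$ with $h(z)\in\operatorname{Im}\theta$. *)

(* Defs.v *)
From HB Require Import structures.
From mathcomp Require Import all_boot all_order all_algebra.
From mathcomp Require Import all_classical all_reals all_analysis.
From mathcomp Require Import complex freeg zify.

Set Implicit Arguments.
Unset Strict Implicit.
Unset Printing Implicit Defensive.

Import Order.TTheory GRing.Theory Num.Theory.
Import numFieldNormedType.Exports.

Local Open Scope quotient_scope.
Local Open Scope classical_set_scope.
Local Open Scope ring_scope.

Section AddGen.
Context (V : zmodType).
Definition zmod_set (S : set V) := S 0 /\ forall x y, S x -> S y -> S (x - y).
Definition add_gen (P : set V) : {pred V} :=
  fun x => `[< forall S, zmod_set S -> P `<=` S -> S x >].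

Lemma add_gen_closed P : zmod_closed (add_gen P).
Proof.
split=> [|x y /asboolP hx /asboolP hy]; apply/asboolP => S hS PS; first exact: hS.1.
by apply: hS.2; [exact: hx|exact: hy].
Qed.
HB.instance Definition _ P := GRing.isZmodClosed.Build V (add_gen P) (add_gen_closed P).
End AddGen.

Section Tensor.
Context (A B : zmodType).
Local Notation F := {freeg (A * B)%type / int}.

(* The tensor product over the integers: the free abelian group on A * B
   modulo the subgroup generated by the biadditivity relations. *)
Definition bilin_rel : set F := [set d |
  (exists a a' b, d = << (a + a', b) >> - << (a, b) >> - << (a', b) >>) \/
  (exists a b b', d = << (a, b + b') >> - << (a, b) >> - << (a, b') >>)].

Definition tensor := {ideal_quot (add_gen bilin_rel)}.
HB.instance Definition _ := GRing.Zmodule.on tensor.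

Definition tens (a : A) (b : B) : tensor := \pi_tensor (<< (a, b) >> : F).

(* The additive map induced by a biadditive f; see tlift_tens and tlift_zmod. *)
Definition tlift (M : zmodType) (f : A -> B -> M) (t : tensor) : M :=
  fglift (fun k => f k.1 k.2 : zmodule M) (repr t).

Section Lift.
Context (M : zmodType) (f : A -> B -> M).
Hypotheses (fDl : forall a a' b, f (a + a') b = f a b + f a' b)
           (fDr : forall a b b', f a (b + b') = f a b + f a b').
Let g : F -> zmodule M := fglift (fun k => f k.1 k.2 : zmodule M).

Lemma fglift_zmod : zmod_morphism g.
Proof.
have gD : {morph g : x y / x + y}.
  move=> x y; rewrite /g -[x]Freeg_enum -[y]Freeg_enum -freeg_cat !fglift_Freeg.
  exact: prelift_cat.
move=> x y; apply: (@addIr _ (g y)); rewrite -gD subrK addrNK //.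
Qed.

Let gK d : d \in add_gen bilin_rel -> g d = 0.
Proof.
have g0 : g 0 = 0 by rewrite -[0]subr0 fglift_zmod subrr.
move=> /asboolP /(_ [set d | g d = 0]); apply.
  by split=> [|x y /= gx gy] //=; rewrite fglift_zmod gx gy subr0.
by move=> d' [[a [a' [b ->]]]|[a [b [b' ->]]]]; rewrite /= !fglift_zmod /g !liftU
  !scale1r /= ?fDl ?fDr -addrA -opprD subrr.
Qed.

Lemma tlift_pi d : tlift f (\pi_tensor d) = g d.
Proof.
apply/eqP; rewrite -subr_eq0; apply/eqP.
rewrite -[tlift _ _]/(g _) -fglift_zmod; apply: gK.
by rewrite Quotient.idealrBE reprK.
Qed.

Lemma tlift_tens a b : tlift f (tens a b) = f a b.
Proof. by rewrite tlift_pi /g liftU scale1r. Qed.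

Lemma tlift_zmod : zmod_morphism (tlift f).
Proof.
move=> x y; have -> : x - y = \pi_tensor (repr x - repr y).
  by rewrite -[x in LHS]reprK -[y in LHS]reprK piE.
by rewrite tlift_pi fglift_zmod.
Qed.
End Lift.

Lemma tensDl a a' b : tens (a + a') b = tens a b + tens a' b.
Proof.
apply/eqP; rewrite -raddfD -Quotient.idealrBE opprD addrA.
by apply/asboolP => S _; apply; left; exists a, a', b.
Qed.

Lemma tensDr a b b' : tens a (b + b') = tens a b + tens a b'.
Proof.
apply/eqP; rewrite -raddfD -Quotient.idealrBE opprD addrA.
by apply/asboolP => S _; apply; right; exists a, b, b'.
Qed.

Lemma tensor_ind (P : set tensor) : zmod_set P ->
  (forall a b, P (tens a b)) -> forall t, P t.
Proof.
move=> hP Pt t; rewrite -[t]reprK -[repr t]freeg_sumE raddf_sum /=.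
have PN x : P x -> P (- x) by move=> Px; rewrite -sub0r; apply: hP.2 => //; exact: hP.1.
have PD x y : P x -> P y -> P (x + y).
  by move=> Px Py; rewrite -[y]opprK; apply: hP.2 => //; exact: PN.
apply: (big_ind P); [exact: hP.1|exact: PD|] => -[a b] _.
rewrite -[coeff _ _]intz -freegU_mulz raddfMz.
have Pn n : P (tens a b *+ n).
  by elim: n => [|n IH]; [exact: hP.1|rewrite mulrS; exact: PD].
by case: (coeff _ _) => n; [exact: Pn|rewrite NegzE mulrNz; exact/PN/Pn].
Qed.
End Tensor.

Section TensorModule.
Context (S : pzRingType) (B : zmodType).

(* S acts on tensor S B through the left factor. *)
Definition tensor_scale (a : S) : tensor S B -> tensor S B :=
  tlift (fun a' b => tens (a * a') b).

Let sDl a a' a'' b : tens (a * (a' + a'')) b = tens (a * a') b + tens (a * a'') b :> tensor S B.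
Proof. by rewrite mulrDr tensDl. Qed.
Let sDr a a' b b' : tens (a * a') (b + b') = tens (a * a') b + tens (a * a') b' :> tensor S B.
Proof. by rewrite tensDr. Qed.

Lemma tensor_scale_tens a a' b : tensor_scale a (tens a' b) = tens (a * a') b.
Proof. by rewrite /tensor_scale tlift_tens. Qed.

Lemma tensor_scale_zmod a : zmod_morphism (tensor_scale a).
Proof. exact: tlift_zmod. Qed.
HB.instance Definition _ a := GRing.isZmodMorphism.Build _ _ (tensor_scale a) (tensor_scale_zmod a).

Lemma tensor_eq (M : zmodType) (f g : {additive tensor S B -> M}) :
  (forall a b, f (tens a b) = g (tens a b)) -> f =1 g.
Proof.
move=> fg; apply: (tensor_ind (P := [set t | f t = g t])) => //.
by split=> [|x y /= fx fy]; rewrite /= ?raddf0 // !raddfB fx fy.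
Qed.

Let sA a b v : tensor_scale a (tensor_scale b v) = tensor_scale (a * b) v.
Proof.
by move: v; apply: (tensor_eq (f := tensor_scale a \o tensor_scale b)) => a' x /=;
  rewrite !tensor_scale_tens mulrA.
Qed.
Let s1 : left_id 1 tensor_scale.
Proof.
by apply: (tensor_eq (f := tensor_scale 1) (g := idfun)) => a' x /=;
  rewrite !tensor_scale_tens mul1r.
Qed.
Let sD : right_distributive tensor_scale +%R.
Proof. by move=> a u v; rewrite raddfD. Qed.
Let sDl' v : {morph tensor_scale^~ v : a b / a + b}.
Proof.
move=> a b; move: v.
by apply: (tensor_eq (g := tensor_scale a \+ tensor_scale b)) => a' x /=;
  rewrite !tensor_scale_tens mulrDl tensDl.
Qed.
HB.instance Definition _ := GRing.Zmodule_isLmodule.Build S (tensor S B) sA s1 sD sDl'.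
End TensorModule.

Section Ideals.
Context (A : pzRingType).

Definition ideal_set (I : set A) :=
  zmod_set I /\ forall a x, I x -> I (a * x) /\ I (x * a).
(* The two-sided ideal generated by w, as the intersection of the ideals
   containing it; subring_gen and submod_gen are defined likewise. *)
Definition ideal_gen (w : A) : {pred A} :=
  fun x => `[< forall I, ideal_set I -> I w -> I x >].

Lemma ideal_gen_closed w : zmod_closed (ideal_gen w).
Proof.
split=> [|x y /asboolP hx /asboolP hy]; apply/asboolP => S hS Sw; first exact: hS.1.1.
by apply: hS.1.2; [exact: hx|exact: hy].
Qed.
HB.instance Definition _ w := GRing.isZmodClosed.Build A (ideal_gen w) (ideal_gen_closed w).

Definition subring_set (S : set A) :=
  [/\ S 1, forall x y, S x -> S y -> S (x - y) & forall x y, S x -> S y -> S (x * y)].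
Definition subring_gen (w : A) : {pred A} :=
  fun x => `[< forall S, subring_set S -> S w -> S x >].

Lemma subring_gen_closed w : subring_closed (subring_gen w).
Proof.
split=> [|x y /asboolP hx /asboolP hy|x y /asboolP hx /asboolP hy];
  apply/asboolP => S hS Sw; case: (hS) => [S1 SB SM] //.
  by apply: SB; [exact: hx|exact: hy].
by apply: SM; [exact: hx|exact: hy].
Qed.
HB.instance Definition _ w := GRing.isSubringClosed.Build A (subring_gen w) (subring_gen_closed w).

Record subring_of (w : A) := SubringOf {
  subring_val : A;
  _ : subring_val \in subring_gen w }.
HB.instance Definition _ w := [isSub for @subring_val w].
HB.instance Definition _ w := [Choice of subring_of w by <:].
HB.instance Definition _ w := 
  GRing.SubChoice_isSubPzRing.Build _ _ (subring_of w) (subringClosedP _).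

Definition ideal_quotient (w : A) := {ideal_quot (ideal_gen w)}.
HB.instance Definition _ w := GRing.Zmodule.on (ideal_quotient w).

Lemma subring_gen_mem w : w \in subring_gen w.
Proof. by apply/asboolP. Qed.

Definition subring_elt w : subring_of w := SubringOf (subring_gen_mem w).
End Ideals.

Section Submodules.
Context (S : pzRingType) (V : lmodType S).
Definition submod_set (N : set V) :=
  zmod_set N /\ forall a x, N x -> N (a *: x).
Definition submod_gen (P : set V) : {pred V} :=
  fun x => `[< forall N, submod_set N -> P `<=` N -> N x >].

Lemma submod_gen_closed P : zmod_closed (submod_gen P).
Proof.
split=> [|x y /asboolP hx /asboolP hy]; apply/asboolP => N hN PN; first exact: hN.1.1.
by apply: hN.1.2; [exact: hx|exact: hy].
Qed.
HB.instance Definition _ P := GRing.isZmodClosed.Build V (submod_gen P) (submod_gen_closed P).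
Definition submod_quotient (P : set V) := {ideal_quot (submod_gen P)}.
HB.instance Definition _ P := GRing.Zmodule.on (submod_quotient P).
End Submodules.

Section Simplices.
Context (R : realType).

Definition simplex (n : nat) : set 'rV[R]_n.+1 :=
  [set x | (forall i, 0 <= x 0 i) /\ \sum_i x 0 i = 1].

Arguments simplex : clear implicits.

(* The affine map between standard simplices sending vertex i to vertex f i. *)
Definition face_fun m n (f : 'I_m.+1 -> 'I_n.+1) (x : 'rV[R]_m.+1) : 'rV[R]_n.+1 :=
  \row_j \sum_(i | f i == j) x 0 i.

Lemma face_fun_subproof m n (f : 'I_m.+1 -> 'I_n.+1) (x : simplex m) :
  face_fun f (val x) \in simplex n.
Proof.
case: x => x /= /set_mem [x0 x1]; apply/mem_set; split=> [j|].
  by rewrite mxE sumr_ge0.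
rewrite -x1 (partition_big f xpredT) //=.
by apply: eq_bigr => j _; rewrite mxE.
Qed.

Definition face_map m n (f : 'I_m.+1 -> 'I_n.+1) (x : simplex m) : simplex n :=
  exist (fun y => y \in simplex n) _ (face_fun_subproof f x).

Lemma face_map_continuous m n (f : 'I_m.+1 -> 'I_n.+1) :
  continuous (face_map f : simplex m -> simplex n).
Proof.
apply: (@continuous_comp_initial (simplex n) (simplex m) 'rV[R]_n.+1 set_val (face_map f)).
move=> x U [P hP PU].
apply: (@filterS _ (nbhs x) _ [set y : simplex m | forall j, P 0 j (face_fun f (val y) 0 j)]).
  by move=> y Py; apply: PU => i j; rewrite ord1.
apply: (@filter_forall _ _ (fun j (y : simplex m) => P 0 j (face_fun f (val y) 0 j)) (nbhs x) (nbhs_filter x)) => j.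
suff : continuous (fun y : simplex m => face_fun f (val y) 0 j) by move=> /(_ x); apply; exact: hP.
have -> : (fun y : simplex m => face_fun f (val y) 0 j) =
          (fun y : simplex m => \sum_(i | f i == j) val y 0 i).
  by apply/funext => y; rewrite mxE.
apply: continuous_big => [|i _]; first exact: add_continuous.
move=> y; apply: (@continuous_comp (simplex m) _ _ set_val (fun M : 'rV[R]_m.+1 => M 0 i)).
  exact: (@initial_continuous (simplex m) _ set_val).
exact: coord_continuous.
Qed.
HB.instance Definition _ m n (f : 'I_m.+1 -> 'I_n.+1) :=
  isContinuous.Build _ _ (face_map f) (@face_map_continuous m n f).
End Simplices.
Arguments simplex : clear implicits.

Section Singular.
Context (R : realType) (X : topologicalType).

(* Singular simplices of all dimensions, so that a function singular -> int is
   an inhomogeneous cochain. *)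
Definition singular := {n : nat & continuousType (simplex R n) X}.
Definition sdim (s : singular) : nat := projT1 s.
(* The m-simplex spanned by the vertices f 0, ..., f m of s; only used when
   these are at most the dimension of s. *)
Definition vert (s : singular) (f : nat -> nat) (m : nat) : singular :=
  existT _ m (projT2 s \o face_map (fun j : 'I_m.+1 => inord (f j) : 'I_(sdim s).+1)
              : continuousType _ _).

Lemma vert_ext s f g m : (forall j, (j <= m)%N -> f j = g j) -> vert s f m = vert s g m.
Proof.
move=> fg; rewrite /vert; congr existT.
suff -> : (fun j : 'I_m.+1 => inord (f j) : 'I_(sdim s).+1) = (fun j => inord (g j)) by [].
by apply/funext => j; rewrite fg // -ltnS.
Qed.

Lemma face_map_comp m n p (f : 'I_n.+1 -> 'I_p.+1) (g : 'I_m.+1 -> 'I_n.+1) (x : simplex R m) :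
  face_map f (face_map g x) = face_map (f \o g) x.
Proof.
apply: val_inj; apply/rowP => j; rewrite /= !mxE.
rewrite [RHS](partition_big g (fun i => f i == j)) //=.
by apply: eq_bigr => i /eqP fij; rewrite mxE; apply: eq_bigl => l;
  case: eqVneq => [->|]; rewrite ?fij ?eqxx ?andbF.
Qed.

Lemma vert_vert s f m g k : (forall j, (j <= k)%N -> (g j <= m)%N) ->
  vert (vert s f m) g k = vert s (f \o g) k.
Proof.
move=> gm; rewrite /vert; congr existT; apply/continuousEP => x /=.
rewrite face_map_comp; congr (projT2 s (face_map _ x)).
by apply/funext => j /=; rewrite inordK // ltnS gm // -ltnS.
Qed.

Lemma vert_id s : vert s id (sdim s) = s.
Proof.
case: s => n s; rewrite /vert /=; congr existT; apply/continuousEP => x /=.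
congr (s _); apply: val_inj; apply/rowP => j; rewrite mxE (bigD1 j) /=; last first.
  by rewrite inord_val.
by rewrite big1 ?addr0 // => i /andP[]; rewrite inord_val => /eqP -> /eqP.
Qed.

(* bump i is the i-th coface map, so this is the usual alternating sum. *)
Definition cobnd (c : singular -> int) : singular -> int := fun s =>
  if sdim s == 0%N then 0 else
  \sum_(i < (sdim s).+1) (-1) ^+ i * c (vert s (bump i) (sdim s).-1).

(* Front p-face times back (n - p)-face. *)
Definition cup (a b : singular -> int) : singular -> int := fun s =>
  \sum_(p < (sdim s).+1) a (vert s id p) * b (vert s (addn p) (sdim s - p)).

Definition cochain1 : singular -> int := fun s => (sdim s == 0%N)%:R.

Lemma cupA : associative cup.
Proof.
move=> a b c; apply/funext => s; rewrite /cup; set n := sdim s.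
pose F r p := a (vert s id r) * b (vert s (addn r) (p - r)) * c (vert s (addn p) (n - p)).
transitivity (\sum_(r < n.+1) \sum_(p < n.+1 | (r <= p)%N) F r p); last first.
  rewrite (exchange_big_dep xpredT) //=; apply: eq_bigr => -[p pn] _ /=.
  rewrite mulr_suml /= (big_ord_widen_cond n.+1 xpredT (fun r =>
    a (vert (vert s id p) id r) * b (vert (vert s id p) (addn r) (p - r)) *
    c (vert s (addn p) (n - p)))) //.
  apply: eq_big => [r|r /= rp]; first by rewrite ltnS.
  rewrite /F !vert_vert //=; last by move=> j jr; apply: leq_trans jr _.
  by move=> j; rewrite leq_subRL.
apply: eq_bigr => -[r rn] _ /=; rewrite mulr_sumr /=.
transitivity (\sum_(r <= p < n.+1) F r p); last first.
  rewrite big_geq_mkord; apply: eq_bigl => i; by [].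
have := big_addn 0 n.+1 r xpredT (F r); rewrite add0n => ->.
rewrite subSn // big_mkord; apply: eq_bigr => -[t tn] _ /=.
rewrite /F addnK mulrA (_ : (n - (t + r) = n - r - t)%N); last by lia.
rewrite ltnS in tn.
rewrite !vert_vert; [|by move=> j; lia..].
congr (_ * b _ * c _).
by apply: vert_ext => j _ /=; lia.
Qed.

Lemma cup1l : left_id cochain1 cup.
Proof.
move=> a; apply/funext => s; rewrite /cup big_ord_recl /= big1 ?addr0.
  by rewrite /cochain1 /= mul1r subn0 -[in RHS](vert_id s); congr a; apply: vert_ext.
by move=> i _; rewrite /cochain1 /= mul0r.
Qed.

Lemma cup1r : right_id cochain1 cup.
Proof.
move=> a; apply/funext => s; rewrite /cup big_ord_recr /= big1 ?add0r.
  by rewrite /cochain1 /= subnn mulr1 vert_id.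
by move=> i _; rewrite /cochain1 /= subn_eq0 leqNgt ltn_ord mulr0.
Qed.

Lemma cupDl : left_distributive cup +%R.
Proof.
move=> a b c; apply/funext => s; transitivity (cup a c s + cup b c s) => //.
by rewrite /cup -big_split /=; apply: eq_bigr => i _; rewrite -mulrDl.
Qed.

Lemma cupDr : right_distributive cup +%R.
Proof.
move=> a b c; apply/funext => s; transitivity (cup a b s + cup a c s) => //.
by rewrite /cup -big_split /=; apply: eq_bigr => i _; rewrite -mulrDr.
Qed.

Definition sign_twist (a : singular -> int) : singular -> int := fun s => (-1) ^+ sdim s * a s.

Lemma cobnd_cup a b : cobnd (cup a b) = cup (cobnd a) b + cup (sign_twist a) (cobnd b).
Proof.
apply/funext => s; transitivity (cup (cobnd a) b s + cup (sign_twist a) (cobnd b) s) => //.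
rewrite /cup {1}/cobnd.
have /= [->|n0] := eqVneq (sdim s) 0%N.
  by rewrite !big_ord_recl !big_ord0 /cobnd /= !(mul0r, mulr0) !addr0.
have [m nE] : exists m, sdim s = m.+1 by exists (sdim s).-1; rewrite prednK // lt0n.
rewrite nE /=.
pose G p i := (-1) ^+ i * (a (vert s (bump i) p) * b (vert s (bump i \o addn p) (m - p))).
pose T p := (-1) ^+ p * (a (vert s id p) * b (vert s (addn p.+1) (m - p))).
transitivity (\sum_(p < m.+1) \sum_(0 <= i < m.+2) G p i).
  rewrite [RHS](eq_bigr (fun p : 'I_m.+1 => \sum_(i < m.+2) G p i)); last first.
    by move=> p _; rewrite big_mkord.
  rewrite exchange_big /=; apply: eq_bigr => i _; rewrite mulr_sumr.
  apply: eq_bigr => -[p pm] _; rewrite /G /= !vert_vert //.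
    by move=> j /=; lia.
  by move=> j /=; lia.
rewrite [X in _ = X + _]big_ord_recl [X in _ = _ + X]big_ord_recr /=.
rewrite {1}/cobnd /= mul0r add0r.
rewrite [X in _ = _ + (_ + X)](_ : _ = 0) ?addr0; last first.
  by rewrite /cobnd /= subnn /= mulr0.
rewrite -big_split /=; apply: eq_bigr => -[p pm] _ /=; rewrite ltnS in pm.
rewrite (big_cat_nat (n := p.+1)) //=; last by lia.
have -> : cobnd a (vert s id (bump 0 p)) * b (vert s (addn (bump 0 p)) (m.+1 - bump 0 p))
          = \sum_(0 <= i < p.+1) G p i - T p.
  rewrite /bump /= add1n subSS /cobnd /= big_ord_recr /= mulrDl; congr (_ + _).
    rewrite mulr_suml big_mkord; apply: eq_bigr => -[i ip] _ /=.
    rewrite vert_vert /=; last by move=> j; rewrite /bump; lia.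
    rewrite /G -mulrA; congr (_ * (a _ * b _)); apply: vert_ext => j _ /=.
    rewrite /bump; lia.
  rewrite vert_vert /=; last by move=> j; rewrite /bump; lia.
  rewrite exprS mulN1r !mulNr /T mulrA; congr (- (_ * a _ * _)).
  by apply: vert_ext => j jp /=; rewrite /bump; lia.
have -> : sign_twist a (vert s id p) * cobnd b (vert s (addn p) (m.+1 - p))
          = T p + \sum_(p.+1 <= i < m.+2) G p i.
  rewrite subSn // /sign_twist /cobnd /= big_ord_recl mulrDr; congr (_ + _).
    rewrite /= vert_vert /=; last by move=> j; rewrite /bump; lia.
    rewrite /T expr0 mul1r mulrA; congr (_ * _ * b _).
    by apply: vert_ext => j _ /=; rewrite /bump; lia.
  have := big_addn 0 m.+2 p.+1 xpredT (G p); rewrite add0n => ->.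
  rewrite (_ : (m.+2 - p.+1 = (m - p).+1)%N); last by lia.
  rewrite big_mkord mulr_sumr; apply: eq_bigr => -[k km] _ /=.
  rewrite vert_vert /=; last by move=> j; rewrite /bump; lia.
  rewrite /G (_ : (k + p.+1 = p + bump 0 k)%N); last by rewrite /bump; lia.
  rewrite exprD -!mulrA; congr (_ * _); rewrite mulrCA; congr (_ * (a _ * b _)).
    by apply: vert_ext => j jp; rewrite /bump; lia.
  by apply: vert_ext => j jp /=; rewrite /bump; lia.
by rewrite addrA subrK.
Qed.
End Singular.
Arguments singular : clear implicits.

Section Cohomology.
Context (R : realType) (X : topologicalType).
Local Notation singular := (singular R X).
Implicit Types (A : set X) (a b c : singular -> int).

(* The cochains of the pair (X, A). Vanishing in large dimensions makes them the
   direct sum, not the product, over all degrees. *)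
Definition rel_cochain A c :=
  (exists N, forall s : singular, (N <= sdim s)%N -> c s = 0) /\
  (forall s : singular, range (projT2 s) `<=` A -> c s = 0).

Lemma rel_cochain_sub A a b : rel_cochain A a -> rel_cochain A b -> rel_cochain A (a - b).
Proof.
move=> [[N aN] a0] [[M bM] b0]; split.
  exists (maxn N M) => s; rewrite geq_max => /andP[sN sM].
  by rewrite -[LHS]/(a s - b s) aN // bM // subr0.
by move=> s sA; rewrite -[LHS]/(a s - b s) a0 // b0 // subr0.
Qed.

Lemma rel_cochain0 A : rel_cochain A 0.
Proof. by split; [exists 0%N|]. Qed.

Lemma cobndB : {morph @cobnd R X : a b / a - b}.
Proof.
move=> a b; apply/funext => s; rewrite -[RHS]/(cobnd a s - cobnd b s) /cobnd.
case: eqP => _; first by rewrite subr0.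
by rewrite -sumrB; apply: eq_bigr => i _; rewrite -mulrBr.
Qed.

Lemma cobnd0 : @cobnd R X 0 = 0.
Proof. by rewrite -[X in cobnd X](subrr 0) cobndB subrr. Qed.

Definition cocycle A : {pred singular -> int} :=
  fun c => `[< rel_cochain A c /\ cobnd c = 0 >].

Lemma cocycle_closed A : zmod_closed (cocycle A).
Proof.
split=> [|a b /asboolP[a0 da] /asboolP[b0 db]]; apply/asboolP.
  by split; [exact: rel_cochain0|exact: cobnd0].
by split; [exact: rel_cochain_sub|rewrite cobndB da db subr0].
Qed.
HB.instance Definition _ A := GRing.isZmodClosed.Build _ (cocycle A) (cocycle_closed A).

Record rel_cocycle A := RelCocycle {
  cocycle_val : singular -> int;
  _ : cocycle_val \in cocycle A }.
HB.instance Definition _ A := [isSub for @cocycle_val A].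
HB.instance Definition _ A := [Choice of rel_cocycle A by <:].
HB.instance Definition _ A :=
  GRing.SubChoice_isSubZmodule.Build _ _ (rel_cocycle A) (zmodClosedP _).

Definition coboundary A : {pred rel_cocycle A} :=
  fun z => `[< exists2 b, rel_cochain A b & cobnd b = val z >].
Arguments coboundary : clear implicits.

Lemma coboundary_closed A : zmod_closed (coboundary A).
Proof.
split=> [|x y /asboolP[a a0 da] /asboolP[b b0 db]]; apply/asboolP.
  by exists 0; [exact: rel_cochain0|rewrite cobnd0 raddf0].
by exists (a - b); [exact: rel_cochain_sub|rewrite cobndB da db raddfB].
Qed.
HB.instance Definition _ A :=
  GRing.isZmodClosed.Build _ (coboundary A) (coboundary_closed A).

(* The total cohomology H^*(X, A; Z), the direct sum over all degrees. *)
Definition rcoh A := {ideal_quot (coboundary A)}.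
HB.instance Definition _ A := GRing.Zmodule.on (rcoh A).

(* The class of a cocycle; 0 if c is not one. *)
Definition cls A c : rcoh A := \pi_(rcoh A) (insubd 0 c).
Definition rep A (x : rcoh A) : singular -> int := val (repr x).

Lemma rep_cocycle A (x : rcoh A) : rep x \in cocycle A.
Proof. exact: valP. Qed.

Lemma repK A (x : rcoh A) : cls A (rep x) = x.
Proof. by rewrite /cls /rep valKd reprK. Qed.

Lemma cls_eq A a b : a \in cocycle A -> b \in cocycle A ->
  (cls A a = cls A b) <-> (exists2 c, rel_cochain A c & cobnd c = a - b).
Proof.
move=> aA bA; split=> [/eqP|[c c0 dc]]; last apply/eqP; rewrite -Quotient.idealrBE.
  by move/asboolP; rewrite raddfB /= !insubdK.
by apply/asboolP; exists c => //; rewrite raddfB /= !insubdK.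
Qed.

Lemma clsD A a b : a \in cocycle A -> b \in cocycle A ->
  cls A (a + b) = cls A a + cls A b.
Proof.
move=> aA bA; rewrite /cls -raddfD; congr (\pi_(rcoh A) _).
by apply: val_inj; rewrite raddfD /= !insubdK // rpredD.
Qed.

Lemma cup0l a : cup 0 a = 0.
Proof. by apply: (addrI (cup 0 a)); rewrite -cupDl !addr0. Qed.

Lemma cup0r a : cup a 0 = 0.
Proof. by apply: (addrI (cup a 0)); rewrite -cupDr !addr0. Qed.

Lemma cupBl a b c : cup (a - b) c = cup a c - cup b c.
Proof. by apply: (addIr (cup b c)); rewrite -cupDl !subrK. Qed.

Lemma cupBr a b c : cup a (b - c) = cup a b - cup a c.
Proof. by apply: (addIr (cup a c)); rewrite -cupDr !subrK. Qed.

Lemma rel_cochain_cup A a b : rel_cochain A a -> rel_cochain set0 b ->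
  rel_cochain A (cup a b).
Proof.
move=> [[N aN] a0] [[M bM] b0]; split.
  exists (N + M)%N => s sNM; rewrite /cup big1 // => -[p pn] _ /=.
  have [Np|pN] := leqP N p; first by rewrite aN // mul0r.
  by rewrite bM ?mulr0 //= -(leq_add2l p) subnKC // (leq_trans _ sNM) // leq_add2r ltnW.
move=> s sA; rewrite /cup big1 // => i _; rewrite a0 ?mul0r //.
by move=> _ [x _ <-] /=; apply: sA; eexists.
Qed.

Lemma cocycle_cup A a b : a \in cocycle A -> b \in cocycle set0 -> cup a b \in cocycle A.
Proof.
move=> /asboolP[aA da] /asboolP[bA db]; apply/asboolP; split.
  exact: rel_cochain_cup.
by rewrite cobnd_cup da db cup0l cup0r addr0.
Qed.

Lemma sign_twist_cocycle A a : a \in cocycle A -> cobnd (sign_twist a) = 0.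
Proof.
move=> /asboolP[_ da]; apply/funext => s; have := congr1 (fun f => f s) da.
rewrite /cobnd; case: eqP => // /eqP s0 da0.
transitivity ((-1) ^+ (sdim s).-1 * \sum_(i < (sdim s).+1) (-1) ^+ i * a (vert s (bump i) (sdim s).-1)).
  by rewrite mulr_sumr; apply: eq_bigr => i _; rewrite /sign_twist /= mulrCA.
by rewrite da0 mulr0.
Qed.

Lemma rel_cochain_sign_twist A a : rel_cochain A a -> rel_cochain A (sign_twist a).
Proof.
move=> [[N aN] a0]; split; first by exists N => s sN; rewrite /sign_twist aN ?mulr0.
by move=> s sA; rewrite /sign_twist a0 ?mulr0.
Qed.

Lemma sign_twistK a : sign_twist (sign_twist a) = a.
Proof. by apply/funext => s; rewrite /sign_twist mulrA -exprD addnn -mul2n exprM sqrrN !expr1n mul1r. Qed.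

(* The product H^*(X, A) x H^*(X) -> H^*(X, A). *)
Definition hcup A (x : rcoh A) (y : rcoh set0) : rcoh A := cls A (cup (rep x) (rep y)).

Lemma hcup_cls A a b : a \in cocycle A -> b \in cocycle set0 ->
  hcup (cls A a) (cls set0 b) = cls A (cup a b).
Proof.
move=> aA bA; rewrite /hcup.
have [c cA dc] := (cls_eq (rep_cocycle (cls A a)) aA).1 (repK _).
have [d dA dd] := (cls_eq (rep_cocycle (cls set0 b)) bA).1 (repK _).
set a' := rep _ in dc *; set b' := rep _ in dd *.
have a'A : a' \in cocycle A := rep_cocycle _.
have b'A : b' \in cocycle set0 := rep_cocycle _.
apply/cls_eq; [exact: cocycle_cup|exact: cocycle_cup|].
exists (cup c b' + cup (sign_twist a) d).
  rewrite -[cup (sign_twist a) d]opprK; apply: rel_cochain_sub.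
    by apply: rel_cochain_cup => //; case/asboolP: b'A.
  rewrite -[- _]sub0r; apply: rel_cochain_sub; first exact: rel_cochain0.
  by apply: rel_cochain_cup => //; apply: rel_cochain_sign_twist; case/asboolP: aA.
have dD x y : cobnd (x + y) = cobnd x + cobnd y :> (singular -> int).
  by apply: (addIr (- cobnd y)); rewrite -cobndB !addrK.
rewrite dD !cobnd_cup dc dd (sign_twist_cocycle aA) sign_twistK cup0l add0r.
case/asboolP: (b'A) => _ ->; rewrite cup0r addr0 cupBl cupBr.
by rewrite addrA subrK.
Qed.

Lemma cochain1_cocycle : @cochain1 R X \in cocycle set0.
Proof.
apply/asboolP; split; first split.
- by exists 1%N => s; rewrite /cochain1; case: sdim.
- move=> s s0.
  have [x _] : exists x : simplex R (sdim s), True.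
    suff h : \row_(j < (sdim s).+1) (j == 0)%:R \in simplex R (sdim s) by exists (exist (fun y => y \in simplex R (sdim s)) _ h).
    apply/mem_set; split=> [i|]; first by rewrite mxE ler0n.
    by rewrite (bigD1 0) //= big1 ?mxE ?addr0 // => i i0; rewrite mxE (negPf i0).
  by case: (s0 (projT2 s x)); exists x.
- apply/funext => s; rewrite /cobnd /cochain1 /=; case: eqP => //.
  case: (sdim s) => [|[|n]] //= _; last by rewrite big1 // => i _; rewrite mulr0.
  by rewrite !big_ord_recl big_ord0.
Qed.

(* The cohomology ring H^*(X; Z). *)
Definition hcoh := rcoh set0.
HB.instance Definition _ := GRing.Zmodule.on hcoh.
Definition hone : hcoh := cls set0 (@cochain1 R X).
Definition hmul (x y : hcoh) : hcoh := @hcup set0 x y.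

Lemma hmulA : associative hmul.
Proof.
move=> x y z; rewrite -[x]repK -[y]repK -[z]repK /hmul.
by rewrite !hcup_cls ?rep_cocycle ?cocycle_cup ?rep_cocycle // cupA.
Qed.

Lemma hmul1l : left_id hone hmul.
Proof.
by move=> x; rewrite -[x]repK /hmul hcup_cls ?cochain1_cocycle ?rep_cocycle // cup1l.
Qed.

Lemma hmul1r : right_id hone hmul.
Proof.
by move=> x; rewrite -[x]repK /hmul hcup_cls ?cochain1_cocycle ?rep_cocycle // cup1r.
Qed.

Lemma hmulDl : left_distributive hmul +%R.
Proof.
move=> x y z; rewrite -[x]repK -[y]repK -[z]repK /hmul -[_ + _ : hcoh]clsD ?rep_cocycle //.
by rewrite !hcup_cls ?rpredD ?rep_cocycle // cupDl clsD // cocycle_cup ?rep_cocycle.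
Qed.

Lemma hmulDr : right_distributive hmul +%R.
Proof.
move=> x y z; rewrite -[x]repK -[y]repK -[z]repK /hmul -[_ + _ : hcoh]clsD ?rep_cocycle //.
by rewrite !hcup_cls ?rpredD ?rep_cocycle // cupDr clsD // cocycle_cup ?rep_cocycle.
Qed.
HB.instance Definition _ := GRing.Zmodule_isPzRing.Build hcoh
  hmulA hmul1l hmul1r hmulDl hmulDr.
End Cohomology.
Arguments rcoh : clear implicits.
Arguments hcoh : clear implicits.

Section Smooth.
Context (R : realType) (V W : normedModType R).
(* f is of class C^k on the open set U: all iterated directional derivatives of
   order at most k exist and are continuous. *)
Fixpoint Ck (k : nat) (U : set V) (f : V -> W) : Prop :=
  match k with
  | 0 => forall x, U x -> {for x, continuous f}
  | k'.+1 => forall v, (forall x, U x -> derivable f x v) /\ Ck k' U ('D_v f)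
  end.
Definition smooth_on (U : set V) (f : V -> W) := forall k, Ck k U f.
End Smooth.

(* chart_map and chart_inv are total functions whose values matter only on
   chart_dom and on its image. *)
Record chart (R : realType) (G : topologicalType) (n : nat) := Chart {
  chart_dom : set G;
  chart_map : G -> 'rV[R]_n;
  chart_inv : 'rV[R]_n -> G;
  chart_dom_open : open chart_dom;
  chart_img_open : open (chart_map @` chart_dom);
  chart_mapK : forall x, chart_dom x -> chart_inv (chart_map x) = x;
  chart_map_cts : forall x, chart_dom x -> {for x, continuous chart_map};
  chart_inv_cts : forall y, (chart_map @` chart_dom) y -> {for y, continuous chart_inv} }.

HB.mixin Record isLieGroup (R : realType) G of Group G & Topological G := {
  lie_dim : nat;
  lie_atlas : set (chart R G lie_dim);
  lie_hausdorff : hausdorff_space G;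
  lie_second_countable : @second_countable G;
  lie_cover : forall x : G, exists2 a, lie_atlas a & chart_dom a x;
  lie_compat : forall a b, lie_atlas a -> lie_atlas b ->
    smooth_on (chart_map a @` (chart_dom a `&` chart_dom b)) (chart_map b \o chart_inv a);
  lie_mul_cts : continuous (fun xy : G * G => (xy.1 * xy.2)%g);
  lie_inv_cts : continuous (fun x : G => (x^-1)%g);
  lie_mul_smooth : forall a b d, lie_atlas a -> lie_atlas b -> lie_atlas d ->
    smooth_on
      [set xy : 'rV[R]_lie_dim * 'rV[R]_lie_dim |
        [/\ (chart_map a @` chart_dom a) xy.1, (chart_map b @` chart_dom b) xy.2
          & chart_dom d (chart_inv a xy.1 * chart_inv b xy.2)%g]]
      (fun xy => chart_map d (chart_inv a xy.1 * chart_inv b xy.2)%g);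
  lie_inv_smooth : forall a b, lie_atlas a -> lie_atlas b ->
    smooth_on
      [set x | (chart_map a @` chart_dom a) x /\ chart_dom b (chart_inv a x)^-1%g]
      (fun x => chart_map b (chart_inv a x)^-1%g) }.

#[short(type = "lieGroupType")]
HB.structure Definition LieGroup (R : realType) :=
  {G of isLieGroup R G & Group G & Topological G}.

Section Groups.
Context (G : groupType).
Definition mul_subgroup (H : set G) :=
  H 1%g /\ forall x y, H x -> H y -> H (x * y^-1)%g.
Definition group_gen (P : set G) : set G :=
  [set x | forall H, mul_subgroup H -> P `<=` H -> H x].
Definition derived (H : set G) : set G :=
  group_gen [set ([~ x, y])%g | x in H & y in H].
Definition solvable_set (H : set G) := exists n, iter n derived H = [set 1%g].
Definition normal_set (H : set G) := forall x g, H x -> H (x ^ g)%g.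
End Groups.

(* The solvable radical is trivial. *)
Definition semisimple (R : realType) (G : lieGroupType R) :=
  forall H : set G, mul_subgroup H -> normal_set H -> connected H ->
    solvable_set H -> H = [set 1%g].

Section OrbitSpace.
Context (Y : topologicalType) (tau : Y -> Y).
(* When tau has finite order this is y = tau^i x for some i, i.e. the orbit
   relation of the cyclic group generated by tau. Allowing iterates on both sides
   makes it an equivalence relation for every tau. *)
Definition orbit_rel : rel Y :=
  fun x y => `[< exists k m, iter k tau x = iter m tau y >].

Lemma orbit_rel_equiv : equiv_class_of orbit_rel.
Proof.
split=> [x|x y|y x z]; first by apply/asboolP; exists 0%N, 0%N.
  by apply/asboolP/asboolP => -[k [m e]]; exists m, k.
move=> /asboolP[k [m e]] /asboolP[k' [m' e']]; apply/asboolP.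
exists (k' + k)%N, (m + m')%N.
by rewrite iterD e -iterD addnC iterD e' -iterD.
Qed.
Canonical orbit_equiv := EquivRelPack orbit_rel_equiv.
Canonical orbit_encModRel := defaultEncModRel orbit_rel.
Definition orbit_space := quotient_topology {eq_quot orbit_rel}.
HB.instance Definition _ := Topological.on orbit_space.
HB.instance Definition _ := Quotient.on orbit_space.
Definition orbit_pi : Y -> orbit_space := \pi_orbit_space.

Lemma orbit_pi_cts : continuous orbit_pi.
Proof. exact: pi_continuous. Qed.
End OrbitSpace.

Section OrbitMap.
Context (Y Y' : topologicalType) (tau : Y -> Y) (tau' : Y' -> Y').
Definition orbit_map (f : continuousType Y Y')
    (fE : forall y, f (tau y) = tau' (f y)) : orbit_space tau -> orbit_space tau' :=
  fun x => orbit_pi tau' (f (repr x)).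

Lemma orbit_map_cts f fE : continuous (@orbit_map f fE).
Proof.
apply: (@repr_comp_continuous _ _ _ (orbit_pi tau' \o f)).
  move=> y; apply: continuous_comp; first exact: cts_fun.
  exact: orbit_pi_cts.
move=> a b /eqP ab; apply/eqP.
suff : f a = f b %[mod {eq_quot (orbit_rel tau')}] by [].
have /eqmodP/asboolP[k [m e]] : a = b %[mod {eq_quot (orbit_rel tau)}] by [].
apply/eqmodP/asboolP; exists k, m.
have fiter j y : f (iter j tau y) = iter j tau' (f y).
  by elim: j => //= j <-.
by rewrite -!fiter e.
Qed.
HB.instance Definition _ f fE := isContinuous.Build _ _ (@orbit_map f fE) (@orbit_map_cts f fE).
End OrbitMap.

Section Pullback.
Context (R : realType) (X Y : topologicalType) (f : continuousType X Y).
Definition pull (c : singular R Y -> int) : singular R X -> int :=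
  fun s => c (existT _ (projT1 s) (f \o projT2 s : continuousType _ _)).
(* Meaningful when f maps A into B. *)
Definition rpull (A : set X) (B : set Y) (x : rcoh R Y B) : rcoh R X A := cls A (pull (rep x)).
Definition hpull (x : hcoh R Y) : hcoh R X := rpull set0 x.
(* The connecting homomorphism H^r(X) -> H^(r+1)(Y, f X) of the pair, for an
   embedding f: extend a representing cocycle to Y, then take its coboundary. *)
Definition connecting (x : hcoh R X) : rcoh R Y (range f) :=
  cls (range f) (cobnd (xget 0 [set b | rel_cochain set0 b /\ pull b = rep x])).
End Pullback.

(* x lies in the degree n summand. *)
Definition homogeneous (R : realType) (X : topologicalType) (A : set X) (n : nat) (x : rcoh R X A) :=
  exists c, [/\ c \in cocycle A, forall s : singular R X, sdim s != n -> c s = 0 & cls A c = x].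

Section Circle.
Context (R : realType).
Definition circle : set R[i]^o := [set z | `|z| = 1].
Definition disc : set R[i]^o := [set z | `|z| <= 1].
Definition cis (t : R) : R[i]^o := (cos t +i* sin t)%C.

Lemma cis_norm t : `|cis t| = 1.
Proof. by rewrite /cis normc_def /= cos2Dsin2 sqrtr1. Qed.

Lemma cis_cts : continuous cis.
Proof.
have emb : continuous (fun x : R => x%:C%C : R[i]^o).
  move=> x; apply/cvgrPdist_lt => /= e e0.
  have eR : e = (complex.Re e)%:C%C by move: e0; case: e => a b; rewrite ltcE /= => /andP[/eqP -> _].
  have e0' : 0 < complex.Re e by move: e0; rewrite ltcE => /andP[].
  near=> y; rewrite -rmorphB /= normc_def /= expr0n /= addr0 sqrtr_sqr eR ltcR.
  by near: y; apply: cvgr_dist_lt e0'.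
have -> : cis = (fun t => (cos t)%:C%C + ('i%C : R[i]) *: ((sin t)%:C%C : R[i]^o)).
  apply/funext => t; rewrite /cis /GRing.scale /=; simpc => //.
move=> t; apply: cvgD; first by apply: (continuous_comp (@continuous_cos R t)); exact: emb.
apply: cvgZr; by apply: (continuous_comp (@continuous_sin R t)); exact: emb.
Unshelve. all: by end_near. Qed.

Lemma rot_circle_subproof (t : R) (z : circle) : cis t * val z \in circle.
Proof. by apply/mem_set; rewrite /circle /= normrM cis_norm mul1r; apply: set_mem (valP z). Qed.

Lemma rot_disc_subproof (t : R) (z : disc) : cis t * val z \in disc.
Proof. by apply/mem_set; rewrite /disc /= normrM cis_norm mul1r; apply: set_mem (valP z). Qed.

Definition rot_circle (t : R) (z : circle) : circle :=
  exist (fun z => z \in circle) _ (rot_circle_subproof t z).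
Definition rot_disc (t : R) (z : disc) : disc :=
  exist (fun z => z \in disc) _ (rot_disc_subproof t z).

Lemma cis_circle t : cis t \in circle. Proof. exact/mem_set/cis_norm. Qed.

Definition circle_pt (t : R) : circle := exist (fun z => z \in circle) _ (cis_circle t).
Definition loop (x : simplex R 1) : circle :=
  circle_pt (2 * pi * val x 0 1).

Lemma loop_cts : continuous loop.
Proof.
apply: (@continuous_comp_initial circle (simplex R 1) R[i]^o set_val loop).
move=> x; apply: (@continuous_comp _ _ _ (fun x : simplex R 1 => 2 * pi * val x 0 1) cis); last exact: cis_cts.
suff h : continuous (fun x : simplex R 1 => (val x : 'rV[R]_2) 0 1).
  by apply: (@cvgM _ _ (nbhs x)); [exact: cvg_cst|exact: h].
move=> y; apply: (@continuous_comp (simplex R 1) _ _ set_val (fun M : 'rV[R]_2 => M 0 1)).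
  exact: (@initial_continuous (simplex R 1) _ set_val).
exact: coord_continuous.
Qed.
HB.instance Definition _ := isContinuous.Build _ _ loop loop_cts.
(* The positively oriented fundamental 1-cycle of the circle. *)
Definition circle_loop : singular R circle := existT _ 1%N (loop : continuousType _ _).

(* The degree 1 class taking the value 1 on the fundamental cycle. *)
Definition orientation_class : hcoh R circle :=
  xget 0 [set e | exists c, [/\ c \in cocycle set0, forall s, sdim s != 1%N -> c s = 0,
     c circle_loop = 1 & cls set0 c = e]].

Lemma circle_disc_subproof (z : circle) : val z \in disc.
Proof. by apply/mem_set; rewrite /disc /= (set_mem (valP z)). Qed.

Definition circle_disc (z : circle) : disc := exist (fun z => z \in disc) _ (circle_disc_subproof z).

Lemma circle_disc_cts : continuous circle_disc.
Proof.
apply: (@continuous_comp_initial disc circle R[i]^o set_val circle_disc).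
exact: (@initial_continuous circle _ set_val).
Qed.
HB.instance Definition _ := isContinuous.Build _ _ circle_disc circle_disc_cts.

Lemma disc0_subproof : 0 \in disc.
Proof. by apply/mem_set; rewrite /disc /= normr0. Qed.

Definition disc0 : disc := exist (fun z => z \in disc) _ disc0_subproof.
End Circle.
Arguments circle : clear implicits.
Arguments disc : clear implicits.
Arguments circle_disc : clear implicits.
Arguments disc0 : clear implicits.
Arguments orientation_class : clear implicits.

(* F : G x R -> G is a smooth map. *)
Definition smooth_family (R : realType) (G : lieGroupType R) (F : G -> R -> G) :=
  continuous (fun x : G * R => F x.1 x.2) /\
  forall a b : chart R G lie_dim, lie_atlas a -> lie_atlas b ->
    smooth_on
      [set x : 'rV[R]_lie_dim * R^o |
        (chart_map a @` chart_dom a) x.1 /\ chart_dom b (F (chart_inv a x.1) x.2)]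
      (fun x => chart_map b (F (chart_inv a x.1) x.2)).

Section Bundle.
Context (R : realType) (G : lieGroupType R) (q : nat) (c : G).
Let angle : R := 2 * pi / q%:R.

(* The action of a generator of Z_q on G, on G x S^1 and on G x D^2. *)
Definition base_gen (g : G) : G := (g * c)%g.
Definition total_gen (x : G * circle R) : G * circle R := ((x.1 * c)%g, rot_circle angle x.2).
Definition disc_gen (x : G * disc R) : G * disc R := ((x.1 * c)%g, rot_disc angle x.2).

Definition base_space := orbit_space base_gen.
Definition total_space := orbit_space total_gen.
Definition disc_space := orbit_space disc_gen.
HB.instance Definition _ := Topological.on base_space.
HB.instance Definition _ := Topological.on total_space.
HB.instance Definition _ := Topological.on disc_space.

Lemma fst_cts (Y Z : topologicalType) : continuous (@fst Y Z).
Proof. by move=> x; exact: cvg_fst. Qed.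

Lemma snd_cts (Y Z : topologicalType) : continuous (@snd Y Z).
Proof. by move=> x; exact: cvg_snd. Qed.

Lemma pair_cts (Y Z W : topologicalType) (f : W -> Y) (g : W -> Z) :
  continuous f -> continuous g -> continuous (fun w => (f w, g w)).
Proof. by move=> fc gc w; apply: (cvg_pair (fc w) (gc w)). Qed.

Lemma slice_cts (g : G) : continuous (fun z : disc R => (g, z)).
Proof. by apply: pair_cts; [exact: (@cst_continuous (disc R) G g)|move=> z; exact: cvg_id]. Qed.

Lemma zero_cts : continuous (fun g : G => (g, disc0 R)).
Proof. by apply: pair_cts; [move=> z; exact: cvg_id|exact: (@cst_continuous G (disc R) (disc0 R))]. Qed.

Lemma incl_cts : continuous (fun x : G * circle R => (x.1, circle_disc R x.2)).
Proof.
apply: pair_cts; first exact: fst_cts.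
move=> x; apply: (@continuous_comp _ _ _ snd (circle_disc R)); first exact: snd_cts.
exact: circle_disc_cts.
Qed.

Definition circle_bundle : continuousType total_space base_space :=
  @orbit_map _ _ total_gen base_gen (mkcts (@fst_cts G (circle R))) (fun=> erefl).
Definition disc_bundle : continuousType disc_space base_space :=
  @orbit_map _ _ disc_gen base_gen (mkcts (@fst_cts G (disc R))) (fun=> erefl).

Lemma zero_gen g : mkcts zero_cts (base_gen g) = disc_gen (mkcts zero_cts g).
Proof. by rewrite /mkcts /disc_gen /=; congr pair; apply: val_inj; rewrite /= mulr0. Qed.

Definition zero_section : continuousType base_space disc_space := orbit_map zero_gen.

Lemma incl_gen x : mkcts incl_cts (total_gen x) = disc_gen (mkcts incl_cts x).
Proof. by rewrite /mkcts /disc_gen /=; congr pair; exact: val_inj. Qed.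

Definition boundary_incl : continuousType total_space disc_space := orbit_map incl_gen.

Definition fibre (g : G) : continuousType (disc R) disc_space :=
  mkcts (@orbit_pi_cts _ disc_gen) \o mkcts (@slice_cts g).

(* [G x D^2]/Z_q is the disc bundle whose boundary is [G x S^1]/Z_q. Its Thom
   class is the degree 2 class restricting on each fibre to the generator of
   H^2(D^2, S^1) given by the orientation of S^1. *)
Definition thom_class : rcoh R disc_space (range boundary_incl) :=
  xget 0 [set u | homogeneous 2 u /\
    forall g, rpull (fibre g) (range (circle_disc R)) u =
              connecting (circle_disc R) (orientation_class R)].

Definition euler_class : hcoh R base_space :=
  hpull zero_section (cls set0 (rep thom_class)).

(* The Gysin sequence is the sequence of the pair (disc bundle, circle bundle)
   rewritten with the Thom isomorphism y |-> u \cup y, so theta is the connecting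
   homomorphism followed by the inverse of that isomorphism. *)
Definition gysin_theta (x : hcoh R total_space) : hcoh R base_space :=
  xget 0 [set y | hcup thom_class (hpull disc_bundle y) = connecting boundary_incl x].

Definition circle_proj : continuousType (G * circle R)%type (circle R) :=
  mkcts (@snd_cts G (circle R)).

(* Mutually inverse homeomorphisms between G x S^1 and [G x S^1]/Z_q for which the
   projection to S^1 is [g, z] |-> z^q. *)
Definition trivialization (phi : continuousType (G * circle R)%type total_space)
    (psi : continuousType total_space (G * circle R)%type) :=
  [/\ cancel phi psi, cancel psi phi &
      forall g z, val (psi (orbit_pi total_gen (g, z))).2 = val z ^+ q].

(* phi and psi are smooth: [G x S^1]/Z_q has the smooth structure for which the
   covering G x S^1 -> [G x S^1]/Z_q is a local diffeomorphism, and the circle is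
   parametrized by angles. *)
Definition smooth_trivialization (phi : continuousType (G * circle R)%type total_space)
    (psi : continuousType total_space (G * circle R)%type) :=
  exists F F' : G -> R -> G,
    [/\ smooth_family F, smooth_family F',
        forall g t, (psi (orbit_pi total_gen (g, circle_pt t))).1 = F g t &
        forall g t, phi (g, circle_pt (t *+ q)) = orbit_pi total_gen (F' g t, circle_pt t)].
End Bundle.

(* Main.v *)
(** A sheet index idx : G -> [0, q) of the covering G -> G/Z_q makes the
   coboundary of floor(t / 2 pi - idx g / q) descend from G x R to a cocycle
   alpha on G x S^1. It is not Z_q-invariant, but the defect is the coboundary
   of a 0-cochain on G and is matched by a 1-cochain mu on G; extending alpha
   by mu over G x D^2 and taking the coboundary yields an invariant relative
   2-cocycle u, which restricts to d(mu) on the zero section. Multiplication by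
   u is an isomorphism since its cone is acyclic: first without equivariance, by
   contracting the disc and unwinding the circle, then on invariants, because
   cochains on a free Z_q-set form an induced module. Restriction to the fibres
   identifies the class of u with the Thom class, so the sequence of the pair
   (disc bundle, circle bundle) becomes the Gysin sequence. The Euler class is
   central, again by a norm argument, and nilpotent, since near every point it
   has a representative vanishing on small simplices; nilpotency makes h onto.

   The trivialization is [g, e^(it)] |-> (g gam(t)^-1, e^(iqt)) for a smooth
   curve gam in G with gam (t + 2 pi / q) = gam t * c; it exists because any two
   points of G are joined by a smooth path which is constant near its ends. *)
Require Import Defs.
From HB Require Import structures.
From mathcomp Require Import all_boot all_order all_algebra.
From mathcomp Require Import all_classical all_reals all_analysis.
From mathcomp Require Import complex freeg.
Import Order.TTheory GRing.Theory Num.Theory.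
Import numFieldNormedType.Exports.
Local Open Scope quotient_scope.
Local Open Scope classical_set_scope.
Local Open Scope ring_scope.
From mathcomp Require Import zify ring lra.

Set Implicit Arguments.
Unset Strict Implicit.
Unset Printing Implicit Defensive.

(** * Smooth functions and smooth maps into a Lie group *)

(** Taking invariants of cochains is not exact, so an isomorphism on the cohomology of G x (D^2,
    S^1) does not by itself pass to the orbit spaces. What passes is acyclicity of a complex of
    induced modules. The Thom isomorphism is therefore stated for cochains, as acyclicity of the
    mapping cone of multiplication by u, with dimensions tracked explicitly; for this u has to be
    strictly invariant and to vanish strictly on the boundary.

    The sheet index may be any function compatible with the action, because 0-cochains carry no
    continuity condition. Its one defect is the jump from q - 1 back to 0. Each orbit jumps exactly
    once, so the jump has norm 1 and its coboundary has norm 0, which is the condition for mu to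
    exist. The norm 1 is used again for centrality: it cancels the commutator of an invariant
    cocycle with the jump, although the cup product of cochains is not commutative. The freedom in
    the sheet index is used for nilpotency: an index adapted to an open set makes mu vanish over
    that set, so no knowledge of the dimension of G is required. *)

Section SmoothCalculus.
Context {R : realType}.

Section Values.
Context {V W : normedModType R}.
Implicit Types (f g : V -> W) (U : set V).

Lemma Ck_sub k U U' f : U' `<=` U -> Ck k U f -> Ck k U' f.
Proof.
elim: k f => [|k IH] f UU' /=; first by move=> fc x /UU'; exact: fc.
move=> h v; have [d dk] := h v; split=> [x /UU'|]; [exact: d|exact: IH].
Qed.

(** Every clause of [Ck] is tested point by point on the total function [f], so [N] need only
    contain [x] and may fail to be a neighbourhood of it. *)
Lemma Ck_local k U f : (forall x, U x -> exists2 N, N x & Ck k N f) -> Ck k U f.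
Proof.
elim: k f => [|k IH] f h /=; first by move=> x Ux; have [N Nx fN] := h x Ux; exact: fN.
move=> v; split=> [x Ux|]; first by have [N Nx fN] := h x Ux; have [d _] := fN v; exact: d.
by apply: IH => x Ux; have [N Nx fN] := h x Ux; exists N => //; have [] := fN v.
Qed.

Lemma open_near_eq U f g x : open U -> (forall x, U x -> f x = g x) -> U x ->
  \forall y \near x, f y = g y.
Proof. by move=> Uo fg Ux; apply: filterS (open_nbhs_nbhs (conj Uo Ux)) => y; exact: fg. Qed.

Lemma Ck_eq k U f g : open U -> (forall x, U x -> f x = g x) -> Ck k U f -> Ck k U g.
Proof.
move=> Uo; elim: k f g => [|k IH] f g fg /=.
  move=> fc x Ux; have h : f @ x --> f x := fc x Ux; rewrite (fg x Ux) in h.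
  exact: (cvg_trans (near_eq_cvg (open_near_eq Uo fg Ux)) h).
move=> h v; have [d dk] := h v; split=> [x Ux|].
  exact: (near_eq_derivable (open_near_eq Uo fg Ux) (d x Ux)).
by apply: IH dk => x Ux; apply: near_eq_derive; exact: open_near_eq Uo fg Ux.
Qed.

Lemma smooth_cts U f x : smooth_on U f -> U x -> {for x, continuous f}.
Proof. by move=> h; exact: (h 0%N). Qed.

Lemma smooth_derivable U f x v : smooth_on U f -> U x -> derivable f x v.
Proof. by move=> h; exact: (h 1%N v).1. Qed.

Lemma smooth_derive U f v : smooth_on U f -> smooth_on U ('D_v f).
Proof. by move=> h k; exact: (h k.+1 v).2. Qed.

Lemma Ck_cst k U (w : W) : Ck k U (fun=> w).
Proof.
elim: k w => [|k IH] w /=; first by move=> x _; exact: cst_continuous.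
move=> v; split=> [x _|]; first exact: derivable_cst.
have -> : 'D_v (fun=> w) = (fun=> 0) :> (V -> W) by apply/funext => x; exact: derive_cst.
exact: IH.
Qed.

Lemma Ck_add k U f g : open U -> Ck k U f -> Ck k U g -> Ck k U (fun x => f x + g x).
Proof.
move=> Uo; elim: k f g => [|k IH] f g /=.
  by move=> fc gc x Ux; apply: cvgD; [exact: fc|exact: gc].
move=> hf hg v; have [df kf] := hf v; have [dg kg] := hg v; split=> [x Ux|].
  by apply: derivableD; [exact: df|exact: dg].
apply: (Ck_eq Uo _ (IH _ _ kf kg)) => x Ux.
by rewrite -[RHS]/('D_v (f + g) x) deriveD //; [exact: df|exact: dg].
Qed.

Lemma Ck_sum (I : Type) (s : seq I) (F : I -> V -> W) k U : open U ->
  (forall i, Ck k U (F i)) -> Ck k U (fun x => \sum_(i <- s) F i x).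
Proof.
move=> Uo FC; elim: s => [|i s IH].
  by apply: (Ck_eq Uo _ (Ck_cst k U 0)) => x _; rewrite big_nil.
by apply: (Ck_eq Uo _ (Ck_add Uo (FC i) IH)) => x _; rewrite big_cons.
Qed.
End Values.

Lemma Ck_scale {V : normedModType R} k (U : set V) (a : R) (f : V -> R) : open U ->
  Ck k U f -> Ck k U (fun x => a * f x).
Proof.
move=> Uo; elim: k f => [|k IH] f /=.
  by move=> fc x Ux; apply: cvgM; [exact: cvg_cst|exact: fc].
move=> h v; have [df kf] := h v; split=> [x Ux|].
  by rewrite -[fun x => _]/(a \*: f); apply: derivableZ; exact: df.
apply: (Ck_eq Uo _ (IH _ kf)) => x Ux.
by rewrite -[RHS]/('D_v (a \*: f) x) deriveZ //; exact: df.
Qed.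

Lemma Ck_mul {V : normedModType R} k (U : set V) (f g : V -> R) : open U ->
  smooth_on U f -> smooth_on U g -> Ck k U (fun x => f x * g x).
Proof.
move=> Uo; elim: k f g => [|k IH] f g sf sg /=.
  by move=> x Ux; apply: cvgM; [exact: (smooth_cts sf)|exact: (smooth_cts sg)].
move=> v; have df x Ux := @smooth_derivable _ _ U f x v sf Ux.
have dg x Ux := @smooth_derivable _ _ U g x v sg Ux; split=> [x Ux|].
  by apply: derivableM; [exact: df|exact: dg].
apply: (Ck_eq Uo _ (Ck_add Uo (IH _ _ sf (smooth_derive v sg)) (IH _ _ sg (smooth_derive v sf)))) => x Ux.
by rewrite -[RHS]/('D_v (f * g) x) deriveM //; [exact: df|exact: dg].
Qed.

Section Affine.
Context {V V' W : normedModType R} (A L : V' -> V).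
Hypotheses (A_cts : continuous A) (A_aff : forall (h : R) v x, A (h *: v + x) = h *: L v + A x).

(** Difference quotients of [f \o A] in direction [v] are those of [f] in direction [L v], so an
    affine substitution needs no chain rule. *)
Lemma affine_quotient (f : V -> W) x v :
  (fun h : R => h^-1 *: (((f \o A) \o shift x) (h *: v) - (f \o A) x)) =
  (fun h : R => h^-1 *: ((f \o shift (A x)) (h *: L v) - f (A x))).
Proof. by apply/funext => h; rewrite /= /shift A_aff. Qed.

Lemma Ck_affine k (U : set V) (f : V -> W) : Ck k U f -> Ck k (A @^-1` U) (f \o A).
Proof.
elim: k f => [|k IH] f /=.
  by move=> fc x Ux; apply: (@continuous_comp _ _ _ A f); [exact: A_cts|exact: fc].
move=> h v; have [d dk] := h (L v); split=> [x Ux|].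
  by rewrite /derivable affine_quotient; exact: d.
have -> : 'D_v (f \o A) = 'D_(L v) f \o A by apply/funext => x; rewrite /derive affine_quotient.
exact: IH.
Qed.
End Affine.

Lemma rV_cts (V : topologicalType) n (F : V -> 'rV[R]_n) x :
  (forall i, {for x, continuous (fun y => F y 0 i)}) -> {for x, continuous F}.
Proof.
move=> Fc N [P hP PN].
apply: (@filterS _ (nbhs x) _ [set y | forall i, P 0 i (F y 0 i)]).
  by move=> y Py; apply: PN => i j; rewrite ord1.
apply: (@filter_forall _ _ (fun i y => P 0 i (F y 0 i)) (nbhs x) (nbhs_filter x)) => i.
by apply: (Fc i); exact: hP.
Qed.

Section Coordinates.
Context {V : normedModType R} {n : nat}.
Implicit Type F : V -> 'rV[R]_n.

Lemma Ck_coords k (U : set V) F : open U ->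
  (forall i, Ck k U (fun x => F x 0 i)) -> Ck k U F.
Proof.
move=> Uo; elim: k F => [|k IH] F h.
  by move=> x Ux; apply: rV_cts => i; exact: (h i).
move=> v; have dF x : U x -> derivable F x v.
  by move=> Ux; apply/derivable_mxP => i j; rewrite ord1; exact: (h j v).1.
split=> //; apply: IH => i; apply: (Ck_eq Uo _ (h i v).2) => x Ux.
by rewrite derive_mx ?mxE //; exact: dF.
Qed.

Lemma Ck_coord k (U : set V) F i : open U -> Ck k U F -> Ck k U (fun x => F x 0 i).
Proof.
move=> Uo; elim: k F => [|k IH] F h.
  move=> x Ux; apply: (@continuous_comp _ _ _ F (fun M : 'rV[R]_n => M 0 i)); first exact: h.
  exact: coord_continuous.
move=> v; have dF x : U x -> derivable F x v := (h v).1 x; split=> [x Ux|].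
  by have /derivable_mxP := dF x Ux; apply.
apply: (Ck_eq Uo _ (IH _ (h v).2)) => x Ux.
by rewrite derive_mx ?mxE //; exact: dF.
Qed.
End Coordinates.

(** * The chain rule for maps given by finitely many coordinates *)

Section ChainRule.
Context {W : normedModType R} (g : W -> R) (U' : set W).
Hypotheses (U'o : open U') (sg : smooth_on U' g).

Lemma shift_nbhs (y e : W) (P : set W) : nbhs y P -> exists A : set W, exists d : R,
  [/\ nbhs y A, 0 < d & forall w t, A w -> `|t| < d -> P (w + t *: e)].
Proof.
move=> yP; have sc : {for (y, 0 : R), continuous (fun p : W * R^o => p.1 + p.2 *: e)}.
  apply: cvgD; first exact: cvg_fst.
  by apply: cvgZr_tmp; exact: cvg_snd.
have := sc P; rewrite scale0r addr0 => /(_ yP)[[A B] /= [yA /nbhs_ballP[d d0 dB]] AB].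
exists A, d; split=> // w t Aw td; apply: (AB (w, t)); split=> //=; apply: dB.
by rewrite -ball_normE /ball_ /= sub0r normrN.
Qed.

Lemma line_is_derive (w e : W) (t : R) : derivable g (w + t *: e) e ->
  is_derive t 1 (fun t : R => g (w + t *: e)) ('D_e g (w + t *: e)).
Proof.
move=> d; have E : (fun h : R => h^-1 *: (((fun t : R => g (w + t *: e)) \o shift t) (h *: 1) - g (w + t *: e))) =
    (fun h : R => h^-1 *: ((g \o shift (w + t *: e)) (h *: e) - g (w + t *: e))).
  apply/funext => h; rewrite /= /shift; congr (_ *: (g _ - _)).
  by rewrite scalerDl -[h *: 1]/(h * 1) mulr1 addrCA.
by split; [rewrite /derivable E|rewrite /derive E].
Qed.

(** Stated for [b] of either sign, because the increments [b i h] of [chain_cvg] have no fixed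
    sign. *)
Lemma mvt_direction (w e : W) (b : R) :
  (forall t, `|t| <= `|b| -> U' (w + t *: e)) ->
  exists t, `|t| <= `|b| /\ g (w + b *: e) - g w = b * 'D_e g (w + t *: e).
Proof.
move=> hU; pose phi (t : R) := g (w + t *: e).
have dphi (t : R) : `|t| <= `|b| -> is_derive t 1 phi ('D_e g (w + t *: e)).
  by move=> tb; apply: line_is_derive; apply: (smooth_derivable sg); exact: hU.
have w0 : phi 0 = g w by rewrite /phi scale0r addr0.
have main (x y : R) : x <= y -> (forall t, x <= t <= y -> `|t| <= `|b|) ->
    exists2 t, `|t| <= `|b| & phi y - phi x = 'D_e g (w + t *: e) * (y - x).
  move=> xy hb; have [t|t|t txy tE] := @MVT_segment R phi (fun t => 'D_e g (w + t *: e)) x y xy.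
  - by rewrite in_itv /= => /andP[/ltW xt /ltW ty]; apply/dphi/hb; rewrite xt.
  - apply: derivable_within_continuous => {}t; rewrite in_itv /= => txy.
    by have [] := dphi t (hb t txy).
  - by exists t => //; apply: hb; move: txy; rewrite in_itv.
have [b0|/ltW b0] := leP 0 b.
  have [|t tb tE] := main 0 b b0.
    by move=> t /andP[t0 tb]; rewrite !ger0_norm.
  by exists t; split=> //; rewrite -w0 -[g _]/(phi b) tE subr0 mulrC.
have [|t tb tE] := main b 0 b0.
  by move=> t /andP[t0 tb]; rewrite !ler0_norm // lerN2.
exists t; split=> //; rewrite -w0 -[g _]/(phi b) -opprB tE sub0r mulrN opprK mulrC //.
Qed.

Context {I : Type} (e : I -> W).

Lemma sum_cvg0 (b : I -> R -> R) (s : seq I) : (forall i, b i h @[h --> 0^'] --> 0) ->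
  \sum_(i <- s) b i h *: e i @[h --> 0^'] --> (0 : W).
Proof.
move=> b0; elim: s => [|j t IH].
  have -> : (fun h : R => \sum_(i <- [::]) b i h *: e i) = (fun=> 0) by apply/funext => h; rewrite big_nil.
  exact: cvg_cst.
have -> : (fun h : R => \sum_(i <- j :: t) b i h *: e i) =
    (fun h => b j h *: e j + \sum_(i <- t) b i h *: e i) by apply/funext => h; rewrite big_cons.
have bj : b j h *: e j @[h --> 0^'] --> 0 *: e j by apply: cvgZr_tmp; exact: b0.
have h := cvgD bj IH; rewrite scale0r addr0 in h; exact: h.
Qed.

(** The vectors [b i h *: e i] are added one at a time. Each is a one-variable increment, which the
    mean value theorem turns into ['D_(e i) g] at an intermediate point tending to [y]; continuity
    of these partial derivatives does the rest. *)
Lemma chain_cvg (y : W) (b : I -> R -> R) (l : I -> R) (s : seq I) : U' y ->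
  (forall i, b i h @[h --> 0^'] --> 0) ->
  (forall i, h^-1 * b i h @[h --> 0^'] --> l i) ->
  h^-1 * (g (y + \sum_(i <- s) b i h *: e i) - g y) @[h --> 0^'] -->
    \sum_(i <- s) l i * 'D_(e i) g y.
Proof.
move=> Uy b0 bl; elim: s => [|i s IH].
  rewrite big_nil; have -> : (fun h : R => h^-1 * (g (y + \sum_(i <- [::]) b i h *: e i) - g y)) = (fun=> 0).
    by apply/funext => h; rewrite big_nil addr0 subrr mulr0.
  exact: cvg_cst.
pose z h := y + \sum_(j <- s) b j h *: e j.
have zy : z h @[h --> 0^'] --> y.
  have cy : y @[h --> (0 : R)^'] --> y by exact: cvg_cst.
  have h := cvgD cy (sum_cvg0 s b0); rewrite addr0 in h; exact: h.
(* The segment lies in [U'] only for small [h]; for the other [h] the intermediate parameter is the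
   dummy value 0. *)
have ex h : exists t, (forall t, `|t| <= `|b i h| -> U' (z h + t *: e i)) ->
    `|t| <= `|b i h| /\ g (z h + b i h *: e i) - g (z h) = b i h * 'D_(e i) g (z h + t *: e i).
  have [hU|nU] := pselect (forall t, `|t| <= `|b i h| -> U' (z h + t *: e i)).
    by have [t tP] := mvt_direction hU; exists t.
  by exists 0 => /nU.
have [th thP] := choice ex.
have good (P : set W) : nbhs y P -> \forall h \near 0^', forall t, `|t| <= `|b i h| -> P (z h + t *: e i).
  move=> /(shift_nbhs (e i))[A [d [yA d0 AP]]].
  have nA : \forall h \near 0^', A (z h) by exact: zy.
  have nb : \forall h \near 0^', `|b i h| < d.
    have := @cvgr0_norm_lt _ _ _ _ _ (b i) (b0 i) d d0; exact.
  near=> h => t tb; apply: AP; first by near: h.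
  by apply: (le_lt_trans tb); near: h.
have nU := good U' (open_nbhs_nbhs (conj U'o Uy)).
have zeta : z h + th h *: e i @[h --> 0^'] --> y.
  move=> P yP; have gP := good P yP; rewrite /nbhs /=; near=> h.
  have hU : forall t, `|t| <= `|b i h| -> U' (z h + t *: e i) by near: h.
  have hP : forall t, `|t| <= `|b i h| -> P (z h + t *: e i) by near: h.
  by apply: hP; have [] := thP h hU.
have Dc : {for y, continuous ('D_(e i) g)} by exact: (smooth_cts (smooth_derive _ sg)).
have Dz : 'D_(e i) g (z h + th h *: e i) @[h --> 0^'] --> 'D_(e i) g y.
  exact: (cvg_trans (cvg_app ('D_(e i) g) zeta) Dc).
have -> : \sum_(j <- i :: s) l j * 'D_(e j) g y = l i * 'D_(e i) g y + \sum_(j <- s) l j * 'D_(e j) g y by rewrite big_cons.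
have hs : h^-1 * b i h * 'D_(e i) g (z h + th h *: e i) + h^-1 * (g (z h) - g y) @[h --> 0^'] -->
    l i * 'D_(e i) g y + \sum_(j <- s) l j * 'D_(e j) g y by exact: (cvgD (cvgM (bl i) Dz) IH).
have eb : \forall h \near (0 : R)^', h^-1 * b i h * 'D_(e i) g (z h + th h *: e i) + h^-1 * (g (z h) - g y) =
    h^-1 * (g (y + \sum_(j <- i :: s) b j h *: e j) - g y).
  near=> h; have hU : forall t, `|t| <= `|b i h| -> U' (z h + t *: e i) by near: h.
  have [_ E] := thP h hU; rewrite -mulrA -E -mulrDr; congr (_ * _).
  by rewrite big_cons [b i h *: _ + _]addrC addrA -/(z h) addrA subrK.
have cb : (fun h : R => h^-1 * (g (y + \sum_(j <- i :: s) b j h *: e j) - g y)) @ 0^' `=>`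
    (fun h : R => h^-1 * b i h * 'D_(e i) g (z h + th h *: e i) + h^-1 * (g (z h) - g y)) @ 0^'.
  by apply: near_eq_cvg; exact: eb.
exact: (cvg_trans cb hs).
Unshelve. all: by end_near. Qed.

Context {V : normedModType R} (U : set V) (w0 : W) (c : I -> V -> R) (s : seq I) (f : V -> W).
Hypotheses (Uo : open U) (sc : forall i, smooth_on U (c i))
  (fE : forall x, f x = w0 + \sum_(i <- s) c i x *: e i) (fU : forall x, U x -> U' (f x)).

Lemma chain_is_derive x v : U x ->
  is_derive x v (g \o f) (\sum_(i <- s) 'D_v (c i) x * 'D_(e i) g (f x)).
Proof.
move=> Ux; pose b i (h : R) := c i (h *: v + x) - c i x.
have bl i : h^-1 * b i h @[h --> 0^'] --> 'D_v (c i) x.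
  exact: (@smooth_derivable _ _ U (c i) x v (sc i) Ux).
have b0 i : b i h @[h --> 0^'] --> 0.
  have id0 : h @[h --> (0 : R)^'] --> (0 : R) by exact: cvg_within.
  have hb : h * (h^-1 * b i h) @[h --> (0 : R)^'] --> 0 * 'D_v (c i) x by exact: (cvgM id0 (bl i)).
  have e0 : 0 * 'D_v (c i) x = 0 by rewrite mul0r.
  rewrite e0 in hb.
  have eb : \forall h \near (0 : R)^', h * (h^-1 * b i h) = b i h.
    near=> h; have h0 : h != 0 by near: h; exact: nbhs_dnbhs_neq.
    by rewrite mulrA divff // mul1r.
  have cb : b i @ 0^' `=>` (fun h : R => h * (h^-1 * b i h)) @ 0^' by apply: near_eq_cvg; exact: eb.
  exact: (cvg_trans cb hb).
have E : (fun h : R => h^-1 *: (((g \o f) \o shift x) (h *: v) - (g \o f) x)) =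
    (fun h => h^-1 * (g (f x + \sum_(i <- s) b i h *: e i) - g (f x))).
  apply/funext => h; rewrite /= /shift; congr (_ * (g _ - _)).
  rewrite !fE -addrA -big_split /=; congr (_ + _); apply: eq_bigr => i _.
  by rewrite -scalerDl /b [c i x + _]addrC subrK.
have main := chain_cvg (s := s) (fU Ux) b0 bl.
split; first by rewrite /derivable E; apply/cvg_ex; eexists; exact: main.
by rewrite /derive E; apply: cvg_lim.
Unshelve. all: by end_near. Qed.

End ChainRule.

Section ChainSmooth.
Context {V W : normedModType R} {I : Type} (e : I -> W) (U : set V) (U' : set W) (w0 : W)
  (c : I -> V -> R) (s : seq I) (f : V -> W).
Hypotheses (Uo : open U) (U'o : open U') (sc : forall i, smooth_on U (c i))
  (fE : forall x, f x = w0 + \sum_(i <- s) c i x *: e i) (fU : forall x, U x -> U' (f x)).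

Lemma chain_cts x : U x -> {for x, continuous f}.
Proof.
move=> Ux; have -> : f = (fun x => w0 + \sum_(i <- s) c i x *: e i) by exact/funext.
apply: cvgD; first exact: cvg_cst.
elim: (s) => [|j t IHt]; first by under eq_fun do rewrite big_nil; rewrite big_nil; exact: cvg_cst.
under eq_fun do rewrite big_cons; rewrite big_cons; apply: cvgD => //.
by apply: cvgZr_tmp; exact: (smooth_cts (sc j)).
Qed.

(** The factor [psi] closes the induction: the derivative of [g \o f] is a sum of terms
    ['D_v (c i) * ('D_(e i) g \o f)], again products of this form. *)
Lemma Ck_chain_mul k (g : W -> R) (psi : V -> R) : smooth_on U' g -> smooth_on U psi ->
  Ck k U (fun x => psi x * g (f x)).
Proof.
elim: k g psi => [|k IH] g psi sg sp.
  move=> x Ux; apply: cvgM; first exact: (smooth_cts sp).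
  apply: (@continuous_comp _ _ _ f g); first exact: chain_cts.
  exact: (smooth_cts sg (fU Ux)).
move=> v; have dg x (Ux : U x) := chain_is_derive U'o sg sc fE fU v Ux.
have dp x Ux := @smooth_derivable _ _ U psi x v sp Ux.
split=> [x Ux|].
  by apply: derivableM; [exact: dp|have [] := dg x Ux].
have smul i : smooth_on U (fun x => psi x * 'D_v (c i) x).
  by move=> m; apply: Ck_mul => //; exact: smooth_derive.
have S1 : Ck k U (fun x => \sum_(i <- s) psi x * 'D_v (c i) x * 'D_(e i) g (f x)).
  by apply: Ck_sum => // i; exact: (IH _ _ (smooth_derive (e i) sg) (smul i)).
apply: (Ck_eq Uo _ (Ck_add Uo (IH g _ sg (smooth_derive v sp)) S1)) => x Ux.
rewrite -[RHS]/('D_v (psi * (g \o f)) x) deriveM; [|exact: dp|by have [] := dg x Ux].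
have [_ ->] := dg x Ux; rewrite addrC; congr (_ + _); last by rewrite mulrC.
by rewrite scaler_sumr; apply: eq_bigr => i _; rewrite -mulrA.
Qed.

Lemma smooth_chain (g : W -> R) : smooth_on U' g -> smooth_on U (g \o f).
Proof.
move=> sg k; have := Ck_chain_mul k sg (fun k => Ck_cst k U (1 : R)).
by apply: Ck_eq => // x _; rewrite mul1r.
Qed.

Lemma smooth_chain_rV n (g : W -> 'rV[R]_n) : smooth_on U' g -> smooth_on U (g \o f).
Proof.
move=> sg k; apply: Ck_coords => // i.
apply: (smooth_chain (g := fun w => g w 0 i)) => m; exact: Ck_coord.
Qed.
End ChainSmooth.
End SmoothCalculus.

(** * Smooth maps from a normed space to the group *)

Section SmoothMaps.
Context {R : realType} {G : lieGroupType R}.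
Local Notation n := (@lie_dim R G).
Local Notation E := 'rV[R]_n.
Local Notation atlas := (@lie_atlas R G).
Local Notation img a := (chart_map a @` chart_dom a).
Implicit Types a b d : chart R G n.

(** Continuity is a clause of its own: it makes the preimages of chart domains open when [U] is, and
    the coordinate expressions are tested on these preimages. *)
Definition smooth_map {V : normedModType R} (U : set V) (f : V -> G) :=
  (forall x, U x -> {for x, continuous f}) /\
  forall d, atlas d -> smooth_on (U `&` f @^-1` chart_dom d) (chart_map d \o f).

Lemma preimage_open {X Y : topologicalType} (U : set X) (f : X -> Y) (P : set Y) : open U -> open P ->
  (forall x, U x -> {for x, continuous f}) -> open (U `&` f @^-1` P).
Proof.
move=> Uo Po fc; rewrite openE => x [Ux Px]; rewrite /interior; apply: filterI.
  exact: open_nbhs_nbhs (conj Uo Ux).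
by apply: (fc x Ux); exact: open_nbhs_nbhs (conj Po Px).
Qed.

Section Basic.
Context {V : normedModType R}.
Implicit Types (U : set V) (f : V -> G).

Lemma smooth_map_open U f d : open U -> smooth_map U f -> open (U `&` f @^-1` chart_dom d).
Proof. by move=> Uo [fc _]; apply: preimage_open => //; exact: chart_dom_open. Qed.

Lemma smooth_map_sub U U' f : U' `<=` U -> smooth_map U f -> smooth_map U' f.
Proof.
move=> UU [fc fs]; split=> [x /UU|d ad]; first exact: fc.
by move=> k; apply: Ck_sub (fs d ad k) => x [/UU].
Qed.

Lemma smooth_map_local U f : (forall x, U x -> exists2 N, N x & smooth_map N f) -> smooth_map U f.
Proof.
move=> h; split=> [x Ux|d ad k]; first by have [N Nx [fc _]] := h x Ux; exact: fc.
apply: Ck_local => x [Ux dx]; have [N Nx [_ fs]] := h x Ux.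
by exists (N `&` f @^-1` chart_dom d) => //; exact: fs.
Qed.

Lemma smooth_map_eq U f f' : open U -> (forall x, U x -> f x = f' x) -> smooth_map U f -> smooth_map U f'.
Proof.
move=> Uo ff sf; have [fc fs] := sf; split=> [x Ux|d ad k].
  have h : f @ x --> f x := fc x Ux; rewrite (ff x Ux) in h.
  have fe : \forall y \near x, f y = f' y.
    by apply: filterS (open_nbhs_nbhs (conj Uo Ux)) => y; exact: ff.
  have ce : f' @ x `=>` f @ x by apply: near_eq_cvg; exact: fe.
  exact: (cvg_trans ce h).
have -> : U `&` f' @^-1` chart_dom d = U `&` f @^-1` chart_dom d.
  by apply/seteqP; split=> x [Ux dx]; split=> //; move: dx; rewrite /preimage /= ff.
by apply: Ck_eq (fs d ad k); [exact: smooth_map_open|move=> x [Ux _]; rewrite /= ff].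
Qed.

Lemma smooth_map_cst U (g : G) : smooth_map U (fun=> g).
Proof.
split=> [x _|d _ k]; first exact: cst_continuous.
exact: (Ck_cst k _ (chart_map d g)).
Qed.
End Basic.

Lemma img_open a : open (img a). Proof. exact: chart_img_open. Qed.

Lemma smooth_chart_inv a : atlas a -> smooth_map (img a) (chart_inv a).
Proof.
move=> aa; split=> [y|d ad k]; first exact: chart_inv_cts.
have h := lie_compat a d aa ad k; refine (Ck_sub _ h) => _ [[x ax <-]]; rewrite /preimage /= chart_mapK // => dx.
by exists x.
Qed.

Lemma smooth_map_affine {V V' : normedModType R} (A L : V' -> V) (U : set V) (f : V -> G) :
  continuous A -> (forall (h : R) v x, A (h *: v + x) = h *: L v + A x) ->
  smooth_map U f -> smooth_map (A @^-1` U) (f \o A).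
Proof.
move=> Ac Aa [fc fs]; split=> [x Ux|d ad k].
  by apply: (@continuous_comp _ _ _ A f); [exact: Ac|exact: fc].
exact: (Ck_affine Ac Aa (fs d ad k)).
Qed.

Lemma smooth_map_comp {V W : normedModType R} {I : Type} (e : I -> W) (U : set V) (U' : set W) (w0 : W)
    (c : I -> V -> R) (s : seq I) (F : V -> W) (f : W -> G) :
  open U -> open U' -> (forall i, smooth_on U (c i)) ->
  (forall x, F x = w0 + \sum_(i <- s) c i x *: e i) -> (forall x, U x -> U' (F x)) ->
  smooth_map U' f -> smooth_map U (f \o F).
Proof.
move=> Uo U'o sc FE FU sf; have [fc fs] := sf.
have Fc x : U x -> {for x, continuous F} by move=> Ux; exact: (chain_cts sc FE Ux).
have fFc x : U x -> {for x, continuous (f \o F)}.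
  by move=> Ux; apply: (@continuous_comp _ _ _ F f); [exact: Fc|apply: fc; exact: FU].
split=> // d ad; have UDo : open (U `&` (f \o F) @^-1` chart_dom d).
  by apply: preimage_open => //; exact: chart_dom_open.
apply: (smooth_chain_rV UDo (smooth_map_open d U'o sf) _ FE _ (fs d ad)) => [i k|x [Ux dx]].
  by apply: Ck_sub (sc i k) => x [].
by split=> //; exact: FU.
Qed.

Lemma smooth_map_comp_rV {V : normedModType R} (U : set V) (U' : set E) (F : V -> E) (f : E -> G) :
  open U -> open U' -> smooth_on U F -> (forall x, U x -> U' (F x)) ->
  smooth_map U' f -> smooth_map U (f \o F).
Proof.
move=> Uo U'o sF; apply: (smooth_map_comp (e := fun i : 'I_n => delta_mx 0 i) (w0 := 0)
  (c := fun i x => F x 0 i) (s := index_enum 'I_n)) => //.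
  by move=> i k; exact: Ck_coord.
by move=> x; rewrite add0r {1}(row_sum_delta (F x)).
Qed.

(** The standard basis of the product, in the shape [w0 + sum of c i *: e i] that [smooth_map_comp]
    asks of its inner map. *)
Lemma row_pairE (x : E * E) : x = 0 + \sum_(i <- [seq inl i | i <- index_enum 'I_n] ++ [seq inr i | i <- index_enum 'I_n])
   (match i with inl j => x.1 0 j | inr j => x.2 0 j end) *:
   (match i with inl j => (delta_mx 0 j, 0) | inr j => (0, delta_mx 0 j) end : E * E).
Proof.
rewrite add0r big_cat /= !big_map; apply: injective_projections.
  rewrite -[LHS](addr0 x.1) -[RHS]/((\sum_(j <- index_enum 'I_n) x.1 0 j *: (delta_mx 0 j, 0 : E)).1 +
    (\sum_(j <- index_enum 'I_n) x.2 0 j *: (0 : E, delta_mx 0 j)).1).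
  rewrite !(big_morph fst (id1 := 0) (op1 := +%R)) //; congr (_ + _).
    exact: row_sum_delta.
  by rewrite big1 // => i _; rewrite /= scaler0.
rewrite -[LHS](add0r x.2) -[RHS]/((\sum_(j <- index_enum 'I_n) x.1 0 j *: (delta_mx 0 j, 0 : E)).2 +
  (\sum_(j <- index_enum 'I_n) x.2 0 j *: (0 : E, delta_mx 0 j)).2).
rewrite !(big_morph snd (id1 := 0) (op1 := +%R)) //; congr (_ + _); last exact: row_sum_delta.
by rewrite big1 // => i _; rewrite /= scaler0.
Qed.

Lemma smooth_mul_charts a b : atlas a -> atlas b ->
  smooth_map [set xy : E * E | img a xy.1 /\ img b xy.2]
    (fun xy => chart_inv a xy.1 * chart_inv b xy.2)%g.
Proof.
move=> aa ab; split=> [[x y] [/= ax ay]|d ad k].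
  apply: (@continuous_comp _ _ _ (fun xy : E * E => (chart_inv a xy.1, chart_inv b xy.2))
    (fun xy : G * G => (xy.1 * xy.2)%g)); last exact: lie_mul_cts.
  apply: cvg_pair.
    apply: (@continuous_comp _ _ _ fst (chart_inv a)); [exact: cvg_fst|exact: chart_inv_cts].
  apply: (@continuous_comp _ _ _ snd (chart_inv b)); [exact: cvg_snd|exact: chart_inv_cts].
have h := lie_mul_smooth a b d aa ab ad k; refine (Ck_sub _ h) => -[x y] [[]] //.
Qed.

Lemma img_pair_open a b : open [set xy : E * E | img a xy.1 /\ img b xy.2].
Proof.
have -> : [set xy : E * E | img a xy.1 /\ img b xy.2] =
  (fst @^-1` (img a)) `&` (snd @^-1` (img b)) by apply/seteqP; split.
apply: openI; apply: open_comp; try exact: img_open.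
  by move=> x _; exact: cvg_fst.
by move=> x _; exact: cvg_snd.
Qed.

Lemma smooth_map_mul {V : normedModType R} (U : set V) (f1 f2 : V -> G) : open U ->
  smooth_map U f1 -> smooth_map U f2 -> smooth_map U (fun x => f1 x * f2 x)%g.
Proof.
move=> Uo s1 s2; apply: smooth_map_local => x0 Ux0.
have [a aa ax] := lie_cover (f1 x0); have [b ab bx] := lie_cover (f2 x0).
pose N := (U `&` f1 @^-1` chart_dom a) `&` (U `&` f2 @^-1` chart_dom b).
have No : open N by apply: openI; exact: smooth_map_open.
exists N => //; pose F x := (chart_map a (f1 x), chart_map b (f2 x)).
have sF : smooth_map N ((fun xy : E * E => chart_inv a xy.1 * chart_inv b xy.2)%g \o F).
  apply: (smooth_map_comp (U' := [set xy : E * E | img a xy.1 /\ img b xy.2]) (w0 := 0)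
    (c := fun i x => match i with inl j => (F x).1 0 j | inr j => (F x).2 0 j end) No _ _
    (fun x => row_pairE (F x))).
  - exact: img_pair_open.
  - have [[_ h1] [_ h2]] := (s1, s2).
    by case=> j k; apply: Ck_coord => //; [apply: Ck_sub (h1 a aa k)|apply: Ck_sub (h2 b ab k)] => x [].
  - by move=> x [[_ xa] [_ xb]]; split; [exists (f1 x)|exists (f2 x)].
  - exact: smooth_mul_charts.
by apply: (smooth_map_eq No _ sF) => x [[_ xa] [_ xb]]; rewrite /= !chart_mapK.
Qed.

Lemma smooth_map_inv {V : normedModType R} (U : set V) (f : V -> G) : open U ->
  smooth_map U f -> smooth_map U (fun x => (f x)^-1)%g.
Proof.
move=> Uo s1; apply: smooth_map_local => x0 Ux0; have [_ h1] := s1.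
have [a aa ax] := lie_cover (f x0); pose N := U `&` f @^-1` chart_dom a.
have No : open N by exact: smooth_map_open.
have si : smooth_map (img a) (fun y => (chart_inv a y)^-1)%g.
  split=> [y ay|d ad k].
    by apply: (@continuous_comp _ _ _ (chart_inv a) (fun x : G => x^-1)%g); [exact: chart_inv_cts|exact: lie_inv_cts].
  have h := lie_inv_smooth a d aa ad k; refine (Ck_sub _ h) => y [] //.
exists N => //; have FN x : N x -> img a ((chart_map a \o f) x) by move=> [_ xa]; exists (f x).
have sN := @smooth_map_comp_rV V N (img a) _ (fun y => (chart_inv a y)^-1)%g No (@img_open a) (h1 a aa) FN si.
by apply: (smooth_map_eq No _ sN) => x [_ xa]; rewrite /= chart_mapK.
Qed.

Lemma smooth_family_left (gam : R^o -> G) : smooth_map setT gam ->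
  smooth_family (fun g (t : R) => g * gam t)%g.
Proof.
move=> sg; have [gc _] := sg; split.
  move=> [g t]; apply: (@continuous_comp _ _ _ (fun x : G * R => (x.1, gam x.2)) (fun xy : G * G => (xy.1 * xy.2)%g)); last exact: lie_mul_cts.
  apply: cvg_pair; first exact: cvg_fst.
  by apply: (@continuous_comp _ _ _ snd gam); [exact: cvg_snd|exact: gc].
move=> a b aa ab; pose U : set (E * R^o) := fst @^-1` (img a).
have Uo : open U by apply: open_comp; [move=> x _; exact: cvg_fst|exact: img_open].
have s1 : smooth_map U (chart_inv a \o fst).
  by apply: (smooth_map_affine (L := fst) _ _ (smooth_chart_inv aa)) => // x; exact: cvg_fst.
have s2 : smooth_map U (gam \o snd).
  apply: smooth_map_sub (smooth_map_affine (A := snd : E * R^o -> R^o) (L := snd) _ _ sg) => // x; exact: cvg_snd.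
have [_ /(_ b ab) h] := smooth_map_mul Uo s1 s2.
by move=> k; apply: Ck_sub (h k) => x [].
Qed.
End SmoothMaps.

(** * Acyclic carriers and singular cochains *)

Section TupleCochains.
Context {P : Type}.
Implicit Types (c : seq P -> int) (l : seq P).

Definition cone (x : P) c : seq P -> int := fun l => c (x :: l).

(* The augmented coboundary of functions on tuples: [::] is the simplex of
   dimension -1, and cone x contracts the resulting complex. *)
Fixpoint dlt c l : int := if l is x :: l' then c l' - dlt (cone x c) l' else 0.

Lemma coneB x c c' : cone x (c - c') = cone x c - cone x c'.
Proof. by []. Qed.

Lemma cone_dlt x c : cone x (dlt c) = c - dlt (cone x c).
Proof. by []. Qed.

Lemma dltB c c' : dlt (c - c') = dlt c - dlt c'.
Proof.
apply/funext => l; elim: l c c' => [|x l IH] c c'; rewrite /= !fctE /= ?subr0 //.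
by rewrite coneB IH !fctE /=; lia.
Qed.

(** [dlt c l] sees only tuples one shorter than [l]. This justifies changing the fuel in the
    recursive operators below. *)
Lemma eq_dlt c c' l :
  (forall l', size l' = (size l).-1 -> c l' = c' l') -> dlt c l = dlt c' l.
Proof.
elim: l c c' => // x l IH c c' cc'; rewrite /= cc' //; congr (_ - _).
case: l IH cc' => // y l IH cc'; apply: IH => l' /= sl'.
by apply: cc'; rewrite /= sl'.
Qed.

Lemma dlt_dlt c l : dlt (dlt c) l = 0.
Proof.
elim: l c => // x l IH c; rewrite [LHS]/= cone_dlt dltB !fctE IH; lia.
Qed.

Lemma dlt_sum c l : dlt c l = \sum_(i < size l) (-1) ^+ i * c (take i l ++ drop i.+1 l).
Proof.
elim: l c => [|x l IH] c /=; first by rewrite big_ord0.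
rewrite big_ord_recl /= drop0 expr0 mul1r IH -sumrN; congr (_ + _).
by apply: eq_bigr => i _; rewrite /bump /= exprS mulN1r mulNr.
Qed.
End TupleCochains.

Lemma cone_map {P Q : Type} (f : P -> Q) x (c : seq Q -> int) :
  cone x (c \o map f) = cone (f x) c \o map f.
Proof. by []. Qed.

Lemma dlt_map {P Q : Type} (f : P -> Q) (c : seq Q -> int) :
  dlt (c \o map f) = dlt c \o map f.
Proof.
apply/funext => l; elim: l c => // x l IH c /=.
by rewrite cone_map IH.
Qed.

Record cochain_map {P Q : Type} (F : (seq Q -> int) -> seq P -> int) : Prop := CochainMap {
  cmB : forall c c', F (c - c') = F c - F c';
  cmD : forall c, F (dlt c) = dlt (F c) }.

(* Acyclic carriers: the operator below is, dually to the recursion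
   h [l] = v(l) . (F [l] - G [l] - h (boundary [l])), a cochain homotopy. *)
Section Carrier.
Context {P Q : Type} (v : seq P -> Q) (F G : (seq Q -> int) -> seq P -> int).

Fixpoint carrier_n n (c : seq Q -> int) l : int :=
  if n is n'.+1 then F (cone (v l) c) l - G (cone (v l) c) l - dlt (carrier_n n' (cone (v l) c)) l
  else 0.
Definition carrier c l := carrier_n (size l) c l.

Lemma carrierE c x l (k := cone (v (x :: l)) c) :
  carrier c (x :: l) = F k (x :: l) - G k (x :: l) - dlt (carrier k) (x :: l).
Proof.
rewrite /carrier; congr (_ - _); apply: eq_dlt => l' sl'.
by rewrite /carrier sl'.
Qed.

Lemma carrier_eq0 c l :
  (forall c l, (forall l', size l' = size l -> c l' = 0) -> F c l = 0) ->
  (forall c l, (forall l', size l' = size l -> c l' = 0) -> G c l = 0) ->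
  (forall l', size l' = (size l).+1 -> c l' = 0) -> carrier c l = 0.
Proof.
move=> F0 G0; have [n] := ubnP (size l); elim: n => // n IH in c l *; rewrite ltnS.
case: l => // x l ln c0; rewrite carrierE F0 ?G0 ?subrr ?sub0r; last 2 first.
- by move=> l' sl'; apply: c0; rewrite /= sl'.
- by move=> l' sl'; apply: c0; rewrite /= sl'.
rewrite (@eq_dlt _ _ (fun=> 0)); first by rewrite dlt_sum big1 ?oppr0 // => i _; rewrite mulr0.
move=> l' sl'; apply: IH; first by rewrite sl'.
by move=> l'' sl''; apply: c0; rewrite /= sl'' sl'.
Qed.

Hypotheses (hF : cochain_map F) (hG : cochain_map G)
  (FG0 : forall c, F c [::] = G c [::]).

Lemma carrierB c c' : carrier (c - c') = carrier c - carrier c'.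
Proof.
apply/funext => l; have [n] := ubnP (size l); elim: n => // n IH in c c' l *.
rewrite ltnS => ln; case: l ln => [|x l] ln; first exact/esym/subrr.
rewrite -[RHS]/(carrier c _ - carrier c' _) !carrierE coneB (cmB hF) (cmB hG).
rewrite (@eq_dlt _ _ (carrier (cone (v (x :: l)) c) - carrier (cone (v (x :: l)) c'))).
  by rewrite dltB !fctE; lia.
by move=> l' sl'; apply: IH; rewrite sl'.
Qed.

(** Unfold at the cone point [v l]. By the contraction identity [cone_dlt] and the formula for
    shorter tuples, all cancels except [F c l - G c l] and a double coboundary. Cone points of
    different tuples need not be compatible. *)
Lemma carrierP c l : dlt (carrier c) l + carrier (dlt c) l = F c l - G c l.
Proof.
have [n] := ubnP (size l); elim: n => // n IH in c l *; rewrite ltnS => ln.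
case: l ln => [|x l] ln.
  by rewrite -[LHS]/(0 + 0 : int) addr0 (FG0 c) subrr.
rewrite (carrierE (dlt c)) cone_dlt (cmB hF) (cmB hG) (cmD hF) (cmD hG) carrierB dltB !fctE.
set k := cone _ c.
have -> : dlt (carrier (dlt k)) (x :: l) = dlt (F k - G k - dlt (carrier k)) (x :: l).
  apply: eq_dlt => l' sl'; rewrite !fctE -IH ?sl' //; lia.
rewrite !dltB !fctE dlt_dlt; lia.
Qed.

End Carrier.

(* The subdivision operator S [l] = b(l) . S (boundary [l]), dually. *)
Section Subdivision.
Context {P : Type} (b : seq P -> P).

Fixpoint subdiv_n n (c : seq P -> int) l : int :=
  if n is n'.+1 then dlt (subdiv_n n' (cone (b l) c)) l else c l.
Definition subdiv c l := subdiv_n (size l) c l.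

Lemma subdivE c x l :
  subdiv c (x :: l) = dlt (subdiv (cone (b (x :: l)) c)) (x :: l).
Proof.
rewrite /subdiv; apply: eq_dlt => l' sl'.
by rewrite /subdiv sl'.
Qed.

Lemma subdiv_cochain_map : cochain_map subdiv.
Proof.
have sB c c' : subdiv (c - c') = subdiv c - subdiv c'.
  apply/funext => l; have [n] := ubnP (size l); elim: n => // n IH in c c' l *.
  rewrite ltnS => ln; case: l ln => // x l ln.
  rewrite -[RHS]/(subdiv c _ - subdiv c' _) !subdivE coneB.
  set k := cone _ c; set k' := cone _ c'.
  rewrite -[RHS]/((dlt (subdiv k) - dlt (subdiv k')) (x :: l)) -dltB.
  by apply: eq_dlt => l' sl'; apply: IH; rewrite sl'.
split=> // c; apply/funext => l.
have [n] := ubnP (size l); elim: n => // n IH in c l *; rewrite ltnS => ln.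
case: l ln => // x l ln; rewrite subdivE cone_dlt sB dltB; set k := cone _ c.
rewrite -[LHS]/(_ - dlt (subdiv (dlt k)) (x :: l)) -[RHS]subr0; congr (_ - _).
rewrite -[RHS](dlt_dlt (subdiv k) (x :: l)); apply: eq_dlt => l' sl'.
by rewrite IH ?sl'.
Qed.

Lemma subdiv_eq0 c l : (forall l', size l' = size l -> c l' = 0) -> subdiv c l = 0.
Proof.
have [n] := ubnP (size l); elim: n => // n IH in c l *; rewrite ltnS.
case: l => [|x l] ln c0; first exact: (c0 [::]).
rewrite subdivE (@eq_dlt _ _ (fun=> 0)).
  by rewrite dlt_sum big1 // => i _; rewrite mulr0.
move=> l' sl'; apply: IH; first by rewrite sl'.
by move=> l'' sl''; apply: c0; rewrite /= sl'' sl'.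
Qed.
End Subdivision.

Lemma subdiv_map {P P' : Type} b b' (f : P' -> P) (c : seq P -> int) :
  (forall x l, b (map f (x :: l)) = f (b' (x :: l))) ->
  subdiv b' (c \o map f) = subdiv b c \o map f.
Proof.
move=> bf; apply/funext => l; have [n] := ubnP (size l); elim: n => // n IH in c l *.
rewrite ltnS; case: l => // x l ln.
rewrite subdivE -[RHS]/(subdiv b c (f x :: map f l)) subdivE.
rewrite -[RHS]/((dlt _ \o map f) (x :: l)) -dlt_map; apply: eq_dlt => l' sl'.
by rewrite cone_map -bf IH ?sl'.
Qed.

Lemma carrier_map {P P' Q Q' : Type} (f : P' -> P) (g : Q' -> Q) v v'
    (F G : (seq Q -> int) -> seq P -> int) (F' G' : (seq Q' -> int) -> seq P' -> int) c :
  (forall x l, v (map f (x :: l)) = g (v' (x :: l))) ->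
  (forall c, F' (c \o map g) = F c \o map f) -> (forall c, G' (c \o map g) = G c \o map f) ->
  carrier v' F' G' (c \o map g) = carrier v F G c \o map f.
Proof.
move=> vf Ff Gf; apply/funext => l; have [n] := ubnP (size l); elim: n => // n IH in c l *.
rewrite ltnS; case: l => // x l ln.
rewrite carrierE -[RHS]/(carrier v F G c (f x :: map f l)) carrierE.
rewrite cone_map -vf Ff Gf; congr (_ - _ - _).
rewrite -[RHS]/((dlt _ \o map f) (x :: l)) -dlt_map; apply: eq_dlt => l' sl'.
by rewrite IH ?sl'.
Qed.

Lemma id_cochain_map {P : Type} : cochain_map (@id (seq P -> int)).
Proof. by []. Qed.

Lemma map_cochain_map {P Q : Type} (f : P -> Q) : cochain_map (fun c : seq Q -> int => c \o map f).
Proof. by split=> // c; rewrite dlt_map. Qed.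

(** * Affine simplices inside a standard simplex *)

Section Affine.
Context {R : realType}.

Lemma simplex_coord_cts n (j : 'I_n.+1) : continuous (fun x : simplex R n => val x 0 j).
Proof.
move=> x; apply: (@continuous_comp (simplex R n) _ _ set_val (fun M : 'rV[R]_n.+1 => M 0 j)).
  exact: (@initial_continuous (simplex R n) _ set_val).
exact: coord_continuous.
Qed.

Lemma cts_to_simplex (T : topologicalType) n (f : T -> simplex R n) :
  (forall j, continuous (fun x => val (f x) 0 j)) -> continuous f.
Proof.
move=> fc; apply: (@continuous_comp_initial (simplex R n) T 'rV[R]_n.+1 set_val f).
move=> x U [P hP PU].
apply: (@filterS _ (nbhs x) _ [set y : T | forall j, P 0 j (val (f y) 0 j)]).
  by move=> y Py; apply: PU => i j; rewrite ord1.
apply: (@filter_forall _ _ (fun j (y : T) => P 0 j (val (f y) 0 j)) (nbhs x) (nbhs_filter x)) => j.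
by apply: fc; exact: hP.
Qed.

Lemma simplex_ge0 n (x : simplex R n) i : 0 <= val x 0 i.
Proof. by case: x => x /= /set_mem[]. Qed.

Lemma simplex_sum1 n (x : simplex R n) : \sum_i val x 0 i = 1.
Proof. by case: x => x /= /set_mem[]. Qed.

Lemma vtx_subproof n (i : 'I_n.+1) : \row_(j < n.+1) (j == i)%:R \in simplex R n.
Proof.
apply/mem_set; split=> [j|]; first by rewrite mxE ler0n.
by rewrite (bigD1 i) //= big1 ?mxE ?eqxx ?addr0 // => j ji; rewrite mxE (negPf ji).
Qed.

Definition vtx n (i : 'I_n.+1) : simplex R n :=
  exist (fun y => y \in simplex R n) _ (vtx_subproof i).

Lemma comb_subproof n (p : nat -> simplex R n) m (x : simplex R m) :
  \sum_(i < m.+1) val x 0 i *: val (p i) \in simplex R n.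
Proof.
apply/mem_set; split=> [j|].
  by rewrite summxE sumr_ge0 // => i _; rewrite mxE mulr_ge0 ?simplex_ge0.
under eq_bigr do rewrite summxE.
rewrite exchange_big /= -(simplex_sum1 x); apply: eq_bigr => i _.
under eq_bigr do rewrite mxE.
by rewrite -mulr_sumr simplex_sum1 mulr1.
Qed.

(** The affine map sending vertex [i] to [p i]; the points are indexed by [nat] so that passing to
    faces needs no casts. *)
Definition comb n (p : nat -> simplex R n) m (x : simplex R m) : simplex R n :=
  exist (fun y => y \in simplex R n) _ (comb_subproof p x).
Arguments comb {n} p {m} x.

Lemma combE n (p : nat -> simplex R n) m (x : simplex R m) j :
  val (comb p x) 0 j = \sum_(i < m.+1) val x 0 i * val (p i) 0 j.
Proof. by rewrite summxE; apply: eq_bigr => i _; rewrite mxE. Qed.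

Lemma comb_cts n (p : nat -> simplex R n) m : continuous (@comb n p m).
Proof.
apply: cts_to_simplex => j; under eq_fun do rewrite combE.
apply: continuous_big => [|i _]; first exact: add_continuous.
by move=> x; apply: (@cvgM _ _ (nbhs x)); [exact: simplex_coord_cts|exact: cvg_cst].
Qed.
HB.instance Definition _ n p m := isContinuous.Build _ _ (@comb n p m) (@comb_cts n p m).

Lemma simplex_eq n (x y : simplex R n) : (forall j, val x 0 j = val y 0 j) -> x = y.
Proof. by move=> xy; apply: val_inj; apply/rowP. Qed.

Lemma comb_ext n (p r : nat -> simplex R n) m :
  (forall j, (j <= m)%N -> p j = r j) -> comb p = comb r :> (simplex R m -> simplex R n).
Proof.
move=> pr; apply/funext => x; apply: simplex_eq => j; rewrite !combE.
by apply: eq_bigr => i _; rewrite pr // -ltnS.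
Qed.

Lemma comb_comb n (p : nat -> simplex R n) m (r : nat -> simplex R m) k (x : simplex R k) :
  comb p (comb r x) = comb (@comb _ p m \o r) x.
Proof.
apply: simplex_eq => j; rewrite !combE.
under eq_bigr do rewrite combE mulr_suml.
rewrite exchange_big /=; apply: eq_bigr => i _; rewrite combE mulr_sumr.
by apply: eq_bigr => l _; rewrite mulrA.
Qed.

Lemma comb_vtx n (p : nat -> simplex R n) m (i : 'I_m.+1) : comb p (vtx i) = p i.
Proof.
apply: simplex_eq => j; rewrite combE (bigD1 i) //= mxE eqxx mul1r big1 ?addr0 // => l li.
by rewrite mxE (negPf li) mul0r.
Qed.

Lemma comb_id m (x : simplex R m) : comb (fun j => vtx (inord j)) x = x.
Proof.
apply: simplex_eq => j; rewrite combE (bigD1 j) //= big1 ?addr0.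
  by rewrite mxE inord_val eqxx mulr1.
by move=> i ij; rewrite mxE inord_val eq_sym (negPf ij) mulr0.
Qed.

Lemma face_comb n m (f : 'I_m.+1 -> 'I_n.+1) (x : simplex R m) :
  face_map f x = comb (fun j => vtx (f (inord j))) x.
Proof.
apply: simplex_eq => j; rewrite combE mxE big_mkcond /=; apply: eq_bigr => i _.
by rewrite mxE inord_val eq_sym; case: eqP => _; rewrite ?mulr1 ?mulr0.
Qed.

Lemma comb_face n (p : nat -> simplex R n) m f k (x : simplex R k) :
  (forall j, (j <= k)%N -> (f j <= m)%N) ->
  comb p (face_map (fun j : 'I_k.+1 => inord (f j) : 'I_m.+1) x) = comb (p \o f) x.
Proof.
move=> fm; rewrite face_comb comb_comb; congr (_ x); apply: comb_ext => j jk.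
by rewrite /= comb_vtx inordK inordK // ltnS fm.
Qed.

Lemma singular_eq (X : topologicalType) m (f g : continuousType (simplex R m) X) :
  f =1 g -> existT _ m f = existT _ m g :> singular R X.
Proof. by move=> fg; congr existT; apply/continuousEP. Qed.

(* Simplices of Z which become affine after a map f from a product of convex sets;
   Q will be a standard simplex, or its product with an interval. *)
Section Faces.
Context {Z : topologicalType} {Q : Type} (S : seq Q -> singular R Z).

(** The value 0 at [[::]] removes the augmentation from [dlt], in accordance with [cobnd], which
    gives 0 on simplices of dimension 0. *)
Definition lin (c : singular R Z -> int) : seq Q -> int :=
  fun l => if l is [::] then 0 else c (S l).

Hypotheses (Sdim : forall l, sdim (S l) = (size l).-1)
  (Sface : forall l i, (i < size l)%N -> (1 < size l)%N ->
     vert (S l) (bump i) (size l).-2 = S (take i l ++ drop i.+1 l)).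

Lemma lin_cobnd c : lin (cobnd c) = dlt (lin c).
Proof.
apply/funext => -[//|x [|y l]].
  by rewrite /= /cobnd Sdim /= subr0.
rewrite dlt_sum /lin /cobnd Sdim /=; apply: eq_bigr => i _; congr (_ * _).
rewrite (Sface (l := [:: x, y & l])) //.
by case: i => -[|[|i]] ltil //=; case: l ltil.
Qed.
End Faces.

Lemma nth_skip (Q : Type) (x0 : Q) i l j :
  (i < size l)%N -> nth x0 (take i l ++ drop i.+1 l) j = nth x0 l (bump i j).
Proof.
move=> il; rewrite nth_cat (size_takel (ltnW il)) /bump (leqNgt i j).
case: ltnP => ij; first by rewrite nth_take.
by rewrite nth_drop; congr nth; lia.
Qed.

Lemma size_skip (Q : Type) i (l : seq Q) : (i < size l)%N ->
  size (take i l ++ drop i.+1 l) = (size l).-1.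
Proof. by move=> il; rewrite size_cat (size_takel (ltnW il)) size_drop; lia. Qed.

Section HAffine.
Context {Y Z : topologicalType} (H : continuousType (Y * simplex R 1)%type Z).

Definition hmap (s : singular R Y) (p : nat -> simplex R (sdim s)) (t : nat -> simplex R 1) m
  (x : simplex R m) : Z := H (projT2 s (comb p x), comb t x).

Lemma hmap_cts s p t m : continuous (@hmap s p t m).
Proof.
move=> x; apply: (@continuous_comp _ _ _
  (fun x : simplex R m => (projT2 s (comb p x), comb t x)) H); last exact: cts_fun.
apply: pair_cts; last exact: comb_cts.
by move=> {}x; apply: (@continuous_comp (simplex R m) (simplex R (sdim s)) Y (comb p) (projT2 s) x);
  [exact: comb_cts|exact: cts_fun].
Qed.
HB.instance Definition _ s p t m := isContinuous.Build _ _ (@hmap s p t m) (@hmap_cts s p t m).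

Definition hsimplex (s : singular R Y) (p : nat -> simplex R (sdim s)) (t : nat -> simplex R 1) m
  : singular R Z := existT _ m (@hmap s p t m : continuousType (simplex R m) Z).

Definition hseq (s : singular R Y) (l : seq (simplex R (sdim s) * simplex R 1)) : singular R Z :=
  hsimplex (nth (vtx 0) (map fst l)) (nth (vtx 0) (map snd l)) (size l).-1.

Lemma hsimplex_ext s p p' t t' m : (forall j, (j <= m)%N -> p j = p' j) ->
  (forall j, (j <= m)%N -> t j = t' j) -> @hsimplex s p t m = hsimplex p' t' m.
Proof.
by move=> pp tt; apply: singular_eq => x; rewrite /= /hmap (comb_ext pp) (comb_ext tt).
Qed.

Lemma hsimplex_vert s p t m f k : (forall j, (j <= k)%N -> (f j <= m)%N) ->
  vert (@hsimplex s p t m) f k = @hsimplex s (p \o f) (t \o f) k.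
Proof.
by move=> fm; apply: singular_eq => x; rewrite /= /hmap !comb_face.
Qed.

Lemma hseq_face s l i : (i < size l)%N -> (1 < size l)%N ->
  vert (@hseq s l) (bump i) (size l).-2 = hseq (take i l ++ drop i.+1 l).
Proof.
move=> il l1; rewrite /hseq hsimplex_vert; last by move=> j; rewrite /bump; lia.
rewrite size_skip //; apply: hsimplex_ext => j jl /=;
  by rewrite map_cat map_take map_drop nth_skip // size_map.
Qed.
End HAffine.
End Affine.
Arguments comb {R n} p {m} x.

Section Push.
Context {R : realType} {X Y : topologicalType}.

Definition push (f : continuousType X Y) (s : singular R X) : singular R Y :=
  existT _ (projT1 s) (f \o projT2 s : continuousType _ _).

Lemma pullE f (c : singular R Y -> int) s : pull f c s = c (push f s).
Proof. by []. Qed.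

Lemma push_vert f s g m : push f (vert s g m) = vert (push f s) g m.
Proof. exact: singular_eq. Qed.
End Push.

(** * From operators on tuples to operators on singular cochains *)

Section NaturalOperators.
Context {R : realType}.

Definition vseq n : seq (simplex R n) := mkseq (fun j => vtx (inord j)) n.+1.

Lemma size_vseq n : size (vseq n) = n.+1.
Proof. exact: size_mkseq. Qed.

Lemma map_comb_vseq n (l : seq (simplex R n)) : l != [::] ->
  map (comb (nth (vtx 0) l)) (vseq (size l).-1) = l.
Proof.
move=> l0; have sl : (size l).-1.+1 = size l by case: l l0.
apply: (@eq_from_nth _ (vtx 0)); first by rewrite size_map size_vseq.
move=> i; rewrite size_map size_vseq => il.
by rewrite (nth_map (vtx 0)) ?size_vseq // nth_mkseq // comb_vtx inordK.
Qed.

Definition lift0 n (x : simplex R n) : simplex R n * simplex R 1 := (x, vtx 0).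

(** Affine simplices inside [s] are the case of [hseq] for the first projection, with the interval
    coordinate frozen at [vtx 0]; one computation of faces serves both. *)
Definition sseq (Y : topologicalType) (s : singular R Y) (l : seq (simplex R (sdim s))) :=
  hseq (mkcts (@fst_cts Y (simplex R 1))) (map (@lift0 _) l).

Lemma sseqE (Y : topologicalType) (s : singular R Y) l x :
  projT2 (@sseq Y s l) x = projT2 s (comb (nth (vtx 0) l) x).
Proof. by rewrite /= /hmap /mkcts /= -map_comp map_id. Qed.

Lemma sseq_vseq (Y : topologicalType) (s : singular R Y) : sseq (vseq (sdim s)) = s.
Proof.
case: s => n s; rewrite /sseq /hseq size_map size_vseq; apply: singular_eq => x /=.
rewrite /hmap /mkcts /=; congr (s _); rewrite -[RHS]comb_id; congr (_ x); apply: comb_ext => j jn.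
rewrite -[LHS]/(nth (vtx 0) (map fst (map (@lift0 n) (vseq n))) j).
by rewrite -map_comp map_id nth_mkseq.
Qed.

Context {Y Z : topologicalType} (H : continuousType (Y * simplex R 1)%type Z).
Context (O : forall n, (seq (simplex R n * simplex R 1) -> int) -> seq (simplex R n) -> int).

Definition hlin (c : singular R Z -> int) (s : singular R Y) := lin (@hseq R Y Z H s) c.

Arguments hlin : clear implicits.

(** As in the method of acyclic models, an operator on standard simplices determines one on singular
    cochains: restrict [c] to the affine simplices inside [s], apply [O], and evaluate on the
    vertices. *)
Definition nat_op (c : singular R Z -> int) : singular R Y -> int :=
  fun s => @O (sdim s) (hlin c s) (vseq (sdim s)).

Hypotheses (O0 : forall n c, c [::] = 0 -> @O n c [::] = 0)
  (Onat : forall n m (p : nat -> simplex R n) c,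
    @O m (c \o map (fun x : simplex R m * simplex R 1 => (comb p x.1, x.2))) =
    @O n c \o map (comb p)).

Lemma hlin_sseq c s l : hlin c (@sseq Y s l) =
  hlin c s \o map (fun x => (comb (nth (vtx 0) l) x.1, x.2)).
Proof.
apply/funext => -[//|x r]; set f := (fun x => _).
rewrite -[LHS]/(c (hseq H (x :: r))) -[RHS]/(c (hseq H (map f (x :: r)))) /hseq [in RHS]size_map.
congr c; apply: singular_eq => y; rewrite /= /hmap; congr (H (_, _)); last first.
  by apply: (congr1 (fun L => comb (nth (vtx 0) (x.2 :: L)) y)); rewrite -map_comp.
rewrite /= /hmap /mkcts /= -map_comp map_id comb_comb; congr (projT2 s _).
congr (_ y); apply: comb_ext => j jr.
transitivity (nth (vtx 0) (map (comb (nth (vtx 0) l)) (map fst (x :: r))) j).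
  by rewrite (nth_map (vtx 0)) //= size_map.
by rewrite -map_comp /= -map_comp.
Qed.

(** By naturality under affine maps the value on the vertices determines the value on every nonempty
    tuple, so identities between tuple operators pass to singular cochains. *)
Lemma nat_op_lin c s : lin (@sseq Y s) (nat_op c) = O (hlin c s).
Proof.
apply/funext => -[|x l]; first by rewrite O0.
rewrite /= /nat_op hlin_sseq Onat /=.
by have := @map_comb_vseq (sdim s) (x :: l) isT; rewrite /= size_map => ->.
Qed.

Lemma sseq_lin_cobnd c (s : singular R Y) : lin (@sseq Y s) (cobnd c) = dlt (lin (@sseq Y s) c).
Proof.
apply: lin_cobnd => [l|l i il l1]; first by rewrite /= size_map.
by rewrite /sseq map_cat map_take map_drop -hseq_face size_map.
Qed.

Lemma hlin_cobnd c s : hlin (cobnd c) s = dlt (hlin c s).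
Proof. by apply: lin_cobnd => // l i il l1; rewrite hseq_face. Qed.

Lemma cobnd_nat_op c s : cobnd (nat_op c) s = dlt (O (hlin c s)) (vseq (sdim s)).
Proof.
by rewrite -nat_op_lin -sseq_lin_cobnd -[in LHS](sseq_vseq s).
Qed.

Lemma nat_op_cobnd c s : nat_op (cobnd c) s = O (dlt (hlin c s)) (vseq (sdim s)).
Proof. by rewrite /nat_op hlin_cobnd. Qed.

Lemma nat_op_rel c n : (forall m (c : seq (simplex R m * simplex R 1) -> int) l,
   (forall l', size l' = (size l + n)%N -> c l' = 0) -> O c l = 0) ->
  forall k, (forall s, sdim s = (k + n)%N -> c s = 0) ->
  forall s, sdim s = k -> nat_op c s = 0.
Proof.
move=> On k c0 s sk; apply: On => -[//|x l]; rewrite size_vseq => ln.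
by apply: c0; rewrite -sk; exact: succn_inj ln.
Qed.

End NaturalOperators.

Arguments hlin {R Y Z} H c s l.
Arguments nat_op {R Y Z} H O c s.

(** * The prism operator of a homotopy *)

Section Homotopy.
Context {R : realType} {Y Z : topologicalType} (H : continuousType (Y * simplex R 1)%type Z).

Definition end_map (b : 'I_2) n (c : seq (simplex R n * simplex R 1) -> int) : seq (simplex R n) -> int :=
  c \o map (fun x => (x, vtx b)).

(** The product with the interval is convex, so any cone point depending naturally on the tuple
    would do; it is the bottom copy of the first vertex. *)
Definition prism n : (seq (simplex R n * simplex R 1) -> int) -> seq (simplex R n) -> int :=
  carrier (fun l => (head (vtx 0) l, vtx 0)) (end_map 1 (n := n)) (end_map 0 (n := n)).

Definition hop : (singular R Z -> int) -> singular R Y -> int := nat_op H prism.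

Lemma end_map_cochain_map b n : cochain_map (@end_map b n).
Proof. exact: map_cochain_map. Qed.

Lemma prism_nat n m (p : nat -> simplex R n) c :
  @prism m (c \o map (fun x : simplex R m * simplex R 1 => (comb p x.1, x.2))) =
    @prism n c \o map (comb p).
Proof.
apply: carrier_map => // d; rewrite /end_map; apply/funext => l /=; congr d; rewrite -!map_comp //.
Qed.

Lemma end_cts (b : 'I_2) : continuous (fun y : Y => H (y, vtx b)).
Proof.
move=> y; apply: (@continuous_comp _ _ _ (fun y : Y => (y, vtx b)) H); last exact: cts_fun.
by apply: pair_cts; [move=> z; exact: cvg_id|exact: cst_continuous].
Qed.

Definition hend b : continuousType Y Z := mkcts (@end_cts b).

Lemma hlin_end b c s : end_map b (hlin H c s) (vseq (sdim s)) = c (push (hend b) s).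
Proof.
rewrite -[LHS]/(c (hseq H (map (fun x => (x, vtx b)) (vseq (sdim s))))); congr c.
case: s => n s; rewrite -[sdim _]/n /hseq size_map.
have : forall j, (j <= n)%N -> nth (vtx 0) (vseq n) j = vtx (inord j) :> simplex R n.
  by move=> j jn; rewrite /vseq nth_mkseq.
rewrite size_vseq; move: (@vseq R n) (@size_vseq R n) => l sl nl; apply: singular_eq => x.
rewrite /= /hmap /hend /mkcts -!map_comp map_id -[in RHS](comb_id x); congr (H (s _, _)).
  by congr (_ x); apply: comb_ext => j jn; rewrite nl.
apply: simplex_eq => k; rewrite combE -[RHS]mul1r -(simplex_sum1 x) mulr_suml.
by apply: eq_bigr => i _; rewrite (nth_map (vtx 0)) // sl.
Qed.

Lemma hopP c s :
  cobnd (hop c) s + hop (cobnd c) s = pull (hend 1) c s - pull (hend 0) c s.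
Proof.
rewrite /hop cobnd_nat_op ?nat_op_cobnd; [|by []|exact: prism_nat].
rewrite !pullE -!hlin_end; apply: carrierP; [exact: end_map_cochain_map..|by []].
Qed.

Lemma hop_dim k c : (forall s, sdim s = k.+1 -> c s = 0) -> forall s, sdim s = k -> hop c s = 0.
Proof.
move=> c0; apply: (@nat_op_rel _ _ _ H prism c 1); last by move=> s; rewrite addn1 => /c0.
move=> m d l dl; apply: carrier_eq0 => [e r d0|e r d0|l' sl'].
- by rewrite /end_map /= d0 // size_map.
- by rewrite /end_map /= d0 // size_map.
- by apply: dl; rewrite addn1.
Qed.
End Homotopy.

(** * Barycentric subdivision of singular cochains *)

Section SubdivisionOperators.
Context {R : realType} {Y : topologicalType}.

Definition uniform_fun n : 'rV[R]_n.+1 := \row__ n.+1%:R^-1.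
Lemma uniform_subproof n : uniform_fun n \in simplex R n.
Proof.
apply/mem_set; split=> [i|]; first by rewrite mxE invr_ge0 ler0n.
under eq_bigr do rewrite mxE.
by rewrite sumr_const card_ord -[_ *+ _]mulr_natl divff // pnatr_eq0.
Qed.
Definition uniform n : simplex R n := exist (fun y => y \in simplex R n) _ (uniform_subproof n).

Definition bary n (l : seq (simplex R n)) : simplex R n := comb (nth (vtx 0) l) (uniform (size l).-1).

Lemma bary_map n m (p : nat -> simplex R n) (l : seq (simplex R m)) : l != [::] ->
  bary (map (comb p) l) = comb p (bary l).
Proof.
move=> l0; rewrite /bary size_map comb_comb; congr (_ _); apply: comb_ext => j jl.
by rewrite /= (nth_map (vtx 0)) //; case: l l0 jl.
Qed.

Definition sd_O n (c : seq (simplex R n * simplex R 1) -> int) : seq (simplex R n) -> int :=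
  subdiv (@bary n) (c \o map (@lift0 R n)).
Definition sdh_O n (c : seq (simplex R n * simplex R 1) -> int) : seq (simplex R n) -> int :=
  carrier (@bary n) id (subdiv (@bary n)) (c \o map (@lift0 R n)).

Let fstm := mkcts (@fst_cts Y (simplex R 1)) : continuousType _ _.
Definition sd : (singular R Y -> int) -> singular R Y -> int := nat_op fstm sd_O.
Definition sdh : (singular R Y -> int) -> singular R Y -> int := nat_op fstm sdh_O.

Lemma lift0_nat n m (p : nat -> simplex R n) (c : seq (simplex R n * simplex R 1) -> int) :
  (c \o map (fun x : simplex R m * simplex R 1 => (comb p x.1, x.2))) \o map (@lift0 R m) =
  (c \o map (@lift0 R n)) \o map (comb p).
Proof. by apply/funext => l /=; rewrite -!map_comp. Qed.

Lemma sd_O_nat n m (p : nat -> simplex R n) c :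
  @sd_O m (c \o map (fun x : simplex R m * simplex R 1 => (comb p x.1, x.2))) =
    @sd_O n c \o map (comb p).
Proof. by rewrite /sd_O lift0_nat; apply: subdiv_map => x l; rewrite bary_map. Qed.

Lemma sdh_O_nat n m (p : nat -> simplex R n) c :
  @sdh_O m (c \o map (fun x : simplex R m * simplex R 1 => (comb p x.1, x.2))) =
    @sdh_O n c \o map (comb p).
Proof.
rewrite /sdh_O lift0_nat; apply: carrier_map => // [x l|d]; first by rewrite bary_map.
by apply: subdiv_map => x l; rewrite bary_map.
Qed.

Definition slin (c : singular R Y -> int) (s : singular R Y) := lin (@sseq R Y s) c.
Arguments slin : clear implicits.

Lemma sd_slin c s : slin (sd c) s = subdiv (@bary _) (slin c s).
Proof.
rewrite /slin nat_op_lin //; last exact: sd_O_nat.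
rewrite /sd_O; congr subdiv; apply/funext => -[]//.
Qed.

Lemma sdhE c s : sdh c s = carrier (@bary _) id (subdiv (@bary _)) (slin c s) (vseq (sdim s)).
Proof.
rewrite /sdh /nat_op /sdh_O; congr (carrier _ _ _ _ _); apply/funext => -[]//.
Qed.

Lemma slinE c s : slin c s (vseq (sdim s)) = c s.
Proof. by rewrite -[in RHS](sseq_vseq s). Qed.

Lemma sd_eq0 c s : (forall t, sdim t = sdim s -> c t = 0) -> sd c s = 0.
Proof.
move=> c0; rewrite -slinE sd_slin; apply: subdiv_eq0 => -[//|x l].
by rewrite size_vseq => -[sl]; apply: c0; rewrite /= size_map.
Qed.

Lemma sdh_eq0 c s : (forall t, sdim t = (sdim s).+1 -> c t = 0) -> sdh c s = 0.
Proof.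
move=> c0; rewrite sdhE; apply: carrier_eq0 => [d l dl|d l dl|[//|x l]].
- exact: dl.
- exact: subdiv_eq0.
- by rewrite size_vseq => -[sl]; apply: c0; rewrite /= size_map.
Qed.

Lemma sd_cobnd c : sd (cobnd c) = cobnd (sd c).
Proof.
apply/funext => s; rewrite -slinE sd_slin -[RHS]slinE /slin !sseq_lin_cobnd.
by rewrite (cmD (subdiv_cochain_map _)) -/(slin (sd c) s) sd_slin.
Qed.

Lemma sdhP c s : cobnd (sdh c) s + sdh (cobnd c) s = c s - sd c s.
Proof.
rewrite -(slinE c) -(slinE (sd c)) sd_slin.
rewrite -(carrierP (@bary _) id_cochain_map (subdiv_cochain_map _)) //.
rewrite sdhE /slin sseq_lin_cobnd; congr (_ + _).
rewrite -slinE /slin sseq_lin_cobnd; congr dlt; rewrite /sdh nat_op_lin //; last exact: sdh_O_nat.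
rewrite /sdh_O; congr carrier; apply/funext => -[]//.
Qed.
End SubdivisionOperators.
Arguments slin {R Y} c s l.

(** * Lebesgue numbers and the mesh of a subdivision *)

Section Lebesgue.
Context {R : realType}.

Lemma simplex_le1 n (x : simplex R n) j : val x 0 j <= 1.
Proof.
rewrite -(simplex_sum1 x) (bigD1 j) //= lerDl sumr_ge0 // => i _; exact: simplex_ge0.
Qed.

Lemma simplex_compact n : compact (simplex R n).
Proof.
apply: (@subclosed_compact _ _ [set v : 'rV[R]_n.+1 | forall i, v ord0 i \in `[0, 1]]).
- rewrite (_ : simplex R n = (\bigcap_i [set x : 'rV[R]_n.+1 | 0 <= x 0 i]) `&`
    [set x : 'rV[R]_n.+1 | \sum_i x 0 i = 1]); last first.
    by apply/seteqP; split=> x /= [x0 x1]; split=> // i; [move=> _; exact: x0|exact: x0].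
  apply: closedI; first apply: closed_bigI => i _.
    have /continuous_closedP := @coord_continuous R 1 n.+1 0 i.
    by move=> /(_ [set y | 0 <= y] (@closed_ge R 0)).
  have /continuous_closedP : continuous (fun x : 'rV[R]_n.+1 => \sum_i x 0 i).
    apply: continuous_big => [|i _]; first exact: add_continuous.
    exact: coord_continuous.
  by move=> /(_ [set y | y = 1] (@closed_eq R 1)).
- apply: (@rV_compact R n.+1 (fun=> `[0, 1]%classic)) => _; exact: segment_compact.
- move=> x [x0 x1] i /=; rewrite in_itv /= x0 /= -x1 (bigD1 i) //= lerDl sumr_ge0 //.
Qed.

(* Distances in the simplex are measured coordinatewise. *)
Definition cdist n (x y : simplex R n) (r : R) := forall j, `|val x 0 j - val y 0 j| <= r.

Lemma nbhs_simplex n (x : simplex R n) (U : set (simplex R n)) : nbhs x U ->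
  exists2 e, 0 < e & forall y, cdist x y e -> U y.
Proof.
move=> [V [[W Wo <-] Wx] WU].
have /nbhs_ballP[e /= e0 eW] := open_nbhs_nbhs (conj Wo Wx).
exists (e / 2) => [|y xy]; first by rewrite divr_gt0.
apply: WU; apply: eW; split=> // i j; rewrite ord1; apply: le_lt_trans (xy j) _.
by rewrite ltr_pdivrMr // ltr_pMr // ltr1n.
Qed.

(** The Lebesgue number lemma, with a hereditary property [Q] of sets in place of containment in a
    member of a cover. *)
Lemma lebesgue n (Q : set (simplex R n) -> Prop) :
  (forall A B, A `<=` B -> Q B -> Q A) -> (forall x : simplex R n, exists2 U, nbhs x U & Q U) ->
  exists2 e, 0 < e & forall x, Q [set y | cdist x y e].
Proof.
move=> Qsub Qloc.
pose P e (z : 'rV[R]_n.+1) := forall x : simplex R n, val x = z -> Q [set y | cdist x y e].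
have /compact_near_coveringP/near_covering_withinP cov := simplex_compact (n := n).
have KP : \forall e \near 0^'+, simplex R n `<=` P e.
  apply: cov => z Kz.
  pose x : simplex R n := exist (fun z => z \in simplex R n) z (mem_set Kz).
  have [U xU QU] := Qloc x.
  have [e e0 eU] := nbhs_simplex xU.
  near=> z' i; move=> _ x' x'z'; apply: Qsub QU => y x'y; apply: eU => j.
  (* One half of the radius is spent on moving the centre, the other on the ball around it. *)
  have zz' : ball z (e / 2) z' by near: z'; apply: nbhsx_ballx; rewrite divr_gt0.
  have ie : i < e / 2 by near: i; apply: nbhs_right_lt; rewrite divr_gt0.
  rewrite (_ : val x 0 j - _ = (z 0 j - z' 0 j) + (val x' 0 j - val y 0 j)).
    rewrite (le_trans (ler_normD _ _)) // (splitr e) lerD //.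
      by apply: ltW; exact: zz'.2.
    by apply: le_trans (x'y j) _; exact: ltW.
  by rewrite x'z' addrA subrK.
near (0 : R)^'+ => e.
have e0 : 0 < e by near: e; exact: nbhs_right_gt.
have KPe : simplex R n `<=` P e by near: e.
by exists e => // x; apply: KPe => //; exact: set_mem (valP x).
Unshelve. all: by end_near. Qed.

End Lebesgue.

Section SmallTuples.
Context {R : realType} {n : nat}.
Implicit Types (l : seq (simplex R n)) (c : seq (simplex R n) -> int).

(* Any interval containing the j-th coordinates of l contains that of x. *)
Definition hull l (x : simplex R n) := forall j a r,
  (forall v, v \in l -> `|a - val v 0 j| <= r) -> `|a - val x 0 j| <= r.
Definition width l (d : R) := forall x y, x \in l -> y \in l -> cdist x y d.

(** For [k] points, that is in dimension n = k - 1, this is the classical factor n / (n + 1) by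
    which barycentric subdivision shrinks diameters. *)
Definition ratio k : R := k.-1%:R / k%:R.

Lemma ratio_ge0 k : 0 <= ratio k. Proof. by rewrite divr_ge0 ?ler0n. Qed.

Lemma ratio_le k : ratio k <= ratio k.+1.
Proof.
rewrite /ratio /=; case: k => [|k]; first by rewrite invr0 mulr0 mul0r.
rewrite ler_pdivrMr ?ltr0n // mulrAC ler_pdivlMr ?ltr0n // -!natrM ler_nat /=; lia.
Qed.

Lemma comb_hull l m (x : simplex R m) : (m < size l)%N -> hull l (comb (nth (vtx 0) l) x).
Proof.
move=> ml j a r alr; rewrite combE -[a]mul1r -(simplex_sum1 x) mulr_suml -sumrB.
rewrite (le_trans (ler_norm_sum _ _ _)) //.
rewrite -[r]mul1r -(simplex_sum1 x) mulr_suml; apply: ler_sum => i _.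
rewrite -mulrBr normrM ger0_norm ?simplex_ge0 // ler_wpM2l ?simplex_ge0 //.
by apply/alr/mem_nth/(leq_trans _ ml).
Qed.

Lemma bary_hull l : l != [::] -> hull l (bary l).
Proof. by move=> l0; apply: comb_hull; case: l l0. Qed.

(** In the average of the differences to [x] the term of [x] itself is 0, which leaves k - 1 terms
    of weight 1 / k. *)
Lemma bary_dist l d x : width l d -> x \in l -> cdist (bary l) x (ratio (size l) * d).
Proof.
move=> ld xl j; have l0 : l != [::] by case: l xl {ld}.
have sl : (size l).-1.+1 = size l by case: l l0 {ld xl}.
rewrite /bary combE -[val x 0 j]mul1r -(simplex_sum1 (uniform (size l).-1)) mulr_suml -sumrB.
rewrite (le_trans (ler_norm_sum _ _ _)) //.
have xi : (index x l < (size l).-1.+1)%N by rewrite sl index_mem.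
rewrite (bigD1 (Ordinal xi)) //= nth_index // -mulrBr subrr mulr0 normr0 add0r.
apply: (@le_trans _ _ (\sum_(i < (size l).-1.+1 | i != Ordinal xi) (size l)%:R^-1 * d)).
  have -> : (size l)%:R^-1 = (size l).-1.+1%:R^-1 :> R by rewrite sl.
  apply: ler_sum => i _; rewrite -mulrBr mxE normrM gtr0_norm ?invr_gt0 ?ltr0n //.
  rewrite ler_wpM2l ?invr_ge0 ?ler0n //; apply: ld => //.
  by apply/mem_nth/(leq_trans (ltn_ord i)); rewrite sl.
by rewrite sumr_const cardC1 card_ord -[leLHS]mulr_natl mulrA /ratio.
Qed.

Lemma hull_trans l l' x : (forall y, y \in l' -> hull l y) -> hull l' x -> hull l x.
Proof. by move=> ll' l'x j a r alr; apply: l'x => v vl'; apply: ll'. Qed.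

Lemma hull_mem l x : x \in l -> hull l x.
Proof. by move=> xl j a r; apply. Qed.

(** Dually to the estimate for subdivided simplices: such a simplex is the barycenter joined to a
    simplex of a subdivided face, and [ratio_le] absorbs the smaller number of points of the
    face. *)
Lemma subdiv_width c l d : 0 <= d -> width l d ->
  (forall l', size l' = size l -> (forall x, x \in l' -> hull l x) ->
    width l' (ratio (size l) * d) -> c l' = 0) -> subdiv (@bary _ n) c l = 0.
Proof.
move=> d0; have [k] := ubnP (size l); elim: k => // k IH in c l *; rewrite ltnS.
case: l => [|x0 l] ls ld cl; first exact: (cl [::]).
rewrite subdivE dlt_sum big1 // => i _; set b := bary _; set r := _ ++ _.
have sr : size r = size l by rewrite size_skip.
have rl x : x \in r -> x \in x0 :: l.
  by rewrite mem_cat => /orP[/mem_take|/mem_drop].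
rewrite (IH (cone b c) r) ?mulr0 ?sr //.
  by move=> x y xr yr; apply: ld; exact: rl.
move=> l' sl' l'r l'd; apply: cl; first by rewrite /= sl'.
  move=> x; rewrite inE => /predU1P[->|/l'r]; first exact: bary_hull.
  by apply: hull_trans => y /rl; exact: hull_mem.
have l'b x : x \in l' -> cdist b x (ratio (size l).+1 * d).
  move=> /l'r rx j; apply: rx => v /rl vl; exact: bary_dist.
move=> x y; rewrite !inE => /predU1P[->|xl'] /predU1P[->|yl'].
- by move=> j; rewrite subrr normr0 mulr_ge0 ?ratio_ge0.
- exact: l'b.
- by move=> j; rewrite distrC; exact: l'b.
- move=> j; apply: le_trans (l'd _ _ xl' yl' j) _.
  by rewrite ler_wpM2r // ratio_le.
Qed.

Lemma iter_subdiv_width K c l d : 0 <= d -> width l d ->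
  (forall l', size l' = size l -> (forall x, x \in l' -> hull l x) ->
    width l' (ratio (size l) ^+ K * d) -> c l' = 0) -> iter K (subdiv (@bary _ n)) c l = 0.
Proof.
elim: K l d => [|K IH] l d d0 ld cl.
  by apply: cl => // [x|]; [exact: hull_mem|rewrite expr0 mul1r].
rewrite iterS; apply: subdiv_width ld _ => // l' sl' l'l l'd.
apply: IH l'd _; first by rewrite mulr_ge0 ?ratio_ge0.
move=> l'' sl'' l''l' l''d; apply: cl; first by rewrite sl''.
  by move=> x /l''l'; exact: hull_trans.
by move: l''d; rewrite exprSr -mulrA sl'.
Qed.
End SmallTuples.

Lemma cls0 (R : realType) (X : topologicalType) (A : set X) : cls A 0 = 0 :> rcoh R X A.
Proof.
rewrite /cls (_ : insubd 0 0 = 0) ?raddf0 //; exact: (valKd 0 (0 : @rel_cocycle R X A)).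
Qed.

(** * Classes represented by cochains that vanish on small simplices *)

Section SmallSimplices.
Context {R : realType} {X : topologicalType}.
Implicit Types (c : singular R X -> int) (s : singular R X).

Definition small_zero c := forall x : X, exists2 U, nbhs x U &
  forall s, range (projT2 s) `<=` U -> c s = 0.

Lemma sd_iter_slin c s k : slin (iter k sd c) s = iter k (subdiv (@bary R _)) (slin c s).
Proof. by elim: k => //= k IH; rewrite sd_slin IH. Qed.

Lemma small_zero_slin c s m : small_zero c ->
  exists K, forall k l, (K <= k)%N -> size l = m.+1 ->
    iter k (subdiv (@bary R _)) (slin c s) l = 0.
Proof.
move=> c0.
pose Q (A : set (simplex R (sdim s))) := forall t : singular R X, range (projT2 t) `<=` projT2 s @` A -> c t = 0.
have [e e0 He] : exists2 e, 0 < e & forall x, Q [set y | cdist x y e].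
  apply: lebesgue => [A B AB QB t tA|x].
    by apply: QB => y /tA[z /AB Bz <-]; exists z.
  have [U xU cU] := c0 (projT2 s x).
  exists (projT2 s @^-1` U); first exact: (@cts_fun _ _ (projT2 s)).
  by move=> t tA; apply: cU => y /tA[z Uz <-].
have : \forall k \near \oo, ratio m.+1 ^+ k <= e :> R.
  have r0 : `|ratio m.+1 : R| < 1.
    by rewrite ger0_norm ?ratio_ge0 // /ratio /= ltr_pdivrMr // mul1r ltr_nat.
  near=> k; apply: ltW; have := ratio_ge0 (R := R) m.+1; near: k.
  have /cvgrPdist_lt/(_ _ e0) := cvg_expr r0.
  apply: filterS => k; rewrite sub0r normrN normrX => + r; by rewrite ger0_norm.
move=> [K _ HK]; exists K => k l Kk sl.
(* Two points of a standard simplex differ by at most 1 in each coordinate. *)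
apply: (iter_subdiv_width (d := 1)) => // [x y _ _ j|].
  rewrite ler_norml; have := simplex_ge0 x j; have := simplex_ge0 y j.
  have := simplex_le1 x j; have := simplex_le1 y j; lra.
move=> l'; rewrite sl mulr1; case: l' => // x l' sl' _ l'e.
apply: (He x) => y [z _ <-]; rewrite sseqE; set w := comb _ z; exists w => // j.
apply: comb_hull => [|v vl']; first by rewrite /= size_map.
apply: (le_trans (l'e _ _ _ vl' j)); first by rewrite inE eqxx.
exact: HK.
Unshelve. all: by end_near. Qed.

(* The sum over k of sdh (sd^k c) is finite on every simplex and its coboundary
   telescopes to c. *)
Lemma small_zero_cobnd c : small_zero c -> c \in cocycle set0 -> cls set0 c = 0.
Proof.
move=> c0 cc; have [/= [[N cN] _] dc] := asboolP _ cc.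
pose B k := sdh (iter k sd c).
have BN k s : (N <= sdim s)%N -> B k s = 0.
  move=> Ns; have iN t : (N <= sdim t)%N -> iter k sd c t = 0.
    by elim: (k) t => [|m IH] t Nt; [exact: cN|apply: sd_eq0 => r rt; apply: IH; rewrite rt].
  by apply: sdh_eq0 => t ts; rewrite iN // ts ltnW.
have dB k s : cobnd (B k) s = iter k sd c s - iter k.+1 sd c s.
  have sd0 : sd (0 : singular R X -> int) = 0 by apply/funext => t; exact: sd_eq0.
  have dk : cobnd (iter k sd c) = 0 by elim: k => //= k IH; rewrite -sd_cobnd IH.
  by rewrite iterS -sdhP dk (@sdh_eq0 _ _ 0) // addr0.
have fin s : exists K, forall k, (K <= k)%N -> B k s = 0 /\ iter k sd c s = 0.
  have [K1 HK1] := small_zero_slin s (sdim s) c0.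
  have [K2 HK2] := small_zero_slin s (sdim s).+1 c0.
  exists (maxn K1 K2) => k; rewrite geq_max => /andP[k1 k2]; split.
    rewrite /B sdhE sd_iter_slin; apply: carrier_eq0 => [d l dl|d l dl|l sl].
    - exact: dl.
    - exact: subdiv_eq0.
    - by apply: HK2 => //; rewrite sl size_vseq.
  by rewrite -slinE sd_iter_slin HK1 // size_vseq.
have [K HK] := choice fin.
pose b s := \sum_(k < K s) B k s.
have bE M s : (K s <= M)%N -> b s = \sum_(k < M) B k s.
  move=> sM; rewrite -(subnKC sM) big_split_ord /= [X in _ + X]big1 ?addr0 // => k _.
  by rewrite (HK s _ _).1 // leq_addr.
rewrite -(cls0 _ set0); apply/cls_eq => //; first exact: rpred0.
exists b.
  split; last by move=> s /(_ (projT2 s (vtx 0))) []; exists (vtx 0).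
  by exists N => s Ns; rewrite /b big1 // => k _; exact: BN.
rewrite subr0; apply/funext => s.
(* One cut-off for [s] and all its faces, so that the coboundary can be taken term by term. *)
pose M := maxn (K s) (\max_(i < (sdim s).+1) K (vert s (bump i) (sdim s).-1)).
have -> : cobnd b s = \sum_(k < M) cobnd (B k) s.
  rewrite /cobnd; case: eqP => _; first by rewrite big1.
  rewrite exchange_big /=; apply: eq_bigr => i _; rewrite -mulr_sumr; congr (_ * _).
  by apply: bE; rewrite leq_max; apply/orP; right; exact: leq_bigmax.
under eq_bigr do rewrite dB.
rewrite -(big_mkord xpredT (fun k => iter k sd c s - iter k.+1 sd c s)).
rewrite (@telescope_sumr_eq _ 0 M (fun k => - iter k sd c s)) // => [|k _]; last by rewrite opprK addrC.
by rewrite (HK s M _).2 ?leq_maxl // oppr0 sub0r opprK.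
Qed.
End SmallSimplices.

(** * Coverings *)

Section Convex.
Context {R : realType} {n : nat}.
Local Notation T := (simplex R n).
Implicit Types (C : set T) (x y z : T).

Definition clip (t : R) : R := Num.max 0 (Num.min t 1).

Lemma clip_itv t : 0 <= clip t <= 1.
Proof. by rewrite /clip le_max lexx /= ge_max ler01 /= ge_min lexx orbT. Qed.

Lemma clip_id t : 0 <= t <= 1 -> clip t = t.
Proof. by move=> /andP[t0 t1]; rewrite /clip min_l // max_r. Qed.

Lemma clip_cts : continuous clip.
Proof.
move=> t; apply: (@continuous_max R R (cst 0) (fun t => Num.min t 1) t); first exact: cst_continuous.
apply: (@continuous_min R R id (cst 1) t); [exact: cvg_id|exact: cst_continuous].
Qed.

Lemma itv_point_subproof t : \row_(j < 2) (if j == 0 then 1 - clip t else clip t) \in simplex R 1.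
Proof.
have /andP[t0 t1] := clip_itv t; apply/mem_set; split=> [j|].
  by rewrite mxE; case: ifP => _ //; rewrite subr_ge0.
by rewrite !big_ord_recl big_ord0 !mxE /= addr0 subrK.
Qed.
Definition itv_point t : simplex R 1 := exist (fun u => u \in simplex R 1) _ (itv_point_subproof t).

Lemma itv_point_cts : continuous itv_point.
Proof.
apply: cts_to_simplex => j.
have -> : (fun t => val (itv_point t) 0 j) = (fun t => if j == 0 then 1 - clip t else clip t).
  by apply/funext => t; rewrite mxE.
by case: (j == 0) => t; [apply: cvgB; [exact: cvg_cst|exact: clip_cts]|exact: clip_cts].
Qed.

Definition seg x y (t : R) : T := comb (nth x [:: x; y]) (itv_point t).

Lemma segE x y t j : val (seg x y t) 0 j = (1 - clip t) * val x 0 j + clip t * val y 0 j.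
Proof. by rewrite combE !big_ord_recl big_ord0 /= !mxE /= addr0. Qed.

Lemma seg_cts x y : continuous (seg x y).
Proof. by move=> t; apply: continuous_comp; [exact: itv_point_cts|exact: comb_cts]. Qed.

Definition cvx C := forall x y t, C x -> C y -> C (seg x y t).

Lemma cvx_connected C : cvx C -> connected C.
Proof.
move=> Cc; have [->|/set0P[x Cx]] := eqVneq C set0; first exact: connected0.
have -> : C = \bigcup_(y in C) (seg x y @` `[0, 1]).
  apply/seteqP; split=> [y Cy|z [y Cy [t _ <-]]]; last exact: Cc.
  exists y => //; exists 1; first by rewrite /= in_itv /= ler01 lexx.
  by apply: simplex_eq => j; rewrite segE clip_id ?ler01 ?lexx // subrr mul0r mul1r add0r.
apply: bigcup_connected.
  exists x => y Cy; exists 0; first by rewrite /= in_itv /= ler01 lexx.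
  by apply: simplex_eq => j; rewrite segE clip_id ?ler01 ?lexx // subr0 mul0r mul1r addr0.
move=> y Cy; apply: connected_continuous_connected; first exact: segment_connected.
by apply: continuous_subspaceT; exact: seg_cts.
Qed.

Lemma cvxI C C' : cvx C -> cvx C' -> cvx (C `&` C').
Proof. by move=> hC hC' x y t [? ?] [? ?]; split; [exact: hC|exact: hC']. Qed.

Lemma cvxT : cvx setT. Proof. by []. Qed.

Definition le_half (j : 'I_n.+1) (m : R) : set T := [set x : T | val x 0 j <= m].
Definition ge_half (j : 'I_n.+1) (m : R) : set T := [set x : T | m <= val x 0 j].

Lemma cvx_le j m : cvx (le_half j m).
Proof.
move=> x y t; rewrite /le_half /= segE => xm ym; have /andP[t0 t1] := clip_itv t.
by have := ler_wpM2l t0 ym; have := @ler_wpM2l _ (1 - clip t) _ _ _ xm; rewrite subr_ge0 => /(_ t1); lra.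
Qed.

Lemma cvx_ge j m : cvx (ge_half j m).
Proof.
move=> x y t; rewrite /ge_half /= segE => xm ym; have /andP[t0 t1] := clip_itv t.
by have := ler_wpM2l t0 ym; have := @ler_wpM2l _ (1 - clip t) _ _ _ xm; rewrite subr_ge0 => /(_ t1); lra.
Qed.

Lemma closed_le_half j m : closed (le_half j m).
Proof.
have /continuous_closedP := @simplex_coord_cts R n j.
by move=> /(_ [set y | y <= m] (@closed_le R m)).
Qed.

Lemma closed_ge_half j m : closed (ge_half j m).
Proof.
have /continuous_closedP := @simplex_coord_cts R n j.
by move=> /(_ [set y | m <= y] (@closed_ge R m)).
Qed.
End Convex.

(* The part of covering space theory needed to lift simplices: p has local
   sections, and the deck transformations in D act transitively on fibres. *)
Record covering (E B : topologicalType) (D : set (E -> E)) (p : E -> B) : Prop := Covering {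
  cov_cts : continuous p;
  cov_haus : hausdorff_space E;
  cov_inj : forall e : E, exists2 W, nbhs e W & {in W &, injective p};
  cov_sec : forall b : B, exists2 V, nbhs b V & exists s : B -> E,
     forall v, V v -> p (s v) = v /\ {for v, continuous s};
  cov_deck : forall d, D d -> continuous d /\ forall e, p (d e) = p e;
  cov_trans : forall e e', p e = p e' -> exists2 d, D d & d e' = e }.

Section Lifting.
Context {R : realType} {E B : topologicalType} {D : set (E -> E)} {p : E -> B}.
Hypothesis pc : covering D p.

Section Simplex.
Context {n : nat}.
Local Notation T := (simplex R n).

(** The set of agreement is open in [C] because [p] is locally injective, and closed because [E] is
    Hausdorff. *)
Lemma lift_unique (C : set T) (L L' : T -> E) (x0 : T) : connected C -> C x0 ->
  {within C, continuous L} -> {within C, continuous L'} ->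
  (forall x, C x -> p (L x) = p (L' x)) -> L x0 = L' x0 ->
  forall x, C x -> L x = L' x.
Proof.
move=> Cc Cx0 /subspace_continuousP Lc /subspace_continuousP L'c pLL' LL'0.
suff : [set x | C x /\ L x = L' x] = C by move=> CE x; rewrite -[X in X x -> _]CE => -[].
apply: Cc; first by exists x0.
- exists (interior [set x | C x -> L x = L' x]); first exact: open_interior.
  apply/seteqP; split=> x [Cx]; last by move=> /interior_subset/(_ Cx) LL'; split.
  move=> LL'; split=> //; have [W We Wi] := cov_inj pc (L x).
  have We' : nbhs (L' x) W by rewrite -LL'.
  have := Lc x Cx _ We; have := L'c x Cx _ We'.
  rewrite /interior /= !nbhs_simpl /= => W1 W2.
  near=> y; move=> Cy; apply: Wi; rewrite ?inE ?pLL' //.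
    by move: Cy; near: y.
  by move: Cy; near: y.
- exists (~` interior [set x | C x -> L x <> L' x]); first exact/open_closedC/open_interior.
  apply/seteqP; split=> x [Cx]; last first.
    move=> ni; split=> //; apply: contrapT => LL'; apply: ni.
    move: LL' => /eqP LL'; have := cov_haus pc; rewrite open_hausdorff => /(_ _ _ LL').
    move=> [[U V] /= [/set_mem Ux /set_mem Vx] [Uo Vo /eqP/seteqP[UV _]]].
    have := Lc x Cx _ (open_nbhs_nbhs (conj Uo Ux)).
    have := L'c x Cx _ (open_nbhs_nbhs (conj Vo Vx)).
    rewrite /interior /= !nbhs_simpl /= => W1 W2.
    near=> y; move=> Cy LL'y; apply: (UV (L y)); split.
      by move: Cy; near: y.
    by rewrite LL'y; move: Cy; near: y.
  by move=> LL'; split=> // /interior_subset/(_ Cx).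
Unshelve. all: by end_near. Qed.

Context (sigma : T -> B) (sigma_cts : continuous sigma).

Definition liftable (C : set T) := exists L : T -> E,
  (forall x, C x -> p (L x) = sigma x) /\ {within C, continuous L}.

Lemma liftableS C C' : C `<=` C' -> liftable C' -> liftable C.
Proof.
move=> CC' [L [pL Lc]]; exists L; split=> [x /CC'/pL //|].
exact: continuous_subspaceW CC' Lc.
Qed.

(** The two parts of [C] meet in a convex set. A deck transformation makes the two lifts agree at
    one of its points, and uniqueness of lifts extends the agreement to all of it. *)
Lemma liftable_glue C j m : closed C -> cvx C ->
  liftable (C `&` le_half j m) -> liftable (C `&` ge_half j m) -> liftable C.
Proof.
move=> Ccl Cc [L [pL Lc]] [L' [pL' L'c]].
set A := C `&` _ in pL Lc; set A' := C `&` _ in pL' L'c.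
have [L'' [pL'' L''c LL'']] : exists L'', [/\ forall x, A' x -> p (L'' x) = sigma x,
    {within A', continuous L''} & forall x, A x -> A' x -> L x = L'' x].
  have [/eqP AA'|/set0P[x0 [Ax0 A'x0]]] := boolP (A `&` A' == set0).
    exists L'; split=> // x Ax A'x; suff : (A `&` A') x by rewrite AA'.
    by [].
  have [d Dd dL] : exists2 d, D d & d (L' x0) = L x0.
    by apply: (cov_trans pc); rewrite pL // pL'.
  have [dc pd] := cov_deck pc Dd.
  exists (d \o L'); split=> [x A'x|x|x Ax A'x]; first by rewrite /= pd pL'.
    by apply: (@continuous_comp (subspace A') E E L' d); [exact: L'c|exact: dc].
  apply: (@lift_unique (A `&` A') _ _ x0) => //.
  - by apply: cvx_connected; apply: cvxI; apply: cvxI => //; [exact: cvx_le|exact: cvx_ge].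
  - exact: continuous_subspaceW Lc.
  - apply: (@continuous_subspaceW _ _ _ A') => // y.
    by apply: (@continuous_comp (subspace A') E E L' d); [exact: L'c|exact: dc].
  - by move=> y [Ay A'y]; rewrite /= pd pL // pL'.
exists (fun x : T => if val x 0 j <= m then L x else L'' x).
have CE : C = A `|` A'.
  apply/seteqP; split=> [x Cx|x [[]|[]]//].
  by case: (lerP (val x 0 j) m) => xm; [left|right; split=> //; exact: ltW].
split=> [x|].
  rewrite CE => -[Ax|A'x]; first by rewrite (Ax.2 : _ <= _) pL.
  by case: ifP => xm; [apply: pL; split=> //; exact: A'x.1|exact: pL''].
rewrite CE; apply: withinU_continuous.
- by apply: closedI => //; exact: closed_le_half.
- by apply: closedI => //; exact: closed_ge_half.
- apply: (@subspace_eq_continuous _ A _ L) => // x /set_mem [_ xm].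
  by rewrite /from_subspace ifT.
- apply: (@subspace_eq_continuous _ A' _ L'') => // x /set_mem A'x; rewrite /from_subspace; case: ifP => // xm.
  by rewrite LL'' //; split=> //; exact: A'x.1.
Qed.

Lemma liftable_all : liftable setT.
Proof.
have [e e0 He] : exists2 e, 0 < e & forall x, liftable [set y | cdist x y e].
  apply: lebesgue => [A A'|x]; first exact: liftableS.
  have [V Vx [s sP]] := cov_sec pc (sigma x).
  exists (sigma @^-1` V); first exact: sigma_cts.
  exists (s \o sigma); split=> [y /sP[]//|]; apply/subspace_continuousP => y /sP[_ sc].
  apply: cvg_within_filter; apply: continuous_comp; [exact: sigma_cts|exact: sc].
(* Induction on the number of coordinates still to be cut: those of index at least [k] already vary
   by at most [e] on [C]. For [k = n.+1] nothing is assumed. *)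
suff : forall k (C : set T), closed C -> cvx C ->
    (forall x y (i : 'I_n.+1), C x -> C y -> (k <= i)%N -> `|val x 0 i - val y 0 i| <= e) -> liftable C.
  by move=> /(_ n.+1 setT); apply=> // x y i _ _; rewrite leqNgt ltn_ord.
elim=> [|k IH] C Ccl Cc Ce.
  have [->|/set0P[x Cx]] := eqVneq C set0; first exact: liftableS (He (vtx 0)).
  by apply: liftableS (He x) => y Cy j; exact: Ce.
have [kn|nk] := ltnP k n.+1; last first.
  apply: IH => // x y i Cx Cy ki; apply: Ce => //.
  by rewrite ltn_neqAle ki andbT; apply/eqP => ki'; have := ltn_ord i; rewrite -ki' ltnNge nk.
(* Coordinate [k] is cut into slabs of thickness [e], which are glued from the bottom upwards. *)
have key N C' : closed C' -> cvx C' -> C' `<=` C ->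
    (forall x, C' x -> val x 0 (Ordinal kn) <= N%:R * e) -> liftable C'.
  have Ce' C'' (C''C : C'' `<=` C) :
      (forall x y, C'' x -> C'' y -> `|val x 0 (Ordinal kn) - val y 0 (Ordinal kn)| <= e) ->
      forall x y (i : 'I_n.+1), C'' x -> C'' y -> (k <= i)%N -> `|val x 0 i - val y 0 i| <= e.
    move=> ke x y i xC yC; rewrite leq_eqVlt => /predU1P[ki|ki]; last first.
      by apply: Ce => //; exact: C''C.
    by rewrite (_ : i = Ordinal kn); [exact: ke|exact: val_inj].
  elim: N C' => [|N IHN] C' C'cl C'c C'C C'N.
    apply: IH => //; apply: Ce' => // x y /C'N x0 /C'N y0.
    have := simplex_ge0 x (Ordinal kn); have := simplex_ge0 y (Ordinal kn).
    rewrite mul0r in x0 y0 => y1 x1; rewrite (_ : _ - _ = 0); last by lra.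
    by rewrite normr0 ltW.
  apply: (@liftable_glue _ (Ordinal kn) (N%:R * e)) => //.
    apply: IHN => [||x []//|x []//]; last by move=> /C'C.
      by apply: closedI => //; exact: closed_le_half.
    by apply: cvxI => //; exact: cvx_le.
  apply: IH; [by apply: closedI => //; exact: closed_ge_half|by apply: cvxI => //; exact: cvx_ge|].
  apply: Ce' => [x []|x y [/C'N x1 x0] [/C'N y1 y0]]; first by move=> /C'C.
  rewrite /ge_half /= in x0 y0; rewrite -natr1 mulrDl mul1r in x1 y1.
  rewrite ler_norml; lra.
have [N eN] : exists N, 1 <= N%:R * e.
  exists (Num.truncn e^-1).+1; rewrite -ler_pdivrMr // mul1r ltW // truncnS_gt // invr_ge0 ltW //.
by apply: (key N) => // x _; apply: le_trans (simplex_le1 _ _) eN.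
Qed.
End Simplex.

Lemma push_lift (pc' : continuousType E B) (s : singular R B) : p = pc' ->
  exists s' : singular R E, push pc' s' = s.
Proof.
move=> pE; case: s => n s; have [L [pL Lc]] := liftable_all (@cts_fun _ _ s).
have {}Lc : continuous (L : simplex R n -> E).
  by move=> x; have := Lc x; rewrite /continuous_at nbhs_subspaceT.
exists (existT _ n (mkcts Lc : continuousType (simplex R n) E)).
by apply: singular_eq => x; rewrite /= /mkcts -pE; apply: pL.
Qed.

Lemma singular_inj (Y : topologicalType) m (f g : continuousType (simplex R m) Y) :
  existT _ m f = existT _ m g :> singular R Y -> f = g.
Proof. by move=> e; have := projT2_eq e; rewrite (eq_irrelevance (projT1_eq e) erefl). Qed.

Lemma push_inj (pc' : continuousType E B) (s s' : singular R E) : p = pc' ->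
  push pc' s = push pc' s' -> exists2 d : continuousType E E, D d & push d s' = s.
Proof.
move=> pE ss'; case: s s' ss' => [n s] [m s'] ss'.
have nm : n = m := congr1 (@projT1 _ _) ss'; case: _ / nm s' ss' => s'.
move=> /singular_inj/(congr1 (fun f : continuousType _ _ => f : simplex R n -> B)) ss'.
have pss' x : p (s x) = p (s' x) by rewrite pE -[LHS]/((pc' \o s) x) ss'.
have [d Dd ds'] := cov_trans pc (pss' (vtx 0)).
have [dc pd] := cov_deck pc Dd.
exists (mkcts dc : continuousType E E) => //; apply: singular_eq => x; apply/esym.
apply: (@lift_unique _ setT s (d \o s') (vtx 0)) => //.
- exact/cvx_connected/cvxT.
- exact/continuous_subspaceT/cts_fun.
- apply: continuous_subspaceT => y; apply: continuous_comp; [exact: cts_fun|exact: dc].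
- by move=> y _; rewrite /= pd.
Qed.
End Lifting.

Section Descent.
Context {R : realType} {E B : topologicalType} {D : set (E -> E)} (p : continuousType E B).
Hypothesis pc : covering D p.

Lemma pull_inj : injective (@pull R E B p).
Proof.
move=> c c' cc'; apply/funext => s; have [s' <-] := push_lift pc s erefl.
by rewrite -!pullE cc'.
Qed.

(** A simplex is connected, so two of its lifts differ by a single deck transformation, and an
    invariant cochain takes the same value on both. *)
Lemma pull_descend (c : singular R E -> int) :
  (forall d : continuousType E E, D d -> pull d c = c) -> exists c', pull p c' = c.
Proof.
move=> cD; have [f fP] := choice (fun s => push_lift (R := R) pc s erefl).
exists (c \o f); apply/funext => s; rewrite pullE /=.
have [d Dd <-] := push_inj pc erefl (fP (push p s)).
by rewrite -[in RHS](cD d Dd).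
Qed.
End Descent.

(** * The covering given by a free cyclic action *)

Section OrbitCovering.
Context {Y : topologicalType} {tau : Y -> Y} {q : nat}.
Hypotheses (tau_cts : continuous tau) (q_gt0 : (0 < q)%N)
  (tauq : forall y, iter q tau y = y)
  (tau_free : forall k y, (0 < k < q)%N -> iter k tau y <> y).

Lemma iter_cts k : continuous (iter k tau).
Proof.
elim: k => [|k IH] y; first exact: cvg_id.
by apply: (@continuous_comp _ _ _ (iter k tau) tau); [exact: IH|exact: tau_cts].
Qed.

Lemma iter_modq k y : iter (k %% q) tau y = iter k tau y.
Proof.
rewrite [in RHS](divn_eq k q) addnC iterD; congr iter.
by elim: (k %/ q)%N => //= m IH; rewrite mulSn iterD -IH tauq.
Qed.

Lemma orbit_piP x y : orbit_pi tau x = orbit_pi tau y -> exists2 k, (k < q)%N & y = iter k tau x.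
Proof.
move=> /eqmodP/asboolP[k [m e]].
(* Another [q * m - m] steps turn [iter m tau y] into [iter (q * m) tau y], which is [y]. *)
exists ((q * m - m + k) %% q)%N; first by rewrite ltn_mod.
rewrite iter_modq iterD e -iterD subnK ?leq_pmull //.
by rewrite -iter_modq modnMr.
Qed.

Lemma orbit_pi_iter k x : orbit_pi tau (iter k tau x) = orbit_pi tau x.
Proof. by apply/eqmodP/asboolP; exists 0%N, k. Qed.

Lemma orbit_pi_open (A : set Y) : open A -> open (orbit_pi tau @` A).
Proof.
move=> Ao; rewrite /open /= /quotient_open.
rewrite (_ : _ @^-1` _ = \bigcup_(k in `I_q) (iter k tau @^-1` A)).
  apply: bigcup_open => k _; apply: open_comp => // y _; exact: iter_cts.
apply/seteqP; split=> [x [y Ay /esym/orbit_piP[k kq yE]]|x [k kq Ak]].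
  by exists k => //=; rewrite -yE.
by exists (iter k tau x) => //; exact: orbit_pi_iter.
Qed.

Hypothesis Yh : hausdorff_space Y.

(** Separate [e] from each of its q - 1 other translates; on [W] a point and its translates stay in
    the corresponding separating sets. *)
Lemma orbit_evenly (e : Y) : exists2 W, open W /\ W e &
  forall k y, (0 < k < q)%N -> W y -> ~ W (iter k tau y).
Proof.
have sep (k : 'I_q) : exists UV : set Y * set Y, (0 < k)%N ->
    [/\ nbhs e UV.1, nbhs (iter k tau e) UV.2 & forall y, UV.1 y -> ~ UV.2 y].
  have [k0|] := posnP k; first by exists (set0, set0); rewrite k0.
  move=> k0; have /eqP ke : e <> iter k tau e by apply/nesym/tau_free; rewrite k0 ltn_ord.
  have := Yh; rewrite open_hausdorff => /(_ _ _ ke) [[U V] /= [/set_mem Ue /set_mem Ve]].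
  move=> [Uo Vo /eqP/seteqP[UV _]]; exists (U, V) => _; split=> /=.
  - exact: open_nbhs_nbhs.
  - exact: open_nbhs_nbhs.
  - by move=> y Uy Vy; apply: (UV y).
have [f fP] := choice sep.
have We : nbhs e [set y | forall k : 'I_q, (0 < k)%N -> (f k).1 y /\ (f k).2 (iter k tau y)].
  apply: filter_forall => k.
  have [k0|k0] := posnP k; first by apply: nearW => y; rewrite k0.
  have [U V _] := fP k k0; near=> y; split; first by near: y.
  by near: y; apply: (@iter_cts k e).
exists (interior [set y | forall k : 'I_q, (0 < k)%N -> (f k).1 y /\ (f k).2 (iter k tau y)]).
  by split; [exact: open_interior|exact: We].
move=> k y /andP[k0 kq] /interior_subset Wy /interior_subset Wky.
have [_ _ dis] := fP (Ordinal kq) k0.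
by apply: (dis (iter k tau y)); [have [] := Wky (Ordinal kq) k0|have [] := Wy (Ordinal kq) k0].
Unshelve. all: by end_near. Qed.

Lemma orbit_evenly_inj (W : set Y) :
  (forall k y, (0 < k < q)%N -> W y -> ~ W (iter k tau y)) ->
  forall x y, W x -> W y -> orbit_pi tau x = orbit_pi tau y -> x = y.
Proof.
move=> Wf x y Wx Wy /orbit_piP[k kq yE]; have [k0|k0] := posnP k; first by rewrite yE k0.
by case: (Wf k x _ Wx); rewrite ?k0 // -yE.
Qed.

Lemma orbit_covering : covering (range (fun k => iter k tau)) (orbit_pi tau).
Proof.
split=> //.
- exact: orbit_pi_cts.
- move=> e; have [W [Wo We] Wf] := orbit_evenly e.
  exists W; first exact: open_nbhs_nbhs.
  by move=> x y /set_mem Wx /set_mem Wy; exact: (orbit_evenly_inj Wf).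
- move=> b; have [W [Wo We] Wf] := orbit_evenly (repr b).
  exists (orbit_pi tau @` W).
    apply: open_nbhs_nbhs; split; first exact: orbit_pi_open.
    by exists (repr b) => //; exact: reprK.
  pose s v := xget (repr b) [set w | W w /\ orbit_pi tau w = v].
  have sP w : W w -> s (orbit_pi tau w) = w.
    move=> Ww; have [Ws ps] := @xgetPex _ (repr b)
      [set w' | W w' /\ orbit_pi tau w' = orbit_pi tau w] (ex_intro _ w (conj Ww erefl)).
    exact: (orbit_evenly_inj Wf).
  exists s => _ [w Ww <-]; split; first by rewrite sP.
  move=> O; rewrite sP // => wO.
  have : nbhs (orbit_pi tau w) (orbit_pi tau @` (W `&` interior O)).
    apply: open_nbhs_nbhs; split; last by exists w => //; split.
    by apply: orbit_pi_open; apply: openI => //; exact: open_interior.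
  by apply: filterS => _ [y [Wy /interior_subset Oy] <-] /=; rewrite /= sP.
- move=> _ [k _ <-]; split; [exact: iter_cts|exact: orbit_pi_iter].
- move=> e e' /esym/orbit_piP[k kq ->]; exists (iter k tau) => //; by exists k.
Qed.
End OrbitCovering.

(** * The covering of the circle by the line *)

Section CircleCovering.
Context {R : realType}.
Implicit Types (t : R) (k : int).
Local Notation turn := (2 * pi : R).

Lemma turn_gt0 : 0 < turn. Proof. by rewrite mulr_gt0 ?pi_gt0. Qed.

Lemma cisD t t' : cis (t + t') = cis t * cis t'.
Proof. by rewrite /cis cosD sinD; simpc; congr (_ +i* _)%C; rewrite addrC. Qed.

Lemma cisX t n : cis (t *+ n) = cis t ^+ n.
Proof.
elim: n => [|n IH]; first by rewrite mulr0n expr0 /cis cos0 sin0.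
by rewrite mulrS cisD IH exprS.
Qed.

Lemma cis_turn k : cis (turn * k%:~R) = 1.
Proof.
have c1 : cis turn = 1 by rewrite /cis mulr_natl cos2pi sin2pi.
have cn n : cis (turn * n%:R) = 1 by rewrite mulr_natr cisX c1 expr1n.
case: k => n; first exact: cn.
have := cn n.+1; rewrite NegzE mulrNz mulrN => c; rewrite -[LHS]mulr1 -[in LHS]c -cisD addNr.
by rewrite /cis cos0 sin0.
Qed.

Lemma cis_eq1 t : cis t = 1 -> exists k, t = turn * k%:~R.
Proof.
move=> t1; pose k := Num.floor (t / turn); exists k.
have /andP[k1 k2] := Num.Theory.floor_itv (t / turn); rewrite -/k in k1 k2.
rewrite ler_pdivlMr ?turn_gt0 // in k1; rewrite ltr_pdivrMr ?turn_gt0 // intrD mulrDl mul1r in k2.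
pose r := t - turn * k%:~R; have tE : t = r + turn * k%:~R by rewrite subrK.
have r0 : 0 <= r by rewrite subr_ge0 mulrC.
have rt : r < turn by rewrite ltrBlDr addrC mulrC.
have cr : cos r = 1.
  by have := congr1 (@complex.Re R) t1; rewrite tE cisD cis_turn mulr1.
suff -> : t = turn * k%:~R + 0 by rewrite addr0.
rewrite {1}tE addrC; congr (_ + _).
have piP := pi_gt0 R.
have [rpi|pir] := leP r pi.
  by apply: (@cos_inj R); rewrite ?in_itv /= ?r0 ?lexx ?(ltW piP) // cos0.
have : turn - r = 0.
  apply: (@cos_inj R); rewrite ?in_itv /= ?lexx ?(ltW piP) //.
    by rewrite subr_ge0 (ltW rt) /=; lra.
  by rewrite cos0 -cosN opprB mulr_natl -(cosD2pi (r - _)) subrK.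
by move/eqP; rewrite subr_eq0 => /eqP tr; move: rt; rewrite tr ltxx.
Qed.

Lemma circle_ptP t t' : circle_pt t = circle_pt t' -> exists k, t' = t + turn * k%:~R.
Proof.
move=> /(congr1 val) /= tt'; have [] := @cis_eq1 (t' - t).
  by rewrite cisD -tt' -cisD subrr /cis cos0 sin0.
by move=> k kE; exists k; rewrite -kE addrC subrK.
Qed.

Lemma circle_pt_turn t k : circle_pt (t + turn * k%:~R) = circle_pt t.
Proof. by apply: val_inj; rewrite /= cisD cis_turn mulr1. Qed.

Lemma circle_pt_cts : continuous (@circle_pt R).
Proof.
apply: (@continuous_comp_initial (circle R) R R[i]^o set_val (@circle_pt R)).
exact: cis_cts.
Qed.

Lemma circle_norm (z : circle R) : complex.Re (val z) ^+ 2 + complex.Im (val z) ^+ 2 = 1.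
Proof.
have := set_mem (valP z); rewrite /circle /= normc_def => /(congr1 (@complex.Re R)) /=.
by move=> /(congr1 (fun x => x ^+ 2)); rewrite sqr_sqrtr ?expr1n // addr_ge0 ?sqr_ge0.
Qed.

Lemma circle_pt_surj (z : circle R) : exists t, circle_pt t = z.
Proof.
have := circle_norm z; case: z => -[x y] /= zc xy.
have x1 : -1 <= x <= 1 by rewrite -ler_norml -(ler_pXn2r (n := 2)) ?nnegrE // ?normr_ge0 // expr1n real_normK ?num_real // -xy lerDl sqr_ge0.
have yE : Num.sqrt (1 - x ^+ 2) = `|y| by rewrite -xy addrC addKr sqrtr_sqr.
have xI : x \in `[-1, 1] by rewrite in_itv.
have [y0|y0] := leP 0 y.
  exists (acos x); apply: val_inj; rewrite /= /cis acosK // sin_acos // yE ger0_norm //.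
exists (- acos x); apply: val_inj.
by rewrite /= /cis cosN sinN acosK // sin_acos // yE ltr0_norm // opprK.
Qed.

Lemma Re_cts : continuous (fun z : R[i]^o => complex.Re z : R).
Proof.
move=> z U /nbhs_ballP[e /= e0 eU]; apply/nbhs_ballP; exists e%:C%C; first by rewrite /= ltcR.
move=> y zy; apply: eU; rewrite /ball /= -ltcR -(raddfB (@complex.Re R)).
exact: le_lt_trans (normc_ge_Re _) zy.
Qed.

Lemma normc_ge_Im (x : R[i]) : `|complex.Im x|%:C%C <= `|x|.
Proof. by rewrite normc_def lecR -sqrtr_sqr ler_wsqrtr // lerDr sqr_ge0. Qed.

Lemma Im_cts : continuous (fun z : R[i]^o => complex.Im z : R).
Proof.
move=> z U /nbhs_ballP[e /= e0 eU]; apply/nbhs_ballP; exists e%:C%C; first by rewrite /= ltcR.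
move=> y zy; apply: eU; rewrite /ball /= -ltcR -(raddfB (@complex.Im R)).
exact: le_lt_trans (normc_ge_Im _) zy.
Qed.

Lemma circle_Re_cts : continuous (fun z : circle R => complex.Re (val z) : R).
Proof.
move=> z; apply: (@continuous_comp (circle R) _ _ set_val (fun z : R[i]^o => complex.Re z : R)).
  exact: (@initial_continuous (circle R) _ set_val).
exact: Re_cts.
Qed.

Lemma circle_Im_cts : continuous (fun z : circle R => complex.Im (val z) : R).
Proof.
move=> z; apply: (@continuous_comp (circle R) _ _ set_val (fun z : R[i]^o => complex.Im z : R)).
  exact: (@initial_continuous (circle R) _ set_val).
exact: Im_cts.
Qed.

Lemma R_hausdorff : hausdorff_space R. Proof. exact: Rhausdorff. Qed.

Definition shift k : R -> R := fun t => t + turn * k%:~R.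

Lemma circle_covering : covering (range shift) (@circle_pt R).
Proof.
split.
- exact: circle_pt_cts.
- exact: R_hausdorff.
(* Two points of this ball are less than a full turn apart. *)
- move=> t; exists (ball t pi); first by apply: nbhsx_ballx; exact: pi_gt0.
  move=> x y /set_mem tx /set_mem ty /circle_ptP[k yE].
  suff k0 : k = 0 by rewrite yE k0 mulr0 addr0.
  rewrite /ball /= in tx ty; have xy : `|y - x| < turn.
    rewrite (_ : y - x = (t - x) - (t - y)); last by rewrite opprB [RHS]addrC addrA subrK.
    by rewrite mulr_natl mulr2n (le_lt_trans (ler_normB _ _)) // ltrD.
  move: xy; rewrite yE addrAC subrr add0r normrM gtr0_norm ?turn_gt0 //.
  rewrite -[ltRHS]mulr1 ltr_pM2l ?turn_gt0 // -intr_norm -[1]/(1%:~R) ltr_int; lia.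
- move=> b; have [t0 t0b] := circle_pt_surj b.
  (* [u v] and [w v] are the real and imaginary parts of [v] divided by [cis t0]; where [u v] is
     positive, the angle of this quotient is [asin (w v)]. *)
  pose u (v : circle R) : R := complex.Re (val v) * cos t0 + complex.Im (val v) * sin t0.
  pose w (v : circle R) : R := complex.Im (val v) * cos t0 - complex.Re (val v) * sin t0.
  have uc : continuous u.
    by move=> v; apply: (@cvgD _ _ _ (nbhs v)); apply: (@cvgM _ _ (nbhs v)); [exact: circle_Re_cts|exact: cvg_cst|exact: circle_Im_cts|exact: cvg_cst].
  have wc : continuous w.
    by move=> v; apply: (@cvgB _ _ _ (nbhs v)); apply: (@cvgM _ _ (nbhs v)); [exact: circle_Im_cts|exact: cvg_cst|exact: circle_Re_cts|exact: cvg_cst].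
  have uw v : u v ^+ 2 + w v ^+ 2 = 1.
    have := cos2Dsin2 t0; have := circle_norm v; rewrite /u /w => h1 h2.
    rewrite -[RHS]mul1r -[X in _ = X * _]h1 -[X in _ = _ * X]h2; ring.
  exists [set v | 0 < u v].
    apply: open_nbhs_nbhs; split.
      have /continuousP := uc; by move=> /(_ [set x | 0 < x] (@open_gt _ 0)).
    by rewrite /= /u -t0b /= -!expr2 cos2Dsin2.
  exists (fun v => t0 + asin (w v)) => v /= u0.
  have w1 : -1 < w v < 1.
    rewrite -ltr_norml -(ltr_pXn2r (n := 2)) ?nnegrE ?normr_ge0 ?ler01 // expr1n real_normK ?num_real //.
    by rewrite -(uw v) ltrDr exprn_gt0.
  have w1' : -1 <= w v <= 1 by case/andP: w1 => /ltW -> /ltW ->.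
  split.
    apply: val_inj; rewrite /= cisD /cis cos_asin // asinK ?in_itv //.
    rewrite -(uw v) addrK sqrtr_sqr gtr0_norm //; have := cos2Dsin2 t0.
    rewrite /u /w /=; case: (sval v) => x y /=; move: (cos t0) (sin t0) => a b' ab.
    by apply/eqP; rewrite eq_complex /=; apply/andP; split; apply/eqP;
      rewrite -[RHS]mulr1 -ab; ring.
  apply: (@cvgD _ _ _ (nbhs v)); first exact: cvg_cst.
  by apply: (@continuous_comp _ _ _ w asin); [exact: wc|exact: continuous_asin].
- move=> _ [k _ <-]; split=> [t|t]; last exact: circle_pt_turn.
  by apply: cvgD; [exact: cvg_id|exact: cvg_cst].
- move=> e e' /esym/circle_ptP[k ->]; exists (shift k) => //; by exists k.
Qed.
End CircleCovering.

(** * Cochains invariant under a free cyclic action *)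

Section CochainAlgebra.
Context {R : realType}.
Local Notation C X := (singular R X -> int).

HB.instance Definition _ (X : topologicalType) :=
  GRing.isZmodMorphism.Build (C X) (C X) (@cobnd R X) (@cobndB R X).

Lemma pullB (X Y : topologicalType) (f : continuousType X Y) : {morph @pull R X Y f : a b / a - b}.
Proof. by []. Qed.
HB.instance Definition _ (X Y : topologicalType) (f : continuousType X Y) :=
  GRing.isZmodMorphism.Build (C Y) (C X) (@pull R X Y f) (@pullB X Y f).

Context {X Y Z : topologicalType}.
Implicit Types (a b c : C X).

Lemma cobnd_cobnd c : cobnd (cobnd c) = 0.
Proof. by apply/funext => s; rewrite -slinE /slin !sseq_lin_cobnd dlt_dlt. Qed.

Lemma pull_cobnd (f : continuousType X Y) (c : C Y) : pull f (cobnd c) = cobnd (pull f c).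
Proof.
apply/funext => s; rewrite pullE /cobnd /=; case: eqP => // _.
by apply: eq_bigr => i _; rewrite pullE push_vert.
Qed.

Lemma pull_cup (f : continuousType X Y) (c d : C Y) : pull f (cup c d) = cup (pull f c) (pull f d).
Proof.
apply/funext => s; rewrite pullE /cup /=.
by apply: eq_bigr => i _; rewrite !pullE !push_vert.
Qed.

Lemma pull_comp (f : continuousType X Y) (g : continuousType Y Z) (h : continuousType X Z) (c : C Z) :
  (forall x, g (f x) = h x) -> pull f (pull g c) = pull h c.
Proof.
move=> gf; apply/funext => s; rewrite !pullE; congr c.
by apply: singular_eq => x /=.
Qed.

Lemma pull_id (f : continuousType X X) c : (forall x, f x = x) -> pull f c = c.
Proof.
move=> fx; apply/funext => -[n s]; rewrite pullE; congr c.
by apply: singular_eq => x /=.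
Qed.

Lemma pull_cochain1 (f : continuousType X Y) : pull f (@cochain1 R Y) = @cochain1 R X.
Proof. by []. Qed.

(* c is concentrated in dimension n - k, hence zero if n < k. *)
Definition supp (k n : nat) c := forall s, (sdim s + k)%N <> n -> c s = 0.

Lemma suppD k n a b : supp k n a -> supp k n b -> supp k n (a + b).
Proof. by move=> ha hb s sn; rewrite -[LHS]/(a s + b s) ha // hb. Qed.

Lemma suppN k n a : supp k n a -> supp k n (- a).
Proof. by move=> ha s sn; rewrite -[LHS]/(- a s) ha // oppr0. Qed.

Lemma suppB k n a b : supp k n a -> supp k n b -> supp k n (a - b).
Proof. by move=> ha hb; apply: suppD => //; exact: suppN. Qed.

Lemma supp_cobnd k n a : supp k.+1 n a -> supp k n (cobnd a).
Proof.
move=> ha s sn; rewrite /cobnd; case: eqP => // s0.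
by rewrite big1 // => i _; rewrite ha ?mulr0 //=; move: s0 sn; lia.
Qed.

Lemma supp_cup p k n a b : supp 0 p a -> supp (k + p) n b -> supp k n (cup a b).
Proof.
move=> ha hb s sn; rewrite /cup big1 // => -[i /= si] _.
have [ip|/eqP ip] := eqVneq i p; last by rewrite ha ?mul0r //= addn0.
by rewrite hb ?mulr0 //=; move: si sn; rewrite ip; lia.
Qed.

Lemma suppS k n a : supp k n a -> supp k.+1 n.+1 a.
Proof. by move=> ha s sn; apply: ha => sn'; apply: sn; rewrite addnS sn'. Qed.

Lemma suppSV k n a : supp k.+1 n.+1 a -> supp k n a.
Proof. by move=> ha s sn; apply: ha; rewrite addnS => -[]. Qed.

Lemma supp_lt k n a : (n < k)%N -> supp k n a -> a = 0.
Proof. by move=> nk ha; apply/funext => s; apply: ha; lia. Qed.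

Lemma cobnd_cup_cocycle a b : cobnd b = 0 -> cobnd (cup a b) = cup (cobnd a) b.
Proof. by move=> db; rewrite cobnd_cup db cup0r addr0. Qed.

Lemma sign_twist2 a : supp 0 2 a -> sign_twist a = a.
Proof.
move=> ha; apply/funext => s; rewrite /sign_twist.
have [s2|/eqP s2] := eqVneq (sdim s) 2%N; first by rewrite s2 sqrrN expr1n mul1r.
by rewrite ha ?mulr0 // addn0.
Qed.

Lemma cobnd_sign_twist a : cobnd a = 0 -> cobnd (sign_twist a) = 0.
Proof.
move=> da; apply/funext => s; have := congr1 (fun f => f s) da.
rewrite /cobnd; case: eqP => // s0 das.
transitivity ((-1) ^+ (sdim s).-1 *
    \sum_(i < (sdim s).+1) (-1) ^+ i * a (vert s (bump i) (sdim s).-1)); last by rewrite das mulr0.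
by rewrite mulr_sumr; apply: eq_bigr => i _; rewrite /sign_twist /= mulrCA.
Qed.
End CochainAlgebra.

Section MoreSupport.
Context {R : realType} {X Y : topologicalType}.

Lemma supp_pull k n (f : continuousType X Y) (c : singular R Y -> int) :
  supp k n c -> supp k n (pull f c).
Proof. by move=> hc s sn; apply: hc. Qed.

Lemma supp_hop (H : continuousType (X * simplex R 1)%type Y) k n (c : singular R Y -> int) :
  supp k n c -> supp k.+1 n (hop H c).
Proof.
move=> hc s sn; apply: (@hop_dim _ _ _ H (sdim s)) => // t ts; apply: hc.
by rewrite ts addSnnS.
Qed.

Lemma supp_pull_inj k n (f : continuousType X Y) (c : singular R Y -> int) :
  (forall s : singular R Y, exists s', push f s' = s) -> supp k n (pull f c) -> supp k n c.
Proof. by move=> fs hc s; have [s' <-] := fs s; exact: hc. Qed.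

(** A 0-cochain carries no continuity condition, so [f] may be discontinuous, as the sheet index and
    the floor function are. *)
Definition pointwise (f : X -> int) : singular R X -> int :=
  fun s => if sdim s == 0%N then f (projT2 s (vtx 0)) else 0.

Lemma supp_pointwise f : supp 0 0 (pointwise f).
Proof. by move=> s; rewrite addn0 /pointwise => /eqP/negPf ->. Qed.

End MoreSupport.

Lemma hausdorff_sep (X : topologicalType) :
  (forall x y : X, x <> y -> exists (Z : topologicalType) (f : X -> Z),
     [/\ hausdorff_space Z, continuous f & f x <> f y]) -> hausdorff_space X.
Proof.
move=> sep; rewrite open_hausdorff => x y /eqP/sep [Z [f [Zh fc /eqP fxy]]].
move: Zh; rewrite open_hausdorff => /(_ _ _ fxy) [[U V] /= [/set_mem Ux /set_mem Vy] [Uo Vo UV]].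
exists (f @^-1` U, f @^-1` V); first by split; apply/mem_set.
have /continuousP fc' := fc.
split; [exact: fc'|exact: fc'|].
by rewrite /= -preimage_setI (eqP UV) preimage_set0.
Qed.

Lemma hausdorff_prod (X Y : topologicalType) :
  hausdorff_space X -> hausdorff_space Y -> hausdorff_space (X * Y)%type.
Proof.
move=> Xh Yh; apply: hausdorff_sep => -[x y] [x' y'] xy.
have [xx|xx] := pselect (x = x').
  by exists Y, snd; split=> //; [exact: snd_cts|move=> /= yy; apply: xy; rewrite xx yy].
by exists X, fst; split=> //; exact: fst_cts.
Qed.

Section CoveringProduct.
Context {X E B : topologicalType} {D : set (E -> E)} {p : E -> B}.
Hypotheses (Xh : hausdorff_space X) (pc : covering D p).

Lemma mapr_cts (Y Y' : topologicalType) (f : Y -> Y') : continuous f ->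
  continuous (fun x : X * Y => (x.1, f x.2)).
Proof.
move=> fc; apply: pair_cts; first exact: fst_cts.
by move=> x; apply: (@continuous_comp _ _ _ snd f); [exact: snd_cts|exact: fc].
Qed.

Lemma covering_prod :
  covering [set (fun x : X * E => (x.1, d x.2)) | d in D] (fun x : X * E => (x.1, p x.2)).
Proof.
split.
- exact/mapr_cts/(cov_cts pc).
- exact: hausdorff_prod (cov_haus pc).
- move=> [x e]; have [W We Wi] := cov_inj pc e.
  exists (snd @^-1` W); first exact: (@cvg_snd _ _ (nbhs x) (nbhs e)).
  move=> [y f] [y' f']; rewrite !inE /= => Wf Wf' [<- /Wi ->] //; exact/mem_set.
- move=> [x b]; have [V Vb [s sP]] := cov_sec pc b.
  exists (snd @^-1` V); first exact: (@cvg_snd _ _ (nbhs x) (nbhs b)).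
  exists (fun y => (y.1, s y.2)) => -[y v] /= /sP[sv sc]; split; first by rewrite sv.
  apply: cvg_pair; first exact: cvg_fst.
  by apply: (@continuous_comp _ _ _ snd s); [exact: snd_cts|exact: sc].
- move=> _ [d Dd <-]; have [dc pd] := cov_deck pc Dd.
  by split=> [|[x e]]; [exact: mapr_cts|rewrite /= pd].
- move=> [x e] [x' e'] [<- /(cov_trans pc)[d Dd de]].
  by exists (fun x => (x.1, d x.2)); [exists d|rewrite /= de].
Qed.
End CoveringProduct.

(** * Embeddings on the level of simplices, and extension of cochains *)

Section Embedding.
Context {R : realType} {X Y : topologicalType} (f : continuousType X Y).

(** What relative cochains require of an embedding: the simplices of [Y] lying in the image are
    those that come from [X]. *)
Definition simplicial_emb := injective f /\
  forall s : singular R Y, range (projT2 s) `<=` range f -> exists s', push f s' = s.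
Hypothesis fe : simplicial_emb.

Lemma push_emb_inj (s s' : singular R X) : push f s = push f s' -> s = s'.
Proof.
case: s s' => [n s] [m s'] ss'.
have nm : n = m := congr1 (@projT1 _ _) ss'; case: _ / nm s' ss' => s'.
move=> /singular_inj/(congr1 (fun f : continuousType _ _ => f : simplex R n -> Y)) ss'.
by apply: singular_eq => x; apply: fe.1; rewrite -[LHS]/((f \o s) x) ss'.
Qed.

Definition extend (a : singular R X -> int) (b : singular R Y -> int) : singular R Y -> int :=
  fun s => if pselect (exists s', push f s' = s) is left e then a (projT1 (cid e)) else b s.

Lemma extend_push a b s : extend a b (push f s) = a s.
Proof.
rewrite /extend; case: pselect => [e|[]]; last by exists s.
by congr a; apply: push_emb_inj; exact: projT2 (cid e).
Qed.

Lemma extend_out a b (s : singular R Y) : ~ range (projT2 s) `<=` range f -> extend a b s = b s.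
Proof.
rewrite /extend; case: pselect => // e []; have [s' <-] := e.
by move=> _ [x _ <-] /=; exists (projT2 s' x).
Qed.

Lemma pull_extend a b : pull f (extend a b) = a.
Proof. by apply/funext => s; exact: extend_push. Qed.

Lemma supp_extend k n a b : supp k n a -> supp k n b -> supp k n (extend a b).
Proof.
move=> ha hb s sn; rewrite /extend; case: pselect => [e|_]; last exact: hb.
by apply: ha => sn'; apply: sn; rewrite -(projT2 (cid e)).
Qed.

Lemma pull0_vanish (c : singular R Y -> int) : pull f c = 0 ->
  forall s : singular R Y, range (projT2 s) `<=` range f -> c s = 0.
Proof. by move=> fc s /fe.2[s' <-]; rewrite -pullE fc. Qed.

Lemma vanish_pull0 (c : singular R Y -> int) :
  (forall s : singular R Y, range (projT2 s) `<=` range f -> c s = 0) -> pull f c = 0.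
Proof.
move=> c0; apply/funext => s; rewrite pullE c0 // => _ [x _ <-] /=; by exists (projT2 s x).
Qed.
End Embedding.

(* A free action of a cyclic group makes the functions on the set an induced
   module, hence cohomologically trivial. *)
Section FreeCyclic.
Context {S : Type} (t : S -> S) (q : nat) (idx : S -> nat).
Hypotheses (tq : forall s, iter q t s = s) (idxq : forall s, (idx s < q)%N)
  (idxt : forall s, idx (t s) = ((idx s).+1 %% q)%N).
Implicit Types a b : S -> int.

Definition tpull a : S -> int := a \o t.
Definition tnorm a : S -> int := \sum_(i < q) iter i tpull a.

Lemma iter_tpull i a s : iter i tpull a s = a (iter i t s).
Proof. by elim: i s => //= i IH s; rewrite /tpull /= IH -iterSr. Qed.

Lemma tnormE a s : tnorm a s = \sum_(i < q) a (iter i t s).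
Proof. by rewrite /tnorm fct_sumE; apply: eq_bigr => i _; rewrite iter_tpull. Qed.

Lemma idx_iter i s : idx (iter i t s) = ((idx s + i) %% q)%N.
Proof.
elim: i => [|i IH]; first by rewrite addn0 modn_small.
by rewrite iterS idxt IH -addn1 modnDml addn1 addnS.
Qed.

(** Every orbit has exactly one point of index 0, so the sum over the orbit picks out a single value
    of [a]. *)
Lemma tnorm_surj a : tpull a = a -> tnorm (fun s => if idx s == 0%N then a s else 0) = a.
Proof.
move=> ta; apply/funext => s; rewrite tnormE.
have aE i : a (iter i t s) = a s by elim: i => //= i IH; rewrite -[RHS]IH -[in RHS]ta.
pose j := ((q - idx s) %% q)%N; have q0 : (0 < q)%N by exact: leq_ltn_trans (idxq s).
have jq : (j < q)%N by rewrite ltn_mod.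
rewrite (bigD1 (Ordinal jq)) //= idx_iter modnDmr subnKC 1?ltnW // modnn eqxx aE.
rewrite big1 ?addr0 // => i /eqP ij; rewrite idx_iter; case: eqP => // si.
case: ij; apply: val_inj; rewrite /= /j; have := ltn_ord i; have := idxq s.
move: si; case: (idx s) => [|k]; first by rewrite add0n modn_small // subn0 modnn.
move=> si kq iq; rewrite [RHS]modn_small; last by lia.
have : (q %| k.+1 + i)%N by rewrite /dvdn si.
move=> /dvdnP[[|[|m]]]; lia.
Qed.

(** The primitive sums [a] from [s] to the end of its orbit in the order of [idx]. It telescopes
    within the orbit, and at the last point, where the index returns to 0, the vanishing norm closes
    the gap. The last clause controls the support of [b]. *)
Lemma tnorm_ker a : tnorm a = 0 -> exists b, a = b - tpull b /\
  forall s, (forall i, a (iter i t s) = 0) -> b s = 0.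
Proof.
move=> Na; exists (fun s => \sum_(i < q - idx s) a (iter i t s)); split; last first.
  by move=> s a0; rewrite big1.
apply/funext => s; rewrite -[RHS]/(_ - \sum_(i < q - idx (t s)) a (iter i t (t s))) idxt.
have q0 : (0 < q)%N by exact: leq_ltn_trans (idxq s).
have [sq|sq] := ltnP (idx s).+1 q.
  rewrite modn_small //; have -> : (q - idx s = (q - (idx s).+1).+1)%N by rewrite subnSK.
  rewrite big_ord_recl -addrA -sumrB big1 ?addr0 // => i _.
  by rewrite -iterSr subrr.
have sE : (idx s).+1 = q by apply/eqP; rewrite eqn_leq sq idxq.
have -> : (q - idx s = 1)%N by rewrite -sE subSnn.
by rewrite sE modnn subn0 -tnormE Na big_ord_recl big_ord0 addr0 subr0.
Qed.
End FreeCyclic.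

(* An acyclic complex of induced modules has acyclic invariants: a two-step
   descent along 0 -> K^T -> K -> K -> K^T -> 0. *)
Section InvariantAcyclic.
Context {K : zmodType} (T d : {additive K -> K}) (q : nat) (deg : nat -> set K).
Hypotheses (deg_zmod : forall n, zmod_set (deg n)) (degT : forall n x, deg n x -> deg n (T x))
  (degd : forall n x, deg n x -> deg n.+1 (d x)) (deg0 : forall x, deg 0 x -> x = 0)
  (dT : forall x, d (T x) = T (d x)) (dd : forall x, d (d x) = 0)
  (Tq : forall x, iter q T x = x)
  (acyclic : forall n x, deg n.+1 x -> d x = 0 -> exists2 y, deg n y & d y = x).
Let N x : K := \sum_(i < q) iter i T x.
Hypotheses (N_surj : forall n x, deg n x -> T x = x -> exists2 a, deg n a & N a = x)
  (N_ker : forall n a, deg n a -> N a = 0 -> exists2 b, deg n b & a = b - T b).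

Let degB n x y : deg n x -> deg n y -> deg n (x - y).
Proof. exact: (deg_zmod n).2. Qed.
Let deg_0 n : deg n 0. Proof. exact: (deg_zmod n).1. Qed.
Let degD n x y : deg n x -> deg n y -> deg n (x + y).
Proof. by move=> hx hy; rewrite -[y]opprK; apply: degB => //; rewrite -sub0r; apply: degB. Qed.

Let NB x y : N (x - y) = N x - N y.
Proof.
rewrite /N -sumrB; apply: eq_bigr => i _; elim: (val i) => //= j ->; exact: raddfB.
Qed.

Let N_T x : N (T x) = N x.
Proof.
rewrite /N; under eq_bigr do rewrite -iterSr.
case: q Tq => [|p] Tp; first by rewrite !big_ord0.
by rewrite big_ord_recr big_ord_recl /= -[in X in _ + X]iterS Tp addrC.
Qed.

Let T_N x : T (N x) = N x.
Proof. by rewrite -[RHS]N_T /N raddf_sum; apply: eq_bigr => i _; rewrite -iterSr. Qed.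

Let d_N x : d (N x) = N (d x).
Proof.
rewrite /N raddf_sum; apply: eq_bigr => i _; elim: (val i) => //= j <-; exact: dT.
Qed.

Let deg_N n x : deg n x -> deg n (N x).
Proof.
move=> hx; rewrite /N; apply: (big_ind (deg n)) => // [y z|i _]; first exact: degD.
by elim: (val i) => //= j; exact: degT.
Qed.

Lemma invariant_acyclic n x : deg n.+1 x -> T x = x -> d x = 0 ->
  exists2 y, deg n y & T y = y /\ d y = x.
Proof.
have [m] := ubnP n; elim: m => // m IH in n x *; rewrite ltnS => nm hx Tx dx.
have [y hy dy] := acyclic hx dx.
case: n => [|n] in nm hx hy *.
  by exists y => //; split=> //; rewrite (deg0 hy) raddf0.
(* The defect of invariance [y - T y] is closed because [d y = x] is invariant. *)
have [y2 hy2 dy2] : exists2 y2, deg n y2 & d y2 = y - T y.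
  by apply: acyclic; [apply: degB => //; exact: degT|rewrite raddfB dT dy Tx subrr].
(* [N y2] is an invariant cocycle two degrees below [x]. By the induction hypothesis it is [d] of an
   invariant element, which in turn is a norm. *)
have [v hv Nv] : exists2 v, deg n.-1 v & d (N v) = N y2.
  case: n => [|n] in nm hx hy y2 hy2 dy2 *.
    by exists 0; [exact: deg_0|rewrite (deg0 hy2) /N !big1 ?raddf0 // => i _; elim: (val i) => //= j ->; rewrite raddf0].
  have [||||w hw [Tw dw]] := IH n (N y2); [lia|exact: deg_N|exact: T_N|by rewrite d_N dy2 NB N_T subrr|].
  by have [v hv vw] := N_surj hw Tw; exists v => //; rewrite vw.
(* Now [y2 - d v] has norm 0, and its primitive [e] is the correction: [y - d e] is invariant. *)
have [e he eE] : exists2 e, deg n e & y2 - d v = e - T e.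
  apply: N_ker; last by rewrite NB -d_N Nv subrr.
  apply: degB => //; case: n hv {hy2 hx hy nm} => [|n] hv; last exact: degd.
  by rewrite (deg0 hv) raddf0.
exists (y - d e); first by apply: degB => //; exact: degd.
split; last by rewrite raddfB dd dy subr0.
have -> : T (y - d e) = T y - d (T e) by rewrite raddfB dT.
have -> : T y = y - (d e - d (T e)) by rewrite -raddfB -eE raddfB dd subr0 dy2 subKr.
by rewrite opprB addrA addrAC addrK.
Qed.
End InvariantAcyclic.

Lemma push_existT {R : realType} {Y Z : topologicalType} (f : continuousType Y Z) (s : singular R Y)
    n (g : continuousType (simplex R n) Z) : push f s = existT _ n g ->
  exists t : continuousType (simplex R n) Y, forall x, f (t x) = g x.
Proof.
case: s => [m s] e; have mn : m = n := congr1 (@projT1 _ _) e; case: _ / mn g e => g.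
by move=> /singular_inj gE; exists s => x; rewrite -gE.
Qed.

Section HomotopyLemmas.
Context {R : realType} {Y Z : topologicalType} (H : continuousType (Y * simplex R 1)%type Z).

Lemma hop_natural (Y' Z' : topologicalType) (H' : continuousType (Y' * simplex R 1)%type Z')
    (f : continuousType Y Y') (g : continuousType Z Z') c :
  (forall x, H' (f x.1, x.2) = g (H x)) -> pull f (hop H' c) = hop H (pull g c).
Proof.
move=> Hfg; apply/funext => s; rewrite pullE /hop /nat_op; congr (prism _ _).
apply/funext => -[//|x l]; rewrite /hlin /= pullE; congr c.
by apply: singular_eq => y; rewrite /= /hmap /= -Hfg.
Qed.
End HomotopyLemmas.

(** * Contractions of the disc and of the line *)

Section Contract.
Context {R : realType} {Y W : topologicalType} (H : continuousType (Y * simplex R 1)%type Y)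
  (pr : continuousType Y W) (z : continuousType W Y).
Hypotheses (H1 : forall y, H (y, vtx 1) = y) (H0 : forall y, H (y, vtx 0) = z (pr y)).

Lemma contract_cocycle (c : singular R Y -> int) : cobnd c = 0 ->
  c = pull pr (pull z c) + cobnd (hop H c).
Proof.
move=> dc; apply/funext => s; have := hopP H c s; rewrite dc.
rewrite -[pull (hend H 1) c]/(pull (mkcts (@end_cts _ _ _ H 1) : continuousType Y Y) c) pull_id //.
rewrite -[hend H 0]/(mkcts (@end_cts _ _ _ H 0) : continuousType Y Y) -(pull_comp (f := pr) (g := z)) //; last by move=> y; rewrite -H0.
have h0 : hop H 0 = 0 :> (singular R Y -> int).
  apply/funext => t; apply: (@hop_dim _ _ _ H (sdim t)) => //.
rewrite h0 addr0 => e; rewrite -[RHS]/(_ s + cobnd _ s) e; exact/esym/subrKC.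
Qed.
End Contract.

Section Scaling.
Context {R : realType}.

Lemma real_complex_cts : continuous (fun x : R => x%:C%C : R[i]^o).
Proof.
move=> x; apply/cvgrPdist_lt => /= e e0.
have eR : e = (complex.Re e)%:C%C by move: e0; case: e => a b; rewrite ltcE /= => /andP[/eqP -> _].
have e0' : 0 < complex.Re e by move: e0; rewrite ltcE => /andP[].
near=> y; rewrite -rmorphB /= normc_def /= expr0n /= addr0 sqrtr_sqr eR ltcR.
by near: y; apply: cvgr_dist_lt e0'.
Unshelve. all: by end_near. Qed.

Definition height (t : simplex R 1) : R := val t 0 1.

Lemma height_cts : continuous height. Proof. exact: simplex_coord_cts. Qed.
Lemma height1 : height (vtx 1) = 1. Proof. by rewrite /height mxE eqxx. Qed.
Lemma height0 : height (vtx 0) = 0. Proof. by rewrite /height mxE. Qed.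
Lemma height_itv t : 0 <= height t <= 1.
Proof. by rewrite simplex_ge0 simplex_le1. Qed.

Lemma scale_disc_subproof (z : disc R) (t : simplex R 1) : (height t)%:C%C * val z \in disc R.
Proof.
apply/mem_set; rewrite /disc /= normrM; have /andP[t0 t1] := height_itv t.
have z1 : `|val z| <= 1 := set_mem (valP z).
have t0' : 0 <= (height t)%:C%C by rewrite lecR.
have t1' : (height t)%:C%C <= 1 by rewrite -[1]/(1%:C%C) lecR.
by rewrite ger0_norm // mulr_ile1.
Qed.
Definition scale_disc (z : disc R) (t : simplex R 1) : disc R :=
  exist (fun z => z \in disc R) _ (scale_disc_subproof z t).

Lemma to_disc_cts (X : topologicalType) (f : X -> disc R) :
  continuous (fun x => val (f x) : R[i]^o) -> continuous f.
Proof. exact: (@continuous_comp_initial (disc R) X R[i]^o set_val f). Qed.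

Lemma to_circle_cts (X : topologicalType) (f : X -> circle R) :
  continuous (fun x => val (f x) : R[i]^o) -> continuous f.
Proof. exact: (@continuous_comp_initial (circle R) X R[i]^o set_val f). Qed.

Lemma disc_val_cts : continuous (fun z : disc R => val z : R[i]^o).
Proof. exact: (@initial_continuous (disc R) _ set_val). Qed.

Lemma circle_val_cts : continuous (fun z : circle R => val z : R[i]^o).
Proof. exact: (@initial_continuous (circle R) _ set_val). Qed.

Lemma scale_disc_cts : continuous (fun x : disc R * simplex R 1 => scale_disc x.1 x.2).
Proof.
apply: to_disc_cts => x; apply: (@cvgM R[i] _ (nbhs x)).
  apply: (@continuous_comp _ _ _ (height \o snd) (fun x : R => x%:C%C : R[i]^o)); last exact: real_complex_cts.
  by apply: (@continuous_comp _ _ _ snd height); [exact: snd_cts|exact: height_cts].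
by apply: (@continuous_comp _ _ _ fst (fun z : disc R => val z : R[i]^o)); [exact: fst_cts|exact: disc_val_cts].
Qed.

Lemma rot_circle_cts t : continuous (@rot_circle R t).
Proof.
apply: to_circle_cts => x; apply: (@cvgM R[i] _ (nbhs x)); first exact: cvg_cst.
exact: circle_val_cts.
Qed.

Lemma rot_disc_cts t : continuous (@rot_disc R t).
Proof.
apply: to_disc_cts => x; apply: (@cvgM R[i] _ (nbhs x)); first exact: cvg_cst.
exact: disc_val_cts.
Qed.

Lemma disc_hausdorff : hausdorff_space (disc R).
Proof.
apply: hausdorff_sep => x y xy; exists R[i]^o, (fun z : disc R => val z); split.
- exact: norm_hausdorff.
- exact: disc_val_cts.
- by move=> /val_inj.
Qed.

Lemma circle_disc_emb : simplicial_emb (circle_disc R : continuousType _ _) (R := R).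
Proof.
split=> [x y /(congr1 val) /= xy|[n s] sr]; first exact: val_inj.
have sc x : val (s x) \in circle R.
  have [z _ <-] : range (circle_disc R) (s x) by apply: sr; exists x.
  exact: valP z.
have fc : continuous (fun x : simplex R n => exist (fun z => z \in circle R) _ (sc x) : circle R).
  apply: to_circle_cts => x.
  by apply: (@continuous_comp _ _ _ s (fun z : disc R => val z : R[i]^o)); [exact: cts_fun|exact: disc_val_cts].
exists (existT _ n (mkcts fc : continuousType (simplex R n) (circle R))).
by apply: singular_eq => x /=; exact: val_inj.
Qed.

Lemma emb_prod (X Y Y' : topologicalType) (f : continuousType Y Y')
    (g : continuousType (X * Y)%type (X * Y')%type) :
  (forall x, g x = (x.1, f x.2)) -> simplicial_emb (R := R) f -> simplicial_emb (R := R) g.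
Proof.
move=> gE [fi fs]; split=> [[x y] [x' y']|[n s] sr].
  by rewrite !gE => -[-> /fi ->].
pose s2 : continuousType (simplex R n) Y' := (mkcts (@snd_cts X Y') : continuousType _ _) \o s.
have [t tE] : exists s', push f s' = existT _ n s2.
  by apply: fs => _ [x _ <-]; have [[x' y] _] := sr _ (imageT s x); rewrite gE /s2 /mkcts /= => <-; exists y.
have [t' t'E] := push_existT tE.
have rc : continuous (fun x : simplex R n => ((s x).1, t' x)).
  apply: pair_cts; last exact: cts_fun.
  by move=> x; apply: (@continuous_comp _ _ _ s fst); [exact: cts_fun|exact: fst_cts].
exists (existT _ n (mkcts rc : continuousType (simplex R n) (X * Y)%type)).
by apply: singular_eq => x; rewrite /= gE /mkcts /= t'E /s2 /mkcts /= -surjective_pairing.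
Qed.
End Scaling.

(** * The circle and disc bundles *)

Section BundleGeometry.
Context {R : realType} {G : lieGroupType R} {q : nat} {c : G}.
Hypotheses (q_gt0 : (0 < q)%N) (c_order : (c ^+ q)%g = 1%g)
  (c_order_min : forall k : nat, (0 < k < q)%N -> (c ^+ k)%g <> 1%g).
Local Notation turn := (2 * pi : R).
Local Notation angle := (2 * pi / q%:R : R).

Lemma iter_base_gen k g : iter k (base_gen c) g = (g * c ^+ k)%g.
Proof.
elim: k => [|k IH]; first by rewrite expg0 mulg1.
by rewrite iterS IH /base_gen -mulgA -expgSr.
Qed.

Lemma base_gen_cts : continuous (base_gen c).
Proof.
move=> g; apply: (@continuous_comp _ _ _ (fun g : G => (g, c)) (fun x : G * G => (x.1 * x.2)%g)).
  by apply: pair_cts; [move=> x; exact: cvg_id|exact: cst_continuous].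
exact: lie_mul_cts.
Qed.

Lemma base_gen_order g : iter q (base_gen c) g = g.
Proof. by rewrite iter_base_gen c_order mulg1. Qed.

Lemma base_gen_free k g : (0 < k < q)%N -> iter k (base_gen c) g <> g.
Proof.
move=> kq; rewrite iter_base_gen => e; apply: (c_order_min kq).
by apply: (@mulgI _ g); rewrite e mulg1.
Qed.

Lemma iter_disc_gen k x : iter k (disc_gen q c) x =
  (iter k (base_gen c) x.1, iter k (rot_disc angle) x.2).
Proof. by elim: k => [|k IH]; [case: x|rewrite !iterS IH]. Qed.

Lemma cis_angle : cis angle ^+ q = 1.
Proof.
rewrite -cisX -[_ *+ q]mulr_natr divfK ?pnatr_eq0 -?lt0n //.
by have := cis_turn (R := R) 1; rewrite mulr1.
Qed.

Lemma val_iter_rot_disc k z : val (iter k (rot_disc angle) z) = cis angle ^+ k * val z.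
Proof. by elim: k => [|k IH]; [rewrite mul1r|rewrite iterS /= IH mulrA -exprS]. Qed.

Lemma disc_gen_order x : iter q (disc_gen q c) x = x.
Proof.
rewrite iter_disc_gen base_gen_order; case: x => g z; congr pair.
by apply: val_inj; rewrite val_iter_rot_disc cis_angle mul1r.
Qed.

Lemma disc_gen_free k x : (0 < k < q)%N -> iter k (disc_gen q c) x <> x.
Proof. by move=> kq; rewrite iter_disc_gen => /(congr1 fst); exact: base_gen_free. Qed.

Lemma prodmap_cts (X X' Y Y' : topologicalType) (f : X -> X') (g : Y -> Y') :
  continuous f -> continuous g -> continuous (fun x : X * Y => (f x.1, g x.2)).
Proof.
move=> fc gc; apply: pair_cts => x.
  by apply: (@continuous_comp _ _ _ fst f); [exact: fst_cts|exact: fc].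
by apply: (@continuous_comp _ _ _ snd g); [exact: snd_cts|exact: gc].
Qed.

Lemma total_gen_cts : continuous (total_gen q c).
Proof. exact: prodmap_cts base_gen_cts (@rot_circle_cts R angle). Qed.

Lemma disc_gen_cts : continuous (disc_gen q c).
Proof. exact: prodmap_cts base_gen_cts (@rot_disc_cts R angle). Qed.

Definition Tbase : continuousType G G := mkcts base_gen_cts.
Definition Ttotal : continuousType (G * circle R)%type (G * circle R)%type := mkcts total_gen_cts.
Definition Tdisc : continuousType (G * disc R)%type (G * disc R)%type := mkcts disc_gen_cts.
Definition Pbase : continuousType G (base_space c) := mkcts (@orbit_pi_cts _ (base_gen c)).
Definition Ptotal : continuousType (G * circle R)%type (total_space q c) :=
  mkcts (@orbit_pi_cts _ (total_gen q c)).
Definition Pdisc : continuousType (G * disc R)%type (disc_space q c) :=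
  mkcts (@orbit_pi_cts _ (disc_gen q c)).

Lemma base_covering : covering (range (fun k => iter k (base_gen c))) Pbase.
Proof.
apply: (orbit_covering base_gen_cts q_gt0 base_gen_order base_gen_free).
exact: lie_hausdorff.
Qed.

Lemma disc_covering : covering (range (fun k => iter k (disc_gen q c))) Pdisc.
Proof.
apply: (orbit_covering disc_gen_cts q_gt0 disc_gen_order disc_gen_free).
by apply: hausdorff_prod; [exact: lie_hausdorff|exact: disc_hausdorff].
Qed.

Lemma pull_iter (Y : topologicalType) (T d : continuousType Y Y) k (x : singular R Y -> int) :
  (forall y, d y = iter k T y) -> pull d x = iter k (pull T) x.
Proof.
elim: k d x => [|k IH] d x dE; first exact: pull_id.
have kc : continuous (iter k T) by apply: iter_cts; exact: cts_fun.
rewrite iterSr -(IH (mkcts kc : continuousType Y Y)) //.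
by rewrite (pull_comp (h := d)).
Qed.

Lemma pull_iter_fixed (Y : topologicalType) (T d : continuousType Y Y) k (x : singular R Y -> int) :
  (forall y, d y = iter k T y) -> pull T x = x -> pull d x = x.
Proof. by move=> dE Tx; rewrite (pull_iter x dE); elim: k {dE} => //= k ->. Qed.

Lemma base_descend (x : singular R G -> int) : pull Tbase x = x -> exists y, pull Pbase y = x.
Proof.
move=> Tx; apply: (pull_descend base_covering) => d [k _ dk].
by apply: (pull_iter_fixed (k := k) (T := Tbase)) => // y; rewrite -dk.
Qed.

Lemma disc_descend (x : singular R (G * disc R)%type -> int) :
  pull Tdisc x = x -> exists y, pull Pdisc y = x.
Proof.
move=> Tx; apply: (pull_descend disc_covering) => d [k _ dk].
by apply: (pull_iter_fixed (k := k) (T := Tdisc)) => // y; rewrite -dk.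
Qed.

Lemma orbit_map_pi (Y Y' : topologicalType) (t : Y -> Y) (t' : Y' -> Y') (f : continuousType Y Y')
  (fE : forall y, f (t y) = t' (f y)) y : orbit_map fE (orbit_pi t y) = orbit_pi t' (f y).
Proof.
rewrite /orbit_map; apply/eqmodP/asboolP.
have /eqmodP/asboolP[k [m e]] : repr (orbit_pi t y) = y %[mod {eq_quot (orbit_rel t)}] by rewrite reprK.
exists k, m; have fiter j z : f (iter j t z) = iter j t' (f z) by elim: j => //= j <-.
by rewrite -!fiter e.
Qed.

Definition fstD : continuousType (G * disc R)%type G := mkcts (@fst_cts G (disc R)).
Definition fstC : continuousType (G * circle R)%type G := mkcts (@fst_cts G (circle R)).
Definition fstR : continuousType (G * R)%type G := mkcts (@fst_cts G R).
Definition zeroD : continuousType G (G * disc R)%type := mkcts (@zero_cts R G).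
Definition incl : continuousType (G * circle R)%type (G * disc R)%type := mkcts (@incl_cts R G).
Definition wind : continuousType (G * R)%type (G * circle R)%type :=
  mkcts (@mapr_cts G _ _ _ (@circle_pt_cts R)).

Lemma disc_bundleP x : disc_bundle q c (Pdisc x) = Pbase (fstD x).
Proof. exact: orbit_map_pi. Qed.
Lemma circle_bundleP x : circle_bundle q c (Ptotal x) = Pbase (fstC x).
Proof. exact: orbit_map_pi. Qed.
Lemma zero_sectionP x : zero_section q c (Pbase x) = Pdisc (zeroD x).
Proof. exact: orbit_map_pi. Qed.
Lemma boundary_inclP x : boundary_incl q c (Ptotal x) = Pdisc (incl x).
Proof. exact: orbit_map_pi. Qed.

Lemma Pbase_surj b : exists x, Pbase x = b.
Proof. by exists (repr b); exact: reprK. Qed.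
Lemma Ptotal_surj b : exists x, Ptotal x = b.
Proof. by exists (repr b); exact: reprK. Qed.
Lemma incl_emb : simplicial_emb (R := R) incl.
Proof. by apply: (emb_prod (f := circle_disc R : continuousType _ _)) => //; exact: circle_disc_emb. Qed.

Lemma range_incl x : range incl x <-> `|val x.2| = 1.
Proof.
split=> [[y _ <-]|x1]; first exact: set_mem (valP y.2).
have xc : val x.2 \in circle R by apply/mem_set.
by exists (x.1, exist (fun z => z \in circle R) _ xc) => //; case: x x1 xc => g z x1 xc;
  rewrite /incl /mkcts /=; congr pair; exact: val_inj.
Qed.

Lemma range_incl_gen k x : range incl (iter k (disc_gen q c) x) <-> range incl x.
Proof.
by rewrite !range_incl iter_disc_gen /= val_iter_rot_disc normrM normrX cis_norm expr1n mul1r.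
Qed.

Lemma range_boundary x : range (boundary_incl q c) (Pdisc x) <-> range incl x.
Proof.
split=> [[y _]|[y _ <-]]; last by exists (Ptotal y) => //; exact: boundary_inclP.
have [z <-] := Ptotal_surj y; rewrite boundary_inclP.
move=> /(orbit_piP q_gt0 disc_gen_order)[k _ ->].
by apply/range_incl_gen; exists z.
Qed.

(** A simplex in the boundary lifts to [G * disc R]; since the action preserves [G * circle R], the
    lift stays in it. *)
Lemma boundary_emb : simplicial_emb (R := R) (boundary_incl q c).
Proof.
split=> [x y|s sr].
  have [x' <-] := Ptotal_surj x; have [y' <-] := Ptotal_surj y.
  rewrite !boundary_inclP => /(orbit_piP q_gt0 disc_gen_order)[k _].
  have -> : iter k (disc_gen q c) (incl x') = incl (iter k (total_gen q c) x').
    by elim: k => //= k ->; rewrite incl_gen.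
  by move=> /incl_emb.1 ->; apply/esym/orbit_pi_iter.
have [s' s'E] := push_lift disc_covering s erefl.
have [s'' s''E] : exists s'', push incl s'' = s'.
  apply: incl_emb.2 => _ [x _ <-]; apply/range_boundary; apply: sr; rewrite -s'E.
  by exists x.
exists (push Ptotal s''); rewrite -s'E -s''E; case: s'' {s''E} => n t.
by apply: singular_eq => x; exact: boundary_inclP.
Qed.

Lemma wind_covering : covering [set (fun x : G * R => (x.1, d x.2)) | d in range (@shift R)] wind.
Proof. by apply: covering_prod; [exact: lie_hausdorff|exact: circle_covering]. Qed.

Lemma turnR_cts k : continuous (fun x : G * R => (x.1, shift k x.2)).
Proof.
by apply: mapr_cts => t; apply: (@cvgD _ _ _ (nbhs t)); [exact: cvg_id|exact: cvg_cst].
Qed.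
Definition turnR k : continuousType (G * R)%type (G * R)%type := mkcts (turnR_cts (k := k)).

Lemma wind_descend (x : singular R (G * R)%type -> int) : (forall k, pull (turnR k) x = x) ->
  exists y, pull wind y = x.
Proof.
move=> Tx; apply: (pull_descend wind_covering) => d [_ [k _ <-] dk].
rewrite -[RHS](Tx k); apply/funext => -[n s]; rewrite !pullE; congr x; apply: singular_eq => y.
by rewrite /= -dk.
Qed.

Definition Hdisc_fun (x : (G * disc R) * simplex R 1) : G * disc R :=
  (x.1.1, scale_disc x.1.2 x.2).
Lemma Hdisc_cts : continuous Hdisc_fun.
Proof.
apply: pair_cts => x.
  by apply: (@continuous_comp _ _ _ fst fst); [exact: fst_cts|exact: fst_cts].
apply: (@continuous_comp _ _ _ (fun x : (G * disc R) * simplex R 1 => (x.1.2, x.2))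
  (fun x : disc R * simplex R 1 => scale_disc x.1 x.2)); last exact: scale_disc_cts.
apply: pair_cts; last exact: snd_cts.
by move=> {}x; apply: (@continuous_comp _ _ _ fst snd); [exact: fst_cts|exact: snd_cts].
Qed.
Definition Hdisc : continuousType ((G * disc R) * simplex R 1)%type (G * disc R)%type := mkcts Hdisc_cts.

Definition Hline_fun (x : (G * R) * simplex R 1) : G * R := (x.1.1, height x.2 * x.1.2).
Lemma Hline_cts : continuous Hline_fun.
Proof.
apply: pair_cts => x.
  by apply: (@continuous_comp _ _ _ fst fst); [exact: fst_cts|exact: fst_cts].
apply: (@cvgM R _ (nbhs x)).
  by apply: (@continuous_comp _ _ _ snd (@height R)); [exact: snd_cts|exact: height_cts].
by apply: (@continuous_comp _ _ _ fst snd); [exact: fst_cts|exact: snd_cts].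
Qed.
Definition Hline : continuousType ((G * R) * simplex R 1)%type (G * R)%type := mkcts Hline_cts.

Lemma zeroR_cts : continuous (fun g : G => (g, 0 : R)).
Proof. by apply: pair_cts; [move=> z; exact: cvg_id|exact: cst_continuous]. Qed.
Definition zeroR : continuousType G (G * R)%type := mkcts zeroR_cts.

Lemma contract_disc (x : singular R (G * disc R)%type -> int) : cobnd x = 0 ->
  x = pull fstD (pull zeroD x) + cobnd (hop Hdisc x).
Proof.
apply: contract_cocycle => -[g z]; rewrite /Hdisc /zeroD /mkcts /Hdisc_fun; congr pair; apply: val_inj.
  by rewrite /= height1 mul1r.
by rewrite /= height0 mul0r.
Qed.

Lemma contract_line (x : singular R (G * R)%type -> int) : cobnd x = 0 ->
  x = pull fstR (pull zeroR x) + cobnd (hop Hline x).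
Proof.
apply: contract_cocycle => -[g t]; rewrite /Hline /zeroR /mkcts /Hline_fun; congr pair => /=.
  by rewrite height1 mul1r.
by rewrite height0 mul0r.
Qed.

Lemma hop_disc_equiv x : pull Tdisc (hop Hdisc x) = hop Hdisc (pull Tdisc x).
Proof.
apply: hop_natural => -[[g z] t]; rewrite /Hdisc /Tdisc /mkcts /Hdisc_fun /disc_gen /=; congr pair.
by apply: val_inj; rewrite /= mulrCA.
Qed.
End BundleGeometry.

(** * The Thom cocycle *)

Lemma push_order {R : realType} (Y : topologicalType) (T : continuousType Y Y) q (s : singular R Y) :
  (forall y, iter q T y = y) -> iter q (push T) s = s.
Proof.
move=> Tq; case: s => n s.
have : forall k, exists f : continuousType (simplex R n) Y,
    iter k (push T) (existT _ n s) = existT _ n f /\ forall x, f x = iter k T (s x).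
  elim=> [|k [f [fE fP]]]; first by exists s.
  by rewrite iterS fE; exists (T \o f : continuousType _ _); split=> // x; rewrite iterS -fP.
by move=> /(_ q)[f [-> fP]]; apply: singular_eq => x; rewrite fP.
Qed.

Section ThomCocycle.
Context {R : realType} {G : lieGroupType R} {q : nat} {c : G} (idx : G -> nat).
Hypotheses (q_gt0 : (0 < q)%N) (c_order : (c ^+ q)%g = 1%g)
  (c_order_min : forall k : nat, (0 < k < q)%N -> (c ^+ k)%g <> 1%g)
  (idx_lt : forall g, (idx g < q)%N) (idx_c : forall g, idx (g * c)%g = ((idx g).+1 %% q)%N).
Local Notation turn := (2 * pi : R).
Local Notation angle := (2 * pi / q%:R : R).
Local Notation C X := (singular R X -> int).
Local Notation Tbase := (@Tbase R G c).
Local Notation Tdisc := (@Tdisc R G q c).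
Local Notation Ttotal := (@Ttotal R G q c).
Local Notation incl := (@incl R G).
Local Notation wind := (@wind R G).
Local Notation fstR := (@fstR R G).
Local Notation fstD := (@fstD R G).
Local Notation fstC := (@fstC R G).
Local Notation turnR := (@turnR R G).
Local Notation zeroR := (@zeroR R G).
Local Notation zeroD := (@zeroD R G).

(* The winding cochain of G x R, measured in the sheet of G -> G/Z_q given by
   idx; its coboundary descends to G x S^1. *)
Definition wcochain : C (G * R)%type :=
  pointwise (fun x : (G * R)%type => Num.floor (x.2 / turn - (idx x.1)%:R / q%:R)).
(** The indicator of the last sheet, of index q - 1, where multiplication by [c] resets the index to
    0. *)
Definition jump : C G := pointwise (fun g => ((idx g).+1 %% q == 0)%N%:R).

Lemma floor_shift (x : R) (k : int) : Num.floor (x + k%:~R) = Num.floor x + k.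
Proof. by rewrite floorDrz ?intr_int // intrKfloor. Qed.

Lemma wcochain_turn k : pull (turnR k) wcochain = wcochain + pointwise (fun=> k).
Proof.
apply/funext => s; rewrite pullE -[RHS]/(wcochain s + pointwise (fun=> k) s) /wcochain /pointwise /=.
case: ifP => // _; rewrite -floor_shift; congr Num.floor.
rewrite /turnR /mkcts /shift mulrDl addrAC; congr (_ + _).
by rewrite mulrAC divff ?mul1r // gt_eqF // turn_gt0.
Qed.

Lemma cobnd_pointwise_cst (X : topologicalType) (k : int) :
  cobnd (pointwise (fun=> k)) = 0 :> C X.
Proof.
have [_ d1] := asboolP _ (cochain1_cocycle R X).
apply/funext => s; transitivity (cobnd (@cochain1 R X) s * k); last by rewrite d1 mul0r.
rewrite /cobnd; case: ifP => _; first by rewrite mul0r.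
rewrite mulr_suml; apply: eq_bigr => i _; rewrite -mulrA; congr (_ * _).
by rewrite /pointwise /cochain1; case: eqP; rewrite ?mul1r ?mul0r.
Qed.

Lemma pointwise1 (X : topologicalType) : pointwise (fun=> 1) = @cochain1 R X.
Proof. by apply/funext => s; rewrite /pointwise /cochain1; case: eqP. Qed.

Lemma twist_cts : continuous (fun x : G * R => ((x.1 * c)%g, x.2 + angle)).
Proof.
apply: (@prodmap_cts _ _ _ _ (base_gen c) (fun t : R => t + angle)); first exact: base_gen_cts.
by move=> t; apply: (@cvgD _ _ _ (nbhs t)); [exact: cvg_id|exact: cvg_cst].
Qed.
(** A lift to [G * R] of the generator acting on [G * circle R]. *)
Definition twist : continuousType (G * R)%type (G * R)%type := mkcts twist_cts.

(** The twist adds 1 / q to the angle measured in turns and, off the last sheet, the same amount to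
    the term subtracted from it. On the last sheet that term drops by (q - 1) / q instead, so the
    floor grows by 1. *)
Lemma wcochain_twist : pull twist wcochain - wcochain = pull fstR jump.
Proof.
apply/funext => s; rewrite -[LHS]/(wcochain (push twist s) - wcochain s) [RHS]pullE.
rewrite /wcochain /jump /pointwise /=; case: ifP => _; last by rewrite subrr.
rewrite /twist /fstR /mkcts /=; move: (projT2 s (vtx 0)) => [g t] /=.
have q0 : q%:R != 0 :> R by rewrite pnatr_eq0 -lt0n.
have tE : (t + angle) / turn = t / turn + 1 / q%:R.
  by rewrite mulrDl mulrAC divff ?gt_eqF // turn_gt0.
rewrite idx_c tE; have := idx_lt g; rewrite leq_eqVlt => /predU1P[gq|gq].
  rewrite gq modnn eqxx mul0r subr0.
  have -> : t / turn + 1 / q%:R = t / turn - (idx g)%:R / q%:R + 1%:~R.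
    rewrite -addrA; congr (_ + _); rewrite -[X in _ = _ + X](divff q0) -mulNr -mulrDl; congr (_ / _).
    by rewrite -[in RHS]gq -natr1 addKr.
  by rewrite floor_shift addrC addKr.
rewrite modn_small // -[RHS]/(0 : int).
have -> : t / turn + 1 / q%:R - (idx g).+1%:R / q%:R = t / turn - (idx g)%:R / q%:R.
  by rewrite -addrA -mulrBl -[(idx g).+1%:R]natr1 opprD addrCA subrr addr0 mulNr.
exact: subrr.
Qed.

(** Full turns change [wcochain] by constants only, so its coboundary is periodic. *)
Lemma alpha_exists : exists a, pull wind a = cobnd wcochain.
Proof.
apply: (wind_descend (G := G)) => k.
by rewrite pull_cobnd wcochain_turn raddfD /= cobnd_pointwise_cst addr0.
Qed.
Definition alpha : C (G * circle R)%type := projT1 (cid alpha_exists).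
Lemma alphaE : pull wind alpha = cobnd wcochain. Proof. exact: projT2 (cid alpha_exists). Qed.

Let wind_lift s : exists s', push wind s' = s :> singular R _.
Proof. exact: (push_lift (wind_covering (G := G))). Qed.
Let wind_inj := pull_inj (R := R) (wind_covering (R := R) (G := G)).

Lemma supp_wcochain : supp 0 0 wcochain. Proof. exact: supp_pointwise. Qed.
Lemma supp_jump : supp 0 0 jump. Proof. exact: supp_pointwise. Qed.

Lemma supp_alpha : supp 0 1 alpha.
Proof.
apply: (supp_pull_inj wind_lift); rewrite alphaE.
by apply: supp_cobnd; apply: suppS; exact: supp_wcochain.
Qed.

Lemma cobnd_alpha : cobnd alpha = 0.
Proof. by apply: wind_inj; rewrite pull_cobnd alphaE cobnd_cobnd raddf0. Qed.

Lemma alpha_gen : pull Ttotal alpha - alpha = pull fstC (cobnd jump).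
Proof.
apply: wind_inj; rewrite raddfB /= alphaE.
have -> : pull wind (pull Ttotal alpha) = pull twist (pull wind alpha).
  rewrite (pull_comp (h := wind \o twist : continuousType _ _)) ?(pull_comp (h := wind \o twist : continuousType _ _)) //.
  move=> [g t]; rewrite /= /Ttotal /twist /wind /mkcts /total_gen /=; congr pair.
  by apply: val_inj; rewrite /= -cisD addrC.
rewrite alphaE !pull_cobnd -cobndB wcochain_twist; congr cobnd.
Qed.

Let pidx (s : singular R G) := idx (projT2 s (vtx 0)).
Let pidx_lt s : (pidx s < q)%N. Proof. exact: idx_lt. Qed.
Let pidx_c s : pidx (push Tbase s) = ((pidx s).+1 %% q)%N. Proof. exact: idx_c. Qed.

Let push_base_order (s : singular R G) : iter q (push Tbase) s = s.
Proof. by apply: push_order => y; exact: base_gen_order. Qed.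

(** Each orbit meets the last sheet once. The index is shifted by one because [tnorm_surj] selects
    the points of index 0. *)
Lemma jump_norm : tnorm (push Tbase) q jump = @cochain1 R G.
Proof.
have idxS_lt s : ((pidx s).+1 %% q < q)%N by rewrite ltn_mod.
have idxS_c s : ((pidx (push Tbase s)).+1 %% q = ((pidx s).+1 %% q).+1 %% q)%N by rewrite pidx_c.
rewrite -[RHS](tnorm_surj (t := push Tbase) (idx := fun s => (pidx s).+1 %% q)%N idxS_lt idxS_c) //.
congr tnorm; apply/funext => s; rewrite /jump /pointwise /cochain1 /pidx.
by case: (sdim s) => [|n] /=; case: eqP.
Qed.

(** The norm commutes with [cobnd]. The sign comes from [tnorm_ker], which returns [b - tpull b].
    The last clause will make [mu] vanish over open sets on which the sheet index is locally
    constant. *)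
Lemma mu_exists : exists mu : C G, [/\ pull Tbase mu - mu = cobnd jump, supp 0 1 mu &
  forall s : singular R G, (forall i, cobnd jump (iter i (push Tbase) s) = 0) -> mu s = 0].
Proof.
have N0 : tnorm (push Tbase) q (- cobnd jump) = 0.
  have -> : tnorm (push Tbase) q (- cobnd jump) = - cobnd (tnorm (push Tbase) q jump).
    rewrite /tnorm raddf_sum -sumrN; apply: eq_bigr => i _.
    by elim: (val i) => //= j ->; rewrite -[tpull _ _]/(pull Tbase _) -[tpull _ _ in RHS]/(pull Tbase _) raddfN /= pull_cobnd.
  by rewrite jump_norm -pointwise1 cobnd_pointwise_cst oppr0.
have [mu [muE mu0]] := tnorm_ker pidx_lt pidx_c N0.
have mu0' (s : singular R G) : (forall i, cobnd jump (iter i (push Tbase) s) = 0) -> mu s = 0.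
  by move=> s0; apply: mu0 => i; rewrite -[LHS]/(- _) s0 oppr0.
exists mu; split=> //; first by rewrite -[pull _ _]/(tpull (push Tbase) mu) -[LHS]opprB -muE opprK.
move=> s sn; apply: mu0' => i; have sj : supp 0 1 (cobnd jump).
  by apply: supp_cobnd; apply: suppS; exact: supp_jump.
apply: sj; rewrite (_ : sdim (iter i _ s) = sdim s) //.
by elim: i => //= i; exact.
Qed.
Definition mu : C G := projT1 (cid mu_exists).
Lemma muP : [/\ pull Tbase mu - mu = cobnd jump, supp 0 1 mu &
  forall s : singular R G, (forall i, cobnd jump (iter i (push Tbase) s) = 0) -> mu s = 0].
Proof. exact: projT2 (cid mu_exists). Qed.

Definition alphabar : C (G * disc R)%type := extend incl alpha (pull fstD mu).
Definition ucocycle := cobnd alphabar.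

Lemma supp_alphabar : supp 0 1 alphabar.
Proof. by apply: supp_extend; [exact: supp_alpha|apply: supp_pull; have [] := muP]. Qed.

Lemma supp_u : supp 0 2 ucocycle.
Proof. by apply: supp_cobnd; apply: suppS; exact: supp_alphabar. Qed.

Lemma pull_incl_u : pull incl ucocycle = 0.
Proof. by rewrite pull_cobnd pull_extend ?cobnd_alpha //; exact: incl_emb. Qed.

Lemma cobnd_u : cobnd ucocycle = 0. Proof. exact: cobnd_cobnd. Qed.

(** On boundary simplices the defect is that of [alpha], elsewhere that of [mu]; [mu] was chosen to
    make the two agree. The defect is closed, which is why [ucocycle] is invariant. *)
Lemma alphabar_gen : pull Tdisc alphabar - alphabar = pull fstD (cobnd jump).
Proof.
apply/funext => s; rewrite -[LHS]/(alphabar (push Tdisc s) - alphabar s) [RHS]pullE.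
have [mug _ _] := muP.
have [[s' <-]|ns] := pselect (exists s', push incl s' = s).
  have -> : push Tdisc (push incl s') = push incl (push Ttotal s').
    apply: singular_eq => x; rewrite /= /Tdisc /Ttotal /incl /mkcts; exact/esym/incl_gen.
  rewrite /alphabar !extend_push; [|exact: incl_emb..].
  by rewrite -[LHS]/((pull Ttotal alpha - alpha) s') alpha_gen.
have out t : ~ (exists t', push incl t' = t) -> alphabar t = mu (push fstD t).
  by rewrite /alphabar /extend; case: pselect.
have fT : push fstD (push Tdisc s) = push Tbase (push fstD s) by exact: singular_eq.
rewrite !out // ?fT; first by rewrite -[LHS]/((pull Tbase mu - mu) (push fstD s)) mug.
case: s fT ns => n s _ ns [t' t'E]; apply: ns; apply: incl_emb.2 => _ [x _ <-].
have [t tE] := push_existT t'E.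
by apply/(range_incl_gen (c := c) (q := q) 1); exists (t x).
Qed.

Lemma u_gen : pull Tdisc ucocycle = ucocycle.
Proof.
by apply/eqP; rewrite -subr_eq0 pull_cobnd -cobndB alphabar_gen pull_cobnd cobnd_cobnd.
Qed.

(** The zero section misses the boundary, so along it [alphabar] is given by [mu]. *)
Lemma zeroD_u : pull zeroD ucocycle = cobnd mu.
Proof.
rewrite pull_cobnd; congr cobnd; apply/funext => s; rewrite pullE /alphabar extend_out.
  by rewrite -pullE (pull_comp (h := mkcts (fun x => @cvg_id _ (nbhs (x : G))) : continuousType G G)) ?pull_id.
move=> sr; have : range incl (zeroD (projT2 s (vtx 0))) by apply: sr; exists (vtx 0).
by move=> /range_incl; rewrite -[val _]/(0 : R[i]) normr0 => /eqP; rewrite eq_sym oner_eq0.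
Qed.

Lemma turnRE i (x : G * R) : turnR i x = (x.1, x.2 + turn * i%:~R). Proof. by []. Qed.

Lemma push_turnD i j (s : singular R (G * R)%type) : push (turnR i) (push (turnR j) s) = push (turnR (i + j)) s.
Proof.
case: s => m s; apply: singular_eq => x; rewrite -[LHS]/(turnR i (turnR j (s x))).
by rewrite -[RHS]/(turnR (i + j) (s x)) !turnRE intrD (mulrDr turn) addrA addrAC.
Qed.

Lemma push_turn0 (s : singular R (G * R)%type) : push (turnR 0) s = s.
Proof.
case: s => m s; apply: singular_eq => x; rewrite -[LHS]/(turnR 0 (s x)) turnRE mulr0 addr0.
by case: (s x).
Qed.

Lemma turn_fixed (z : C (G * R)%type) : pull (turnR 1) z = z -> forall k, pull (turnR k) z = z.
Proof.
move=> Tz; have Tn (n : nat) : pull (turnR n) z = z.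
  elim: n => [|n IH]; first by apply/funext => s; rewrite pullE push_turn0.
  by rewrite -[RHS]IH -[in RHS]Tz; apply/funext => s; rewrite !pullE push_turnD.
case=> n; first exact: Tn.
rewrite -[in LHS](Tn n.+1); apply/funext => s; rewrite !pullE push_turnD NegzE addrN.
by rewrite push_turn0.
Qed.

(** Full turns act freely on simplices, so the difference equation can be summed along each orbit,
    starting from the translate whose first vertex lies in the turn from 0. *)
Lemma turn_surj k n (e : C (G * R)%type) : supp k n e ->
  exists2 f, supp k n f & pull (turnR 1) f - f = e.
Proof.
move=> he.
have pushD := push_turnD; have push0 := push_turn0.
pose ht (s : singular R (G * R)%type) : int := Num.floor ((projT2 s (vtx 0)).2 / turn).
have htD i s : ht (push (turnR i) s) = ht s + i.
  have -> : ht (push (turnR i) s) = Num.floor ((turnR i (projT2 s (vtx 0))).2 / turn) by [].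
  rewrite turnRE /ht -floor_shift; congr Num.floor.
  by rewrite [LHS]mulrDl mulrAC divff ?mul1r // gt_eqF // turn_gt0.
(* The sum of [e] over the first [i] translates of [s], continued to negative [i] so that the
   recursion [S1] holds for all integers. *)
pose S s (i : int) : int := match i with
  | Posz m => \sum_(j < m) e (push (turnR j%:Z) s)
  | Negz m => - \sum_(j < m.+1) e (push (turnR (- j.+1%:Z)) s) end.
have S1 s i : S s (i + 1) - S s i = e (push (turnR i) s).
  case: i => [m|[|m]].
  - by rewrite -PoszD addn1 /S big_ord_recr [LHS]addrAC subrr add0r.
  - by rewrite /S /= big_ord_recl !big_ord0 addr0 sub0r opprK NegzE.
  - have -> : Negz m.+1 + 1 = Negz m by rewrite !NegzE -[m.+2]addn1 PoszD opprD subrK.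
    by rewrite /S [X in _ - - X]big_ord_recr /= opprK addKr NegzE.
exists (fun s => S (push (turnR (- ht s)) s) (ht s)).
  move=> s sn; have ez i : e (push (turnR i) (push (turnR (- ht s)) s)) = 0 by exact: he.
  by rewrite /S; case: (ht s) ez => m ez; rewrite big1 ?oppr0 // => j _; exact: ez.
apply/funext => s; rewrite -[LHS]/(S _ (ht (push _ s)) - S _ _) htD pushD.
by rewrite opprD subrK S1 pushD addrN push0.
Qed.
End ThomCocycle.

Lemma slice_right_cts (X Y : topologicalType) (y : Y) : continuous (fun x : X => (x, y)).
Proof. by apply: pair_cts; [move=> z; exact: cvg_id|exact: cst_continuous]. Qed.

Section ZmodIdentities.
Context {V : zmodType}.
Implicit Types a b m w x : V.
Lemma zmod_cancel1 a m w : a + m - w - (a - w) = m.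
Proof. by rewrite opprB addrA subrK addrAC subrr add0r. Qed.
Lemma zmod_cancel2 a b m : a + b - (a + m) = b - m.
Proof. by rewrite opprD addrACA subrr add0r. Qed.
Lemma zmod_cancel3 a b m : a - m - (b - m) = a - b.
Proof. by rewrite opprB addrA subrK. Qed.
Lemma zmod_cancel4 a b m w : a - m - (b - w) = a - b - (m - w).
Proof. by rewrite !opprB addrACA [RHS]addrACA; congr (_ + _); rewrite addrC. Qed.
Lemma zmod_cancel5 a b x : a - (x + (a - b)) - (b - x) = 0.
Proof.
apply/eqP; rewrite subr_eq0 opprD opprB addrCA.
by rewrite [a + _]addrC subrK addrC.
Qed.
Lemma zmod_cancel6 a b x : a + b - a - x - (b - x) = 0.
Proof. by rewrite [a + b]addrC addrK subrr. Qed.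
Lemma zmod_cancel7 a x : a = a - 0 - x - 0 + x.
Proof. by rewrite !subr0 subrK. Qed.
Lemma zmod_cancel8 a b : a - - b = b + a.
Proof. by rewrite opprK addrC. Qed.
Lemma zmod_cancel9 a b : a + b - a = b.
Proof. by rewrite addrC addKr. Qed.
Lemma zmod_cancel10 a : - (0 - a) = a.
Proof. by rewrite sub0r opprK. Qed.
Lemma zmod_cancel11 a b m w : a - b + (m - w) = a + m - (b + w).
Proof. by rewrite opprD addrACA. Qed.
Lemma zmod_cancel12 a b : - (a - b) = - a - - b.
Proof. exact: opprD. Qed.
End ZmodIdentities.

(** * Acyclicity of the Thom cone, without equivariance *)

Section ThomAcyclic.
Context {R : realType} {G : lieGroupType R}.
Local Notation C X := (singular R X -> int).
Local Notation incl := (@incl R G).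
Local Notation wind := (@wind R G).
Local Notation fstR := (@fstR R G).
Local Notation fstD := (@fstD R G).
Local Notation fstC := (@fstC R G).
Local Notation T1 := (@turnR R G 1).
Local Notation zeroR := (@zeroR R G).
Local Notation zeroD := (@zeroD R G).
Context (phi : C (G * R)%type) (al : C (G * circle R)%type) (ab : C (G * disc R)%type).
Hypotheses (phi_turn : pull T1 phi = phi + @cochain1 R _) (supp_phi : supp 0 0 phi)
  (wind_al : pull wind al = cobnd phi) (incl_ab : pull incl ab = al) (supp_ab : supp 0 1 ab).
Let u := cobnd ab.
Local Opaque pull cup cobnd hop.

Definition windD : continuousType (G * R)%type (G * disc R)%type := incl \o wind.
Definition oneD_fun (g : G) : G * disc R := windD (g, 0).
Lemma oneD_cts : continuous oneD_fun.
Proof. exact: (@slice_right_cts _ _ (circle_disc R (circle_pt 0))). Qed.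
Definition oneD : continuousType G (G * disc R)%type := mkcts oneD_cts.

Let pull_windD (x : C (G * disc R)%type) : pull windD x = pull wind (pull incl x).
Proof. by rewrite (pull_comp (h := windD)). Qed.

Let windD_fst (x : C G) : pull windD (pull fstD x) = pull fstR x.
Proof. by apply: pull_comp => -[]. Qed.

Let zeroR_fst (x : C G) : pull zeroR (pull fstR x) = x.
Proof.
by rewrite (pull_comp (h := mkcts (fun x => @cvg_id _ (nbhs (x : G))) : continuousType G G)) // pull_id.
Qed.

Let T1_windD (x : C (G * disc R)%type) : pull T1 (pull windD x) = pull windD x.
Proof.
apply: pull_comp => -[g t]; rewrite /windD /=; congr (incl _).
rewrite /wind /turnR /mkcts /shift; congr pair; exact: circle_pt_turn.
Qed.

Let T1_fst (x : C G) : pull T1 (pull fstR x) = pull fstR x.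
Proof. by apply: pull_comp => -[]. Qed.

Let supp_u : supp 0 2 u.
Proof. by apply: supp_cobnd; apply: suppS. Qed.

Let windD_u : pull windD u = 0.
Proof. by rewrite pull_windD !pull_cobnd incl_ab wind_al cobnd_cobnd. Qed.

Let al_cocycle : cobnd al = 0.
Proof.
apply: (pull_inj (R := R) (wind_covering (R := R) (G := G))).
by rewrite pull_cobnd wind_al cobnd_cobnd raddf0.
Qed.

(** Injectivity of multiplication by [u]. The cochain [a + cup ab (pull fstD m)] is closed, so up to
    a coboundary it comes from [G]; on [G * R] this yields an [f] which a full turn changes by [m].
    Once [f] is made closed, a full turn changes it by a coboundary only. *)
Lemma thom_acyclic_base n a m : supp 0 n a -> supp 1 n m -> pull incl a = 0 ->
  cobnd a + cup u (pull fstD m) = 0 -> cobnd m = 0 -> exists2 k, supp 2 n k & m = cobnd k.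
Proof.
move=> sa sm ia dam dm.
have [w wE] : exists w, w = a + cup ab (pull fstD m) by eexists.
have dm' : cobnd (pull fstD m) = 0 by rewrite -pull_cobnd dm raddf0.
have dw : cobnd w = 0 by rewrite wE raddfD /= (cobnd_cup_cocycle _ dm').
have wD := contract_disc dw.
have se : supp 1 n (hop (@Hdisc R G) w).
  apply: supp_hop; rewrite wE; apply: suppD => //; apply: (supp_cup supp_ab); exact: supp_pull.
have ww : pull windD w = cup (cobnd phi) (pull fstR m).
  by rewrite wE raddfD /= pull_windD ia raddf0 add0r pull_cup windD_fst pull_windD incl_ab wind_al.
move: (pull zeroD w) (hop _ w) wD se => v e wD se.
(* On [G * R], [cup phi m] is a primitive of [w] and [e] is one up to the term [v] from [G], so [f]
   has coboundary [v]. Only [phi] fails to be periodic, whence [Tf]. *)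
have [f fE] : exists f, f = cup phi (pull fstR m) - pull windD e by eexists.
have sf : supp 1 n f.
  rewrite fE; apply: suppB; last exact: supp_pull.
  by apply: (supp_cup supp_phi); rewrite addn0; exact: supp_pull.
have dm'' : cobnd (pull fstR m) = 0 by rewrite -pull_cobnd dm raddf0.
have df : cobnd f = pull fstR v.
  rewrite fE cobndB (cobnd_cup_cocycle _ dm'') -ww wD -pull_cobnd raddfD /= windD_fst.
  exact: addrK.
have Tf : pull T1 f - f = pull fstR m.
  rewrite fE pullB T1_windD pull_cup phi_turn T1_fst cupDl cup1l.
  exact: zmod_cancel1.
have [f0 f0E] : exists f0, f0 = pull zeroR f by eexists.
have [f1 f1E] : exists f1, f1 = f - pull fstR f0 by eexists.
have df1 : cobnd f1 = 0.
  rewrite f1E cobndB -pull_cobnd df f0E -pull_cobnd df zeroR_fst; exact: subrr.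
have sf1 : supp 1 n f1.
  by rewrite f1E; apply: suppB => //; apply: supp_pull; rewrite f0E; exact: supp_pull.
have f1D := contract_line df1.
have se' : supp 2 n (hop (@Hline R G) f1) by exact: supp_hop.
move: (pull zeroR f1) (hop _ f1) f1D se' => v' e' f1D se'.
have Tf1 : pull T1 f1 - f1 = cobnd (pull T1 e' - e').
  rewrite cobndB -pull_cobnd f1D raddfD /= T1_fst; exact: zmod_cancel2.
exists (pull zeroR (pull T1 e' - e')).
  by apply: supp_pull; apply: suppB => //; exact: supp_pull.
rewrite -pull_cobnd -Tf1 -[LHS]zeroR_fst -Tf; congr (pull zeroR _).
by rewrite f1E pullB T1_fst; exact/esym/zmod_cancel3.
Qed.

(** Surjectivity of multiplication by [u]. A primitive of [a], restricted to the boundary and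
    unwound over [G * R], is closed there and has a primitive up to a term from [G]. The failure of
    the latter to be periodic gives [k], in effect the integral over the circle. *)
Lemma thom_acyclic_cocycle n a : supp 0 n a -> pull incl a = 0 -> cobnd a = 0 ->
  exists b k, [/\ supp 1 n b, supp 2 n k, pull incl b = 0, cobnd k = 0 &
    a = cobnd b + cup u (pull fstD k)].
Proof.
move=> sa ia da.
have aE := contract_disc da.
have se : supp 1 n (hop (@Hdisc R G) a) by exact: supp_hop.
move: (pull zeroD a) (hop _ a) aE se => v e aE se.
(* [a] vanishes on the slice through the boundary point 1, so the value of [e] there corrects [e] to
   a true primitive of [a]. *)
have [k1 k1E] : exists k1, k1 = pull oneD e by eexists.
have [e1 e1E] : exists e1, e1 = e - pull fstD k1 by eexists.
have dk1 : cobnd k1 = - v.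
  apply/eqP; rewrite -addr_eq0 k1E -pull_cobnd; apply/eqP.
  have := congr1 (pull oneD) aE; rewrite raddfD /=.
  have -> : pull oneD a = pull zeroR (pull windD a) by rewrite (pull_comp (h := oneD)).
  have -> : pull oneD (pull fstD v) = v.
    by rewrite (pull_comp (h := mkcts (fun x => @cvg_id _ (nbhs (x : G))) : continuousType G G)) // pull_id.
  by rewrite pull_windD ia !raddf0 addrC => <-.
have de1 : cobnd e1 = a.
  rewrite e1E cobndB -pull_cobnd dk1 aE raddfN /=; exact: zmod_cancel8.
have se1 : supp 1 n e1.
  by rewrite e1E; apply: suppB => //; apply: supp_pull; rewrite k1E; exact: supp_pull.
have [x1 x1E] : exists x1, x1 = pull windD e1 by eexists.
have dx1 : cobnd x1 = 0 by rewrite x1E -pull_cobnd de1 pull_windD ia raddf0.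
have Tx1 : pull T1 x1 = x1 by rewrite x1E T1_windD.
have sx1 : supp 1 n x1 by rewrite x1E; exact: supp_pull.
have x1D := contract_line dx1.
have se2 : supp 2 n (hop (@Hline R G) x1) by exact: supp_hop.
have dv2 : cobnd (pull zeroR x1) = 0 by rewrite -pull_cobnd dx1 raddf0.
have sv2 : supp 1 n (pull zeroR x1) by exact: supp_pull.
move: (pull zeroR x1) (hop _ x1) x1D se2 dv2 sv2 => v2 e2 x1D se2 dv2 sv2.
(* The failure of [e2] to be periodic; it is closed because [x1] is periodic. *)
have [y yE] : exists y, y = pull T1 e2 - e2 by eexists.
have dy : cobnd y = 0.
  have de2 : cobnd e2 = x1 - pull fstR v2 by rewrite x1D; exact/esym/zmod_cancel9.
  rewrite yE cobndB -pull_cobnd de2 pullB T1_fst Tx1; exact: subrr.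
have sy : supp 2 n y by rewrite yE; apply: suppB => //; exact: supp_pull.
have yD := contract_line dy.
have [e4 se4 e4E] := turn_surj (supp_hop (@Hline R G) sy).
have dk2 : cobnd (pull zeroR y) = 0 by rewrite -pull_cobnd dy raddf0.
have sk2 : supp 2 n (pull zeroR y) by exact: supp_pull.
rewrite -e4E in yD; move: (pull zeroR y) yD dk2 sk2 => k2 yD dk2 sk2.
(* Subtracting [cobnd e4] leaves exactly [k2] as the defect of periodicity, with no coboundary added
   to it. *)
have [e5 e5E] : exists e5, e5 = e2 - cobnd e4 by eexists.
have Te5 : pull T1 e5 - e5 = pull fstR k2.
  rewrite e5E pullB zmod_cancel4 -yE yD pull_cobnd -cobndB; exact: addrK.
have se5 : supp 2 n e5 by rewrite e5E; apply: suppB => //; exact: supp_cobnd.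
have dk2D : cobnd (pull fstD k2) = 0 by rewrite -pull_cobnd dk2 raddf0.
have dk2R : cobnd (pull fstR k2) = 0 by rewrite -pull_cobnd dk2 raddf0.
(* [phi] grows by 1 in each turn, so the subtracted product has the same defect [k2] and [z]
   descends to [G * circle R]. *)
have [z zE] : exists z, z = e5 - cup phi (pull fstR k2) by eexists.
have Tz : pull T1 z = z.
  apply/eqP; rewrite -subr_eq0 zE pullB pull_cup phi_turn T1_fst cupDl cup1l -Te5.
  exact/eqP/zmod_cancel5.
have [e6 e6E] : exists e6, pull wind e6 = z.
  by apply: wind_descend => k; exact: turn_fixed.
have se6 : supp 2 n e6.
  apply: (supp_pull_inj (f := wind)); first by move=> s; exact: (push_lift (wind_covering (G := G)) s erefl).
  rewrite e6E zE; apply: suppB => //; apply: (supp_cup supp_phi); rewrite addn0; exact: supp_pull.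
have [v2D v2DE] : exists v2D, v2D = pull fstD v2 by eexists.
have [E6 E6E] : exists E6, E6 = extend incl e6 0 by eexists.
have dv2D : cobnd v2D = 0 by rewrite v2DE -pull_cobnd dv2 raddf0.
have iE6 : pull incl E6 = e6 by rewrite E6E; apply: pull_extend; exact: incl_emb.
(* The corrections make [e1] vanish on the boundary. Of them only the product with [ab] affects the
   coboundary, and it accounts for the term with [u]. *)
exists (e1 - v2D - cup ab (pull fstD k2) - cobnd E6), k2; split => //.
- apply: suppB; first apply: suppB; first apply: suppB => //.
  + by rewrite v2DE; exact: supp_pull.
  + by apply: (supp_cup supp_ab); exact: supp_pull.
  + by apply: supp_cobnd; rewrite E6E; apply: supp_extend.
- apply: (pull_inj (R := R) (wind_covering (R := R) (G := G))); rewrite raddf0 -pull_windD.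
  rewrite 3!pullB -x1E v2DE windD_fst pull_cup windD_fst [pull windD (cobnd _)]pull_cobnd.
  rewrite !pull_windD incl_ab iE6 wind_al e6E x1D zE cobndB (cobnd_cup_cocycle _ dk2R).
  have -> : cobnd e5 = cobnd e2 by rewrite e5E cobndB cobnd_cobnd; exact: subr0.
  exact: zmod_cancel6.
- rewrite 3!cobndB de1 dv2D cobnd_cobnd (cobnd_cup_cocycle _ dk2D).
  exact: zmod_cancel7.
Qed.

(** Injectivity gives [m = cobnd k]; adding [cup u (pull fstD k)] then turns [a] into a relative
    cocycle, to which surjectivity applies. *)
Lemma thom_acyclic n a m : supp 0 n a -> supp 1 n m -> pull incl a = 0 ->
  cobnd a + cup u (pull fstD m) = 0 -> cobnd m = 0 ->
  exists b k, [/\ supp 1 n b, supp 2 n k, pull incl b = 0,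
    cobnd b + cup u (pull fstD k) = a & - cobnd k = m].
Proof.
move=> sa sm ia dam dm; have [k sk mE] := thom_acyclic_base sa sm ia dam dm.
have du : cobnd (cup u (pull fstD k)) = cup u (pull fstD m).
  by rewrite cobnd_cup cobnd_cobnd cup0l add0r sign_twist2 // -pull_cobnd -mE.
have [b [k' [sb sk' ib dk' abE]]] : exists b k', [/\ supp 1 n b, supp 2 n k', pull incl b = 0,
    cobnd k' = 0 & a + cup u (pull fstD k) = cobnd b + cup u (pull fstD k')].
  apply: thom_acyclic_cocycle.
  - by apply: suppD => //; apply: (supp_cup supp_u); exact: supp_pull.
  - by rewrite raddfD /= ia add0r pull_cup pull_cobnd incl_ab al_cocycle cup0l.
  - by rewrite raddfD /= du.
exists b, (k' - k); split=> //; first exact: suppB.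
  by rewrite pullB cupBr addrA -abE; exact: addrK.
by rewrite cobndB dk' -mE; exact: zmod_cancel10.
Qed.
End ThomAcyclic.

(** * Acyclicity of the Thom cone on invariants *)

Section EquivariantThom.
Context {R : realType} {G : lieGroupType R} {q : nat} {c : G} (idx : G -> nat).
Hypotheses (q_gt0 : (0 < q)%N) (c_order : (c ^+ q)%g = 1%g)
  (c_order_min : forall k : nat, (0 < k < q)%N -> (c ^+ k)%g <> 1%g)
  (idx_lt : forall g, (idx g < q)%N) (idx_c : forall g, idx (g * c)%g = ((idx g).+1 %% q)%N).
Local Notation C X := (singular R X -> int).
Local Notation Tbase := (@Tbase R G c).
Local Notation Tdisc := (@Tdisc R G q c).
Local Notation incl := (@incl R G).
Local Notation fstD := (@fstD R G).
Local Notation Pbase := (@Pbase R G c).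
Local Notation Pdisc := (@Pdisc R G q c).
Context (u : C (G * disc R)%type).
Hypotheses (supp_u : supp 0 2 u) (cobnd_u : cobnd u = 0) (u_gen : pull Tdisc u = u)
  (incl_u : pull incl u = 0)
  (u_acyclic : forall n a m, supp 0 n a -> supp 1 n m -> pull incl a = 0 ->
    cobnd a + cup u (pull fstD m) = 0 -> cobnd m = 0 ->
    exists b k, [/\ supp 1 n b, supp 2 n k, pull incl b = 0,
      cobnd b + cup u (pull fstD k) = a & - cobnd k = m]).

Let K : zmodType := (C (G * disc R)%type * C G)%type.
(** The differential of the mapping cone of multiplication by [u], from cochains of [G] to cochains
    of [G * disc R] relative to [G * circle R]. *)
Definition cone_d (x : K) : K := (cobnd x.1 + cup u (pull fstD x.2), - cobnd x.2).
Definition cone_T (x : K) : K := (pull Tdisc x.1, pull Tbase x.2).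

Lemma cone_dB : zmod_morphism cone_d.
Proof.
move=> [a m] [b k]; rewrite /cone_d /= !cobndB pullB cupBr; congr pair.
  exact: zmod_cancel11.
exact: zmod_cancel12.
Qed.
Lemma cone_TB : zmod_morphism cone_T. Proof. by []. Qed.
HB.instance Definition _ := GRing.isZmodMorphism.Build K K cone_d cone_dB.
HB.instance Definition _ := GRing.isZmodMorphism.Build K K cone_T cone_TB.

(** The shift by one makes degree 0 trivial, as the induction of [invariant_acyclic] requires. *)
Definition cone_deg n (x : K) := [/\ supp 1 n x.1, pull incl x.1 = 0 & supp 2 n x.2].

Let sidx (s : singular R G) := idx (projT2 s (vtx 0)).
Let didx (s : singular R (G * disc R)%type) := idx (projT2 s (vtx 0)).1.

Let iter_cone i x : iter i cone_T x =
  (iter i (tpull (push Tdisc)) x.1, iter i (tpull (push Tbase)) x.2).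
Proof. by elim: i => [|i IH]; [case: x|rewrite !iterS IH]. Qed.

Let cone_norm p x : \sum_(i < p) iter i cone_T x =
  (tnorm (push Tdisc) p x.1, tnorm (push Tbase) p x.2).
Proof.
rewrite /tnorm; elim: p => [|p IH]; first by rewrite !big_ord0.
by rewrite !big_ord_recr /= IH iter_cone.
Qed.

Let push_incl_iter i s : exists s', iter i (push Tdisc) (push incl s) = push incl s' :> singular R _.
Proof.
elim: i => [|i [s' IH]]; first by exists s.
rewrite iterS IH; exists (push (@Ttotal R G q c) s'); apply: singular_eq => x.
exact/esym/incl_gen.
Qed.

Let sdim_iter (Y : topologicalType) (T : continuousType Y Y) i (s : singular R Y) :
  sdim (iter i (push T) s) = sdim s.
Proof. by elim: i => //= i. Qed.

Let sidx_c s : sidx (push Tbase s) = ((sidx s).+1 %% q)%N. Proof. exact: idx_c. Qed.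
Let didx_c s : didx (push Tdisc s) = ((didx s).+1 %% q)%N. Proof. exact: idx_c. Qed.

Let sidx_lt s : (sidx s < q)%N. Proof. exact: idx_lt. Qed.
Let didx_lt s : (didx s < q)%N. Proof. exact: idx_lt. Qed.

Lemma cone_invariant n x : cone_deg n.+1 x -> cone_T x = x -> cone_d x = 0 ->
  exists2 y, cone_deg n y & cone_T y = y /\ cone_d y = x.
Proof.
apply: (@invariant_acyclic K cone_T cone_d q cone_deg).
- move=> m; split=> [|x' y [a b c'] [a' b' c'']]; first by split=> //; exact: raddf0.
  by split; [exact: suppB|rewrite pullB b b' subrr|exact: suppB].
- move=> m [a k] [/= sa ia sk]; split=> /=; [exact: supp_pull| |exact: supp_pull].
  apply/funext => s; rewrite !pullE; have [s' E] := push_incl_iter 1 s.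
  by rewrite -[push Tdisc _]/(iter 1 (push Tdisc) (push incl s)) E -pullE ia.
- move=> m [a k] [/= sa ia sk]; split=> /=.
  + apply: suppD; first by apply: supp_cobnd; apply: suppS.
    by apply: (supp_cup supp_u); apply: supp_pull; apply: suppS.
  + by rewrite raddfD /= pull_cobnd ia raddf0 add0r pull_cup incl_u cup0l.
  + by apply: suppN; apply: supp_cobnd; apply: suppS.
- move=> [a m] [/= sa _ sm]; congr pair; first exact: (supp_lt _ sa).
  exact: (supp_lt _ sm).
- move=> [a m]; rewrite /cone_d /cone_T /=; congr pair.
    rewrite raddfD /= pull_cobnd pull_cup u_gen; congr (_ + cup _ _).
    by rewrite (pull_comp (h := fstD \o Tdisc : continuousType _ _)) // (pull_comp (h := fstD \o Tdisc : continuousType _ _)).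
  by rewrite raddfN /= pull_cobnd.
- move=> [a m]; rewrite /cone_d /=; congr pair.
    rewrite raddfD /= cobnd_cobnd add0r cobnd_cup cobnd_u cup0l add0r sign_twist2 //.
    by rewrite -pull_cobnd -cupDr raddfN /= subrr cup0r.
  by rewrite raddfN /= cobnd_cobnd !oppr0.
- move=> [a m]; rewrite iter_cone; congr pair; apply/funext => s; rewrite iter_tpull push_order //.
    by move=> y; exact: disc_gen_order.
  by move=> y; exact: base_gen_order.
- move=> m [a k] [/= sa ia sk] [da dk].
  have [|||||b [k' [sb sk' ib bE k'E]]] := @u_acyclic m a k; [exact: suppSV|exact: suppSV|by []|by []| |].
    by apply/eqP; rewrite -oppr_eq0; apply/eqP.
  by exists (b, k') => //; rewrite /cone_d /= bE k'E.
- move=> m [a k] [/= sa ia sk] [Ta Tk].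
  exists (fun s => if didx s == 0%N then a s else 0, fun s => if sidx s == 0%N then k s else 0).
    split=> /= [s sn||s sn]; [by rewrite sa ?if_same| |by rewrite sk ?if_same].
    by apply/funext => s; rewrite pullE; case: ifP => // _; rewrite -pullE ia.
  rewrite cone_norm /=; congr pair.
    exact: (tnorm_surj (idx := didx) didx_lt didx_c Ta).
  exact: (tnorm_surj (idx := sidx) sidx_lt sidx_c Tk).
- move=> m [a k] [/= sa ia sk]; rewrite cone_norm => -[Na Nk].
  have [b [bE b0]] := tnorm_ker didx_lt didx_c Na.
  have [l [lE l0]] := tnorm_ker sidx_lt sidx_c Nk.
  exists (b, l); last by rewrite [in LHS]bE [in LHS]lE.
  split=> /= [s sn||s sn].
  + by apply: b0 => i; apply: sa; rewrite sdim_iter.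
  + apply/funext => s; rewrite pullE; apply: b0 => i; have [s' ->] := push_incl_iter i s.
    by rewrite -pullE ia.
  + by apply: l0 => i; apply: sk; rewrite sdim_iter.
Qed.

Context (U : C (disc_space q c)).
Hypothesis UE : pull Pdisc U = u.
Local Notation Bundle := (disc_bundle q c).
Local Notation Bdry := (boundary_incl q c).

Let pull_inj_disc := pull_inj (R := R) (disc_covering (R := R) q_gt0 c_order c_order_min).
Let pull_inj_base := pull_inj (R := R) (base_covering (R := R) q_gt0 c_order c_order_min).

Lemma pull_Pdisc_bundle (m : C (base_space c)) :
  pull Pdisc (pull Bundle m) = pull fstD (pull Pbase m).
Proof.
apply/funext => s; rewrite !pullE; congr m; apply: singular_eq => x; exact: disc_bundleP.
Qed.

Lemma pull_Pdisc_bdry (a : C (disc_space q c)) : pull Bdry a = 0 <-> pull incl (pull Pdisc a) = 0.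
Proof.
split=> a0; apply/funext => s; rewrite !pullE.
  have -> : push Pdisc (push incl s) = push Bdry (push (@Ptotal R G q c) s).
    by apply: singular_eq => x; exact/esym/boundary_inclP.
  by rewrite -pullE a0.
have [s' s'E] := push_lift (disc_covering (R := R) q_gt0 c_order c_order_min) (push Bdry s) erefl.
have [s'' s''E] : exists s'', push incl s'' = s'.
  apply: incl_emb.2 => _ [x _ <-].
  apply/(range_boundary q_gt0 c_order); case: s' s'E x => n t s'E x.
  have [v vE] := push_existT (esym s'E).
  by exists (v x) => //; rewrite vE.
by rewrite -s'E -s''E -!pullE a0.
Qed.

Lemma pull_Tbase_Pbase (m : C (base_space c)) : pull Tbase (pull Pbase m) = pull Pbase m.
Proof. by apply: pull_comp => g; exact: (orbit_pi_iter 1). Qed.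

Lemma pull_Tdisc_Pdisc (m : C (disc_space q c)) : pull Tdisc (pull Pdisc m) = pull Pdisc m.
Proof. by apply: pull_comp => g; exact: (orbit_pi_iter 1). Qed.

(** The invariant cochains of the covering spaces are the pullbacks of cochains of the orbit spaces,
    so [cone_invariant] descends. *)
Lemma orbit_acyclic n (a : C (disc_space q c)) (m : C (base_space c)) :
  supp 0 n a -> supp 1 n m -> pull Bdry a = 0 ->
  cobnd a + cup U (pull Bundle m) = 0 -> cobnd m = 0 ->
  exists b k, [/\ supp 1 n b, supp 2 n k, pull Bdry b = 0,
    cobnd b + cup U (pull Bundle k) = a & - cobnd k = m].
Proof.
move=> sa sm ba dam dm.
have [|||[b k] [/= sb ib sk] [[Tb Tk] [dbk dk]]] := @cone_invariant n (pull Pdisc a, pull Pbase m).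
- by split; [apply: supp_pull; apply: suppS|apply/pull_Pdisc_bdry|apply: supp_pull; apply: suppS].
- by rewrite /cone_T /= pull_Tbase_Pbase pull_Tdisc_Pdisc.
- rewrite /cone_d /=; congr pair; last by rewrite -pull_cobnd dm; exact: oppr0.
  by rewrite -pull_cobnd -pull_Pdisc_bundle -UE -pull_cup -raddfD /= dam raddf0.
have [b' b'E] := disc_descend q_gt0 c_order c_order_min Tb.
have [k' k'E] := base_descend q_gt0 c_order c_order_min Tk.
exists b', k'; split.
- apply: (supp_pull_inj (f := Pdisc)); last by rewrite b'E.
  by move=> s; exact: (push_lift (disc_covering q_gt0 c_order c_order_min) s erefl).
- apply: (supp_pull_inj (f := Pbase)); last by rewrite k'E.
  by move=> s; exact: (push_lift (base_covering q_gt0 c_order c_order_min) s erefl).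
- by apply/pull_Pdisc_bdry; rewrite b'E.
- apply: pull_inj_disc; rewrite raddfD /= pull_cobnd pull_cup UE pull_Pdisc_bundle b'E k'E.
  exact: dbk.
- by apply: pull_inj_base; rewrite raddfN /= pull_cobnd k'E.
Qed.
End EquivariantThom.

(** * Cohomology classes and the sequence of a pair *)

Section GradedParts.
Context {R : realType}.
Local Notation C X := (singular R X -> int).

Definition bounded {X : topologicalType} (c : C X) :=
  exists N, forall s, (N <= sdim s)%N -> c s = 0.

Context {X Y : topologicalType}.
Implicit Types c : C X.

Definition compk k n c : C X := fun s => if (sdim s + k == n)%N then c s else 0.

Lemma supp_compk k n c : supp k n (compk k n c).
Proof. by move=> s /eqP/negPf sn; rewrite /compk sn. Qed.

Lemma compkS k n c : compk k n c = compk k.+1 n.+1 c.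
Proof. by apply/funext => s; rewrite /compk addnS eqSS. Qed.

Lemma compkD k n c d : compk k n (c + d) = compk k n c + compk k n d.
Proof.
by apply/funext => s; rewrite -[RHS]/(compk k n c s + compk k n d s) /compk; case: ifP; rewrite ?addr0.
Qed.

Lemma compk0 k n : compk k n 0 = 0.
Proof. by apply/funext => s; rewrite /compk if_same. Qed.

Lemma cobnd_compk k n c : cobnd (compk k.+1 n c) = compk k n (cobnd c).
Proof.
apply/funext => s; rewrite /compk /cobnd; case: eqP => s0; first by rewrite if_same.
have -> : (sdim s + k == n)%N = ((sdim s).-1 + k.+1 == n)%N.
  by rewrite addnS -addSn prednK // lt0n; apply/eqP.
by case: eqP => // _; rewrite big1 // => i _; rewrite mulr0.
Qed.

Lemma cup_compk p k n (u c : C X) : supp 0 p u ->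
  cup u (compk (k + p) n c) = compk k n (cup u c).
Proof.
move=> su; apply/funext => s; rewrite /compk /cup.
have uz (i : 'I_(sdim s).+1) x : val i != p -> u (vert s id i) * x = 0.
  by move=> /eqP ip; rewrite su ?mul0r //= addn0.
have [sn|sn] := eqVneq (sdim s + k)%N n; [|apply: big1 => i _]; last first.
  have [ip|ip] := eqVneq (val i) p; last exact: uz.
  rewrite /= ifF ?mulr0 //; apply: contraNF sn => /eqP <-.
  by apply/eqP; rewrite -ip addnCA addnC subnK // -ltnS.
apply: eq_bigr => i _; have [ip|ip] := eqVneq (val i) p; last by rewrite !uz.
rewrite /= ifT // -sn -ip addnCA addnC subnK //; last by rewrite -ltnS.
Qed.

Lemma sum_compk k M c : (forall s, (M <= sdim s + k)%N -> c s = 0) ->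
  c = \sum_(n < M) compk k n c.
Proof.
move=> cM; apply/funext => s; rewrite fct_sumE.
have [sM|sM] := ltnP (sdim s + k)%N M; last first.
  rewrite cM // big1 // => i _; rewrite /compk; case: eqP => // _; exact: cM.
rewrite (bigD1 (Ordinal sM)) //= /compk eqxx big1 ?addr0 // => i /eqP ni.
by case: eqP => // e; case: ni; apply: val_inj.
Qed.

Lemma cup_suml (I : finType) (u : C X) (F : I -> C X) :
  cup u (\sum_i F i) = \sum_i cup u (F i).
Proof. by apply: (big_morph (cup u)); [exact: cupDr|exact: cup0r]. Qed.

Lemma bounded_sum M (F : 'I_M -> C X) : (forall i, bounded (F i)) -> bounded (\sum_i F i).
Proof.
elim: M F => [|M IH] F bF; first by rewrite big_ord0; exists 0%N.
rewrite big_ord_recr; have [N1 h1] := IH _ (fun i => bF (widen_ord (leqnSn M) i)).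
have [N2 h2] := bF ord_max; exists (maxn N1 N2) => s; rewrite geq_max => /andP[s1 s2].
by rewrite -[LHS]/((\sum_(i < M) F (widen_ord (leqnSn M) i)) s + F ord_max s) h1 // h2.
Qed.

Lemma supp_bounded k n c : supp k n c -> bounded c.
Proof. by move=> sc; exists n.+1 => s ns; apply: sc; lia. Qed.

Lemma rel0P c : rel_cochain set0 c <-> bounded c.
Proof.
split=> [[]//|bc]; split=> // s s0; case: (s0 (projT2 s (vtx 0))).
by exists (vtx 0).
Qed.

Lemma boundedB c d : bounded c -> bounded d -> bounded (c - d).
Proof.
by move=> /rel0P hc /rel0P hd; apply/rel0P; exact: rel_cochain_sub.
Qed.

Lemma boundedN c : bounded c -> bounded (- c).
Proof. by move=> hc; rewrite -sub0r; apply: boundedB => //; exists 0%N. Qed.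

Lemma bounded_cobnd c : bounded c -> bounded (cobnd c).
Proof.
move=> [N cN]; exists N.+1 => s Ns; rewrite /cobnd; case: eqP => // _.
by rewrite big1 // => i _; rewrite cN ?mulr0 //=; lia.
Qed.

Lemma bounded_cup c d : bounded c -> bounded d -> bounded (cup c d).
Proof. by move=> /rel0P hc /rel0P hd; apply/rel0P; exact: rel_cochain_cup. Qed.

Lemma bounded_sign_twist c : bounded c -> bounded (sign_twist c).
Proof. by move=> /rel0P hc; apply/rel0P; exact: rel_cochain_sign_twist. Qed.

Lemma cocycle0P c : c \in cocycle set0 <-> bounded c /\ cobnd c = 0.
Proof. by split=> [/asboolP[/rel0P]//|[bc dc]]; apply/asboolP; split=> //; exact/rel0P. Qed.

Lemma cocycle_rel_abs (A : set X) c : c \in cocycle A -> c \in cocycle set0.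
Proof. by move=> /asboolP[[bc _] dc]; exact/cocycle0P. Qed.
End GradedParts.

Section PullClasses.
Context {R : realType} {X Y : topologicalType} (f : continuousType X Y).
Local Notation C X := (singular R X -> int).

Lemma bounded_pull (c : C Y) : bounded c -> bounded (pull f c).
Proof. by move=> [N cN]; exists N => s Ns; exact: cN. Qed.

Lemma rel_pull (A : set X) (B : set Y) (c : C Y) : (forall x, A x -> B (f x)) ->
  rel_cochain B c -> rel_cochain A (pull f c).
Proof.
move=> AB [bc vc]; split; first exact: bounded_pull.
by move=> s sA; apply: vc => _ [x _ <-]; apply/AB/sA; exists x.
Qed.

Lemma cocycle_pull (A : set X) (B : set Y) (c : C Y) : (forall x, A x -> B (f x)) ->
  c \in cocycle B -> pull f c \in cocycle A.
Proof.
move=> AB /asboolP[rc dc]; apply/asboolP; split; first exact: rel_pull rc.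
by rewrite -pull_cobnd dc raddf0.
Qed.

Lemma rpull_cls (A : set X) (B : set Y) (c : C Y) : (forall x, A x -> B (f x)) ->
  c \in cocycle B -> rpull f A (cls B c) = cls A (pull f c).
Proof.
move=> AB cB; apply/cls_eq; [exact: (cocycle_pull AB (rep_cocycle _))|exact: (cocycle_pull AB cB)|].
have [e eB de] := (cls_eq (rep_cocycle (cls B c)) cB).1 (repK _).
by exists (pull f e); [exact: (rel_pull AB eB)|rewrite -pull_cobnd de].
Qed.

Lemma hpull_cls (c : C Y) : c \in cocycle set0 -> hpull f (cls set0 c) = cls set0 (pull f c).
Proof. exact: rpull_cls. Qed.

Lemma cocycle_pull0 (c : C Y) : c \in cocycle set0 -> pull f c \in cocycle set0.
Proof. exact: cocycle_pull. Qed.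
End PullClasses.

Section Classes.
Context {R : realType} {X : topologicalType}.
Local Notation C X := (singular R X -> int).

Lemma clsB (A : set X) (a b : C X) : a \in cocycle A -> b \in cocycle A ->
  cls A (a - b) = cls A a - cls A b.
Proof.
move=> aA bA; apply: (@addIr _ (cls A b)); rewrite -clsD ?rpredB // !subrK //.
Qed.

Lemma cls_eq0 (A : set X) (a : C X) : a \in cocycle A ->
  cls A a = 0 <-> exists2 b, rel_cochain A b & cobnd b = a.
Proof.
move=> aA; rewrite -(cls0 R A); split.
  by move/(cls_eq aA (rpred0 _)) => [b bA db]; exists b => //; rewrite db subr0.
by move=> [b bA db]; apply/(cls_eq aA (rpred0 _)); exists b => //; rewrite db subr0.
Qed.

Lemma clsMz (A : set X) (a : C X) (n : int) : a \in cocycle A ->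
  cls A (fun s => a s * n) = cls A a *~ n.
Proof.
move=> aA; have mE (m : nat) : (fun s => a s * m%:Z) = a *+ m.
  apply/funext => s; rewrite natmulfctE; elim: m => [|m IH]; first by rewrite mulr0.
  by rewrite -addn1 PoszD mulrDr IH mulr1 mulrnDr.
have cm m : cls A (a *+ m) = cls A a *+ m.
  elim: m => [|m IH]; first by rewrite !mulr0n cls0.
  by rewrite !mulrS clsD ?IH // rpredMn.
case: n => m; first by rewrite mE cm.
rewrite NegzE mulrNz -[_ *~ _]cm -mE.
have -> : (fun s => a s * - m.+1%:Z) = 0 - (fun s => a s * m.+1%:Z).
  by apply/funext => s; rewrite mulrN -sub0r.
by rewrite clsB ?cls0 ?sub0r // ?rpred0 // mE rpredMn.
Qed.

(** [cls set0 (rep z)] plays the part of the map from relative to absolute cohomology; it does not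
    depend on the representative. *)
Lemma cls_rep_abs (A : set X) (a : C X) : a \in cocycle A ->
  cls set0 (rep (cls A a)) = cls set0 a.
Proof.
move=> aA; apply/cls_eq; [exact: cocycle_rel_abs (rep_cocycle _)|exact: cocycle_rel_abs aA|].
have [e [be _] de] := (cls_eq (rep_cocycle (cls A a)) aA).1 (repK _).
by exists e => //; exact/rel0P.
Qed.
End Classes.

(** * The exact sequence of a pair *)

Section PairSequence.
Context {R : realType} {X Y : topologicalType} (f : continuousType X Y).
Local Notation C X := (singular R X -> int).
Hypothesis fe : simplicial_emb (R := R) f.

Lemma rel_embP (c : C Y) : rel_cochain (range f) c <-> bounded c /\ pull f c = 0.
Proof.
split=> [[bc vc]|[bc fc]]; split=> //; first exact: vanish_pull0.
exact: pull0_vanish.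
Qed.

Lemma bounded_extend (a : C X) : bounded a -> bounded (extend f a 0).
Proof.
move=> [N aN]; exists N => s Ns; rewrite /extend; case: pselect => // e.
by apply: aN; rewrite -(projT2 (cid e)) in Ns.
Qed.

Lemma cobnd_cocycle_rel (b : C Y) : bounded b -> cobnd (pull f b) = 0 ->
  cobnd b \in cocycle (range f).
Proof.
move=> bb db; apply/asboolP; split; last exact: cobnd_cobnd.
by apply/rel_embP; split; [exact: bounded_cobnd|rewrite pull_cobnd].
Qed.

(** The choices made in [connecting] are immaterial: two extensions differ by a relative cochain, up
    to the coboundary of an extended cochain. *)
Lemma connecting_cls (a : C X) (b : C Y) : a \in cocycle set0 -> bounded b -> pull f b = a ->
  connecting f (cls set0 a) = cls (range f) (cobnd b).
Proof.
move=> aX bb fb; rewrite /connecting.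
set B := [set b | _]; have [b0 r0] : B !=set0.
  exists (extend f (rep (cls set0 a)) 0); split; last exact: pull_extend.
  by apply/rel0P/bounded_extend; have /cocycle0P[] := rep_cocycle (cls set0 a).
have [/rel0P bx fx] := xgetPex 0 (ex_intro _ b0 r0).
move: (xget 0 B) bx fx => x bx fx.
have [/cocycle0P[_ drep] /cocycle0P[_ da]] := (rep_cocycle (cls set0 a), aX).
have [e /rel0P be de] := (cls_eq (rep_cocycle (cls set0 a)) aX).1 (repK _).
apply/cls_eq; [by apply: cobnd_cocycle_rel; rewrite ?fx|by apply: cobnd_cocycle_rel; rewrite ?fb|].
exists (x - b - cobnd (extend f e 0)); last by rewrite !cobndB cobnd_cobnd; exact: subr0.
apply/rel_embP; split.
  by apply: boundedB; [exact: boundedB|apply/bounded_cobnd/bounded_extend].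
by rewrite !pullB fx fb pull_cobnd pull_extend // de; exact: subrr.
Qed.

Lemma connecting_ext (x : hcoh R X) : exists b, [/\ bounded b, cobnd (pull f b) = 0,
  x = cls set0 (pull f b) & connecting f x = cls (range f) (cobnd b)].
Proof.
have /cocycle0P[br dr] := rep_cocycle x.
exists (extend f (rep x) 0); rewrite pull_extend //; split=> //.
- exact: bounded_extend.
- by rewrite repK.
- rewrite -[in LHS](repK x); apply: connecting_cls; [exact: rep_cocycle|exact: bounded_extend|].
  exact: pull_extend.
Qed.

Let pull_cocycle0 (b : C Y) : bounded b -> cobnd (pull f b) = 0 -> pull f b \in cocycle set0.
Proof. by move=> bb db; apply/cocycle0P; split=> //; exact: bounded_pull. Qed.

Lemma connecting_zmod : zmod_morphism (@connecting R X Y f).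
Proof.
move=> x y; have [b [bb db xE cx]] := connecting_ext x; have [d [bd dd yE cy]] := connecting_ext y.
rewrite cx cy {1}xE {1}yE -clsB ?pull_cocycle0 // -pullB (@connecting_cls _ (b - d)) //.
- by rewrite cobndB clsB // cobnd_cocycle_rel.
- by rewrite pull_cocycle0 //; [exact: boundedB|rewrite pullB cobndB db dd subrr].
- exact: boundedB.
Qed.

Lemma connecting_eq0 (x : hcoh R X) : connecting f x = 0 <-> exists w, hpull f w = x.
Proof.
split=> [cx|[w <-]]; last first.
  have wc := rep_cocycle w; rewrite -[w]repK hpull_cls // (@connecting_cls _ (rep w)) //.
  - by have /cocycle0P[_ ->] := wc; exact: cls0.
  - exact: cocycle_pull0.
  - by have /cocycle0P[] := wc.
have [b [bb db xE cE]] := connecting_ext x; move: cx; rewrite cE.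
move/(cls_eq0 (cobnd_cocycle_rel bb db)) => [d /rel_embP[bd fd] dd].
have bdc : b - d \in cocycle set0.
  by apply/cocycle0P; split; [exact: boundedB|rewrite cobndB dd subrr].
by exists (cls set0 (b - d)); rewrite hpull_cls // pullB fd xE; congr cls; exact: subr0.
Qed.

Lemma connecting_range (z : rcoh R Y (range f)) :
  cls set0 (rep z) = 0 <-> exists x, connecting f x = z.
Proof.
split=> [|[x <-]]; last first.
  have [b [bb db _ ->]] := connecting_ext x; rewrite cls_rep_abs ?cobnd_cocycle_rel //.
  apply/cls_eq0; last by exists b => //; exact/rel0P.
  exact: cocycle_rel_abs (cobnd_cocycle_rel bb db).
have zc := rep_cocycle z; move/(cls_eq0 (cocycle_rel_abs zc)) => [b /rel0P bb db].
have dfb : cobnd (pull f b) = 0.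
  by rewrite -pull_cobnd db; apply: vanish_pull0; have /asboolP[[]] := zc.
exists (cls set0 (pull f b)); rewrite (@connecting_cls _ b) ?db ?repK //.
exact: pull_cocycle0.
Qed.

Lemma connecting_mul (x : hcoh R X) (w : hcoh R Y) :
  connecting f (hmul x (hpull f w)) = hcup (connecting f x) w.
Proof.
have [b [bb db xE cx]] := connecting_ext x; have wc := rep_cocycle w.
have /cocycle0P[bw dw] := wc.
rewrite cx -[w]repK xE hpull_cls // /hmul hcup_cls ?pull_cocycle0 ?cocycle_pull0 //.
rewrite hcup_cls ?cobnd_cocycle_rel // -pull_cup (@connecting_cls _ (cup b (rep w))) //.
- by rewrite cobnd_cup_cocycle.
- by rewrite pull_cup; apply: cocycle_cup; [exact: pull_cocycle0|exact: cocycle_pull0].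
- exact: bounded_cup.
- by rewrite -pull_cobnd dw.
Qed.
End PairSequence.

(** * Points, arcs, and degree one classes of the circle *)

Section Points.
Context {R : realType} {X : topologicalType}.
Local Notation C X := (singular R X -> int).

Lemma pt_cts (x : X) : continuous (fun _ : simplex R 0 => x).
Proof. exact: cst_continuous. Qed.
Definition pt (x : X) : singular R X := existT _ 0%N (mkcts (@pt_cts x) : continuousType (simplex R 0) X).

Lemma simplex0 (y : simplex R 0) : y = vtx 0.
Proof.
apply: simplex_eq => j; rewrite ord1 mxE eqxx; have := simplex_sum1 y.
by rewrite big_ord1.
Qed.

Lemma ptE (s : singular R X) : sdim s = 0%N -> s = pt (projT2 s (vtx 0)).
Proof.
case: s => n s; rewrite /sdim /= => n0; case: _ / (esym n0) s => s.
by apply: singular_eq => x; rewrite /= (simplex0 x).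
Qed.

Lemma supp0E (c : C X) : supp 0 0 c -> c = pointwise (fun x => c (pt x)).
Proof.
move=> sc; apply/funext => s; rewrite /pointwise; case: eqP => s0; last by apply: sc; rewrite addn0.
by rewrite {1}(ptE s0).
Qed.

Lemma cup_pointwise_cst (a : C X) (k : int) : cup a (pointwise (fun=> k)) = (fun s => a s * k).
Proof.
apply/funext => s; rewrite -[in RHS](cup1r a) /cup mulr_suml; apply: eq_bigr => i _.
rewrite -mulrA; congr (_ * _); rewrite /pointwise /cochain1.
by case: eqP; rewrite ?mul1r ?mul0r.
Qed.

End Points.

Section LinePaths.
Context {R : realType} {X : topologicalType}.
Local Notation C X := (singular R X -> int).

Definition arc_fun (f : continuousType R X) (a b : R) (x : simplex R 1) : X := f (a + b * val x 0 1).
Lemma arc_cts f a b : continuous (arc_fun f a b).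
Proof.
move=> x; apply: (@continuous_comp _ _ _ (fun x : simplex R 1 => a + b * val x 0 1) f); last exact: cts_fun.
apply: (@cvgD _ _ _ (nbhs x)); first exact: cvg_cst.
by apply: (@cvgM _ _ (nbhs x)); [exact: cvg_cst|exact: simplex_coord_cts].
Qed.
Definition arc f a b : singular R X := existT _ 1%N (mkcts (@arc_cts f a b) : continuousType (simplex R 1) X).

Lemma cobnd_arc (c : C X) f a b : cobnd c (arc f a b) = c (pt (f (a + b))) - c (pt (f a)).
Proof.
rewrite /cobnd /= !big_ord_recl big_ord0 expr0 mul1r addr0 expr1 mulN1r.
have face i (j : 'I_2) : inord (bump i 0) = j :> 'I_2 ->
    vert (arc f a b) (bump i) 0 = pt (f (a + b * (j == 1)%:R)).
  move=> ij; rewrite [LHS]ptE //; congr pt; rewrite -[LHS]/(arc_fun f a b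
    (face_map (fun j : 'I_1 => inord (bump i j) : 'I_2) (vtx 0))) face_comb comb_vtx /arc_fun.
  by rewrite mxE inordK // ij [1 == j]eq_sym.
rewrite (face 0%N 1) ?(face 1%N 0) ?mulr1 ?mulr0 ?addr0 //; apply: val_inj; rewrite /= inordK //.
Qed.
End LinePaths.

Section CircleDegree.
Context {R : realType}.
Local Notation C X := (singular R X -> int).
Local Notation turn := (2 * pi : R).

(** All three faces of a constant 2-simplex are the constant 1-simplex, and their signs add up to
    1. *)
Lemma const_cocycle (X : topologicalType) (c : C X) (f : continuousType (simplex R 1) X) (y : X) :
  cobnd c = 0 -> (forall x, f x = y) -> c (existT _ 1%N f) = 0.
Proof.
move=> dc fy; have yc : continuous (fun _ : simplex R 2 => y) by exact: cst_continuous.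
pose s2 : singular R X := existT _ 2%N (mkcts yc : continuousType (simplex R 2) X).
have v i : vert s2 (bump i) 1 = existT _ 1%N f by apply: singular_eq => x; rewrite fy.
have := congr1 (fun c => c s2) dc; rewrite /cobnd /= !big_ord_recl big_ord0 /= !v.
rewrite expr0 expr1 /bump /= !add1n sqrrN expr1n; lia.
Qed.

Definition cp : continuousType R (circle R) := mkcts (@circle_pt_cts R).
Definition idR : continuousType R R := mkcts (fun x : R => @cvg_id _ (nbhs x)).

Lemma circle_loopE : circle_loop R = arc cp 0 turn.
Proof. by apply: singular_eq => x; rewrite /= /mkcts /arc_fun /cp /mkcts /loop add0r. Qed.

Lemma push_arc (X Y : topologicalType) (f : continuousType R X) (g : continuousType X Y)
  (h : continuousType R Y) a b : (forall t, g (f t) = h t) -> push g (arc f a b) = arc h a b.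
Proof. by move=> gf; apply: singular_eq => x; rewrite -[LHS]/(g (f _)) gf. Qed.

Lemma line_contr_cts : continuous (fun x : R * simplex R 1 => height x.2 * x.1).
Proof.
move=> x; apply: (@cvgM R _ (nbhs x)).
  by apply: (@continuous_comp _ _ _ snd (@height R)); [exact: snd_cts|exact: height_cts].
exact: fst_cts.
Qed.

Lemma zero_line_cts : continuous (fun _ : R => 0 : R). Proof. exact: cst_continuous. Qed.

Lemma line_primitive (x : C R) : supp 0 1 x -> cobnd x = 0 -> exists2 f, supp 0 0 f & cobnd f = x.
Proof.
move=> sx dx; pose H : continuousType (R * simplex R 1)%type R := mkcts line_contr_cts.
exists (hop H x); first by apply: suppSV; apply: supp_hop.
pose pr : continuousType R R := mkcts zero_line_cts.
have H1 y : H (y, vtx 1) = y by rewrite -[LHS]/(height (vtx 1) * y) height1 mul1r.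
have H0 y : H (y, vtx 0) = idR (pr y) by rewrite -[LHS]/(height (vtx 0) * y) height0 mul0r.
rewrite [RHS](contract_cocycle H1 H0 dx).
(* The part pulled back from the point 0 is a value on a constant simplex, hence 0. *)
rewrite [X in _ = X + _](_ : _ = 0) ?add0r //; apply/funext => -[n s]; rewrite !pullE.
have [n1|/eqP n1] := eqVneq n 1%N; last by apply: sx; rewrite addn0.
by case: _ / (esym n1) s => s; apply: (const_cocycle (y := 0)).
Qed.

(** [f] is a primitive of [a] along the line; over each turn it grows by the period of [a]. *)
Lemma circle_primitive (a : C (circle R)) : supp 0 1 a -> cobnd a = 0 -> exists f : C R,
  [/\ supp 0 0 f, pull cp a = cobnd f &
      forall t k, f (pt (t + turn * k%:~R)) = f (pt t) + a (circle_loop R) * k].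
Proof.
move=> sa da; have [||f sf df] := @line_primitive (pull cp a); first exact: supp_pull.
  by rewrite -pull_cobnd da raddf0.
exists f; split=> //.
have fa t b : f (pt (t + b)) - f (pt t) = a (arc cp t b).
  by rewrite -(cobnd_arc f idR t b) df pullE (push_arc (h := cp)).
have shift_arc t b : arc cp (t + turn) b = arc cp t b.
  apply: singular_eq => x; rewrite -[LHS]/(circle_pt (t + turn + b * val x 0 1)) addrAC.
  by have := circle_pt_turn (t + b * val x 0 1) 1; rewrite mulr1.
have f1 t : f (pt (t + turn)) = f (pt t) + a (circle_loop R).
  have := fa 0 turn; have := fa turn t; have := fa 0 t.
  have -> : arc cp turn t = arc cp 0 t by rewrite -(shift_arc 0) add0r.
  rewrite !add0r -circle_loopE [t + turn]addrC; move: (f _) (f _) (f _) (f _) (a _) (a _) => ??????; 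
  by move=> <- /eqP; rewrite subr_eq => /eqP -> <-; ring.
have fn (n : nat) t : f (pt (t + turn * n%:R)) = f (pt t) + a (circle_loop R) * n%:Z.
  elim: n t => [|n IH] t; first by rewrite !mulr0 !addr0.
  have -> : t + turn * n.+1%:R = t + turn * n%:R + turn by rewrite -natr1; ring.
  by rewrite f1 IH -addn1 PoszD; ring.
move=> t [] n; first exact: fn.
have := fn n.+1 (t + turn * (Negz n)%:~R); rewrite NegzE mulrNz mulrN subrK.
by move=> ->; ring.
Qed.

(** When the period is 0, the primitive on the line takes one value on all arguments of a point, so
    any choice of arguments defines it on the circle. *)
Lemma circle_coboundary (a : C (circle R)) : supp 0 1 a -> cobnd a = 0 -> a (circle_loop R) = 0 ->
  exists2 b, supp 0 0 b & cobnd b = a.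
Proof.
move=> sa da a0; have [f [sf df fk]] := circle_primitive sa da.
have [t tE] := choice (@circle_pt_surj R).
exists (pointwise (fun z => f (pt (t z)))); first exact: supp_pointwise.
apply: (pull_inj (R := R) (p := cp) (@circle_covering R)); rewrite pull_cobnd df; congr cobnd.
apply/funext => s; rewrite pullE /pointwise /=; case: eqP => s0; last by rewrite sf ?addn0.
rewrite [in RHS](ptE s0); move: (projT2 s (vtx 0)) => x.
by have [k xE] := circle_ptP (tE (cp x)); rewrite [in RHS]xE fk a0 mul0r addr0.
Qed.

Lemma loop_power (a : C (circle R)) (n : nat) : supp 0 1 a -> cobnd a = 0 ->
  a (arc cp 0 (turn * n%:R)) = a (circle_loop R) * n%:Z.
Proof.
move=> sa da; have [f [sf df fk]] := circle_primitive sa da.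
have -> : arc cp 0 (turn * n%:R) = push cp (arc idR 0 (turn * n%:R)) by rewrite (push_arc (h := cp)).
by rewrite -pullE df cobnd_arc -[idR _]/(0 + turn * (n%:Z)%:~R) fk addrC addKr.
Qed.

Lemma orientation_eq (a : C (circle R)) : supp 0 1 a -> cobnd a = 0 -> a (circle_loop R) = 1 ->
  orientation_class R = cls set0 a.
Proof.
move=> sa da a1; have ac : a \in cocycle set0 by apply/cocycle0P; split=> //; exact: supp_bounded sa.
rewrite /orientation_class; set E := [set e | _].
have [c [/cocycle0P[bc dc] sc c1 <-]] : E (xget 0 E).
  apply: (xgetPex 0); exists (cls set0 a), a; split=> // s s1; apply: sa.
  by rewrite addn0; apply/eqP.
have sc' : supp 0 1 c by move=> s; rewrite addn0 => /eqP; exact: sc.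
have [|||b sb db] := @circle_coboundary (c - a); [exact: suppB| | |].
- by rewrite cobndB dc da subrr.
- by rewrite -[LHS]/(c _ - a _) c1 a1 subrr.
- apply/cls_eq => //; first exact/cocycle0P.
  by exists b => //; apply/rel0P; exact: supp_bounded sb.
Qed.

(** [b - b2] is closed, so by contraction it is a coboundary plus a cochain pulled back from the
    centre. The first vanishes on the loop because the loop is closed, the second because the loop
    becomes constant. *)
Lemma disc_degree (b b2 : C (disc R)) : cobnd b = cobnd b2 ->
  pull (circle_disc R : continuousType _ _) b2 = 0 ->
  b (push (circle_disc R : continuousType _ _) (circle_loop R)) = 0.
Proof.
move=> db ib2; pose y := b - b2; have dy : cobnd y = 0 by rewrite cobndB db subrr.
set l := push _ _; have b2l : b2 l = 0 by rewrite -pullE ib2.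
suff : y l = 0 by rewrite -[y l]/(b l - b2 l) b2l subr0.
have zc : continuous (fun _ : disc R => disc0 R) by exact: cst_continuous.
have ic : continuous (fun z : disc R => z) by move=> z; exact: cvg_id.
pose H : continuousType (disc R * simplex R 1)%type (disc R) := mkcts (@scale_disc_cts R).
have H1 z : H (z, vtx 1) = z.
  by apply: val_inj; rewrite [LHS](_ : _ = (height (vtx 1))%:C%C * val z) // height1 mul1r.
pose pr : continuousType (disc R) (disc R) := mkcts zc.
pose iz : continuousType (disc R) (disc R) := mkcts ic.
have H0 z : H (z, vtx 0) = iz (pr z).
  by apply: val_inj; rewrite [LHS](_ : _ = (height (vtx 0))%:C%C * val z) // height0 mul0r.
rewrite (contract_cocycle H1 H0 dy) -[LHS]/(_ l + cobnd _ l).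
have -> : l = arc (circle_disc R \o cp : continuousType _ _) 0 turn.
  by rewrite /l circle_loopE; exact: push_arc.
rewrite cobnd_arc; set p1 := pt _; set p0 := pt _; have -> : p1 = p0.
  congr pt; congr (circle_disc R _); apply: val_inj.
  by have /(congr1 val) := circle_pt_turn (0 : R) 1; rewrite mulr1.
by rewrite subrr addr0 !pullE; apply: (const_cocycle (y := disc0 R)).
Qed.
End CircleDegree.

(** * The Thom class and the Euler class *)

Section RingMaps.
Context {R : realType}.
Local Notation C X := (singular R X -> int).

Lemma hcupBr {X : topologicalType} (A : set X) (x : rcoh R X A) : zmod_morphism (hcup x).
Proof.
move=> y z; rewrite -[x]repK -[y]repK -[z]repK -clsB ?rep_cocycle //.
by rewrite !hcup_cls ?rpredB ?rep_cocycle // cupBr clsB ?cocycle_cup ?rep_cocycle.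
Qed.

Lemma hcupA {X : topologicalType} (A : set X) (x : rcoh R X A) (y z : hcoh R X) :
  hcup (hcup x y) z = hcup x (y * z).
Proof.
rewrite -[x]repK -[y]repK -[z]repK -[_ * _]/(hmul _ _) /hmul.
by rewrite !hcup_cls ?cocycle_cup ?rep_cocycle // cupA.
Qed.

Lemma natr_cls {X : topologicalType} (n : nat) :
  n%:R = cls set0 (pointwise (fun=> n%:Z)) :> hcoh R X.
Proof.
have -> : pointwise (fun=> n%:Z) = (fun s => @cochain1 R X s * n).
  by apply/funext => s; rewrite /pointwise /cochain1; case: eqP; rewrite ?mul1r ?mul0r.
by rewrite clsMz ?cochain1_cocycle.
Qed.

Context {X Y : topologicalType} (f : continuousType X Y).

Lemma hpullB : zmod_morphism (hpull f : hcoh R Y -> hcoh R X).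
Proof.
move=> x y; rewrite -[x]repK -[y]repK -clsB ?rep_cocycle //.
by rewrite !hpull_cls ?rpredB ?rep_cocycle // pullB clsB ?cocycle_pull0 ?rep_cocycle.
Qed.
HB.instance Definition _ := GRing.isZmodMorphism.Build (hcoh R Y) (hcoh R X) (hpull f) hpullB.

Lemma hpullM : monoid_morphism (hpull f : hcoh R Y -> hcoh R X).
Proof.
split; first by rewrite -[1]/(cls set0 (@cochain1 R Y)) hpull_cls ?cochain1_cocycle.
move=> x y; rewrite -[x]repK -[y]repK -[_ * _]/(hmul _ _) -[_ * _ in RHS]/(hmul _ _) /hmul.
rewrite hcup_cls ?rep_cocycle // !hpull_cls ?cocycle_cup ?rep_cocycle // pull_cup.
by rewrite hcup_cls ?cocycle_pull0 ?rep_cocycle.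
Qed.
HB.instance Definition _ := GRing.isMonoidMorphism.Build (hcoh R Y) (hcoh R X) (hpull f) hpullM.
End RingMaps.

Lemma zmod_morphMz (V W : zmodType) (f : V -> W) : zmod_morphism f ->
  forall x n, f (x *~ n) = f x *~ n.
Proof.
move=> fB x n; pose F : {additive V -> W} := HB.pack f (GRing.isZmodMorphism.Build V W f fB).
exact: (raddfMz F).
Qed.

Lemma circle_class_degree {R : realType} (a b : singular R (circle R) -> int) (n : int) :
  supp 0 1 a -> supp 0 1 b -> cobnd a = 0 -> cobnd b = 0 ->
  b (circle_loop R) = a (circle_loop R) * n -> cls set0 b = cls set0 a *~ n.
Proof.
move=> sa sb da db ba.
have ac : a \in cocycle set0 by apply/cocycle0P; split=> //; exact: supp_bounded sa.
have bc : b \in cocycle set0 by apply/cocycle0P; split=> //; exact: supp_bounded sb.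
have san : supp 0 1 (fun s => a s * n) by move=> s s1; rewrite sa ?mul0r.
have dan : cobnd (fun s => a s * n) = 0.
  by rewrite -(cup_pointwise_cst a) cobnd_cup_cocycle ?da ?cup0l ?cobnd_pointwise_cst.
have anc : (fun s => a s * n) \in cocycle set0.
  by apply/cocycle0P; split=> //; exact: supp_bounded san.
have [|||d sd dE] := @circle_coboundary R (b - (fun s => a s * n)).
- exact: suppB.
- by rewrite cobndB db dan subrr.
- by rewrite -[LHS]/(b _ - a _ * n) ba subrr.
rewrite -clsMz //; apply/cls_eq => //; exists d => //; apply/rel0P; exact: supp_bounded sd.
Qed.

Lemma hpull_comp {R : realType} (X Y Z : topologicalType) (f : continuousType X Y) (g : continuousType Y Z)
  (h : continuousType X Z) (x : hcoh R Z) : (forall x, g (f x) = h x) -> hpull f (hpull g x) = hpull h x.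
Proof.
move=> fg; rewrite -[x]repK !hpull_cls ?cocycle_pull0 ?rep_cocycle //.
by rewrite (pull_comp (h := h)).
Qed.

Lemma expg_order_inj (G : groupType) (q : nat) (c : G) :
  (forall k : nat, (0 < k < q)%N -> (c ^+ k)%g <> 1%g) ->
  forall k l, (k < q)%N -> (l < q)%N -> (c ^+ k)%g = (c ^+ l)%g -> k = l.
Proof.
move=> c_min; have le_inj k l : (k <= l)%N -> (l < q)%N -> (c ^+ k)%g = (c ^+ l)%g -> k = l.
  move=> kl lq ckl; apply/eqP; rewrite eqn_leq kl leqNgt; apply/negP => lk.
  apply: (c_min (l - k)%N); first by rewrite subn_gt0 lk (leq_ltn_trans (leq_subr _ _) lq).
  by apply: (mulgI (c ^+ k)%g); rewrite -expgnDr subnKC // -ckl mulg1.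
move=> k l kq lq ckl; have [kl|/ltnW lk] := leqP k l; first exact: le_inj.
by apply/esym/le_inj.
Qed.

(** The index is measured from a choice [r] of representatives. That [r] is arbitrary is used in
    [euler_locally_zero], where it is adapted to an open set. *)
Lemma index_exists {R : realType} {G : lieGroupType R} {q : nat} {c : G} (r : base_space c -> G) :
  (0 < q)%N -> (c ^+ q)%g = 1%g -> (forall k : nat, (0 < k < q)%N -> (c ^+ k)%g <> 1%g) ->
  (forall b, Pbase (r b) = b) ->
  exists idx : G -> nat, [/\ forall g, (idx g < q)%N,
    forall g, idx (g * c)%g = ((idx g).+1 %% q)%N &
    forall g, g = (r (Pbase g) * c ^+ idx g)%g].
Proof.
move=> q_gt0 c_order c_min rE.
have ex g : exists k, (k < q)%N /\ g = (r (Pbase g) * c ^+ k)%g.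
  have [k kq kE] := orbit_piP q_gt0 (base_gen_order c_order) (rE (Pbase g)).
  by exists k; rewrite -iter_base_gen.
have [idx idxP] := choice ex; exists idx.
split=> [g|g|g]; [by have [] := idxP g| |by have [] := idxP g].
have [ig gE] := idxP g; have [igc gcE] := idxP (g * c)%g.
have Pg : Pbase (c := c) (g * c)%g = Pbase g by exact: (orbit_pi_iter (tau := base_gen c) 1 g).
have cE : (c ^+ idx (g * c))%g = (c ^+ ((idx g).+1 %% q))%g.
  apply: (mulgI (r (Pbase g))); rewrite -{1}Pg -gcE {1}gE -mulgA -expgSr.
  rewrite {1}(divn_eq (idx g).+1 q) expgnDr mulnC expgnA c_order expg1n mul1g //.
by apply: (expg_order_inj c_min) cE; rewrite ?ltn_mod.
Qed.

(** * The Thom isomorphism and the Thom class *)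

Section ThomClass.
Context {R : realType} {G : lieGroupType R} {q : nat} {c : G} {idx : G -> nat}.
Hypotheses (q_gt0 : (0 < q)%N) (c_order : (c ^+ q)%g = 1%g)
  (c_order_min : forall k : nat, (0 < k < q)%N -> (c ^+ k)%g <> 1%g)
  (idx_lt : forall g, (idx g < q)%N) (idx_c : forall g, idx (g * c)%g = ((idx g).+1 %% q)%N).
Local Notation C X := (singular R X -> int).
Local Notation turn := (2 * pi : R).
Local Notation Tdisc := (@Tdisc R G q c).
Local Notation Pbase := (@Pbase R G c).
Local Notation Pdisc := (@Pdisc R G q c).
Local Notation Ptotal := (@Ptotal R G q c).
Local Notation Bundle := (disc_bundle q c).
Local Notation Bdry := (boundary_incl q c).
Local Notation A := (range Bdry).
Local Notation incl := (@incl R G).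
Local Notation u := (ucocycle (R := R) q_gt0 idx_lt idx_c).
Local Notation cdisc := (circle_disc R : continuousType (circle R) (disc R)).

Definition thom_cochain : C (disc_space q c) :=
  projT1 (cid (disc_descend q_gt0 c_order c_order_min (u_gen q_gt0 idx_lt idx_c))).
Local Notation U := thom_cochain.

Lemma pull_Pdisc_thom : pull Pdisc U = u.
Proof. exact: projT2 (cid (disc_descend q_gt0 c_order c_order_min (u_gen q_gt0 idx_lt idx_c))). Qed.

Let disc_lift (s : singular R (disc_space q c)) : exists s', push Pdisc s' = s.
Proof. exact: (push_lift (disc_covering q_gt0 c_order c_order_min) s erefl). Qed.

Lemma supp_thom : supp 0 2 U.
Proof. by apply: (supp_pull_inj disc_lift); rewrite pull_Pdisc_thom; exact: supp_u. Qed.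

Lemma cobnd_thom : cobnd U = 0.
Proof.
apply: (pull_inj (R := R) (disc_covering q_gt0 c_order c_order_min)).
by rewrite pull_cobnd pull_Pdisc_thom cobnd_u raddf0.
Qed.

Lemma pull_Bdry_thom : pull Bdry U = 0.
Proof.
by apply/(pull_Pdisc_bdry q_gt0 c_order c_order_min); rewrite pull_Pdisc_thom pull_incl_u.
Qed.

Let bemb := boundary_emb (R := R) (G := G) q_gt0 c_order c_order_min.

Lemma thom_cocycle : U \in cocycle A.
Proof.
apply/asboolP; split; last exact: cobnd_thom.
by apply/(rel_embP bemb); split; [exact: supp_bounded supp_thom|exact: pull_Bdry_thom].
Qed.

Lemma thom_graded n (a : C (disc_space q c)) (m : C (base_space c)) :
  supp 0 n a -> supp 1 n m -> pull Bdry a = 0 ->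
  cobnd a + cup U (pull Bundle m) = 0 -> cobnd m = 0 ->
  exists b k, [/\ supp 1 n b, supp 2 n k, pull Bdry b = 0,
    cobnd b + cup U (pull Bundle k) = a & - cobnd k = m].
Proof.
apply: (orbit_acyclic q_gt0 c_order c_order_min idx_lt idx_c (supp_u q_gt0 idx_lt idx_c)
  (cobnd_u q_gt0 idx_lt idx_c) (u_gen q_gt0 idx_lt idx_c) (pull_incl_u q_gt0 idx_lt idx_c) _ pull_Pdisc_thom).
move=> {}n {}a {}m; apply: (thom_acyclic (phi := wcochain (q := q) idx) (al := alpha (q := q) idx)).
- by rewrite wcochain_turn pointwise1.
- exact: supp_wcochain.
- exact: alphaE.
- by apply: pull_extend; exact: incl_emb.
- exact: supp_alphabar.
Qed.

Lemma pull_compk (X Y : topologicalType) (f : continuousType X Y) k n (x : C Y) :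
  pull f (compk k n x) = compk k n (pull f x).
Proof. by []. Qed.

(** The graded statement is applied to each homogeneous component; boundedness leaves finitely many
    solutions to add up. *)
Lemma thom_total (a : C (disc_space q c)) (m : C (base_space c)) :
  bounded a -> bounded m -> pull Bdry a = 0 ->
  cobnd a + cup U (pull Bundle m) = 0 -> cobnd m = 0 ->
  exists b k, [/\ bounded b, bounded k, pull Bdry b = 0,
    cobnd b + cup U (pull Bundle k) = a & - cobnd k = m].
Proof.
move=> [N aN] [M mM] ba dam dm.
have ex n : exists bk : C (disc_space q c) * C (base_space c),
    [/\ supp 1 n bk.1, supp 2 n bk.2, pull Bdry bk.1 = 0,
    cobnd bk.1 + cup U (pull Bundle bk.2) = compk 0 n a & - cobnd bk.2 = compk 1 n m].
  have [|||||b [k P]] := @thom_graded n (compk 0 n a) (compk 1 n m); last by exists (b, k).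
  - exact: supp_compk.
  - exact: supp_compk.
  - by rewrite pull_compk ba compk0.
  - rewrite [compk 0 n a]compkS cobnd_compk pull_compk [compk 1 n _]compkS (cup_compk 0 _ _ supp_thom).
    by rewrite -compkD dam compk0.
  - by rewrite cobnd_compk dm compk0.
have [f fP] := choice ex; pose L := (N + M).+1.
exists (\sum_(n < L) (f n).1), (\sum_(n < L) (f n).2); split.
- by apply: bounded_sum => n; have [s1 _ _ _ _] := fP n; exact: supp_bounded s1.
- by apply: bounded_sum => n; have [_ s2 _ _ _] := fP n; exact: supp_bounded s2.
- by rewrite raddf_sum big1 // => n _; have [] := fP n.
- rewrite !raddf_sum cup_suml -big_split /= [RHS](sum_compk (k := 0) (M := L)).
    by apply: eq_bigr => n _; have [] := fP n.
  by move=> s Ls; apply: aN; rewrite /L in Ls; lia.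
- rewrite raddf_sum -sumrN [RHS](sum_compk (k := 1) (M := L)).
    by apply: eq_bigr => n _; have [] := fP n.
  by move=> s Ls; apply: mM; rewrite /L in Ls; lia.
Qed.

Lemma thom_iso_surj (z : rcoh R (disc_space q c) A) :
  exists y : hcoh R (base_space c), hcup (cls A U) (hpull Bundle y) = z.
Proof.
have zc := rep_cocycle z; have /asboolP[/(rel_embP bemb)[bz vz] dz] := zc.
have [||||b [k [bb bk vb bE kE]]] := @thom_total (rep z) 0 bz; [by exists 0%N|by []| | |].
- by rewrite dz raddf0 cup0r; exact: addr0.
- by rewrite raddf0.
have dk : cobnd k = 0 by apply: oppr_inj; rewrite kE oppr0.
have kc : k \in cocycle set0 by exact/cocycle0P.
exists (cls set0 k); rewrite hpull_cls // hcup_cls ?thom_cocycle ?cocycle_pull0 // -[RHS]repK.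
apply/cls_eq => //; first by rewrite cocycle_cup ?thom_cocycle ?cocycle_pull0.
exists (- b); first by apply/(rel_embP bemb); split; [exact: boundedN|rewrite raddfN /= vb oppr0].
by rewrite -bE raddfN opprD addrCA subrr addr0.
Qed.

Lemma thom_iso_inj (y : hcoh R (base_space c)) :
  hcup (cls A U) (hpull Bundle y) = 0 -> y = 0.
Proof.
have yc := rep_cocycle y; have /cocycle0P[by0 dy] := yc.
rewrite -[y]repK hpull_cls // hcup_cls ?thom_cocycle ?cocycle_pull0 //.
move/cls_eq0 => [|e /(rel_embP bemb)[be ve] de]; first by rewrite cocycle_cup ?thom_cocycle ?cocycle_pull0.
have [|||||b [k [bb bk vb bE kE]]] := @thom_total (- e) (rep y); [exact: boundedN|by []| | |by []|].
- by rewrite raddfN /= ve oppr0.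
- by rewrite raddfN /= de addNr.
apply/cls_eq0 => //; exists (- k); first exact/rel0P/boundedN.
by rewrite raddfN.
Qed.

Lemma thom_iso_eq (y y' : hcoh R (base_space c)) :
  hcup (cls A U) (hpull Bundle y) = hcup (cls A U) (hpull Bundle y') -> y = y'.
Proof.
move=> yy; apply/eqP; rewrite -subr_eq0; apply/eqP/thom_iso_inj.
by rewrite raddfB /= hcupBr yy subrr.
Qed.

Lemma cslice_cts (g : G) : continuous (fun z : circle R => (g, z)).
Proof. by apply: pair_cts; [exact: cst_continuous|move=> z; exact: cvg_id]. Qed.
Definition cslice g : continuousType (circle R) (G * circle R)%type := mkcts (@cslice_cts g).
Definition dslice (g : G) : continuousType (disc R) (G * disc R)%type := mkcts (@slice_cts R G g).

Definition angular g : C (circle R) := pull (cslice g) (alpha (q := q) idx).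

Lemma supp_angular g : supp 0 1 (angular g).
Proof. by apply: supp_pull; exact: supp_alpha. Qed.
Lemma cobnd_angular g : cobnd (angular g) = 0.
Proof. by rewrite -pull_cobnd cobnd_alpha raddf0. Qed.
(** The loop unwinds to one turn of the line, over which [wcochain] grows by 1. *)
Lemma angular_loop g : angular g (circle_loop R) = 1.
Proof.
have gc : continuous (fun t : R => (g, t)).
  by apply: pair_cts; [exact: cst_continuous|move=> z; exact: cvg_id].
pose ga : continuousType R (G * R)%type := mkcts gc.
rewrite /angular pullE circle_loopE.
have -> : push (cslice g) (arc cp 0 turn) = push wind (arc ga 0 turn) by exact: singular_eq.
rewrite -pullE alphaE cobnd_arc.
have -> : pt (ga (0 + turn)) = push (turnR 1) (pt (ga 0)) :> singular R _.
  rewrite [RHS]ptE //; congr pt; rewrite -[RHS]/(g, shift 1 0).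
  by congr pair; rewrite /shift mulr1.
rewrite -[wcochain _ (push _ _)]pullE wcochain_turn -[X in X - _]/(_ + pointwise _ (pt (ga 0))).
by rewrite addrAC subrr add0r.
Qed.

Local Notation orient := (connecting (circle_disc R) (orientation_class R)).
Local Notation S1 := (range (circle_disc R)).

Lemma angular_cocycle g : angular g \in cocycle set0.
Proof. by apply/cocycle0P; split; [exact: supp_bounded (@supp_angular g)|exact: cobnd_angular]. Qed.

Lemma pull_fibre_cls g (b : C (disc_space q c)) (a : C (circle R)) : bounded b ->
  a \in cocycle set0 -> pull cdisc (pull (fibre q c g) b) = a ->
  cls S1 (cobnd (pull (fibre q c g) b)) = connecting (circle_disc R) (cls set0 a).
Proof.
move=> bb ac ab; apply/esym/connecting_cls => //; first exact: circle_disc_emb.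
exact: bounded_pull.
Qed.

(** On a fibre, [alphabar] extends the angular cochain from the circle to the disc, so its
    coboundary computes the connecting homomorphism. *)
Lemma thom_fibre g : cls S1 (pull (fibre q c g) U) = orient /\
  pull (fibre q c g) U \in cocycle S1.
Proof.
have fE : pull (fibre q c g) U = cobnd (pull (dslice g) (alphabar q_gt0 idx_lt idx_c)).
  rewrite -pull_cobnd -[cobnd _]/u -pull_Pdisc_thom.
  by rewrite (pull_comp (h := fibre q c g : continuousType _ _)).
have iE : pull cdisc (pull (dslice g) (alphabar q_gt0 idx_lt idx_c)) = angular g.
  rewrite /angular -(pull_extend (f := incl) (@incl_emb R G) (alpha idx) (pull (@fstD R G) (mu q_gt0 idx_lt idx_c))).
  rewrite (pull_comp (h := dslice g \o cdisc : continuousType _ _)) //.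
  by rewrite (pull_comp (h := dslice g \o cdisc : continuousType _ _)).
have bb : bounded (pull (dslice g) (alphabar q_gt0 idx_lt idx_c)).
  by apply: bounded_pull; apply: supp_bounded; exact: supp_alphabar.
rewrite fE (orientation_eq (@supp_angular g) (cobnd_angular g) (angular_loop g)); split.
  by apply/esym/connecting_cls => //; [exact: circle_disc_emb|exact: angular_cocycle].
by apply: (cobnd_cocycle_rel (@circle_disc_emb R)) => //; rewrite iE cobnd_angular.
Qed.

(** If [n] times the class is a relative coboundary, [disc_degree] makes [n] times the period of the
    angular cochain vanish, and that period is 1. *)
Lemma orient_torsionfree (n : int) : orient *~ n = 0 -> n = 0.
Proof.
have [oE _] := thom_fibre 1%g; have aE := orientation_eq (@supp_angular 1%g) (cobnd_angular 1%g) (angular_loop 1%g).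
have ac := angular_cocycle 1%g; set a := angular 1%g in aE ac *.
have de := @circle_disc_emb R.
pose b := extend cdisc a 0; have ib : pull cdisc b = a by exact: pull_extend.
have bb : bounded b by apply: bounded_extend => //; have /cocycle0P[] := ac.
have -> : orient = cls S1 (cobnd b) by rewrite aE; exact: connecting_cls.
have cb : cobnd b \in cocycle S1.
  by apply: cobnd_cocycle_rel => //; rewrite ib; have /cocycle0P[] := ac.
have nE : (fun s => cobnd b s * n) = cobnd (fun s => b s * n).
  apply/funext => s; rewrite /cobnd; case: ifP => _; first by rewrite mul0r.
  by rewrite mulr_suml; apply: eq_bigr => i _; rewrite mulrA.
rewrite -clsMz //; move/cls_eq0 => [|e /(rel_embP de)[be ve] eE].
  by rewrite nE; apply: cobnd_cocycle_rel => //; first last;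
    [rewrite -pull_cobnd -nE; apply/funext => s; rewrite pullE -pullE pull_cobnd ib cobnd_angular mul0r
    |case: bb => N bN; exists N => s Ns; rewrite bN ?mul0r].
have := @disc_degree R (fun s => b s * n) e; rewrite -nE eE => /(_ erefl ve) bl.
have : angular 1%g (circle_loop R) * n = 0 by rewrite -[angular _]/a -ib.
by rewrite angular_loop mul1r.
Qed.

(** Surjectivity of the Thom isomorphism in its lowest degree, where the factor [k] is a closed
    0-cochain. *)
Lemma homogeneous_thom (z : rcoh R (disc_space q c) A) : homogeneous 2 z ->
  exists k : C (base_space c), [/\ supp 0 0 k, cobnd k = 0 & z = cls A (cup U (pull Bundle k))].
Proof.
move=> [d [dA sd <-]]; have /asboolP[/(rel_embP bemb)[bd vd] dd] := dA.
have [|||||b [k [sb sk vb bE kE]]] := @thom_graded 2 d 0.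
- by move=> s; rewrite addn0 => /eqP; exact: sd.
- by [].
- exact: vd.
- by rewrite dd raddf0 cup0r; exact: addr0.
- by rewrite raddf0.
have dk : cobnd k = 0 by apply: oppr_inj; rewrite kE oppr0.
(* [supp 2 2] and [supp 0 0] both mean concentration in dimension 0. *)
have sk0 : supp 0 0 k by move=> s s0; apply: sk; lia.
have kc : k \in cocycle set0 by apply/cocycle0P; split=> //; exact: supp_bounded sk0.
exists k; split=> //; apply/cls_eq => //; first by rewrite cocycle_cup ?thom_cocycle ?cocycle_pull0.
exists b; first by apply/(rel_embP bemb); split=> //; exact: supp_bounded sb.
by rewrite -bE addrK.
Qed.

Let fibre_bdry g x : S1 x -> A (fibre q c g x).
Proof. by move=> [z _ <-]; exists (Ptotal (g, z)) => //; exact: boundary_inclP. Qed.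

Lemma fibre_class g (k : C (base_space c)) : supp 0 0 k -> cobnd k = 0 ->
  rpull (fibre q c g) S1 (cls A (cup U (pull Bundle k))) = orient *~ k (pt (Pbase g)).
Proof.
move=> sk dk; have kc : k \in cocycle set0.
  by apply/cocycle0P; split=> //; exact: supp_bounded sk.
rewrite rpull_cls; [|exact: fibre_bdry|by rewrite cocycle_cup ?thom_cocycle ?cocycle_pull0].
rewrite pull_cup; have -> : pull (fibre q c g) (pull Bundle k) = pointwise (fun=> k (pt (Pbase g))).
  rewrite [in LHS](supp0E sk); apply/funext => s; rewrite !pullE /pointwise /=; case: ifP => // _.
  congr k; congr pt; exact: (disc_bundleP (g, _)).
by have [oE fc] := thom_fibre g; rewrite cup_pointwise_cst clsMz // oE.
Qed.

(** Absence of torsion forces the factor [k] to be the constant [n]. The case [n = 1] gives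
    uniqueness of the Thom class, the case [n = q] the value of theta on xi_1. *)
Lemma thom_determined (z : rcoh R (disc_space q c) A) (n : int) : homogeneous 2 z ->
  (forall g, rpull (fibre q c g) S1 z = orient *~ n) -> z = cls A (cup U (pointwise (fun=> n))).
Proof.
move=> /homogeneous_thom[k [sk dk ->]] kn.
have kE g : k (pt (Pbase g)) = n.
  have := kn g; rewrite fibre_class // => /eqP; rewrite -subr_eq0 -mulrzBr => /eqP.
  by move/orient_torsionfree/eqP; rewrite subr_eq0 => /eqP.
congr (cls _ (cup U _)); rewrite (supp0E sk); apply/funext => s; rewrite pullE /pointwise /=.
by case: ifP => // _; have [g <-] := Pbase_surj (Bundle (projT2 s (vtx 0))); rewrite kE.
Qed.

Lemma thom_class_eq : thom_class q c = cls A U.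
Proof.
have one : cls A U = cls A (cup U (pull Bundle (@cochain1 R _))) by rewrite pull_cochain1 cup1r.
rewrite /thom_class; set E := [set v | _].
have [h2 hf] : E (xget 0 E).
  apply: (xgetPex 0); exists (cls A U); split.
    exists U; split=> //; first exact: thom_cocycle.
    by move=> s /eqP s2; apply: supp_thom; rewrite addn0.
  move=> g; rewrite one fibre_class //; last by have /asboolP[_ ->] := cochain1_cocycle R (base_space c).
  by move=> s; rewrite addn0 /cochain1 => /eqP/negPf ->.
by rewrite (thom_determined (n := 1) h2) ?pointwise1 ?cup1r // => g; rewrite hf.
Qed.

(** Centrality and nilpotency of the Euler class are both read off from this explicit
    representative. *)
Lemma euler_class_eq : exists2 w : C (base_space c), euler_class q c = cls set0 w &
  w \in cocycle set0 /\ pull Pbase w = cobnd (mu q_gt0 idx_lt idx_c).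
Proof.
have tc := cocycle_rel_abs thom_cocycle.
exists (pull (zero_section q c) U).
  by rewrite /euler_class thom_class_eq cls_rep_abs ?thom_cocycle // hpull_cls.
split; first exact: cocycle_pull0.
rewrite -zeroD_u -pull_Pdisc_thom !(pull_comp (h := Pdisc \o @zeroD R G : continuousType _ _)) //.
by move=> x; exact: zero_sectionP.
Qed.

Lemma gysin_thetaE x : hcup (thom_class q c) (hpull Bundle (gysin_theta x)) = connecting Bdry x.
Proof.
have [y yE] : exists y : hcoh R (base_space c), hcup (thom_class q c) (hpull Bundle y) = connecting Bdry x.
  by rewrite thom_class_eq; exact: thom_iso_surj.
exact: (xgetPex 0 (P := [set y | hcup (thom_class q c) (hpull Bundle y) = connecting Bdry x]) (ex_intro _ y yE)).
Qed.

(** On the circle over [g] the map [zeta] is the q-th power, so the pulled back class restricts to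
    [q] times the orientation class, and [thom_determined] applies to its image under the connecting
    homomorphism. *)
Lemma gysin_theta_power (zeta : continuousType (total_space q c) (circle R)) :
  (forall g z, val (zeta (Ptotal (g, z))) = val z ^+ q) ->
  gysin_theta (hpull zeta (orientation_class R)) = q%:R.
Proof.
move=> zq; have [a [sa da a1]] : exists a : C (circle R), [/\ supp 0 1 a, cobnd a = 0 & a (circle_loop R) = 1].
  by exists (angular 1%g); rewrite angular_loop cobnd_angular; split=> //; exact: supp_angular.
have ac : a \in cocycle set0 by apply/cocycle0P; split=> //; exact: supp_bounded sa.
have oE := orientation_eq sa da a1.
have [x xE] : exists x, x = pull zeta a by eexists.
have xc : x \in cocycle set0 by rewrite xE; exact: cocycle_pull0.
have sx : supp 0 1 x by rewrite xE; exact: supp_pull.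
have [e [ie se]] : exists e, pull Bdry e = x /\ supp 0 1 e.
  by exists (extend Bdry x 0); split; [exact: pull_extend|exact: supp_extend].
have be := supp_bounded se; have /cocycle0P[_ dx] := xc.
have cE : connecting Bdry (hpull zeta (orientation_class R)) = cls A (cobnd e).
  by rewrite oE (hpull_cls zeta ac) -xE (connecting_cls bemb xc be ie).
have ec : cobnd e \in cocycle A by apply: (cobnd_cocycle_rel bemb be); rewrite ie.
have sde : supp 0 2 (cobnd e) by apply: supp_cobnd; apply: suppS.
have zE : cls A (cobnd e) = cls A (cup U (pointwise (fun=> q%:Z))).
  apply: thom_determined.
    have [d dE] : exists d, d = cobnd e by eexists.
    rewrite -dE in sde ec *; exists d; split=> // s /eqP s2; apply: sde; rewrite addn0 //.
  move=> g; rewrite (rpull_cls (@fibre_bdry g) ec) pull_cobnd.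
  have [pw pwE] : exists pw, pw = pull (cslice g) (pull Ptotal x) by eexists.
  have pwc : pw \in cocycle set0 by rewrite pwE; exact/cocycle_pull0/cocycle_pull0.
  have fe : pull cdisc (pull (fibre q c g) e) = pw.
    apply/funext => s; rewrite pwE -ie !pullE; congr e; apply: singular_eq => z.
    exact: (esym (boundary_inclP (g, projT2 s z))).
  suff pwa : cls set0 pw = cls set0 a *~ q%:Z.
    by rewrite (pull_fibre_cls be pwc fe) pwa oE -(zmod_morphMz (connecting_zmod (@circle_disc_emb R))).
  have /cocycle0P[_ dpw] := pwc.
  have spw : supp 0 1 pw by rewrite pwE; do 2 apply: supp_pull.
  apply: (circle_class_degree sa spw da dpw); rewrite -(loop_power q sa da) pwE xE !pullE; congr a; rewrite circle_loopE; apply: singular_eq => s.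
  rewrite -[LHS]/(zeta (Ptotal (g, circle_pt (0 + turn * val s 0 1)))).
  apply: val_inj; rewrite zq -[val (circle_pt _)]/(cis _) -cisX.
  rewrite -[RHS]/(cis (0 + turn * q%:R * val s 0 1)); congr cis.
  by rewrite -[_ *+ q]mulr_natr; move: (val s 0 1) => t; ring.
apply: thom_iso_eq; rewrite -thom_class_eq gysin_thetaE cE zE thom_class_eq natr_cls.
have [p pE] : exists p : C (base_space c), p = pointwise (fun=> q%:Z) by eexists.
have pc : p \in cocycle set0.
  apply/cocycle0P; rewrite pE; split; last exact: cobnd_pointwise_cst.
  exact: (supp_bounded (k := 0) (n := 0) (supp_pointwise _)).
have pp : pull Bundle p = pointwise (fun=> q%:Z) by rewrite pE.
by rewrite -pE (hpull_cls Bundle pc) (hcup_cls thom_cocycle (cocycle_pull0 Bundle pc)) pp.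
Qed.
End ThomClass.

Lemma zmod_cancel_commute (V : zmodType) (a b x d e : V) :
  a + b - (x + d) - (e + (b - d)) = a - x - e.
Proof.
by rewrite (opprD x) (addrACA a) (opprD e) [LHS]addrACA subrr addr0.
Qed.

(** * Centrality of the Euler class *)

Section Commutation.
Context {R : realType} {G : lieGroupType R} {q : nat} {c : G} {idx : G -> nat}.
Hypotheses (q_gt0 : (0 < q)%N) (c_order : (c ^+ q)%g = 1%g)
  (c_order_min : forall k : nat, (0 < k < q)%N -> (c ^+ k)%g <> 1%g)
  (idx_lt : forall g, (idx g < q)%N) (idx_c : forall g, idx (g * c)%g = ((idx g).+1 %% q)%N).
Local Notation C X := (singular R X -> int).
Local Notation T := (@Tbase R G c).
Local Notation Pbase := (@Pbase R G c).
Local Notation mu := (mu (R := R) q_gt0 idx_lt idx_c).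
Local Notation j := (@jump R G q idx).

Lemma base_lift (s : singular R (base_space c)) : exists s', push Pbase s' = s.
Proof. exact: (push_lift (base_covering q_gt0 c_order c_order_min) s erefl). Qed.

Lemma pull_sign_twist (X Y : topologicalType) (f : continuousType X Y) (a : C Y) :
  pull f (sign_twist a) = sign_twist (pull f a).
Proof. by []. Qed.

Lemma cobnd_twist_cup (X : topologicalType) (a b : C X) : cobnd a = 0 ->
  cobnd (cup a b) = cup (sign_twist a) (cobnd b).
Proof. by move=> da; rewrite cobnd_cup da cup0l add0r. Qed.

(** [Y] is invariant, so the norm passes to the factor [jump], whose norm is the unit. *)
Lemma norm_jump_cup (Y : C G) : pull T Y = Y ->
  tnorm (push T) q (cup Y j - cup j Y) = 0.
Proof.
move=> TY; have itE i : iter i (tpull (push T)) (cup Y j - cup j Y) =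
    cup Y (iter i (tpull (push T)) j) - cup (iter i (tpull (push T)) j) Y.
  elim: i => // i IH; rewrite iterS IH iterS -/(pull T _) -/(pull T _).
  by rewrite -[LHS]/(pull T _) pullB !pull_cup TY.
rewrite /tnorm; under eq_bigr => i _ do rewrite itE.
have cDl : {morph (fun a => cup a Y) : a b / a + b} by move=> a b; rewrite /= cupDl.
have c0l : (fun a => cup a Y) 0 = 0 by rewrite /= cup0l.
rewrite sumrB -cup_suml -(big_morph (fun a => cup a Y) cDl c0l).
by rewrite -/(tnorm (push T) q j) (jump_norm q_gt0 idx_c) cup1l cup1r subrr.
Qed.

Lemma euler_commute (w z : C (base_space c)) : pull Pbase w = cobnd mu ->
  w \in cocycle set0 -> z \in cocycle set0 -> cls set0 (cup w z) = cls set0 (cup z w).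
Proof.
move=> wE wc zc; apply/cls_eq; [exact: cocycle_cup|exact: cocycle_cup|].
have [Y YE] : exists Y, Y = pull Pbase z by eexists.
have /cocycle0P[[N zN] dz] := zc.
have TY : pull T Y = Y by rewrite YE pull_Tbase_Pbase.
have dY : cobnd Y = 0 by rewrite YE -pull_cobnd dz raddf0.
have dY' := cobnd_sign_twist dY.
have YN (s : singular R G) : (N <= sdim s)%N -> Y s = 0 by move=> Ns; rewrite YE; exact: zN.
have [Tmu smu _] := muP (R := R) q_gt0 idx_lt idx_c.
have TmuE : pull T mu = mu + cobnd j by rewrite -Tmu addrC subrK.
pose sidx (s : singular R G) := idx (projT2 s (vtx 0)).
have gidx_lt s : (sidx s < q)%N by exact: idx_lt.
have gidx_c s : sidx (push T s) = ((sidx s).+1 %% q)%N by exact: idx_c.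
have nN := norm_jump_cup TY.
have [b [bE b0]] := tnorm_ker gidx_lt gidx_c nN.
have bb : bounded b.
  have bY : bounded Y by exists N.
  have bj : bounded j by apply: supp_bounded; exact: supp_jump.
  have [M hM] : bounded (cup Y j - cup j Y) by apply: boundedB; exact: bounded_cup.
  exists M => s Ms; apply: b0 => i; apply: hM.
  by rewrite (_ : sdim (iter i _ s) = sdim s) //; elim: i => //= i.
(* Without [cobnd b] this is the evident primitive of the commutator on [G]. Its defect under [T] is
   the coboundary of [cup j Y - cup Y j], which equals [pull T b - b]. *)
have [e eE] : exists e, e = cup mu Y - cup (sign_twist Y) mu - cobnd b by eexists.
have Te : pull T e = e.
  have TbE : pull T b = b + (cup j Y - cup Y j).
    by rewrite -opprB bE opprB addrC subrK.
  have dTb : cobnd (pull T b) = cobnd b + (cup (cobnd j) Y - cup (sign_twist Y) (cobnd j)).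
    rewrite TbE; transitivity (cobnd b + cobnd (cup j Y - cup Y j)); first exact: raddfD.
    by rewrite cobndB (cobnd_cup_cocycle j dY) (cobnd_twist_cup j dY).
  rewrite eE !pullB !pull_cup pull_sign_twist TY TmuE cupDl cupDr pull_cobnd dTb.
  exact: zmod_cancel_commute.
have be : bounded e.
  have bY : bounded Y by exists N.
  rewrite eE; apply: boundedB; last exact: bounded_cobnd.
  by apply: boundedB; apply: bounded_cup => //; [exact: supp_bounded smu|exact: bounded_sign_twist|exact: supp_bounded smu].
have [d dE] := base_descend q_gt0 c_order c_order_min Te.
exists d.
  apply/rel0P; case: be => M eM; exists M => s Ms; have [s' s'E] := base_lift s.
  by rewrite -s'E -pullE dE eM // -[sdim s']/(sdim (push Pbase s')) s'E.
apply: (pull_inj (R := R) (base_covering q_gt0 c_order c_order_min)).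
rewrite pull_cobnd dE pullB !pull_cup wE -YE eE !cobndB cobnd_cobnd subr0.
by rewrite (cobnd_cup_cocycle mu dY) (cobnd_twist_cup mu dY') sign_twistK.
Qed.
End Commutation.

Lemma locally_constant (X : topologicalType) (S : eqType) (f : X -> S) : connected [set: X] ->
  (forall x, \forall y \near x, f y = f x) -> forall x y, f x = f y.
Proof.
move=> Xc fl x y.
have op (P : set S) : open (f @^-1` P).
  rewrite openE => z Pz; rewrite /interior; near=> z'.
  by rewrite /preimage /= (near (fl z) z').
have : f @^-1` [set f x] = setT.
  apply: Xc; first by exists x.
    by exists (f @^-1` [set f x]) => //; rewrite setTI.
  exists (f @^-1` [set f x]); last by rewrite setTI.
  by rewrite -[X in closed X]setCK preimage_setC; apply: open_closedC.
by move=> fE; have : (f @^-1` [set f x]) y by rewrite fE.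
Unshelve. all: by end_near. Qed.

(** * Nilpotency of the Euler class *)

Section Nilpotency.
Context {R : realType} {G : lieGroupType R} {q : nat} {c : G}.
Hypotheses (q_gt0 : (0 < q)%N) (c_order : (c ^+ q)%g = 1%g)
  (c_order_min : forall k : nat, (0 < k < q)%N -> (c ^+ k)%g <> 1%g).
Local Notation C X := (singular R X -> int).
Local Notation T := (@Tbase R G c).
Local Notation Pbase := (@Pbase R G c).

Lemma cobnd_pointwise_eq (X : topologicalType) (f : X -> int) (s : singular R X) :
  (forall x y, f (projT2 s x) = f (projT2 s y)) -> cobnd (pointwise f) s = 0.
Proof.
move=> fs; transitivity (cobnd (pointwise (fun=> f (projT2 s (vtx 0)))) s); last by rewrite cobnd_pointwise_cst.
rewrite /cobnd; case: ifP => // _; apply: eq_bigr => i _; congr (_ * _).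
by rewrite /pointwise /=; case: ifP => // _; exact: fs.
Qed.

(** Over the image of [W] the representatives lie in the one sheet [W], so near [g] the index is
    that of the translate of [W] containing [g]. *)
Lemma index_locally_constant (W : set G) (r : base_space c -> G) (idx : G -> nat) : open W ->
  (forall k y, (0 < k < q)%N -> W y -> ~ W (iter k (base_gen c) y)) ->
  (forall g, W g -> W (r (Pbase g))) -> (forall b, Pbase (r b) = b) ->
  (forall g, (idx g < q)%N) -> (forall g, g = (r (Pbase g) * c ^+ idx g)%g) ->
  forall g, (exists2 w, W w & Pbase w = Pbase g) -> exists2 V, nbhs g V &
    forall g', V g' -> (exists2 w, W w & Pbase w = Pbase g') -> idx g' = idx g.
Proof.
move=> Wo Wfree rW rE idx_lt idxE g [w Ww wg].
pose back := base_gen (c ^- idx g)%g.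
have bc : continuous back by exact: (@base_gen_cts R G (c ^- idx g)%g).
have Pback g' : Pbase (back g') = Pbase g'.
  rewrite -[Pbase (back g')](orbit_pi_iter (tau := base_gen c) (idx g)) iter_base_gen.
  by rewrite /back /base_gen mulgVK.
exists (back @^-1` W).
  apply: open_nbhs_nbhs; split; first by apply: open_comp.
  rewrite /preimage /= /back /base_gen {1}(idxE g) mulgK -wg; exact: rW.
move=> g' Wg' _; have eqr : back g' = r (Pbase g').
  apply: (orbit_evenly_inj (tau := base_gen c) q_gt0 (base_gen_order c_order) Wfree) => //.
    by rewrite -Pback; exact: rW.
  by rewrite -[LHS]/(Pbase _) -[RHS]/(Pbase _) rE Pback.
apply: (expg_order_inj c_order_min) => //; apply: (mulgI (r (Pbase g'))).
by rewrite -idxE -eqr /back /base_gen mulgVK.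
Qed.

Lemma euler_locally_zero (g0 : G) : exists O : set (base_space c), exists w : C (base_space c),
  [/\ open O, O (Pbase g0), w \in cocycle set0, euler_class q c = cls set0 w &
      forall s : singular R _, range (projT2 s) `<=` O -> w s = 0].
Proof.
have [W [Wo Wg0] Wfree] := orbit_evenly (tau := base_gen c) (base_gen_cts (R := R)) (base_gen_free c_order_min) (@lie_hausdorff R G) g0.
pose O := Pbase @` W.
have ex b : exists x, Pbase x = b /\ (O b -> W x).
  have [[x Wx xb]|nO] := pselect (O b); first by exists x.
  by have [x xb] := Pbase_surj b; exists x.
have [r rP] := choice ex; have rE b : Pbase (r b) = b by have [] := rP b.
have [idx [idx_lt idx_c idxE]] := index_exists q_gt0 c_order c_order_min rE.
have [w wE [wc wmu]] := euler_class_eq q_gt0 c_order c_order_min idx_lt idx_c.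
exists O, w; split=> //; first exact: (orbit_pi_open (tau := base_gen c) base_gen_cts q_gt0 (base_gen_order c_order) Wo).
  by exists g0.
have jump0 (t : singular R G) : (forall x, O (Pbase (projT2 t x))) -> cobnd (jump (q := q) idx) t = 0.
  move=> tO; apply: cobnd_pointwise_eq => x y; suff -> : idx (projT2 t x) = idx (projT2 t y) by [].
  move: x y; apply: locally_constant; first by apply: cvx_connected; exact: cvxT.
  move=> x; have [V nV VP] : exists2 V, nbhs (projT2 t x) V & forall g', V g' ->
      (exists2 w, W w & Pbase w = Pbase g') -> idx g' = idx (projT2 t x).
    apply: (index_locally_constant Wo Wfree _ rE idx_lt idxE) => [g Wg|].
      by have [_ ] := rP (Pbase g); apply; exists g.
    by have [v Wv vE] := tO x; exists v.
  have tc : continuous (projT2 t) by exact: cts_fun.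
  have pre : nbhs x (projT2 t @^-1` V) := tc x V nV.
  apply: (filterS (F := nbhs x) _ pre) => y Vy.
  by apply: VP => //; have [v Wv vE] := tO y; exists v.
have step (t : singular R G) : (forall x, O (Pbase (projT2 t x))) ->
    forall x, O (Pbase (projT2 (push T t) x)).
  move=> tO x; suff : O (Pbase (base_gen c (projT2 t x))) by [].
  have -> : Pbase (base_gen c (projT2 t x)) = Pbase (projT2 t x).
    exact: (orbit_pi_iter (tau := base_gen c) 1).
  exact: tO.
have mu0 (t : singular R G) : (forall x, O (Pbase (projT2 t x))) -> mu q_gt0 idx_lt idx_c t = 0.
  move=> tO; have [_ _ mu0] := muP (R := R) q_gt0 idx_lt idx_c; apply: mu0 => i; apply: jump0.
  by elim: i => [|i IH] //; exact: step.
move=> s sO; have [t tE] := base_lift q_gt0 c_order c_order_min s.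
rewrite -tE -pullE wmu /cobnd; case: ifP => // _; rewrite big1 // => i _.
rewrite mu0 ?mulr0 // => x; apply: sO; rewrite -tE.
by exists (face_map (fun j : 'I_((sdim t).-1).+1 => inord (bump i j) : 'I_(sdim t).+1) x).
Qed.

Lemma cup_vanish (X : topologicalType) (O : set X) (a b : C X) :
  ((forall s : singular R _, range (projT2 s) `<=` O -> a s = 0) \/ (forall s : singular R _, range (projT2 s) `<=` O -> b s = 0)) ->
  forall s : singular R _, range (projT2 s) `<=` O -> cup a b s = 0.
Proof.
have sub (s : singular R X) f m : range (projT2 s) `<=` O -> range (projT2 (vert s f m)) `<=` O.
  by move=> sO _ [x _ <-]; apply: sO; exists (face_map (fun j : 'I_m.+1 => inord (f j) : 'I_(sdim s).+1) x).
move=> ab s sO; rewrite /cup big1 // => i _.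
by case: ab => h; rewrite h ?mul0r ?mulr0 //; exact: sub.
Qed.

(** The exponent is the size of a finite cover. Each factor of the power is represented by a cocycle
    vanishing on the simplices inside one of the covering sets, so the product vanishes on all small
    simplices. *)
Lemma euler_nilpotent : compact [set: G] -> exists n, (euler_class q c : hcoh R (base_space c)) ^+ n = 0.
Proof.
move=> Gc0; pose pG : ptopologicalType := HB.pack (LieGroup.sort G) (isPointed.Build G 1%g).
have Gc : @cover_compact pG setT by rewrite -(@compact_cover pG).
have [N /choice[w P]] := choice euler_locally_zero.
have Pc : continuous Pbase by exact: cts_fun.
have [||D _ DP] := Gc G [set: G] (fun g => Pbase @^-1` (N g)).
- by move=> g _; have [Oo _ _ _ _] := P g; exact: open_comp.
- by move=> g _; exists g => //; have [] := P g.
pose l := finmap.enum_fset D.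
have pE : exists p : C (base_space c), [/\ p \in cocycle set0,
    (euler_class q c : hcoh R (base_space c)) ^+ size l = cls set0 p &
    forall g (s : singular R _), g \in l -> range (projT2 s) `<=` N g -> p s = 0].
  elim: l => [|g l [p [pc pE p0]]].
    by exists (@cochain1 R _); split=> //; exact: cochain1_cocycle.
  have [_ _ wc wE w0] := P g.
  exists (cup (w g) p); split; first exact: cocycle_cup.
    by rewrite exprS pE wE; exact: hcup_cls.
  move=> g' s; rewrite inE => /orP[/eqP ->|g'l] sO; apply: (cup_vanish _ sO).
    by left.
  by right=> t tO; apply: p0 tO.
have [p [pc pE' p0]] := pE; exists (size l); rewrite pE'; apply: small_zero_cobnd => // x.
have [g gx] := Pbase_surj x; have [g' g'D Og'] := DP g I.
have [Oo _ _ _ _] := P g'; exists (N g').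
  by apply: open_nbhs_nbhs; split=> //; rewrite -gx.
by move=> s sO; apply: (p0 g').
Qed.
End Nilpotency.

(** * The algebra of the Gysin sequence *)

Section GysinAlgebra.
Context (H K : pzRingType) (w : H) (Cs : H -> K) (theta : K -> H) (nil : nat).
Hypotheses (CsB : zmod_morphism Cs) (thetaB : zmod_morphism theta)
  (w_central : forall y, y * w = w * y) (w_nil : w ^+ nil = 0)
  (Cs_eq0 : forall y, Cs y = 0 <-> exists v, y = v * w)
  (theta_eq0 : forall x, theta x = 0 <-> exists y, Cs y = x)
  (theta_range : forall y, (exists x, theta x = y) <-> y * w = 0).
Local Notation Q := (ideal_quotient w).
Local Notation J := (subring_of w).
Local Notation g := (\pi_Q : H -> Q).

Lemma ideal_genP y : (y \in ideal_gen w) <-> exists v, y = v * w.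
Proof.
split=> [/asboolP|[v ->]]; last first.
  by apply/asboolP => I [_ Im] Iw; have [] := Im v w Iw.
move=> /(_ [set y | exists v, y = v * w]); apply; last by exists 1; rewrite mul1r.
split.
  split; first by exists 0; rewrite mul0r.
  by move=> _ _ [u ->] [v ->]; exists (u - v); rewrite mulrBl.
move=> a _ [u ->]; split; first by exists (a * u); rewrite mulrA.
by exists (u * a); rewrite -mulrA -w_central mulrA.
Qed.

Lemma quotientP y y' : g y = g y' <-> exists v, y - y' = v * w.
Proof.
rewrite -ideal_genP; split=> [/eqP|yy]; first by rewrite -Quotient.idealrBE.
by apply/eqP; rewrite -Quotient.idealrBE.
Qed.

Lemma quotient_piB : zmod_morphism g. Proof. exact: raddfB. Qed.

Lemma Cs_quotient y y' : g y = g y' <-> Cs y = Cs y'.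
Proof.
rewrite quotientP -Cs_eq0 CsB; split=> [/eqP|->]; last exact: subrr.
by rewrite subr_eq0 => /eqP.
Qed.

Definition Cs_bar (x : Q) : K := Cs (repr x).
Lemma Cs_barE y : Cs_bar (g y) = Cs y.
Proof. by apply/Cs_quotient; rewrite reprK. Qed.
Lemma Cs_barB : zmod_morphism Cs_bar.
Proof. by move=> x y; rewrite -[x]reprK -[y]reprK -quotient_piB !Cs_barE CsB. Qed.
HB.instance Definition _ := GRing.isZmodMorphism.Build Q K Cs_bar Cs_barB.

Lemma gysin_exact :
  [/\ exists Cbar : {additive Q -> K},
        [/\ forall y : H, Cbar (g y) = Cs y, injective Cbar & range Cbar = [set x | theta x = 0]],
      zmod_morphism theta,
      range theta = [set y | y * w = 0] &
      range (fun y : H => y * w) = [set y | y \in ideal_gen w]].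
Proof.
split.
- exists Cs_bar; split; first exact: Cs_barE.
    move=> x y xy; have : Cs_bar x = Cs_bar y := xy.
    by rewrite -[x]reprK -[y]reprK !Cs_barE => /Cs_quotient.
  apply/seteqP; split=> [_ [x _ <-]|x /theta_eq0[y <-]].
    by apply/theta_eq0; exists (repr x).
  by exists (g y) => //; exact: Cs_barE.
- exact: thetaB.
- apply/seteqP; split=> [_ [x _ <-]|y /theta_range[x <-]]; last by exists x.
  by apply/theta_range; exists x.
- apply/seteqP; split=> [_ [v _ <-]|y /ideal_genP[v ->]]; last by exists v.
  by apply/ideal_genP; exists v.
Qed.

Context (j : {additive Q -> H}).
Hypothesis jK : forall x, g (j x) = x.
Local Notation elt := (subring_elt w).
Let f (a : J) (x : Q) : H := subring_val a * j x.
Definition tensor_to_ring : tensor J Q -> H := tlift f.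
Local Notation h := tensor_to_ring.

Let fDl a a' b : f (a + a') b = f a b + f a' b.
Proof. by rewrite /f -mulrDl -[subring_val _]/(val _) raddfD. Qed.
Let fDr a b b' : f a (b + b') = f a b + f a b'.
Proof. by rewrite /f raddfD mulrDr. Qed.

Lemma tensor_to_ringB : zmod_morphism h. Proof. exact: tlift_zmod. Qed.
HB.instance Definition _ := GRing.isZmodMorphism.Build _ _ h tensor_to_ringB.

Lemma tensor_to_ring_tens a x : h (tens a x) = subring_val a * j x.
Proof. exact: tlift_tens. Qed.

Lemma subring_valX r : subring_val (elt ^+ r) = w ^+ r.
Proof. by rewrite -[subring_val _]/(val _) rmorphXn. Qed.

Lemma tensor_to_ringZ (a : J) t : h (a *: t) = subring_val a * h t.
Proof.
have h0 : h 0 = 0 by exact: raddf0.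
apply: (tensor_ind (P := [set t | h (a *: t) = subring_val a * h t])).
  split=> [|x y /= hx hy]; first by rewrite /= scaler0 h0 mulr0.
  by rewrite scalerBr !tensor_to_ringB hx hy mulrBr.
move=> b x; suff : h (tensor_scale a (tens b x)) = subring_val a * h (tens b x) by [].
rewrite tensor_scale_tens !tensor_to_ring_tens.
by rewrite -[subring_val (a * b)]/(val _) rmorphM /= mulrA.
Qed.

(** The elements with a constant term and a remainder divisible by [w] form a subring containing
    [w]. *)
Lemma subring_decomp (a : J) : exists (n : int) (b : J), a = n%:~R + elt * b.
Proof.
have vM (x y : J) : subring_val (x * y) = subring_val x * subring_val y by exact: (rmorphM val).
have vD (x y : J) : subring_val (x + y) = subring_val x + subring_val y by exact: (rmorphD val).
have vB (x y : J) : subring_val (x - y) = subring_val x - subring_val y by exact: (rmorphB val).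
have vZ n : subring_val (n%:~R : J) = n%:~R by exact: (rmorph_int val).
have : subring_val a \in subring_gen w by exact: valP.
move/asboolP => /(_ [set a | exists (n : int) (b : J), a = n%:~R + w * subring_val b]).
case.
- split.
  + by exists 1, 0; rewrite -[subring_val 0]/(val 0) rmorph0 mulr0 addr0.
  + move=> _ _ [n [b ->]] [m [d ->]]; exists (n - m), (b - d).
    by rewrite intrB vB mulrBr opprD addrACA.
  + move=> _ _ [n [b ->]] [m [d ->]]; exists (n * m), (b * m%:~R + n%:~R * d + b * elt * d).
    rewrite !vD !vM !vZ.
    have nw : n%:~R * (w * subring_val d) = w * (n%:~R * subring_val d) by rewrite !mulrA (commr_int w).
    by rewrite intrM mulrDl !mulrDr nw !mulrA -!addrA; congr (_ + _); exact: addrCA.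
- by exists 0, 1; rewrite add0r -[subring_val 1]/(val 1) rmorph1 mulr1.
move=> n [b aE]; exists n, b; apply: val_inj.
by rewrite -[val a]/(subring_val a) aE -vZ -[w]/(subring_val elt) -vM -vD.
Qed.

(** The constant term of the left factor is an integer and moves across the tensor sign. *)
Lemma tensor_decomp (t : tensor J Q) : exists x z, t = tens 1 x + elt *: z.
Proof.
apply: (tensor_ind (P := [set t | exists x z, t = tens 1 x + elt *: z])).
  split=> [|_ _ [x [z ->]] [y [u ->]]].
    exists 0, 0; rewrite scaler0 addr0; apply: (@addIr _ (tens 1 0)).
    by rewrite -tensDr add0r addr0.
  exists (x - y), (z - u); rewrite scalerBr opprD addrACA; congr (_ + _).
  by apply: (@addIr _ (tens 1 y)); rewrite -tensDr !subrK.
move=> a x; have [n [b ->]] := subring_decomp a; exists (x *~ n), (tens b x).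
rewrite -[elt *: _]/(tensor_scale elt _) tensor_scale_tens tensDl; congr (_ + _).
have l_zmod : zmod_morphism (fun a : J => tens a x).
  by move=> a' b'; apply: (@addIr _ (tens b' x)); rewrite -tensDl !subrK.
have r_zmod : zmod_morphism (fun x : Q => tens (1 : J) x).
  by move=> a' b'; apply: (@addIr _ (tens 1 b')); rewrite -tensDr !subrK.
by rewrite (zmod_morphMz l_zmod) (zmod_morphMz r_zmod).
Qed.

Definition gysin_relations : set (tensor J Q) :=
  [set elt *: z | z in [set z | range theta (h z)]].
Local Notation N := gysin_relations.
Local Notation M := (submod_quotient N).

(** For [t = tens 1 x + elt *: z] in the kernel, [j x] is a multiple of [w], so [x = g (j x)] is 0.
    Then [w] annihilates [h z], exactness puts [h z] into the range of [theta], and [t] is itself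
    one of the generators. *)
Lemma tensor_to_ring_eq0 t : h t = 0 <-> t \in submod_gen N.
Proof.
split=> [ht|/asboolP /(_ [set t | h t = 0])]; last first.
  apply.
    split; first by split=> [|x y hx hy] /=; [exact: raddf0|rewrite raddfB /= hx hy subrr].
    by move=> a x hx; rewrite /= tensor_to_ringZ hx mulr0.
  move=> _ [z [x _ xz] <-]; rewrite /= tensor_to_ringZ -w_central.
  by apply/theta_range; exists x.
have [x [z tE]] := tensor_decomp t; rewrite tE in ht *.
rewrite raddfD /= tensor_to_ring_tens tensor_to_ringZ /= mul1r in ht.
have x0 : x = 0.
  rewrite -[x]jK -(raddf0 g); apply/quotientP; exists (- h z).
  by rewrite subr0 mulNr w_central -(addr0_eq ht) opprK.
rewrite x0 raddf0 add0r in ht.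
have -> : tens 1 x = 0 :> tensor J Q.
  by apply: (@addIr _ (tens 1 x)); rewrite {2}x0 -tensDr add0r addr0.
rewrite add0r; apply/asboolP => S hS NS; apply: NS; exists z => //.
have [k kE] : exists k, theta k = h z by apply/theta_range; rewrite w_central.
by exists k.
Qed.

(** [y] and [j (g y)] differ by a multiple of [w]; repeating this with the cofactor pushes the
    remainder into ever higher powers of [w]. *)
Lemma tensor_to_ring_surj y : exists t, h t = y.
Proof.
have step n : forall y, exists t v, y = h t + w ^+ n * v.
  elim: n => [|n IH] {}y; first by exists 0, y; rewrite raddf0 add0r mul1r.
  have [t [v yE]] := IH y.
  have /quotientP[v' vE] : g v = g (j (g v)) by rewrite jK.
  exists (t + elt ^+ n *: tens 1 (g v)), v'.
  rewrite raddfD /= tensor_to_ringZ subring_valX tensor_to_ring_tens mul1r -addrA.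
  by rewrite exprSr -mulrA -mulrDr -w_central -vE addrCA subrr addr0.
by have [t [v ->]] := step nil y; exists t; rewrite w_nil mul0r addr0.
Qed.

Definition tensor_bar (z : M) : H := h (repr z).
Lemma tensor_barE z : tensor_bar (\pi_M z) = h z.
Proof.
apply/eqP; rewrite -subr_eq0; apply/eqP; rewrite -tensor_to_ringB.
by apply/tensor_to_ring_eq0; rewrite Quotient.idealrBE reprK.
Qed.
Lemma tensor_barB : zmod_morphism tensor_bar.
Proof.
by move=> x y; rewrite -[x]reprK -[y]reprK -raddfB !tensor_barE raddfB.
Qed.
HB.instance Definition _ := GRing.isZmodMorphism.Build M H tensor_bar tensor_barB.

Lemma gysin_tensor :
  [/\ zmod_morphism h,
      forall (r : nat) (x : Q), h (tens (elt ^+ r) x) = w ^+ r * j x &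
      exists hbar : {additive M -> H},
        [/\ forall z, hbar (\pi_M z) = h z,
            forall (a : J) z, hbar (\pi_M (a *: z)) = subring_val a * hbar (\pi_M z) &
            bijective hbar]].
Proof.
split; first exact: tensor_to_ringB.
  by move=> r x; rewrite tensor_to_ring_tens subring_valX.
exists tensor_bar; split; first exact: tensor_barE.
  by move=> a z; rewrite /= !tensor_barE tensor_to_ringZ.
have [s sP] := choice tensor_to_ring_surj.
exists (fun y => \pi_M (s y)) => [x|y] /=; last by rewrite tensor_barE.
rewrite -[x in RHS]reprK; apply/eqP; rewrite -Quotient.idealrBE.
by apply/tensor_to_ring_eq0; rewrite raddfB /= sP subrr.
Qed.
End GysinAlgebra.

(** * The Gysin sequence from the sequence of the pair *)

Section GysinSequence.
Context {R : realType} {G : lieGroupType R} {q : nat} {c : G} {idx : G -> nat}.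
Hypotheses (q_gt0 : (0 < q)%N) (c_order : (c ^+ q)%g = 1%g)
  (c_order_min : forall k : nat, (0 < k < q)%N -> (c ^+ k)%g <> 1%g)
  (idx_lt : forall g, (idx g < q)%N) (idx_c : forall g, idx (g * c)%g = ((idx g).+1 %% q)%N).
Local Notation C X := (singular R X -> int).
Local Notation HB := (hcoh R (base_space c)).
Local Notation HT := (hcoh R (total_space q c)).
Local Notation Pdisc := (@Pdisc R G q c).
Local Notation Bundle := (disc_bundle q c).
Local Notation Circle := (circle_bundle q c).
Local Notation Bdry := (boundary_incl q c).
Local Notation Zero := (zero_section q c).
Local Notation U := (thom_cochain (R := R) q_gt0 c_order c_order_min idx_lt idx_c).
Local Notation omega := (euler_class q c : HB).
Let bemb := boundary_emb (R := R) (G := G) q_gt0 c_order c_order_min.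
Let thomE := thom_class_eq (R := R) q_gt0 c_order c_order_min idx_lt idx_c.
Let iso_eq := @thom_iso_eq R G q c idx q_gt0 c_order c_order_min idx_lt idx_c.
Let iso_surj := @thom_iso_surj R G q c idx q_gt0 c_order c_order_min idx_lt idx_c.
Let thetaE := @gysin_thetaE R G q c idx q_gt0 c_order c_order_min idx_lt idx_c.

Lemma hpull_id (X : topologicalType) (f : continuousType X X) (x : hcoh R X) :
  (forall z, f z = z) -> hpull f x = x.
Proof.
move=> fz; rewrite -[x]repK hpull_cls ?rep_cocycle //; congr cls.
by apply/funext => s; rewrite pullE; congr rep; case: s => n s; apply: singular_eq => t; rewrite /= fz.
Qed.

Lemma zero_section_bundle (y : HB) : hpull Zero (hpull Bundle y) = y.
Proof.
rewrite (hpull_comp (h := Bundle \o Zero : continuousType _ _)) // hpull_id // => b.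
by have [g <-] := Pbase_surj b; rewrite /= zero_sectionP disc_bundleP.
Qed.

(** The radial contraction commutes with rotations, so its homotopy operator preserves invariant
    cochains and descends to the disc bundle. *)
Lemma bundle_zero_section (w : hcoh R (disc_space q c)) : hpull Bundle (hpull Zero w) = w.
Proof.
have wc := rep_cocycle w; have /cocycle0P[[N aN] da] := wc.
rewrite -[w]repK; move: (rep w) wc aN da => a wc aN da.
rewrite (hpull_cls Zero wc) (hpull_cls Bundle (cocycle_pull0 Zero wc)).
have [x xE] : exists x, x = pull Pdisc a by eexists.
have dx : cobnd x = 0 by rewrite xE -pull_cobnd da raddf0.
have Tx : pull (@Tdisc R G q c) x = x by rewrite xE pull_Tdisc_Pdisc.
have xdec := contract_disc dx.
have [|d dE] := @disc_descend R G q c q_gt0 c_order c_order_min (hop (@Hdisc R G) x).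
  by rewrite hop_disc_equiv Tx.
have bb : pull Pdisc (pull Bundle (pull Zero a)) = pull (@fstD R G) (pull (@zeroD R G) x).
  rewrite pull_Pdisc_bundle xE; apply/funext => s; rewrite !pullE; congr a; apply: singular_eq => t.
  exact: zero_sectionP.
have aE : a = pull Bundle (pull Zero a) + cobnd d.
  apply: (pull_inj (R := R) (disc_covering q_gt0 c_order c_order_min)).
  transitivity (pull Pdisc (pull Bundle (pull Zero a)) + pull Pdisc (cobnd d)); last by [].
  by rewrite bb pull_cobnd dE -xE.
have wc2 := cocycle_pull0 Bundle (cocycle_pull0 Zero wc).
apply: (cls_eq wc2 wc).2.
exists (- d); last by rewrite raddfN /= {2}aE opprD addNKr.
apply/rel0P; apply: boundedN; exists N => s Ns.
have [s' s'E] := push_lift (disc_covering q_gt0 c_order c_order_min) s erefl.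
have ss' : sdim s = sdim s' by rewrite -s'E.
rewrite -s'E -pullE dE; apply: (@hop_dim _ _ _ (@Hdisc R G) (sdim s')) => // t ts.
by rewrite xE; apply: aN; rewrite -[sdim _]/(sdim t) ts -ss' ltnW.
Qed.

Lemma circle_bundleE (y : HB) : hpull Circle y = hpull Bdry (hpull Bundle y).
Proof.
rewrite (hpull_comp (h := Circle)) // => x.
by have [z <-] := Ptotal_surj x; rewrite boundary_inclP disc_bundleP circle_bundleP.
Qed.

(** The Thom class restricts to the Euler class on the zero section; under the Thom isomorphism the
    map from relative to absolute cohomology thus becomes multiplication by [omega]. *)
Lemma thom_cap (y : HB) :
  hpull Zero (cls set0 (rep (hcup (thom_class q c) (hpull Bundle y)))) = omega * y.
Proof.
have yc := rep_cocycle y; have tc := thom_cocycle (R := R) q_gt0 c_order c_order_min idx_lt idx_c.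
have tc0 := cocycle_rel_abs tc; have uc := rep_cocycle (thom_class (R := R) q c).
rewrite /euler_class -{2}[y]zero_section_bundle -rmorphM /=; congr (hpull Zero _).
rewrite -[y]repK hpull_cls // -[thom_class q c]repK hcup_cls ?cocycle_pull0 //.
rewrite repK cls_rep_abs ?cocycle_cup ?cocycle_pull0 //.
by apply/esym/hcup_cls; [exact: cocycle_rel_abs uc|exact: cocycle_pull0].
Qed.

Definition thom_mul (y : HB) := hcup (thom_class q c) (hpull Bundle y).

Lemma thom_mulB : zmod_morphism thom_mul.
Proof. by move=> x y; rewrite /thom_mul hpullB hcupBr. Qed.

Lemma thom_mul0 : thom_mul 0 = 0.
Proof. by have := thom_mulB 0 0; rewrite !subrr. Qed.

Lemma thom_mulM y z : hcup (thom_mul y) (hpull Bundle z) = thom_mul (y * z).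
Proof. by rewrite /thom_mul hcupA (hpullM _).2. Qed.

Lemma thom_mul_inj : injective thom_mul.
Proof. by move=> x y; rewrite /thom_mul thomE; exact: iso_eq. Qed.

Lemma thom_mul_theta (x : HT) : thom_mul (gysin_theta x) = connecting Bdry x.
Proof. exact: thetaE. Qed.

Local Opaque gysin_theta connecting thom_class hcup hpull cls thom_mul.

(** [gysin_theta] picks a preimage under [thom_mul]; injectivity of [thom_mul] turns identities
    between connecting classes into identities between the picked values. *)
Lemma gysin_thetaB (x y : HT) : gysin_theta (x - y) = gysin_theta x - gysin_theta y.
Proof.
apply: thom_mul_inj; rewrite thom_mulB.
have [u v] := (thom_mul_theta x, thom_mul_theta y).
by rewrite u v -(connecting_zmod bemb x y) thom_mul_theta.
Qed.

Lemma gysin_theta_eq0 (x : HT) : gysin_theta x = 0 <-> exists y, hpull Circle y = x.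
Proof.
have -> : gysin_theta x = 0 <-> connecting Bdry x = 0.
  rewrite -thom_mul_theta; split=> [->|h]; first exact: thom_mul0.
  exact: (thom_mul_inj (etrans h (esym thom_mul0))).
rewrite (connecting_eq0 bemb); split=> [[w <-]|[y <-]].
  by exists (hpull Zero w); rewrite circle_bundleE bundle_zero_section.
by exists (hpull Bundle y); rewrite circle_bundleE.
Qed.

Lemma gysin_theta_range (y : HB) : (exists x : HT, gysin_theta x = y) <-> omega * y = 0.
Proof.
have -> : (exists x : HT, gysin_theta x = y) <-> (exists x : HT, connecting Bdry x = thom_mul y).
  split=> [[x <-]|[x xE]]; exists x; first by rewrite thom_mul_theta.
  by apply: thom_mul_inj; rewrite thom_mul_theta.
rewrite -(connecting_range bemb) -thom_cap -/(thom_mul y); split=> [->|h]; first exact: raddf0.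
by rewrite -[LHS]bundle_zero_section h raddf0.
Qed.

Lemma gysin_theta_mul (x : HT) (y : HB) :
  gysin_theta (x * hpull Circle y) = gysin_theta x * y.
Proof.
apply: thom_mul_inj; rewrite thom_mul_theta circle_bundleE.
rewrite -thom_mulM thom_mul_theta.
exact: (connecting_mul bemb).
Qed.

Lemma pair_exact (X Y : topologicalType) (f : continuousType X Y) (w : hcoh R Y) :
  simplicial_emb (R := R) f -> hpull f w = 0 <-> exists z : rcoh R Y (range f), cls set0 (rep z) = w.
Proof.
move=> fe; split=> [fw|[z <-]]; last first.
  have zc := rep_cocycle z; rewrite hpull_cls ?(cocycle_rel_abs zc) //.
  by have /asboolP[/(rel_embP fe)[_ ->] _] := zc; exact: cls0.
have wc := rep_cocycle w; have /cocycle0P[bw dw] := wc.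
move: fw; rewrite -[w]repK hpull_cls //.
move/(cls_eq0 (cocycle_pull0 f wc)) => [b /rel0P bb db].
have ac : rep w - cobnd (extend f b 0) \in cocycle (range f).
  apply/asboolP; split; last by rewrite cobndB dw cobnd_cobnd subrr.
  apply/(rel_embP fe); split.
    by apply: boundedB => //; apply/bounded_cobnd/bounded_extend.
  by rewrite pullB pull_cobnd pull_extend // db subrr.
exists (cls (range f) (rep w - cobnd (extend f b 0))); rewrite cls_rep_abs //.
apply/cls_eq => //; first exact: cocycle_rel_abs ac.
exists (- extend f b 0); first exact/rel0P/boundedN/bounded_extend.
by rewrite raddfN /= addrC addKr.
Qed.

Lemma circle_bundle_eq0 (y : HB) : hpull Circle y = 0 <-> exists v, y = omega * v.
Proof.
rewrite circle_bundleE (pair_exact _ bemb); split=> [[z zE]|[v ->]].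
  have [v] := iso_surj z; rewrite -thomE => vE; exists v.
  by rewrite -[y]zero_section_bundle -zE -vE thom_cap.
by exists (hcup (thom_class q c) (hpull Bundle v)); rewrite -thom_cap bundle_zero_section.
Qed.

Lemma euler_central (y : HB) : y * omega = omega * y.
Proof.
have [w -> [wc wmu]] := euler_class_eq (R := R) q_gt0 c_order c_order_min idx_lt idx_c.
have yc := rep_cocycle y; rewrite -[y]repK -[LHS]/(hmul _ _) -[RHS]/(hmul _ _) /hmul.
rewrite (hcup_cls yc wc) (hcup_cls wc yc); apply/esym.
exact: (euler_commute c_order c_order_min wmu wc yc).
Qed.
End GysinSequence.

Lemma hpull_cancel {R : realType} (X Y : topologicalType) (f : continuousType X Y)
  (g : continuousType Y X) (x : hcoh R X) : cancel f g -> hpull f (hpull g x) = x.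
Proof.
move=> fg; rewrite (hpull_comp (h := g \o f : continuousType _ _)) //.
exact: hpull_id.
Qed.

Lemma gysin_of_trivialization {R : realType} {G : lieGroupType R} {q : nat} {c : G}
    (G_compact : compact [set: G]) (q_gt0 : (0 < q)%N) (c_order : (c ^+ q)%g = 1%g)
    (c_order_min : forall k : nat, (0 < k < q)%N -> (c ^+ k)%g <> 1%g)
    (phi : continuousType (G * circle R)%type (total_space q c))
    (psi : continuousType (total_space q c) (G * circle R)%type) :
    trivialization phi psi ->
    let H := hcoh R (base_space c) in
    let HGS := hcoh R (G * circle R)%type in
    let omega : H := euler_class q c in
    let Q := ideal_quotient omega in
    let g : H -> Q := \pi_Q in
    let Cstar : H -> HGS := fun y => hpull phi (hpull (circle_bundle q c) y) in
    let theta : HGS -> H := fun x => gysin_theta (hpull psi x) in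
    let xi1 : HGS := hpull (circle_proj G) (orientation_class R) in
    [/\ exists Cbar : {additive Q -> HGS},
          [/\ forall y : H, Cbar (g y) = Cstar y,
              injective Cbar &
              range Cbar = [set x | theta x = 0]],
        zmod_morphism theta,
        range theta = [set y | y * omega = 0] &
        range (fun y : H => y * omega) = [set y | y \in ideal_gen omega]] /\
    theta xi1 = q%:R /\
    (forall (x : HGS) (y : H), theta (x * Cstar y) = theta x * y) /\
    (forall j : {additive Q -> H}, (forall x : Q, g (j x) = x) ->
      let J := subring_of omega in
      let h : tensor J Q -> H := tlift (fun (a : J) (x : Q) => subring_val a * j x) in
      let N := [set subring_elt omega *: z | z in [set z | range theta (h z)]] in
      [/\ zmod_morphism h,
          forall (r : nat) (x : Q), h (tens (subring_elt omega ^+ r) x) = omega ^+ r * j x &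
          exists hbar : {additive submod_quotient N -> H},
            [/\ forall z, hbar (\pi_(submod_quotient N) z) = h z,
                forall (a : J) z, hbar (\pi_(submod_quotient N) (a *: z)) =
                                  subring_val a * hbar (\pi_(submod_quotient N) z) &
                bijective hbar]]).
Proof.
move=> [phiK psiK zq] H HGS omega Q g Cstar theta xi1.
have [r rE] := choice (Pbase_surj (R := R) (c := c)).
have [idx [idx_lt idx_c _]] := index_exists q_gt0 c_order c_order_min rE.
have CsB : zmod_morphism Cstar by move=> x y; rewrite /Cstar !hpullB.
have thetaB : zmod_morphism theta.
  by move=> x y; rewrite /theta hpullB (gysin_thetaB q_gt0 c_order c_order_min idx_lt idx_c).
have central (y : H) : y * omega = omega * y.
  exact: (euler_central q_gt0 c_order c_order_min idx_lt idx_c).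
have [n nil] : exists n, omega ^+ n = 0 by exact: (euler_nilpotent q_gt0 c_order c_order_min G_compact).
have phi0 : hpull phi 0 = 0 :> HGS by rewrite -[X in hpull phi X](subrr 0) hpullB subrr.
have psi0 : hpull psi 0 = 0 :> hcoh R (total_space q c) by rewrite -[X in hpull psi X](subrr 0) hpullB subrr.
have Cs_eq0 y : Cstar y = 0 <-> exists v, y = v * omega.
  have -> : Cstar y = 0 <-> hpull (circle_bundle q c) y = 0.
    split=> [h|h]; last by rewrite /Cstar h.
    by rewrite -[LHS](hpull_cancel _ psiK) -/(Cstar y) h.
  rewrite (circle_bundle_eq0 q_gt0 c_order c_order_min idx_lt idx_c).
  by split=> -[v ->]; exists v; rewrite central.
have theta_eq0 x : theta x = 0 <-> exists y, Cstar y = x.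
  rewrite (gysin_theta_eq0 q_gt0 c_order c_order_min idx_lt idx_c); split=> -[y yE]; exists y.
    by rewrite /Cstar yE hpull_cancel.
  by rewrite -yE hpull_cancel.
have theta_range y : (exists x, theta x = y) <-> y * omega = 0.
  rewrite central -(gysin_theta_range q_gt0 c_order c_order_min idx_lt idx_c).
  split=> [[x <-]|[x <-]]; first by exists (hpull psi x).
  by exists (hpull phi x); rewrite /theta hpull_cancel.
split; first exact: (gysin_exact CsB thetaB central Cs_eq0 theta_eq0 theta_range).
split.
  rewrite /theta /xi1.
  have zeta_cts : continuous (circle_proj G \o psi).
    by move=> x; apply: continuous_comp; [exact: cts_fun|exact: cts_fun].
  pose zeta : continuousType (total_space q c) (circle R) := mkcts zeta_cts.
  rewrite (hpull_comp (h := zeta)) //.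
  by apply: (gysin_theta_power q_gt0 c_order c_order_min idx_lt idx_c) => g0 z; exact: zq.
split.
  move=> x y; rewrite /theta (hpullM psi).2 /Cstar hpull_cancel //.
  exact: (gysin_theta_mul q_gt0 c_order c_order_min idx_lt idx_c).
move=> j jK; exact: (gysin_tensor central nil theta_range jK).
Qed.

(** * Smooth paths and the trivialization *)

Section Bump.
Context {R : realType}.

(** The powers of [t^-1] make the family closed under differentiation: the derivative of [flat n] is
    [- n%:R * flat n.+1 + flat n.+2]. *)
Definition flat (n : nat) (t : R) : R := if 0 < t then t^-1 ^+ n * expR (- t^-1) else 0.

Lemma flat_ge0 n t : 0 <= flat n t.
Proof.
rewrite /flat; case: ifP => // t0; apply: mulr_ge0; last exact: expR_ge0.
by apply: exprn_ge0; rewrite invr_ge0 ltW.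
Qed.

Lemma flat_le0 n t : t <= 0 -> flat n t = 0.
Proof. by move=> t0; rewrite /flat ltNge t0. Qed.

Lemma flat_gt0 t : 0 < t -> 0 < flat 0 t.
Proof. by move=> t0; rewrite /flat t0 expr0 mul1r expR_gt0. Qed.

Lemma flat_mono s t : s <= t -> flat 0 s <= flat 0 t.
Proof.
move=> st; have [s0|s0] := leP s 0; first by rewrite flat_le0 ?flat_ge0.
have t0 := lt_le_trans s0 st.
by rewrite /flat s0 t0 !expr0 !mul1r ler_expR lerN2 lef_pV2 ?posrE.
Qed.

(** From the term of degree n + 1 in the exponential series at [t^-1]. The bound gives the
    derivative of [flat] at 0. *)
Lemma flat_bound n t : `|flat n t| <= `|t| * n.+1`!%:R.
Proof.
have [t0|t0] := leP t 0; first by rewrite flat_le0 // normr0 mulr_ge0.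
rewrite (gtr0_norm t0) (ger0_norm (flat_ge0 n t)) /flat t0.
have x0 : 0 <= t^-1 by rewrite invr_ge0 ltW.
have := expR_ge1Dxn n x0; set x := t^-1; set F : R := n.+1`!%:R => h.
have F0 : 0 < F by rewrite ltr0n fact_gt0.
have xE : x ^+ n.+1 <= F * expR x.
  rewrite mulrC -ler_pdivrMr //; apply: le_trans h; rewrite -/F lerDr //.
have tx : t * x = 1 by rewrite /x divff // gt_eqF.
have -> : x ^+ n = t * x ^+ n.+1 by rewrite exprS mulrA tx mul1r.
rewrite -mulrA ler_pM2l // expRN ler_pdivrMr ?expR_gt0 //; exact: xE.
Qed.

Lemma is_derive_val (f : R -> R) (t a b : R) : is_derive t 1 f a -> a = b -> is_derive t 1 f b.
Proof. by move=> h <-. Qed.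

Lemma inv_is_derive (t : R) : t != 0 -> is_derive t 1 (fun t : R => t^-1) (- t^-1 ^+ 2).
Proof.
move=> tn; have h : is_derive t 1 (fun y : R => (id y)^-1) (- (id t) ^- 2 *: 1).
  by exact: (is_deriveV (f := id) tn (is_derive_id t 1)).
by apply: (is_derive_val h); rewrite /= -[_ *: 1]/(_ * 1) mulr1 exprVn.
Qed.

Lemma expR_inv_is_derive (t : R) : t != 0 ->
  is_derive t 1 (fun t : R => expR (- t^-1)) (t^-1 ^+ 2 * expR (- t^-1)).
Proof.
move=> tn; have dN : is_derive t 1 (fun t : R => - t^-1) (t^-1 ^+ 2).
  by have h := is_deriveN (inv_is_derive tn); rewrite opprK in h; exact: h.
have h : is_derive t 1 (expR \o (fun t : R => - t^-1)) (expR (- t^-1) * t^-1 ^+ 2).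
  by exact: (is_derive1_comp (is_derive_expR _) dN).
by apply: (is_derive_val h); rewrite mulrC.
Qed.

Lemma flat_step n (x E : R) : x * (- n%:R * (x ^+ n.+1 * E) + x ^+ n.+2 * E) + x ^+ n * E * (- x ^+ 2) =
  - n.+1%:R * (x ^+ n.+2 * E) + x ^+ n.+3 * E.
Proof. by rewrite -natr1 !exprS expr0; ring. Qed.

Lemma flat_inv_derive n (t : R) : 0 < t ->
  is_derive t 1 (fun t : R => t^-1 ^+ n * expR (- t^-1)) (- n%:R * flat n.+1 t + flat n.+2 t).
Proof.
move=> t0; have tn : t != 0 by rewrite gt_eqF.
rewrite /flat t0; elim: n => [|n IH].
  have -> : (fun t : R => t^-1 ^+ 0 * expR (- t^-1)) = (fun t : R => expR (- t^-1)).
    by apply/funext => x; rewrite expr0 mul1r.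
  by apply: (is_derive_val (expR_inv_is_derive tn)); rewrite oppr0 mul0r add0r.
have -> : (fun t : R => t^-1 ^+ n.+1 * expR (- t^-1)) =
    (fun t : R => t^-1) * (fun t : R => t^-1 ^+ n * expR (- t^-1)).
  by apply/funext => x; rewrite -[RHS]/(x^-1 * (x^-1 ^+ n * expR (- x^-1))) exprS mulrA.
have h : is_derive t 1 ((fun t : R => t^-1) * (fun t : R => t^-1 ^+ n * expR (- t^-1)))
    (t^-1 *: (- n%:R * (t^-1 ^+ n.+1 * expR (- t^-1)) + t^-1 ^+ n.+2 * expR (- t^-1)) +
     (t^-1 ^+ n * expR (- t^-1)) *: (- t^-1 ^+ 2)) by exact: (is_deriveM (inv_is_derive tn) IH).
by apply: (is_derive_val h); exact: flat_step.
Qed.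

Lemma flat_is_derive n (t : R) : is_derive t 1 (flat n) (- n%:R * flat n.+1 t + flat n.+2 t).
Proof.
have [t0|t0|t0] := ltgtP t 0.
- rewrite !flat_le0 ?ltW // mulr0 addr0.
  have ne : \forall x \near t, 0 = flat n x.
    by near=> x; rewrite flat_le0 //; apply/ltW; near: x; exact: lt_nbhsl.
  have h : is_derive t 1 (fun=> 0 : R) 0 by exact: is_derive_cst.
  split; first by apply: (near_eq_derivable ne); exact: ex_derive.
  by rewrite -(near_eq_derive (f := fun=> 0) _ ne) derive_val.
- have ne : \forall x \near t, x^-1 ^+ n * expR (- x^-1) = flat n x.
    by near=> x; rewrite /flat ifT //; near: x; exact: lt_nbhsr.
  have h := flat_inv_derive n t0.
  split; first by apply: (near_eq_derivable ne); exact: ex_derive.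
  by rewrite -(near_eq_derive (f := fun x : R => x^-1 ^+ n * expR (- x^-1)) _ ne) derive_val.
rewrite t0 !(flat_le0 _ (lexx 0)) mulr0 addr0.
have c0 : flat n.+1 h @[h --> (0 : R)^'] --> 0.
  apply/cvgr0Pnorm_le => e e0; near=> h.
  apply: le_trans (flat_bound _ _) _; rewrite -ler_pdivlMr ?ltr0n ?fact_gt0 //; near: h.
  apply: dnbhs0_le; rewrite divr_gt0 // ltr0n fact_gt0 //.
have E : (fun h : R => h^-1 *: ((flat n \o +%R^~ 0) (h *: 1) - flat n 0)) @ 0^' --> 0.
  apply: cvg_trans c0; apply: near_eq_cvg; near=> h.
  have h0 : h != 0 by near: h; exact: nbhs_dnbhs_neq.
  rewrite /= addr0 (flat_le0 _ (lexx 0)) subr0 -[h *: 1]/(h * 1) mulr1 -[RHS]/(h^-1 * flat n h) /flat.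
  by case: ifP => _; rewrite ?mulr0 // exprS mulrA.
split; [apply/cvg_ex; exists 0; exact: E|exact: cvg_lim E].
Unshelve. all: by end_near. Qed.

Lemma Ck_flat k n : Ck k setT (flat n : R^o -> R^o).
Proof.
elim: k n => [|k IH] n.
  move=> x _; apply: differentiable_continuous; apply/derivable1_diffP.
  by have [] := flat_is_derive n x.
have df x : differentiable (flat n : R^o -> R^o) x.
  by apply/derivable1_diffP; have [] := flat_is_derive n x.
move=> v; split=> [x _|]; first exact: diff_derivable.
have h1 := Ck_scale (v * - n%:R) openT (IH n.+1).
have h2 := Ck_scale v openT (IH n.+2).
apply: (Ck_eq openT _ (Ck_add openT h1 h2)) => x _.
have -> : 'D_v (flat n : R^o -> R^o) x = v * 'D_1 (flat n : R^o -> R^o) x.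
  rewrite !deriveE //; have -> : 'd (flat n : R^o -> R^o) x v = 'd (flat n : R^o -> R^o) x (v *: (1 : R^o)).
    by rewrite -[v *: 1]/(v * 1) mulr1.
  by rewrite linearZ.
have [_ ->] := flat_is_derive n x.
by rewrite mulrDr mulrA.
Qed.

(** [expR (- 1)] is [flat 0 1]. For [t <= 0] the inner [flat 0 (1 - t)] is at least as large, so the
    outer argument is not positive; for [1 <= t] it is 0. Composing two copies of [flat] keeps the
    denominator constant. *)
Definition bump (t : R) : R := flat 0 (expR (- 1) - flat 0 (1 - t)) / flat 0 (expR (- 1)).

Let lam_gt0 : 0 < flat 0 (expR (- 1)). Proof. by apply: flat_gt0; exact: expR_gt0. Qed.

Lemma bump_ge0 t : 0 <= bump t.
Proof. by rewrite /bump divr_ge0 ?flat_ge0. Qed.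

Lemma bump_le1 t : bump t <= 1.
Proof.
by rewrite /bump ler_pdivrMr // mul1r flat_mono // lerBlDr lerDl flat_ge0.
Qed.

Lemma bump_left t : t <= 0 -> bump t = 0.
Proof.
move=> t0; rewrite /bump flat_le0 ?mul0r // subr_le0.
have -> : expR (- 1) = flat 0 1 by rewrite /flat ltr01 expr0 mul1r invr1.
by apply: flat_mono; rewrite lerBrDr -lerBrDl subrr.
Qed.

Lemma bump_right t : 1 <= t -> bump t = 1.
Proof. by move=> t1; rewrite /bump [flat 0 (1 - t)]flat_le0 ?subr_le0 // subr0 divff // gt_eqF. Qed.

Lemma smooth_bump : smooth_on setT (bump : R^o -> R^o).
Proof.
move=> k; have Ac : continuous (fun t : R^o => 1 - t : R^o).
  by move=> x; apply: cvgB; [exact: cvg_cst|exact: cvg_id].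
have Aa (h : R) (v x : R^o) : 1 - (h *: v + x) = h *: (- v) + (1 - x) :> R^o.
  by rewrite scalerN opprD addrCA.
have sc (i : unit) : smooth_on setT (fun t : R^o => - 1 * flat 0 (1 - t) : R).
  move=> m; apply: Ck_scale; first exact: openT.
  by have := Ck_affine Ac Aa (Ck_flat m 0); rewrite preimage_setT.
have sf : smooth_on setT ((flat 0 : R^o -> R) \o (fun t : R^o => expR (- 1) - flat 0 (1 - t) : R^o)).
  apply: (smooth_chain (e := fun _ : unit => 1 : R^o) (w0 := expR (- 1) : R^o) (s := [:: tt]) openT openT sc) => //.
    by move=> t; rewrite big_cons big_nil addr0 -[_ *: 1]/(_ * 1) mulr1 mulN1r.
  by move=> m; exact: Ck_flat.
have := Ck_scale (flat 0 (expR (- 1)))^-1 openT (sf k).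
by apply: (Ck_eq openT) => t _; rewrite mulrC.
Qed.
End Bump.

(** * Joining points of the group by smooth paths *)

Section SmoothPaths.
Context {R : realType} {G : lieGroupType R}.
Local Notation n := (@lie_dim R G).
Local Notation E := 'rV[R]_n.
Local Notation img a := (chart_map a @` chart_dom a).

(** Paths that are constant outside the unit interval can be combined by multiplication in the group
    and remain smooth. *)
Definition joined (x y : G) := exists al : R^o -> G,
  [/\ smooth_map setT al, forall t, t <= 0 -> al t = x & forall t, 1 <= t -> al t = y].

Lemma smooth_map_line (al : R^o -> G) (a b : R) : smooth_map setT al ->
  smooth_map setT (fun t : R^o => al (a * t + b)).
Proof.
move=> sa; have := @smooth_map_affine R G R^o R^o (fun t => a * t + b) (fun t => a * t) setT al.
rewrite preimage_setT; apply => //.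
  by move=> x; apply: cvgD; [apply: cvgM; [exact: cvg_cst|exact: cvg_id]|exact: cvg_cst].
by move=> h v x; rewrite -[h *: v]/(h * v) -[h *: (a * v)]/(h * (a * v)); ring.
Qed.

Lemma joined_trans x y z : joined x y -> joined y z -> joined x z.
Proof.
move=> [al [sa a0 a1]] [be [sb b0 b1]].
(* Concatenation as a product: for [t <= 1/2] the last two factors cancel, for [t >= 1/2] the first
   two. *)
exists (fun t => al (2 * t + 0) * y^-1 * be (2 * t + (- 1)))%g; split.
- apply: smooth_map_mul; first exact: openT.
    by apply: smooth_map_mul; [exact: openT|exact: smooth_map_line|exact: smooth_map_cst].
  exact: smooth_map_line.
- move=> t t0; rewrite a0; last by lra.
  by rewrite b0; [rewrite mulgVK|lra].
- move=> t t1; rewrite a1; last by lra.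
  by rewrite b1; [rewrite mulgV mul1g|lra].
Qed.

Lemma joined_refl x : joined x x.
Proof. by exists (fun=> x); split=> //; exact: smooth_map_cst. Qed.

Lemma joined_segment (a : chart R G n) (p v : E) : lie_atlas a ->
  (forall s, 0 <= s <= 1 -> img a (p + s *: v)) -> joined (chart_inv a p) (chart_inv a (p + v)).
Proof.
move=> aa seg; exists (fun t : R^o => chart_inv a (p + bump t *: v)); split.
- have FE t : p + bump t *: v = p + \sum_(i <- [:: tt]) bump t *: v by rewrite big_cons big_nil addr0.
  have FU t : setT t -> img a (p + bump t *: v) by move=> _; apply: seg; rewrite bump_ge0 bump_le1.
  have sm := @smooth_map_comp R G R^o E unit (fun=> v) setT (img a) p (fun=> bump) [:: tt]
    (fun t => p + bump t *: v) (chart_inv a) openT (@img_open R G a) (fun=> smooth_bump) FE FU (smooth_chart_inv aa).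
  exact: sm.
- by move=> t t0; rewrite bump_left // scale0r addr0.
- by move=> t t1; rewrite bump_right // scale1r.
Qed.

(** Both directions are recorded because [locally_constant] will need an equivalence between being
    joined to neighbouring points. *)
Lemma joined_near (x : G) : \forall y \near x, joined x y /\ joined y x.
Proof.
have [a aa ax] := lie_cover x; pose p := chart_map a x.
have pI : nbhs p (img a) by apply: open_nbhs_nbhs; split; [exact: img_open|exists x].
have [r r0 rI] := (nbhs_ballP _ _).1 pI.
have inI (w : E) : `|w| < r -> img a (p + w).
  by move=> wr; apply: rI; rewrite -ball_normE /ball_ /= opprD addNKr normrN.
have nb : \forall y \near x, ball p r (chart_map a y).
  by apply: (chart_map_cts ax); exact: nbhsx_ballx.
have nd : \forall y \near x, chart_dom a y.
  by apply: open_nbhs_nbhs; split=> //; exact: chart_dom_open.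
near=> y.
have dy : chart_dom a y by near: y.
have yr : `|chart_map a y - p| < r.
  rewrite -normrN opprB; have : ball p r (chart_map a y) by near: y.
  by rewrite -ball_normE.
pose v := chart_map a y - p; have pv : p + v = chart_map a y by rewrite /v addrC subrK.
have small s : 0 <= s <= 1 -> `|s *: v| < r.
  move=> /andP[s0 s1]; rewrite normrZ ger0_norm //; apply: le_lt_trans yr.
  by rewrite ler_piMl.
split.
  have := @joined_segment a p v aa _; rewrite pv !chart_mapK //; apply => s hs.
  exact/inI/small.
have := @joined_segment a (p + v) (- v) aa _; rewrite addrK pv !chart_mapK //; apply => s /andP[s0 s1].
have -> : chart_map a y + s *: - v = p + (1 - s) *: v.
  by rewrite -pv scalerN scalerBl scale1r -addrA.
by apply/inI/small; rewrite subr_ge0 s1 lerBlDr lerDl.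
Unshelve. all: by end_near. Qed.

Lemma joined_all (x y : G) : connected [set: G] -> joined x y.
Proof.
move=> Gc; have := @locally_constant G bool (fun y => `[< joined x y >]) Gc _ x y.
move=> h; apply/asboolP; rewrite -h; first by apply/asboolP; exact: joined_refl.
move=> z; apply: filterS (joined_near z) => w [zw wz]; apply/asbool_equiv_eq.
by split=> h'; apply: joined_trans h' _.
Qed.
End SmoothPaths.

(** * A smooth curve multiplied by the central element after each period *)

Section EquivariantCurve.
Context {R : realType} {G : lieGroupType R} {c : G} (T : R).
Hypotheses (c_central : forall x : G, (c * x = x * c)%g) (T_gt0 : 0 < T).

Definition cpow (z : int) : G := match z with Posz m => (c ^+ m)%g | Negz m => (c ^- m.+1)%g end.

Lemma cpowS z : cpow (z + 1) = (cpow z * c)%g.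
Proof.
case: z => m; first by rewrite -[Posz m + 1]/(Posz (m + 1)%N) addn1 /= expgSr.
have -> : Negz m + 1 = - m%:Z by rewrite NegzE; lia.
have -> : cpow (- m%:Z) = (c ^- m)%g by case: m => [|m] //; rewrite oppr0 /= invg1.
by apply: (mulgI (c ^+ m.+1)%g); rewrite mulgA mulgV mul1g expgS -mulgA mulgV mulg1.
Qed.

(** A path from 1 to [c] is repeated with period [T], each copy multiplied by the next power of [c];
    the constant ends make the copies fit smoothly. *)
Lemma equivariant_curve : connected [set: G] -> exists gam : R^o -> G,
  smooth_map setT gam /\ forall t, gam (t + T) = (gam t * c)%g.
Proof.
move=> Gc; have [al [sal al0 al1]] := @joined_all R G 1%g c Gc.
pose gam (t : R^o) := (al (t / T - (Num.floor (t / T))%:~R) * cpow (Num.floor (t / T)))%g.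
exists gam; split; last first.
  move=> t; rewrite /gam mulrDl divff ?gt_eqF //.
  have -> : Num.floor (t / T + 1) = Num.floor (t / T) + 1.
    by rewrite -[1 in LHS]/(1%:~R) floorDrz ?intr_int // intrKfloor.
  by rewrite cpowS mulgA intrD opprD addrACA subrr addr0.
(* [m] is an integer nearest to [t0 / T], so [N] contains [t0] and meets only the two copies
   adjacent to [m * T]. *)
apply: smooth_map_local => t0 _; pose m := Num.floor (t0 / T + 2^-1).
pose N : set R^o := [set t | (m%:~R - 1) * T < t /\ t < (m%:~R + 1) * T].
have No : open N.
  have -> : N = [set` `](m%:~R - 1) * T, (m%:~R + 1) * T[ ].
    by apply/seteqP; split=> x /=; rewrite in_itv /=; [move=> [-> ->]|move/andP].
  exact: itv_open.
exists N.
  have /andP[m1 m2] := floor_itv (t0 / T + 2^-1); rewrite -/m intrD in m1 m2.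
  by rewrite /N /= -(ltr_pdivlMr _ _ T_gt0) -(ltr_pdivrMr _ _ T_gt0); split; move: (t0 / T) m1 m2 => u m1 m2; lra.
(* Left of [m * T] the second factor is 1; from there on the first factor is [c], which centrality
   moves into the power of [c]. *)
have sN : smooth_map N (fun t : R^o => al (T^-1 * t + (1 - m%:~R)) * al (T^-1 * t + (- m%:~R)) * cpow (m - 1))%g.
  apply: (@smooth_map_sub _ _ _ setT) => //.
  apply: smooth_map_mul; [exact: openT| |exact: smooth_map_cst].
  by apply: smooth_map_mul; [exact: openT|exact: smooth_map_line|exact: smooth_map_line].
apply: (smooth_map_eq No _ sN) => t [t1 t2]; rewrite /gam ![T^-1 * t]mulrC.
rewrite -(ltr_pdivlMr _ _ T_gt0) in t1; rewrite -(ltr_pdivrMr _ _ T_gt0) in t2; move: (t / T) t1 t2 => u u1 u2.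
have [um|um] := ltP u m%:~R.
  have -> : Num.floor u = m - 1.
    by apply: floor_def; rewrite subrK um andbT intrB ltW.
  rewrite (al0 (u + - m%:~R)); last by lra.
  by rewrite mulg1 intrB -[1%:~R]/(1 : R) opprB.
have -> : Num.floor u = m by apply: floor_def; rewrite um intrD.
rewrite (al1 (u + (1 - m%:~R))); last by lra.
have -> : cpow m = (cpow (m - 1) * c)%g by rewrite -cpowS subrK.
by rewrite -mulgA c_central mulgA.
Qed.
End EquivariantCurve.

(** * The trivialization defined by the curve *)

Section Trivialization.
Context {R : realType} {G : lieGroupType R} {q : nat} {c : G} (gam : R^o -> G) (arg : circle R -> R).
Local Notation turn := (2 * pi : R).
Local Notation angle := (2 * pi / q%:R : R).
Hypotheses (q_gt0 : (0 < q)%N) (c_order : (c ^+ q)%g = 1%g) (gam_cts : continuous gam)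
  (gam_step : forall t, gam (t + angle) = (gam t * c)%g) (argE : forall z, circle_pt (arg z) = z).
Local Notation Ptotal := (@Ptotal R G q c).

Lemma angle_turn : angle *+ q = turn.
Proof. by rewrite -[LHS]mulr_natr mulfVK // pnatr_eq0 -lt0n. Qed.

Lemma gam_iter k t : gam (t + angle *+ k) = (gam t * c ^+ k)%g.
Proof.
elim: k => [|k IH]; first by rewrite mulr0n addr0 mulg1.
by rewrite mulrSr addrA gam_step IH -mulgA -expgSr.
Qed.

Lemma gam_turn t (k : int) : gam (t + turn * k%:~R) = gam t.
Proof.
have nat_turn (m : nat) s : gam (s + turn * m%:R) = gam s.
  by rewrite mulr_natr -angle_turn -mulrnA gam_iter expgnA c_order expg1n mulg1.
case: k => m; first exact: nat_turn.
by rewrite NegzE mulrNz mulrN -[LHS](nat_turn m.+1) subrK.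
Qed.

Definition gam_circle (z : circle R) : G := gam (arg z).

Lemma gam_circleE t : gam_circle (circle_pt t) = gam t.
Proof.
by rewrite /gam_circle; have [k ->] := circle_ptP (esym (argE (circle_pt t))); rewrite gam_turn.
Qed.

(** Near each point a continuous section of the covering of the circle replaces [arg]; by [gam_turn]
    the value of [gam] is the same. *)
Lemma gam_circle_cts : continuous gam_circle.
Proof.
move=> z; have [V Vz [s sP]] := cov_sec (@circle_covering R) z.
have sz : {for z, continuous (gam \o s)}.
  apply: (@continuous_comp _ _ _ s gam); last exact: gam_cts.
  by have [] := sP z (nbhs_singleton Vz).
have h : (gam \o s) @ z --> (gam \o s) z := sz.
have e : forall z', V z' -> (gam \o s) z' = gam_circle z'.
  by move=> z' Vz'; have [sE _] := sP z' Vz'; rewrite -{2}sE gam_circleE.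
rewrite (e z (nbhs_singleton Vz)) in h.
move=> P nP; have hP : nbhs z ((gam \o s) @^-1` P) := h P nP.
have FF : Filter (nbhs z) := @nbhs_filter _ z.
have both := @filterI _ _ FF _ _ Vz hP.
have sub : V `&` (gam \o s) @^-1` P `<=` gam_circle @^-1` P.
  by move=> z' [Vz' Pz']; rewrite /preimage /= -(e z' Vz').
exact: (@filterS _ _ FF _ _ sub both).
Qed.

Lemma circle_val_exp_cts m : continuous (fun z : circle R => val z ^+ m : R[i]^o).
Proof.
elim: m => [|m IH] z.
  have -> : (fun z : circle R => val z ^+ 0 : R[i]^o) = (fun=> 1) by apply/funext => x; rewrite expr0.
  exact: cst_continuous.
have -> : (fun x : circle R => val x ^+ m.+1 : R[i]^o) = (fun x => val x * val x ^+ m) by apply/funext => x; rewrite exprS.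
by apply: (@cvgM R[i] _ (nbhs z)); [exact: circle_val_cts|exact: IH].
Qed.

Lemma power_subproof (z : circle R) : val z ^+ q \in circle R.
Proof. by apply/mem_set; rewrite /circle /= normrX (set_mem (valP z)) expr1n. Qed.
Definition circle_power (z : circle R) : circle R := exist (fun z => z \in circle R) _ (power_subproof z).

Lemma circle_power_cts : continuous circle_power.
Proof.
by apply: to_circle_cts => z; exact: circle_val_exp_cts.
Qed.

Lemma circle_powerE t : circle_power (circle_pt t) = circle_pt (t *+ q).
Proof. by apply: val_inj; rewrite /= -cisX. Qed.

Definition triv_out (x : G * circle R) : G * circle R :=
  ((x.1 * (gam_circle x.2)^-1)%g, circle_power x.2).

Lemma triv_out_cts : continuous triv_out.
Proof.
apply: pair_cts => x.
  apply: (@continuous_comp _ _ _ (fun x : G * circle R => (x.1, (gam_circle x.2)^-1)%g) (fun y : G * G => (y.1 * y.2)%g)); last exact: lie_mul_cts.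
  apply: cvg_pair; first exact: cvg_fst.
  apply: (@continuous_comp _ _ _ (fun x : G * circle R => gam_circle x.2) (fun y : G => y^-1)%g); last exact: lie_inv_cts.
  by apply: (@continuous_comp _ _ _ snd gam_circle); [exact: cvg_snd|exact: gam_circle_cts].
by apply: (@continuous_comp _ _ _ snd circle_power); [exact: cvg_snd|exact: circle_power_cts].
Qed.

(** [g] and [gam] both acquire the factor [c], which cancels, and the q-th power forgets the
    rotation by [angle]. *)
Lemma triv_out_gen x : triv_out (total_gen q c x) = triv_out x.
Proof.
case: x => g z; rewrite /triv_out /total_gen /= -(argE z); set t := arg z.
have -> : rot_circle angle (circle_pt t) = circle_pt (t + angle).
  by apply: val_inj; rewrite /= -cisD addrC.
rewrite !gam_circleE gam_step !circle_powerE; congr pair.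
  by apply: (mulIg (gam t * c)%g); rewrite mulgVK mulgA mulgVK.
by rewrite mulrnDl angle_turn; have := circle_pt_turn (t *+ q) 1; rewrite mulr1.
Qed.

Definition triv_psi (x : total_space q c) : G * circle R := triv_out (repr x).

Lemma triv_out_orbit a b : orbit_pi (total_gen q c) a = orbit_pi (total_gen q c) b -> triv_out a = triv_out b.
Proof.
move=> ab; have /eqmodP/asboolP[k [m e]] : a = b %[mod {eq_quot (orbit_rel (total_gen q c))}] := ab.
have it i x : triv_out (iter i (total_gen q c) x) = triv_out x.
  by elim: i => //= i <-; rewrite triv_out_gen.
by rewrite -(it k a) e it.
Qed.

Lemma triv_psiE x : triv_psi (orbit_pi (total_gen q c) x) = triv_out x.
Proof. by apply: triv_out_orbit; exact: reprK. Qed.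

Lemma triv_psi_cts : continuous triv_psi.
Proof.
apply: (@repr_comp_continuous _ _ _ triv_out); first exact: triv_out_cts.
by move=> a b /eqP ab; apply/eqP; exact: triv_out_orbit.
Qed.

(** Advancing [s] by [angle] applies the generator to the pair, so the orbit depends only on [g] and
    [circle_pt (s *+ q)]. *)
Definition triv_sheet (g : G) (s : R) : total_space q c := orbit_pi (total_gen q c) ((g * gam s)%g, circle_pt s).

Lemma triv_sheet_angle g s (k : int) : triv_sheet g (s + angle * k%:~R) = triv_sheet g s.
Proof.
have step s' : triv_sheet g (s' + angle) = triv_sheet g s'.
  rewrite /triv_sheet -[RHS](orbit_pi_iter (tau := total_gen q c) 1); congr orbit_pi.
  rewrite /= /total_gen gam_step mulgA; congr pair.
  by apply: val_inj; rewrite /= -cisD addrC.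
have nat_step (m : nat) s' : triv_sheet g (s' + angle * m%:R) = triv_sheet g s'.
  elim: m s' => [|m IH] s'; first by rewrite mulr0 addr0.
  have -> : s' + angle * m.+1%:R = s' + angle * m%:R + angle by rewrite -natr1; ring.
  by rewrite step.
case: k => m; first exact: nat_step.
by rewrite NegzE mulrNz mulrN -[LHS](nat_step m.+1) subrK.
Qed.

Definition triv_phi (x : G * circle R) : total_space q c := triv_sheet x.1 (arg x.2 / q%:R).

Let qn0 : q%:R != 0 :> R. Proof. by rewrite pnatr_eq0 -lt0n. Qed.

Lemma divqK t : (t / q%:R : R) *+ q = t.
Proof. by rewrite -[LHS]mulr_natr mulfVK. Qed.

Lemma triv_phiE g s : triv_phi (g, circle_pt (s *+ q)) = triv_sheet g s.
Proof.
rewrite /triv_phi /=; have [k ->] := circle_ptP (esym (argE (circle_pt (s *+ q)))).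
rewrite -[RHS](triv_sheet_angle g s k); congr triv_sheet.
by rewrite -mulr_natr; field.
Qed.

Lemma triv_phi_cts : continuous triv_phi.
Proof.
move=> [g z]; have [V Vz [s sP]] := cov_sec (@circle_covering R) z.
pose sq (x : G * circle R) : R := s x.2 / q%:R.
pose k (x : G * circle R) := ((x.1 * gam (sq x))%g, circle_pt (sq x)).
have sc : {for (g, z), continuous sq}.
  apply: (@continuous_comp _ _ _ snd (fun z => s z / q%:R : R)); first exact: cvg_snd.
  have h : {for z, continuous s} by have [] := sP z (nbhs_singleton Vz).
  by apply: (@cvgM R _ (nbhs z)); [exact: h|exact: cvg_cst].
have gc : {for (g, z), continuous (gam \o sq)}.
  by apply: (@continuous_comp _ _ _ sq gam); [exact: sc|exact: gam_cts].
have fc : {for (g, z), continuous (@fst G (circle R))} by exact: cvg_fst.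
have c1 : {for (g, z), continuous (fun x : G * circle R => (x.1 * gam (sq x))%g)}.
  apply: (@continuous_comp _ _ _ (fun x : G * circle R => (x.1, gam (sq x))) (fun y : G * G => (y.1 * y.2)%g)); last exact: lie_mul_cts.
  exact: (cvg_pair fc gc).
have c2 : {for (g, z), continuous (fun x : G * circle R => circle_pt (sq x))}.
  by apply: (@continuous_comp _ _ _ sq (@circle_pt R)); [exact: sc|exact: circle_pt_cts].
have kc : {for (g, z), continuous k} by exact: (cvg_pair c1 c2).
have Pc : continuous Ptotal by exact: cts_fun.
have h : (Ptotal \o k) @ (g, z) --> (Ptotal \o k) (g, z) by apply: (@continuous_comp _ _ _ k Ptotal); [exact: kc|exact: Pc].
have e x : V x.2 -> (Ptotal \o k) x = triv_phi x.
  move=> Vx; have [sE _] := sP x.2 Vx; rewrite -[LHS]/(triv_sheet x.1 (sq x)) -triv_phiE divqK sE.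
  by case: (x).
have Vx : nbhs (g, z) (snd @^-1` V) by exact: (@cvg_snd _ _ (nbhs g) (nbhs z) _ V Vz).
rewrite (e (g, z) (nbhs_singleton Vz)) in h.
move=> P nP; have hP : nbhs (g, z) ((Ptotal \o k) @^-1` P) := h P nP.
have FF : Filter (nbhs (g, z)) := @nbhs_filter _ (g, z).
have both := @filterI _ _ FF _ _ Vx hP.
have sub : snd @^-1` V `&` (Ptotal \o k) @^-1` P `<=` triv_phi @^-1` P.
  by move=> x [Vx' Px]; rewrite /preimage /= -(e x Vx').
exact: (@filterS _ _ FF _ _ sub both).
Qed.

Lemma triv_phiK : cancel triv_phi triv_psi.
Proof.
move=> [g z]; rewrite /triv_phi triv_psiE /triv_out /= gam_circleE circle_powerE mulgK; congr pair.
by rewrite divqK.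
Qed.

Lemma triv_psiK : cancel triv_psi triv_phi.
Proof.
move=> x; have [[g z] <-] := Ptotal_surj x; rewrite triv_psiE /triv_out /= -(argE z).
by rewrite gam_circleE circle_powerE triv_phiE /triv_sheet mulgVK.
Qed.
End Trivialization.

Lemma trivialization_exists {R : realType} {G : lieGroupType R} {q : nat} {c : G} :
  connected [set: G] -> (forall x : G, (c * x = x * c)%g) -> (0 < q)%N -> (c ^+ q)%g = 1%g ->
  exists (phi : continuousType (G * circle R)%type (total_space q c))
         (psi : continuousType (total_space q c) (G * circle R)%type),
    trivialization phi psi /\ smooth_trivialization phi psi.
Proof.
move=> Gc c_central q_gt0 c_order.
have T_gt0 : 0 < 2 * pi / q%:R :> R by rewrite divr_gt0 ?turn_gt0 ?ltr0n.
have [gam [sg gam_step]] := equivariant_curve c_central T_gt0 Gc.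
have gam_cts : continuous gam by have [gc _] := sg; move=> t; exact: gc.
have [arg argE] := choice (@circle_pt_surj R).
have phic : continuous (@triv_phi R G q c gam arg) by exact: triv_phi_cts.
have psic : continuous (@triv_psi R G q c gam arg) by exact: triv_psi_cts.
have psiE x : @triv_psi R G q c gam arg (orbit_pi (total_gen q c) x) = @triv_out R G q gam arg x.
  by exact: triv_psiE.
have gE t : gam_circle gam arg (circle_pt t) = gam t by exact: (gam_circleE (q := q) (c := c)).
exists (mkcts phic), (mkcts psic); split.
  split; [exact: triv_phiK|exact: triv_psiK|].
  by move=> g z; exact: (congr1 (fun x : G * circle R => val x.2) (psiE (g, z))).
exists (fun g t => g * (gam t)^-1)%g, (fun g t => g * gam t)%g; split.
- exact: (smooth_family_left (smooth_map_inv openT sg)).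
- exact: smooth_family_left.
- move=> g t; transitivity ((@triv_out R G q gam arg (g, circle_pt t)).1).
    exact: (congr1 fst (psiE (g, circle_pt t))).
  by rewrite /triv_out /= gE.
- by move=> g t; exact: triv_phiE.
Qed.

Theorem theorem1p3 (R : realType) (G : lieGroupType R) (q : nat) (c : G)
    (G_compact : compact [set: G]) (G_connected : connected [set: G])
    (G_semisimple : semisimple G)
    (c_central : forall x : G, (c * x = x * c)%g)
    (q_gt0 : (0 < q)%N) (c_order : (c ^+ q)%g = 1%g)
    (c_order_min : forall k : nat, (0 < k < q)%N -> (c ^+ k)%g <> 1%g) :
  (exists (phi : continuousType (G * circle R)%type (total_space q c))
          (psi : continuousType (total_space q c) (G * circle R)%type),
      trivialization phi psi /\ smooth_trivialization phi psi) /\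
  (forall (phi : continuousType (G * circle R)%type (total_space q c))
          (psi : continuousType (total_space q c) (G * circle R)%type),
    trivialization phi psi ->
    let H := hcoh R (base_space c) in
    let HGS := hcoh R (G * circle R)%type in
    let omega : H := euler_class q c in
    let Q := ideal_quotient omega in
    let g : H -> Q := \pi_Q in
    let Cstar : H -> HGS := fun y => hpull phi (hpull (circle_bundle q c) y) in
    let theta : HGS -> H := fun x => gysin_theta (hpull psi x) in
    let xi1 : HGS := hpull (circle_proj G) (orientation_class R) in
    [/\ exists Cbar : {additive Q -> HGS},
          [/\ forall y : H, Cbar (g y) = Cstar y,
              injective Cbar &
              range Cbar = [set x | theta x = 0]],
        zmod_morphism theta,
        range theta = [set y | y * omega = 0] &
        range (fun y : H => y * omega) = [set y | y \in ideal_gen omega]] /\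
    theta xi1 = q%:R /\
    (forall (x : HGS) (y : H), theta (x * Cstar y) = theta x * y) /\
    (forall j : {additive Q -> H}, (forall x : Q, g (j x) = x) ->
      let J := subring_of omega in
      let h : tensor J Q -> H := tlift (fun (a : J) (x : Q) => subring_val a * j x) in
      let N := [set subring_elt omega *: z | z in [set z | range theta (h z)]] in
      [/\ zmod_morphism h,
          forall (r : nat) (x : Q), h (tens (subring_elt omega ^+ r) x) = omega ^+ r * j x &
          exists hbar : {additive submod_quotient N -> H},
            [/\ forall z, hbar (\pi_(submod_quotient N) z) = h z,
                forall (a : J) z, hbar (\pi_(submod_quotient N) (a *: z)) =
                                  subring_val a * hbar (\pi_(submod_quotient N) z) &
                bijective hbar]])).
Proof.
split; first exact: trivialization_exists.
move=> phi psi triv.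
exact: (gysin_of_trivialization G_compact q_gt0 c_order c_order_min triv).
Qed.
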